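(* There exists an inverse integrating factor $V_0(x,y)$, of class at least $\mathcal{C}^1$, in a neighborhood of the following two types of singular points of a real analytic planar system: (1) a degenerate focus without characteristic directions, that is, the origin of a system $\dot x=p_d(x,y)+P_{d+1}(x,y)$, $\dot y=q_d(x,y)+Q_{d+1}(x,y)$ with $d>1$ odd, when it is a focus without characteristic directions; (2) a nilpotent focus, that is, the origin of a system $\dot x=y+P_2(x,y)$, $\dot y=Q_2(x,y)$, when it is a focus.
   Context: In (1), $p_d,q_d$ are homogeneous polynomials of degree $d$ with $p_d^2+q_d^2\not\equiv0$, and $P_{d+1},Q_{d+1}$ are analytic near the origin and of order at least $d+1$ there. A characteristic direction is a real linear factor of $xq_d(x,y)-yp_d(x,y)$; there are none exactly when $q_d(\cos\theta,\sin\theta)\cos\theta-p_d(\cos\theta,\sin\theta)\sin\theta\ne0$ for all $\theta$. In (2), $P_2,Q_2$ are analytic near the origin without constant nor linear terms. A focus is an isolated singular point having a neighborhood in which all orbits spiral to it in forward or in backward time. An inverse integrating factor of $\dot x=P$, $\dot y=Q$ in a neighborhood $\mathcal{U}$ of the origin is a function $V_0:\mathcal{U}\to\mathbb{R}$ of class $\mathcal{C}^1$, not locally null, with $P\,\frac{\partial V_0}{\partial x}+Q\,\frac{\partial V_0}{\partial y}=\left(\frac{\partial P}{\partial x}+\frac{\partial Q}{\partial y}\right)V_0$. *)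

(* Defs.v *)
From Stdlib Require Export Reals.
From Coquelicot Require Export Coquelicot.
Open Scope R_scope.

(* The homogeneous polynomial of degree d whose coefficient of
   x^i y^(d-i) is c i; the values c i with i > d play no role. *)
Definition form (d : nat) (c : nat -> R) (x y : R) : R :=
  sum_n (fun i => c i * x ^ i * y ^ (d - i)) d.

(* a n is the coefficient list of the homogeneous part of degree n of the
   double power series.  The first series below is that of the absolute
   values of all the monomials, grouped by degree, so the double series
   converges absolutely and the grouping in the second one is harmless. *)
Definition has_expansion (f : R -> R -> R) (x0 y0 : R) (a : nat -> nat -> R) :=
  exists r : R, 0 < r /\
    forall h k : R, Rabs h < r -> Rabs k < r ->
      ex_series (fun n => form n (fun i => Rabs (a n i)) (Rabs h) (Rabs k)) /\
      is_series (fun n => form n (a n) h k) (f (x0 + h) (y0 + k)).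

Definition analytic_on (D : R * R -> Prop) (f : R -> R -> R) :=
  forall x y : R, D (x, y) -> exists a, has_expansion f x y a.

Definition order_at_least (m : nat) (f : R -> R -> R) :=
  exists a, has_expansion f 0 0 a /\
    forall n i : nat, (n < m)%nat -> (i <= n)%nat -> a n i = 0.

(* The real linear form a x + b y is a factor of x q_d - y p_d. *)
Definition characteristic_direction (d : nat) (p q : nat -> R) (a b : R) :=
  (a <> 0 \/ b <> 0) /\
  exists e : nat -> R, forall x y : R,
    x * form d q x y - y * form d p x y = (a * x + b * y) * form d e x y.

(* Only the values at times t >= 0 matter: a one-sided solution on [0, +oo)
   extends affinely to t < 0 so as to be differentiable at 0. *)
Definition positive_half_orbit (D : R * R -> Prop) (P Q : R -> R -> R)
    (x y : R -> R) :=
  forall t : R, 0 <= t ->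
    D (x t, y t) /\
    is_derive x t (P (x t) (y t)) /\ is_derive y t (Q (x t) (y t)).

(* The curve tends to the origin, and a continuous determination of its polar
   angle tends to infinity in absolute value. *)
Definition spirals_to_origin (x y : R -> R) :=
  exists r th : R -> R,
    (forall t : R, 0 <= t ->
       0 < r t /\ continuous th t /\
       x t = r t * cos (th t) /\ y t = r t * sin (th t)) /\
    is_lim r p_infty 0 /\
    is_lim (fun t => Rabs (th t)) p_infty p_infty.

Definition isolated_singular_point (P Q : R -> R -> R) :=
  P 0 0 = 0 /\ Q 0 0 = 0 /\
  locally (0, 0) (fun z : R * R =>
    P (fst z) (snd z) = 0 -> Q (fst z) (snd z) = 0 -> z = (0, 0)).

(* The origin is a focus of x' = P, y' = Q, a system on the open set D.
   Negative half-orbits are the positive half-orbits of the time-reversed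
   system. *)
Definition is_focus (D : R * R -> Prop) (P Q : R -> R -> R) :=
  isolated_singular_point P Q /\
  locally (0, 0) (fun z : R * R => z <> (0, 0) ->
    exists x y : R -> R,
      x 0 = fst z /\ y 0 = snd z /\ spirals_to_origin x y /\
      (positive_half_orbit D P Q x y \/
       positive_half_orbit D (fun u v => - P u v) (fun u v => - Q u v) x y)).

Definition d1 (f : R -> R -> R) (x y : R) : R := Derive (fun u => f u y) x.
Definition d2 (f : R -> R -> R) (x y : R) : R := Derive (fun v => f x v) y.

Definition C1_on (U : R * R -> Prop) (V : R -> R -> R) :=
  forall x y : R, U (x, y) ->
    ex_derive (fun u => V u y) x /\ ex_derive (fun v => V x v) y /\
    continuity_2d_pt (d1 V) x y /\ continuity_2d_pt (d2 V) x y.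

Definition not_locally_null (U : R * R -> Prop) (V : R -> R -> R) :=
  forall W : R * R -> Prop,
    open W -> (exists z, W z) -> (forall z, W z -> U z) ->
    exists x y : R, W (x, y) /\ V x y <> 0.

Definition inverse_integrating_factor (U : R * R -> Prop)
    (P Q V : R -> R -> R) :=
  C1_on U V /\ not_locally_null U V /\
  forall x y : R, U (x, y) ->
    P x y * d1 V x y + Q x y * d2 V x y = (d1 P x y + d2 Q x y) * V x y.

Definition has_inverse_integrating_factor (D : R * R -> Prop)
    (P Q : R -> R -> R) :=
  exists (U : R * R -> Prop) (V0 : R -> R -> R),
    open U /\ U (0, 0) /\ (forall z, U z -> D z) /\
    inverse_integrating_factor U P Q V0.

(* Main.v *)
Require Import Defs.
From Stdlib Require Import Reals Arith ZArith Lra Lia Psatz ClassicalEpsilon Classical.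
From Coquelicot Require Import Coquelicot.
Open Scope R_scope.
Set Bullet Behavior "Strict Subproofs".

(* In weighted polar coordinates x = r cos th, Y = r^n sin th (n = 1 and Y = y in
   case 1) the orbits are the graphs of the solutions of dr/dth = F(th, r) with F
   2 pi-periodic and of class C^2, and V0 corresponds to r^k B V, where V is a
   periodic solution of V_th + F V_r = F_r V. One orbit spiralling to the origin
   cuts a neighbourhood of it into fundamental strips between consecutive turns.
   On such a strip V is prescribed as a bump transported by the flow; it vanishes,
   with its derivatives, on the boundary and hence glues by periodicity. As in
   Denjoy's argument, the sum of the widths of the successive turns is bounded,
   so the distortion of the flow and the derivative V_r stay bounded, and the
   factor r^k makes V0 of class C^1 at the origin. V0 vanishes on a spiral only,
   so it is not locally null.

   In case 1 the absence of characteristic directions says that B(th, 0) <> 0.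
   In case 2 put Y = y + P2(x, y); two Weierstrass divisions by Y give x' = Y,
   Y' = f(x) + phi(x) Y + Y^2 g(x, y). For a focus, f = a x^(2n-1) + ... and
   phi = b x^(n-1) + ... with a < 0 and b^2 + 4 a n < 0: otherwise a curve Y = 0
   or Y = c x^n + ... is crossed in one direction only in a half-plane and the
   orbits cannot spiral. These inequalities give B(th, 0) <> 0. *)

(** * Functions of class C^k of two variables *)

(** The transport equation says that V d/dr commutes with d/dth + F d/dr, so V is an inverse
    integrating factor of the latter field. Such a factor is multiplied by the time scale th' and by
    the Jacobian when one returns to (x, y); since th' is r^k B divided by the Jacobian, up to sign,
    the result is r^k B V. A bump repeated turn after turn needs no matching condition and no normal
    form of the return map. The price is paid at the origin, where infinitely many turns accumulate.
    Let h be the initial value of an orbit and l the logarithm of the h-derivative of the flow. Then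
    V = v(h) e^l and V_r = v'(h) + v(h) l_h, where l_h is the integral of F_rr e^l along the orbit.
    Bounded distortion makes e^l at most a multiple of the width of the strip, and that width is
    integrable in th; hence V and V_r are bounded. This is where two derivatives of F in r are used.
    The exponent k exceeds the weight of y by at least one, which makes the derivatives of V0 tend
    to 0 at the origin. In case 2 the second division is what puts Y^2 in front of g: its weighted
    order is then higher than that of the two other terms, so g does not contribute to B(th, 0). *)

Lemma continuity_2d_pt_comp (f g h : R -> R -> R) (x y : R) :
  continuity_2d_pt f (g x y) (h x y) ->
  continuity_2d_pt g x y -> continuity_2d_pt h x y ->
  continuity_2d_pt (fun u v => f (g u v) (h u v)) x y.
Proof.
  intros Hf Hg Hh eps.
  destruct (Hf eps) as [d Hd].
  apply locally_2d_impl with (2 := locally_2d_and _ _ _ _ (Hg d) (Hh d)).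
  apply locally_2d_forall. intros u v [H1 H2]. now apply Hd.
Qed.

Lemma continuity_2d_pt_1 (f : R -> R) (x y : R) :
  continuous f x -> continuity_2d_pt (fun u _ => f u) x y.
Proof.
  intros Hf. apply (continuity_1d_2d_pt_comp f (fun u _ => u)).
  - now apply continuity_pt_filterlim.
  - apply continuity_2d_pt_id1.
Qed.

Lemma continuity_2d_pt_2 (f : R -> R) (x y : R) :
  continuous f y -> continuity_2d_pt (fun _ v => f v) x y.
Proof.
  intros Hf. apply (continuity_1d_2d_pt_comp f (fun _ v => v)).
  - now apply continuity_pt_filterlim.
  - apply continuity_2d_pt_id2.
Qed.

Lemma continuous_2d_comp (f : R -> R -> R) (g h : R -> R) (t : R) :
  continuity_2d_pt f (g t) (h t) -> continuous g t -> continuous h t ->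
  continuous (fun s => f (g s) (h s)) t.
Proof.
  intros Hf Hg Hh.
  apply (continuous_comp_2 g h f).
  - exact Hg.
  - exact Hh.
  - now apply continuity_2d_pt_filterlim in Hf.
Qed.

Lemma differentiable_partials (f fx : R -> R -> R) (x y ly : R) :
  locally_2d (fun u v => is_derive (fun z => f z v) u (fx u v)) x y ->
  is_derive (fun z => f x z) y ly ->
  continuity_2d_pt fx x y ->
  differentiable_pt_lim f x y (fx x y) ly.
Proof.
  intros H1 H2 H3.
  apply filterdiff_differentiable_pt_lim.
  apply (is_derive_filterdiff f x y fx ly).
  - now apply locally_2d_locally in H1.
  - exact H2.
  - now apply continuity_2d_pt_filterlim in H3.
Qed.

Lemma differentiable_is_derive (f : R -> R -> R) (x y lx ly : R) :
  differentiable_pt_lim f x y lx ly ->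
  is_derive (fun u => f u y) x lx /\ is_derive (fun v => f x v) y ly.
Proof.
  intros H; split.
  - apply is_derive_Reals.
    replace lx with (lx * 1 + ly * 0) by ring.
    apply (derivable_pt_lim_comp_2d f (fun u => u) (fun _ => y)).
    + exact H.
    + apply derivable_pt_lim_id.
    + apply derivable_pt_lim_const.
  - apply is_derive_Reals.
    replace ly with (lx * 0 + ly * 1) by ring.
    apply (derivable_pt_lim_comp_2d f (fun _ => x) (fun v => v)).
    + exact H.
    + apply derivable_pt_lim_const.
    + apply derivable_pt_lim_id.
Qed.

Lemma is_derive_comp_2d (f : R -> R -> R) (g h : R -> R) (t lx ly dg dh : R) :
  differentiable_pt_lim f (g t) (h t) lx ly ->
  is_derive g t dg -> is_derive h t dh ->
  is_derive (fun s => f (g s) (h s)) t (lx * dg + ly * dh).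
Proof.
  intros Hf Hg Hh. apply is_derive_Reals.
  apply derivable_pt_lim_comp_2d; trivial; now apply is_derive_Reals.
Qed.

Lemma differentiable_continuity (f : R -> R -> R) (x y lx ly : R) :
  differentiable_pt_lim f x y lx ly -> continuity_2d_pt f x y.
Proof.
  intros H. apply differentiable_continuity_pt. now exists lx, ly.
Qed.

(** A continuous local inverse of a map with invertible differential is differentiable. The charts
    below are built by hand, proved continuous and then passed to this lemma. The increments u, v of
    the inverse solve the linear system up to remainders of size at most e m, where m is the larger
    of |u| and |v|. If K e is at most 1/2, this first gives m <= 2 K s and then an error of at most
    2 K^2 e s. *)
Lemma differentiable_inverse (f g al be : R -> R -> R) (x0 y0 a b c d : R) :
  differentiable_pt_lim f (al x0 y0) (be x0 y0) a b ->
  differentiable_pt_lim g (al x0 y0) (be x0 y0) c d ->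
  a * d - b * c <> 0 ->
  continuity_2d_pt al x0 y0 -> continuity_2d_pt be x0 y0 ->
  locally_2d (fun x y => f (al x y) (be x y) = x /\ g (al x y) (be x y) = y) x0 y0 ->
  differentiable_pt_lim al x0 y0 (d / (a * d - b * c)) (- b / (a * d - b * c)) /\
  differentiable_pt_lim be x0 y0 (- c / (a * d - b * c)) (a / (a * d - b * c)).
Proof.
  intros Hf Hg HD Ha Hb Hinv.
  set (D := a * d - b * c) in *.
  set (K := (Rabs a + Rabs b + Rabs c + Rabs d) / Rabs D).
  assert (HDp : 0 < Rabs D) by now apply Rabs_pos_lt.
  assert (HK : 0 <= K).
  { apply Rdiv_le_0_compat; trivial.
    assert (A := Rabs_pos a). assert (B := Rabs_pos b).
    assert (C := Rabs_pos c). assert (E := Rabs_pos d). lra. }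
  (* One bound for both rows of the inverse matrix, whose entries are those of the matrix divided by
     D, up to sign; K bounds the sum of their absolute values. *)
  assert (Hlin : forall p q p' q' R1 R2 m, 
     (p = a /\ q = c \/ p = d /\ q = b) -> Rabs R1 <= m -> Rabs R2 <= m ->
     p' = p / D -> q' = q / D -> Rabs (p' * R1 - q' * R2) <= K * m).
  { intros p q p' q' R1 R2 m Hpq HR1 HR2 -> ->.
    assert (Hm : 0 <= m) by (apply Rle_trans with (2 := HR1); apply Rabs_pos).
    replace (p / D * R1 - q / D * R2) with ((p * R1 - q * R2) / D) by (unfold Rdiv; ring).
    unfold Rdiv at 1. rewrite Rabs_mult, Rabs_inv. unfold K, Rdiv.
    replace ((Rabs a + Rabs b + Rabs c + Rabs d) * / Rabs D * m) with
     (((Rabs a + Rabs b + Rabs c + Rabs d) * m) * / Rabs D) by ring.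
    apply Rmult_le_compat_r. { left; now apply Rinv_0_lt_compat. }
    apply Rle_trans with (1 := Rabs_triang _ _).
    rewrite Rabs_Ropp, !Rabs_mult.
    assert (Rabs p * Rabs R1 <= Rabs p * m) by (apply Rmult_le_compat_l; trivial; apply Rabs_pos).
    assert (Rabs q * Rabs R2 <= Rabs q * m) by (apply Rmult_le_compat_l; trivial; apply Rabs_pos).
    assert (A1 := Rmult_le_pos _ _ (Rabs_pos a) Hm). assert (A2 := Rmult_le_pos _ _ (Rabs_pos b) Hm).
    assert (A3 := Rmult_le_pos _ _ (Rabs_pos c) Hm). assert (A4 := Rmult_le_pos _ _ (Rabs_pos d) Hm).
    destruct Hpq as [[-> ->]|[-> ->]]; lra. }
  assert (Hmain : forall eps : posreal, locally_2d (fun x y =>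
     Rabs (al x y - al x0 y0 - (d / D * (x - x0) + - b / D * (y - y0)))
       <= eps * Rmax (Rabs (x - x0)) (Rabs (y - y0)) /\
     Rabs (be x y - be x0 y0 - (- c / D * (x - x0) + a / D * (y - y0)))
       <= eps * Rmax (Rabs (x - x0)) (Rabs (y - y0))) x0 y0).
  { intros eps.
    (* The first bound gives K e <= 1/2, the second one 2 K^2 e <= eps. *)
    set (e := Rmin (/ (2 * (K + 1))) (eps / (2 * K ^ 2 + 1))).
    assert (He : 0 < e).
    { apply Rmin_case. apply Rinv_0_lt_compat; lra.
      apply Rdiv_lt_0_compat. apply cond_pos. nra. }
    assert (He1 : K * e <= / 2).
    { apply Rle_trans with (K * / (2 * (K + 1))).
      apply Rmult_le_compat_l; trivial. apply Rmin_l.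
      apply Rmult_le_reg_r with (2 * (K + 1)). lra. field_simplify; lra. }
    assert (He2 : 2 * K ^ 2 * e <= eps).
    { assert (E : e * (2 * K ^ 2 + 1) <= eps).
      { apply Rle_trans with (eps / (2 * K ^ 2 + 1) * (2 * K ^ 2 + 1)).
        apply Rmult_le_compat_r. nra. apply Rmin_r. right. field. nra. }
      nra. }
    destruct (Hf (mkposreal e He)) as [df Hdf]. destruct (Hg (mkposreal e He)) as [dg Hdg].
    simpl in Hdf, Hdg.
    assert (Hm : 0 < Rmin df dg) by (apply Rmin_case; apply cond_pos).
    destruct (locally_2d_singleton _ _ _ Hinv) as [Hx0 Hy0].
    apply locally_2d_impl with (2 := locally_2d_and _ _ _ _ Hinv 
      (locally_2d_and _ _ _ _ (Ha (mkposreal _ Hm)) (Hb (mkposreal _ Hm)))).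
    apply locally_2d_forall. simpl. intros x y [[Hx Hy] [H1 H2]].
    assert (Hdf' := Hdf (al x y) (be x y) (Rlt_le_trans _ _ _ H1 (Rmin_l _ _)) (Rlt_le_trans _ _ _ H2 (Rmin_l _ _))).
    assert (Hdg' := Hdg (al x y) (be x y) (Rlt_le_trans _ _ _ H1 (Rmin_r _ _)) (Rlt_le_trans _ _ _ H2 (Rmin_r _ _))).
    rewrite Hx, Hx0 in Hdf'. rewrite Hy, Hy0 in Hdg'.
    set (u := al x y - al x0 y0) in *. set (v := be x y - be x0 y0) in *.
    set (m := Rmax (Rabs u) (Rabs v)) in *.
    set (s := Rmax (Rabs (x - x0)) (Rabs (y - y0))).
    set (R1 := x - x0 - (a * u + b * v)) in *.
    set (R2 := y - y0 - (c * u + d * v)) in *.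
    assert (E1 : u - (d / D * (x - x0) + - b / D * (y - y0)) = - (d / D * R1 - b / D * R2)).
    { unfold R1, R2, D. field. exact HD. }
    assert (E2 : v - (- c / D * (x - x0) + a / D * (y - y0)) = - (a / D * R2 - c / D * R1)).
    { unfold R1, R2, D. field. exact HD. }
    assert (B1 : Rabs (d / D * R1 - b / D * R2) <= K * (e * m)) by (apply (Hlin d b); auto).
    assert (B2 : Rabs (a / D * R2 - c / D * R1) <= K * (e * m)) by (apply (Hlin a c); auto).
    assert (C1 : Rabs (d / D * (x - x0) - b / D * (y - y0)) <= K * s).
    { apply (Hlin d b); auto. apply Rmax_l. apply Rmax_r. }
    assert (C2 : Rabs (a / D * (y - y0) - c / D * (x - x0)) <= K * s).
    { apply (Hlin a c); auto. apply Rmax_r. apply Rmax_l. }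
    assert (Hms : m <= 2 * K * s).
    { assert (Hm0 : 0 <= m) by (apply Rle_trans with (2 := Rmax_l _ _); apply Rabs_pos).
      assert (m <= K * s + K * (e * m)).
      { unfold m at 1. apply Rmax_case.
        - replace u with ((d / D * (x - x0) - b / D * (y - y0)) + - (d / D * R1 - b / D * R2)).
          2: rewrite <- E1; unfold Rdiv; ring.
          apply Rle_trans with (1 := Rabs_triang _ _). rewrite Rabs_Ropp. lra.
        - replace v with ((a / D * (y - y0) - c / D * (x - x0)) + - (a / D * R2 - c / D * R1)).
          2: rewrite <- E2; unfold Rdiv; ring.
          apply Rle_trans with (1 := Rabs_triang _ _). rewrite Rabs_Ropp. lra. }
      nra. }
    assert (Hs : 0 <= s) by (apply Rle_trans with (2 := Rmax_l _ _); apply Rabs_pos).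
    assert (F : K * (e * m) <= eps * s).
    { apply Rle_trans with (K * (e * (2 * K * s))).
      - apply Rmult_le_compat_l; trivial. apply Rmult_le_compat_l; lra.
      - replace (K * (e * (2 * K * s))) with (2 * K ^ 2 * e * s) by ring.
        now apply Rmult_le_compat_r. }
    rewrite E1, E2, !Rabs_Ropp. split; lra. }
  split; intros eps; apply locally_2d_impl with (2 := Hmain eps);
    apply locally_2d_forall; tauto.
Qed.

Definition open_2d (D : R -> R -> Prop) : Prop :=
  forall x y, D x y -> locally_2d D x y.

(** Each level asks for a total differential with some partial derivatives instead of naming them by
    [Derive]. Sums, products, quotients and compositions then follow by induction on k from the rule
    for differentials. *)
Fixpoint Ck (k : nat) (D : R -> R -> Prop) (f : R -> R -> R) : Prop :=
  match k with
  | O => forall x y, D x y -> continuity_2d_pt f x y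
  | S k' => exists fx fy : R -> R -> R,
      (forall x y, D x y -> differentiable_pt_lim f x y (fx x y) (fy x y)) /\
      Ck k' D fx /\ Ck k' D fy
  end.

Lemma Ck_S (k : nat) (D : R -> R -> Prop) (f : R -> R -> R) :
  Ck (S k) D f -> Ck k D f.
Proof.
  revert f; induction k as [|k IH]; intros f.
  - intros (fx & fy & H & _) x y Hxy.
    now apply differentiable_continuity with (1 := H x y Hxy).
  - intros (fx & fy & H & H1 & H2). exists fx, fy.
    split; [exact H|split; now apply IH].
Qed.

Lemma Ck_0 (k : nat) (D : R -> R -> Prop) (f : R -> R -> R) :
  Ck k D f -> Ck 0 D f.
Proof. induction k; trivial. intros H. now apply IHk, Ck_S. Qed.

Lemma Ck_subset (k : nat) (D D' : R -> R -> Prop) (f : R -> R -> R) :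
  (forall x y, D' x y -> D x y) -> Ck k D f -> Ck k D' f.
Proof.
  intros HD; revert f; induction k as [|k IH]; intros f.
  - intros H x y Hxy. now apply H, HD.
  - intros (fx & fy & H & H1 & H2). exists fx, fy. split.
    + intros x y Hxy. now apply H, HD.
    + split; now apply IH.
Qed.

Lemma Ck_ext (k : nat) (D : R -> R -> Prop) (f g : R -> R -> R) :
  open_2d D -> (forall x y, D x y -> f x y = g x y) -> Ck k D f -> Ck k D g.
Proof.
  intros HD Hfg Hf.
  assert (Hl : forall x y, D x y -> locally_2d (fun u v => f u v = g u v) x y).
  { intros x y Hxy. apply locally_2d_impl with (2 := HD x y Hxy).
    now apply locally_2d_forall. }
  destruct k as [|k].
  - intros x y Hxy. apply continuity_2d_pt_ext_loc with f; auto.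
  - destruct Hf as (fx & fy & H & H12). exists fx, fy. split; trivial.
    intros x y Hxy. apply differentiable_pt_lim_ext with (1 := Hl x y Hxy). now apply H.
Qed.

Lemma Ck_const (k : nat) (D : R -> R -> Prop) (c : R) : Ck k D (fun _ _ => c).
Proof.
  revert c; induction k as [|k IH]; intros c.
  - intros x y _. apply continuity_2d_pt_const.
  - exists (fun _ _ => 0), (fun _ _ => 0). split; auto.
    intros x y _. apply (differentiable_pt_lim_proj1_0 (fun _ => c)).
    apply derivable_pt_lim_const.
Qed.

Lemma differentiable_fst (x y : R) : differentiable_pt_lim (fun u _ => u) x y 1 0.
Proof. apply (differentiable_pt_lim_proj1_0 (fun u => u)). apply derivable_pt_lim_id. Qed.

Lemma differentiable_snd (x y : R) : differentiable_pt_lim (fun _ v => v) x y 0 1.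
Proof.
  intros eps. apply locally_2d_forall. intros u v.
  replace (v - y - (0 * (u - x) + 1 * (v - y))) with 0 by ring.
  rewrite Rabs_R0. apply Rmult_le_pos. left; apply cond_pos.
  apply Rle_trans with (2 := Rmax_l _ _). apply Rabs_pos.
Qed.

Lemma Ck_fst (k : nat) (D : R -> R -> Prop) : Ck k D (fun x _ => x).
Proof.
  destruct k.
  - intros x y _. apply continuity_2d_pt_id1.
  - exists (fun _ _ => 1), (fun _ _ => 0). split.
    + intros; apply differentiable_fst.
    + split; apply Ck_const.
Qed.

Lemma Ck_snd (k : nat) (D : R -> R -> Prop) : Ck k D (fun _ y => y).
Proof.
  destruct k.
  - intros x y _. apply continuity_2d_pt_id2.
  - exists (fun _ _ => 0), (fun _ _ => 1). split.
    + intros; apply differentiable_snd.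
    + split; apply Ck_const.
Qed.

Lemma differentiable_Rplus (x y : R) : differentiable_pt_lim Rplus x y 1 1.
Proof.
  apply differentiable_pt_lim_ext with (fun u v => u + v).
  { apply locally_2d_forall; trivial. }
  intros eps. apply locally_2d_forall. intros u v.
  replace (u + v - (x + y) - (1 * (u - x) + 1 * (v - y))) with 0 by ring.
  rewrite Rabs_R0. apply Rmult_le_pos. left; apply cond_pos.
  apply Rle_trans with (2 := Rmax_l _ _). apply Rabs_pos.
Qed.

Lemma differentiable_Rmult (x y : R) : differentiable_pt_lim Rmult x y y x.
Proof.
  intros eps. exists eps. intros u v Hu Hv.
  replace (u * v - x * y - (y * (u - x) + x * (v - y))) with ((u - x) * (v - y)) by ring.
  rewrite Rabs_mult.
  apply Rmult_le_compat; try apply Rabs_pos. now left. apply Rmax_r.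
Qed.

Lemma differentiable_plus (f g : R -> R -> R) (x y a b c d : R) :
  differentiable_pt_lim f x y a b -> differentiable_pt_lim g x y c d ->
  differentiable_pt_lim (fun u v => f u v + g u v) x y (a + c) (b + d).
Proof.
  intros Hf Hg. replace (a + c) with (1 * a + 1 * c) by ring.
  replace (b + d) with (1 * b + 1 * d) by ring.
  apply (differentiable_pt_lim_comp Rplus f g); trivial.
  apply differentiable_Rplus.
Qed.

Lemma differentiable_mult (f g : R -> R -> R) (x y a b c d : R) :
  differentiable_pt_lim f x y a b -> differentiable_pt_lim g x y c d ->
  differentiable_pt_lim (fun u v => f u v * g u v) x y
    (a * g x y + f x y * c) (b * g x y + f x y * d).
Proof.
  intros Hf Hg.
  replace (a * g x y + f x y * c) with (g x y * a + f x y * c) by ring.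
  replace (b * g x y + f x y * d) with (g x y * b + f x y * d) by ring.
  apply (differentiable_pt_lim_comp Rmult f g); trivial.
  apply differentiable_Rmult.
Qed.

Lemma differentiable_comp1 (f : R -> R) (g : R -> R -> R) (x y l a b : R) :
  is_derive f (g x y) l -> differentiable_pt_lim g x y a b ->
  differentiable_pt_lim (fun u v => f (g u v)) x y (l * a) (l * b).
Proof.
  intros Hf Hg. replace (l * a) with (l * a + 0 * a) by ring.
  replace (l * b) with (l * b + 0 * b) by ring.
  apply (differentiable_pt_lim_comp (fun u _ => f u) g g); trivial.
  apply differentiable_pt_lim_proj1_0. now apply is_derive_Reals.
Qed.

Lemma differentiable_eq (f : R -> R -> R) (x y a b a' b' : R) :
  differentiable_pt_lim f x y a b -> a = a' -> b = b' ->
  differentiable_pt_lim f x y a' b'.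
Proof. now intros H -> ->. Qed.

Lemma Ck_plus (k : nat) (D : R -> R -> Prop) (f g : R -> R -> R) :
  Ck k D f -> Ck k D g -> Ck k D (fun x y => f x y + g x y).
Proof.
  revert f g; induction k as [|k IH]; intros f g Hf Hg.
  - intros x y Hxy. apply continuity_2d_pt_plus; auto.
  - destruct Hf as (fx & fy & Hf & Hfx & Hfy).
    destruct Hg as (gx & gy & Hg & Hgx & Hgy).
    exists (fun x y => fx x y + gx x y), (fun x y => fy x y + gy x y).
    split; auto. intros x y Hxy. apply differentiable_plus; auto.
Qed.

Lemma Ck_mult (k : nat) (D : R -> R -> Prop) (f g : R -> R -> R) :
  Ck k D f -> Ck k D g -> Ck k D (fun x y => f x y * g x y).
Proof.
  revert f g; induction k as [|k IH]; intros f g Hf Hg.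
  - intros x y Hxy. apply continuity_2d_pt_mult; auto.
  - assert (Hf0 := Ck_S _ _ _ Hf). assert (Hg0 := Ck_S _ _ _ Hg).
    destruct Hf as (fx & fy & Hf & Hfx & Hfy).
    destruct Hg as (gx & gy & Hg & Hgx & Hgy).
    exists (fun x y => fx x y * g x y + f x y * gx x y),
           (fun x y => fy x y * g x y + f x y * gy x y).
    split; [|split; apply Ck_plus; auto].
    intros x y Hxy. apply differentiable_mult; auto.
Qed.

Lemma Ck_opp (k : nat) (D : R -> R -> Prop) (f : R -> R -> R) :
  open_2d D -> Ck k D f -> Ck k D (fun x y => - f x y).
Proof.
  intros HD Hf. apply Ck_ext with (fun x y => -1 * f x y); trivial.
  { intros; ring. } apply Ck_mult; trivial. apply Ck_const.
Qed.

Lemma Ck_minus (k : nat) (D : R -> R -> Prop) (f g : R -> R -> R) :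
  open_2d D -> Ck k D f -> Ck k D g -> Ck k D (fun x y => f x y - g x y).
Proof.
  intros HD Hf Hg. apply (Ck_plus _ _ f (fun x y => - g x y)); trivial.
  now apply Ck_opp.
Qed.

Lemma Ck_inv (k : nat) (D : R -> R -> Prop) (f : R -> R -> R) :
  open_2d D -> Ck k D f -> (forall x y, D x y -> f x y <> 0) ->
  Ck k D (fun x y => / f x y).
Proof.
  intros HD. revert f; induction k as [|k IH]; intros f Hf Hn.
  - intros x y Hxy. apply continuity_2d_pt_inv; auto.
  - assert (Hi := IH f (Ck_S _ _ _ Hf) Hn).
    destruct Hf as (fx & fy & Hf & Hfx & Hfy).
    exists (fun x y => - (/ f x y * / f x y) * fx x y),
           (fun x y => - (/ f x y * / f x y) * fy x y).
    split; [|split; apply Ck_mult; trivial; apply Ck_opp, Ck_mult; trivial].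
    intros x y Hxy. apply (differentiable_comp1 Rinv); auto.
    assert (Hn' := Hn x y Hxy). auto_derive; trivial. field; trivial.
Qed.

Lemma Ck_div (k : nat) (D : R -> R -> Prop) (f g : R -> R -> R) :
  open_2d D -> Ck k D f -> Ck k D g -> (forall x y, D x y -> g x y <> 0) ->
  Ck k D (fun x y => f x y / g x y).
Proof.
  intros HD Hf Hg Hn. apply (Ck_mult _ _ f (fun x y => / g x y)); trivial.
  now apply Ck_inv.
Qed.

Lemma Ck_comp (k : nat) (D D' : R -> R -> Prop) (f g h : R -> R -> R) :
  Ck k D' f -> Ck k D g -> Ck k D h ->
  (forall x y, D x y -> D' (g x y) (h x y)) ->
  Ck k D (fun x y => f (g x y) (h x y)).
Proof.
  revert f; induction k as [|k IH]; intros f Hf Hg Hh HD.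
  - intros x y Hxy. apply continuity_2d_pt_comp; auto.
  - assert (Hg0 := Ck_S _ _ _ Hg). assert (Hh0 := Ck_S _ _ _ Hh).
    destruct Hf as (fx & fy & Hf & Hfx & Hfy).
    destruct Hg as (gx & gy & Hg & Hgx & Hgy).
    destruct Hh as (hx & hy & Hh & Hhx & Hhy).
    exists (fun x y => fx (g x y) (h x y) * gx x y + fy (g x y) (h x y) * hx x y),
           (fun x y => fx (g x y) (h x y) * gy x y + fy (g x y) (h x y) * hy x y).
    split; [|split; apply Ck_plus; apply Ck_mult; auto].
    intros x y Hxy. apply differentiable_pt_lim_comp; auto.
Qed.

Lemma Ck_cos_sin (k : nat) (D : R -> R -> Prop) :
  Ck k D (fun x _ => cos x) /\ Ck k D (fun x _ => sin x).
Proof.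
  induction k as [|k [IHc IHs]].
  - split; intros x y _.
    + apply (continuity_2d_pt_1 cos), continuous_cos.
    + apply (continuity_2d_pt_1 sin), continuous_sin.
  - split.
    + exists (fun x _ => -1 * sin x), (fun _ _ => 0). split; [|split].
      * intros x y _. apply (differentiable_pt_lim_proj1_0 cos).
        replace (-1 * sin x) with (- sin x) by ring. apply derivable_pt_lim_cos.
      * apply (Ck_mult _ _ (fun _ _ => -1)); trivial. apply Ck_const.
      * apply Ck_const.
    + exists (fun x _ => cos x), (fun _ _ => 0). split; [|split]; trivial.
      * intros x y _. apply (differentiable_pt_lim_proj1_0 sin).
        apply derivable_pt_lim_sin.
      * apply Ck_const.
Qed.

Lemma Ck_pow (k : nat) (D : R -> R -> Prop) (f : R -> R -> R) (n : nat) :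
  Ck k D f -> Ck k D (fun x y => f x y ^ n).
Proof.
  intros Hf. induction n as [|n IH]; simpl.
  - apply Ck_const.
  - now apply Ck_mult.
Qed.

(** * Compactness and periodicity *)

(** By uniform continuity a step of length e / 2 changes f by less than 1. A bounded number of steps
    leads along a row to the side x = a, and then along that side to the corner (a, c). *)
Lemma bounded_rectangle (f : R -> R -> R) (a b c d : R) :
  (forall x y, a <= x <= b -> c <= y <= d -> continuity_2d_pt f x y) ->
  exists M, forall x y, a <= x <= b -> c <= y <= d -> Rabs (f x y) <= M.
Proof.
  intros Hf.
  destruct (Rlt_dec b a) as [Hab|Hab]. { exists 0. intros; lra. }
  destruct (Rlt_dec d c) as [Hcd|Hcd]. { exists 0. intros; lra. }
  apply Rnot_lt_le in Hab. apply Rnot_lt_le in Hcd.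
  destruct (uniform_continuity_2d f a b c d Hf (mkposreal 1 Rlt_0_1)) as [e He].
  simpl in He.
  assert (Hrow : forall y, c <= y <= d -> forall n x, a <= x <= b -> x - a <= INR n * (e / 2) ->
      Rabs (f x y - f a y) <= INR n).
  { intros y Hy. induction n as [|n IH]; intros x Hx Hn.
    - simpl in Hn. replace x with a by lra. rewrite Rminus_diag, Rabs_R0. simpl; lra.
    - rewrite S_INR in *.
      set (x' := Rmax a (x - e / 2)).
      assert (Hx' : a <= x' <= x).
      { split. apply Rmax_l. apply Rmax_lub; destruct e as [e0 He0]; simpl in *; lra. }
      replace (f x y - f a y) with ((f x y - f x' y) + (f x' y - f a y)) by ring.
      apply Rle_trans with (1 := Rabs_triang _ _).
      assert (Rabs (f x y - f x' y) < 1).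
      { apply He; try lra. 2: rewrite Rminus_diag, Rabs_R0; apply cond_pos.
        rewrite Rabs_pos_eq by lra. assert (x - e / 2 <= x') by apply Rmax_r.
        destruct e as [e0 He0]; simpl in *; lra. }
      assert (Rabs (f x' y - f a y) <= INR n).
      { apply IH. lra. unfold x'. apply Rmax_case. 
        rewrite Rminus_diag. apply Rmult_le_pos. apply pos_INR. destruct e; simpl in *; lra. lra. }
      lra. }
  assert (Hcol : forall n y, c <= y <= d -> y - c <= INR n * (e / 2) ->
      Rabs (f a y - f a c) <= INR n).
  { induction n as [|n IH]; intros y Hy Hn.
    - simpl in Hn. replace y with c by lra. rewrite Rminus_diag, Rabs_R0. simpl; lra.
    - rewrite S_INR in *.
      set (y' := Rmax c (y - e / 2)).
      assert (Hy' : c <= y' <= y).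
      { split. apply Rmax_l. apply Rmax_lub; destruct e as [e0 He0]; simpl in *; lra. }
      replace (f a y - f a c) with ((f a y - f a y') + (f a y' - f a c)) by ring.
      apply Rle_trans with (1 := Rabs_triang _ _).
      assert (Rabs (f a y - f a y') < 1).
      { apply He; try lra. rewrite Rminus_diag, Rabs_R0; apply cond_pos.
        rewrite Rabs_pos_eq by lra. assert (y - e / 2 <= y') by apply Rmax_r.
        destruct e as [e0 He0]; simpl in *; lra. }
      assert (Rabs (f a y' - f a c) <= INR n).
      { apply IH. lra. unfold y'. apply Rmax_case. 
        rewrite Rminus_diag. apply Rmult_le_pos. apply pos_INR. destruct e; simpl in *; lra. lra. }
      lra. }
  destruct (INR_unbounded ((b - a) / (e / 2))) as [n1 Hn1].
  destruct (INR_unbounded ((d - c) / (e / 2))) as [n2 Hn2].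
  assert (He0 : 0 < e / 2) by (destruct e; simpl; lra).
  assert (B1 : b - a < INR n1 * (e / 2)).
  { apply Rmult_lt_reg_r with (/ (e / 2)). now apply Rinv_0_lt_compat.
    rewrite Rmult_assoc, Rinv_r by lra. rewrite Rmult_1_r. exact Hn1. }
  assert (B2 : d - c < INR n2 * (e / 2)).
  { apply Rmult_lt_reg_r with (/ (e / 2)). now apply Rinv_0_lt_compat.
    rewrite Rmult_assoc, Rinv_r by lra. rewrite Rmult_1_r. exact Hn2. }
  exists (INR n1 + INR n2 + Rabs (f a c)). intros x y Hx Hy.
  replace (f x y) with ((f x y - f a y) + ((f a y - f a c) + f a c)) by ring.
  apply Rle_trans with (1 := Rabs_triang _ _).
  assert (Rabs (f x y - f a y) <= INR n1) by (apply Hrow; lra).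
  assert (Rabs (f a y - f a c) <= INR n2) by (apply Hcol; lra).
  assert (T := Rabs_triang (f a y - f a c) (f a c)). lra.
Qed.

Lemma periodic_nat (f : R -> R) (n : nat) (x : R) :
  (forall x, f (x + 2 * PI) = f x) -> f (x + 2 * PI * INR n) = f x.
Proof.
  intros Hf. induction n as [|n IH].
  - simpl. f_equal. ring.
  - rewrite <- IH, <- (Hf (x + 2 * PI * INR n)). f_equal. rewrite S_INR. ring.
Qed.

Lemma periodic_Z (f : R -> R) (k : Z) (x : R) :
  (forall x, f (x + 2 * PI) = f x) -> f (x + 2 * PI * IZR k) = f x.
Proof.
  intros Hf. destruct (Z.le_gt_cases 0 k) as [Hk|Hk].
  - rewrite <- (Z2Nat.id k) at 1; trivial. rewrite <- INR_IZR_INZ.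
    now apply periodic_nat.
  - replace k with (- Z.of_nat (Z.to_nat (- k)))%Z by lia.
    rewrite opp_IZR, <- INR_IZR_INZ.
    rewrite <- (periodic_nat f (Z.to_nat (- k)) (x + 2 * PI * - INR (Z.to_nat (- k))) Hf).
    f_equal. ring.
Qed.

(** The representative lies in (0, 2 PI], open on the left, because the lifts of an angle to the
    covering half-plane have to be positive. *)
Lemma angle_reduce (x : R) : exists k : Z, 0 < x + 2 * PI * IZR k <= 2 * PI.
Proof.
  assert (HP := PI_RGT_0).
  destruct (archimed (- x / (2 * PI))) as [H1 H2].
  exists (up (- x / (2 * PI))).
  assert (E : - x = 2 * PI * (- x / (2 * PI))) by (field; lra).
  set (q := - x / (2 * PI)) in *. set (k := IZR (up q)) in *.
  replace x with (- (2 * PI * q)) by lra. nra.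
Qed.

(** * Differential equations on the line *)

Lemma ex_RInt_cont (g : R -> R) (a b : R) :
  (forall s, continuous g s) -> ex_RInt g a b.
Proof. intros Hg. apply (ex_RInt_continuous (V := R_CompleteNormedModule)). auto. Qed.

Lemma is_derive_RInt_cont (g : R -> R) (a t : R) :
  (forall s, continuous g s) -> is_derive (fun t => RInt g a t) t (g t).
Proof.
  intros Hg. apply (is_derive_RInt g (fun t => RInt g a t) a t); auto.
  apply filter_forall. intros b. apply (RInt_correct (V := R_CompleteNormedModule)).
  now apply ex_RInt_cont.
Qed.

(** The weight exp (2 L |t|) defines a norm in which integration from 0 gains the factor 1 / (2 L).
    A Picard step for an L-Lipschitz equation therefore contracts by 1/2 on the whole line at
    once. *)
Lemma RInt_exp_bound (g : R -> R) (c L t : R) :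
  0 < L -> (forall s, continuous g s) ->
  (forall s, Rabs (g s) <= c * exp (2 * L * Rabs s)) ->
  Rabs (RInt g 0 t) <= c / (2 * L) * exp (2 * L * Rabs t).
Proof.
  intros HL.
  assert (Hpos : forall g t, 0 <= t -> (forall s, continuous g s) ->
     (forall s, Rabs (g s) <= c * exp (2 * L * Rabs s)) ->
     Rabs (RInt g 0 t) <= c / (2 * L) * exp (2 * L * Rabs t)).
  { clear g t. intros g t Ht Hg Hb.
    apply Rle_trans with (RInt (fun s => Rabs (g s)) 0 t).
    { apply abs_RInt_le; trivial. now apply ex_RInt_cont. }
    assert (HI : is_RInt (fun s => c * exp (2 * L * s)) 0 t
        (c / (2 * L) * exp (2 * L * t) - c / (2 * L) * exp (2 * L * 0))).
    { apply (is_RInt_derive (fun s => c / (2 * L) * exp (2 * L * s))).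
      - intros x _. auto_derive; trivial. field. lra.
      - intros x _. apply (ex_derive_continuous (V := R_NormedModule)). auto_derive; trivial. }
    apply Rle_trans with (RInt (fun s => c * exp (2 * L * s)) 0 t).
    { apply RInt_le; trivial.
      - apply ex_RInt_cont. intros s. apply (continuous_comp g Rabs); auto.
        apply continuous_Rabs.
      - eexists; exact HI.
      - intros x Hx. assert (B := Hb x). rewrite (Rabs_pos_eq x) in B by lra. exact B. }
    rewrite (is_RInt_unique _ _ _ _ HI), (Rabs_pos_eq t) by trivial.
    rewrite Rmult_0_r, exp_0.
    assert (0 <= c / (2 * L)).
    { apply Rdiv_le_0_compat; [|lra].
      assert (B := Hb 0). rewrite Rabs_R0, Rmult_0_r, exp_0, Rmult_1_r in B.
      apply Rle_trans with (2 := B). apply Rabs_pos. }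
    lra. }
  intros Hg Hb. destruct (Rle_dec 0 t) as [Ht|Ht]; [now apply Hpos|].
  assert (E : RInt g 0 t = - RInt (fun s => g (- s)) 0 (- t)).
  { assert (A : is_RInt (fun s => scal (-1) (g (- s))) 0 (- t) (RInt g (- 0) (- - t))).
    { apply (is_RInt_comp (V := R_CompleteNormedModule) g (fun s => - s) (fun _ => -1)).
      - auto.
      - intros x _. split. auto_derive; trivial; ring. apply continuous_const. }
    rewrite Ropp_0, Ropp_involutive in A.
    rewrite <- (is_RInt_unique _ _ _ _ A).
    rewrite (RInt_scal (V := R_CompleteNormedModule)).
    - apply (eq_trans (y := -1 * RInt (fun s => g (- s)) 0 (- t))); [reflexivity|ring].
    - apply ex_RInt_cont. intros s. apply (continuous_comp Ropp g); auto.
      apply (continuous_opp (fun x : R => x)), continuous_id. }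
  rewrite E, Rabs_Ropp. rewrite <- (Rabs_Ropp t). apply Hpos.
  - lra.
  - intros s. apply (continuous_comp Ropp g); auto.
    apply (continuous_opp (fun x : R => x)), continuous_id.
  - intros s. rewrite <- (Rabs_Ropp s). apply Hb.
Qed.

Lemma pow_half_lt (M : R) (eps : posreal) : exists n, M * (/ 2) ^ n < eps.
Proof.
  destruct (Rle_dec M 0) as [HM|HM].
  - exists O. simpl. destruct eps; simpl; lra.
  - destruct (pow_lt_1_zero (/ 2)) with (y := eps / M) as [n Hn].
    + rewrite Rabs_pos_eq; lra.
    + apply Rdiv_lt_0_compat; destruct eps; simpl; lra.
    + exists n. specialize (Hn n (Nat.le_refl n)).
      rewrite Rabs_pos_eq in Hn by (apply pow_le; lra).
      apply Rmult_lt_reg_r with (/ M). apply Rinv_0_lt_compat; lra.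
      replace (M * (/ 2) ^ n * / M) with ((/ 2) ^ n) by (field; lra). exact Hn.
Qed.

(** As f is bounded and Lipschitz on the whole plane, the weighted estimate gives convergence of the
    iterates on all of R, and no continuation of local solutions is involved. *)
Lemma picard_lindelof (f : R -> R -> R) (L M x0 : R) :
  0 < L -> (forall t x, continuity_2d_pt f t x) ->
  (forall t x y, Rabs (f t x - f t y) <= L * Rabs (x - y)) ->
  (forall t x, Rabs (f t x) <= M) ->
  exists phi : R -> R, phi 0 = x0 /\ forall t, is_derive phi t (f t (phi t)).
Proof.
  intros HL Hf HLip HM.
  set (it := fix it (n : nat) : R -> R :=
     match n with O => fun _ => x0 | S n => fun t => x0 + RInt (fun s => f s (it n s)) 0 t end).
  assert (Hfc : forall g : R -> R, (forall s, continuous g s) -> forall s, continuous (fun s => f s (g s)) s).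
  { intros g Hg s. apply (continuous_2d_comp f (fun s => s) g); auto. apply continuous_id. }
  assert (HI : forall g : R -> R, (forall s, continuous g s) ->
      forall t, is_derive (fun t => x0 + RInt (fun s => f s (g s)) 0 t) t (f t (g t))).
  { intros g Hg t. replace (f t (g t)) with (0 + f t (g t)) by ring.
    apply (is_derive_plus (fun _ => x0)). apply (is_derive_const x0).
    apply (is_derive_RInt_cont (fun s => f s (g s))). auto. }
  assert (Hit : forall n s, continuous (it n) s).
  { induction n as [|n IH]; intros s; simpl.
    - apply continuous_const.
    - apply (ex_derive_continuous (V := R_NormedModule)). eexists. now apply HI. }
  set (C := M / (2 * L)).
  assert (HM0 : 0 <= M) by (apply Rle_trans with (2 := HM 0 0); apply Rabs_pos).
  assert (HC : 0 <= C) by (apply Rdiv_le_0_compat; lra).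
  assert (Hstep : forall n t, Rabs (it (S n) t - it n t) <= C * (/ 2) ^ n * exp (2 * L * Rabs t)).
  { induction n as [|n IH]; intros t.
    - simpl. assert (E : forall a, x0 + a - x0 = a) by (intros; ring). rewrite E; clear E.
      rewrite Rmult_1_r. apply RInt_exp_bound; trivial.
      + intros s. apply (Hfc (fun _ => x0)). intros; apply continuous_const.
      + intros s. apply Rle_trans with (1 := HM _ _). rewrite <- (Rmult_1_r M) at 1.
        apply Rmult_le_compat_l; trivial. rewrite <- exp_0 at 1.
        assert (0 <= 2 * L * Rabs s) by (apply Rmult_le_pos; [lra|apply Rabs_pos]).
        destruct H as [H|H]. left; now apply exp_increasing. rewrite <- H. right; reflexivity.
    - change (Rabs (x0 + RInt (fun s => f s (it (S n) s)) 0 t - (x0 + RInt (fun s => f s (it n s)) 0 t))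
         <= C * (/ 2) ^ (S n) * exp (2 * L * Rabs t)).
      assert (E : forall a b, x0 + a - (x0 + b) = a - b) by (intros; ring). rewrite E; clear E.
      rewrite <- (RInt_minus (V := R_CompleteNormedModule)) by (apply ex_RInt_cont; auto).
      replace (C * (/ 2) ^ (S n)) with (L * (C * (/ 2) ^ n) / (2 * L)) by (simpl; field; lra).
      apply RInt_exp_bound; trivial.
      + intros s. apply (continuous_minus (fun s => f s (it (S n) s))); auto.
      + intros s. apply Rle_trans with (1 := HLip _ _ _). rewrite Rmult_assoc.
        apply Rmult_le_compat_l. lra. apply IH. }
  (* The factor 2 - 2 / 2^m is the sum of the first m powers of 1/2, starting from the power 0. *)
  assert (Hcau : forall n m t, Rabs (it (n + m)%nat t - it n t)
      <= (2 - 2 * (/ 2) ^ m) * (C * (/ 2) ^ n * exp (2 * L * Rabs t))).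
  { intros n m t. induction m as [|m IH].
    - rewrite Nat.add_0_r, Rminus_diag, Rabs_R0. simpl. right; ring.
    - rewrite Nat.add_succ_r.
      replace (it (S (n + m)) t - it n t) with ((it (S (n + m)) t - it (n + m)%nat t) + (it (n + m)%nat t - it n t)) by ring.
      apply Rle_trans with (1 := Rabs_triang _ _).
      assert (H := Hstep (n + m)%nat t). rewrite pow_add in H. simpl pow.
      set (E := exp (2 * L * Rabs t)) in *. set (p := (/ 2) ^ n) in *. set (q := (/ 2) ^ m) in *.
      replace ((2 - 2 * (/ 2 * q)) * (C * p * E)) with (C * (p * q) * E + (2 - 2 * q) * (C * p * E)) by field.
      lra. }
  set (B := fun t => 2 * C * exp (2 * L * Rabs t)).
  assert (Hcau2 : forall n m t, (n <= m)%nat -> Rabs (it m t - it n t) <= B t * (/ 2) ^ n).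
  { intros n m t Hnm. replace m with (n + (m - n))%nat by lia.
    apply Rle_trans with (1 := Hcau _ _ _). unfold B.
    replace (2 * C * exp (2 * L * Rabs t) * (/ 2) ^ n) with (2 * (C * (/ 2) ^ n * exp (2 * L * Rabs t))) by ring.
    apply Rmult_le_compat_r.
    - apply Rmult_le_pos. apply Rmult_le_pos; trivial. apply pow_le; lra. left; apply exp_pos.
    - assert (0 <= (/ 2) ^ (m - n)) by (apply pow_le; lra). lra. }
  assert (Hex : forall t, ex_finite_lim_seq (fun n => it n t)).
  { intros t. apply ex_lim_seq_cauchy_corr. intros eps.
    destruct (pow_half_lt (2 * B t) eps) as [N HN]. exists N. intros n m Hn Hm.
    replace (it n t - it m t) with ((it n t - it N t) - (it m t - it N t)) by ring.
    apply Rle_lt_trans with (1 := Rabs_triang _ _). rewrite Rabs_Ropp.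
    assert (H1 := Hcau2 N n t Hn). assert (H2 := Hcau2 N m t Hm). lra. }
  set (phi := fun t => real (Lim_seq (fun n => it n t))).
  assert (Hphi : forall n t, Rabs (phi t - it n t) <= B t * (/ 2) ^ n).
  { intros n t. destruct (Hex t) as [l Hl].
    assert (E : phi t = l) by (unfold phi; now rewrite (is_lim_seq_unique _ _ Hl)).
    rewrite E.
    assert (H1 : is_lim_seq (fun m => Rabs (it m t - it n t)) (Rabs (l - it n t))).
    { apply (is_lim_seq_abs (fun m => it m t - it n t) (l - it n t)).
      apply is_lim_seq_minus'; trivial. apply is_lim_seq_const. }
    apply (is_lim_seq_le_loc (fun m => Rabs (it m t - it n t)) (fun _ => B t * (/ 2) ^ n)
        (Rabs (l - it n t)) (B t * (/ 2) ^ n)).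
    - exists n. intros m Hm. now apply Hcau2.
    - exact H1.
    - apply is_lim_seq_const. }
  assert (HB : forall t u, Rabs (u - t) < 1 -> B u <= B (Rabs t + 1)).
  { intros t u Hu. unfold B. apply Rmult_le_compat_l. lra.
    assert (Rabs u <= Rabs (Rabs t + 1)).
    { rewrite (Rabs_pos_eq (Rabs t + 1)). 2: assert (A := Rabs_pos t); lra.
      replace u with ((u - t) + t) by ring.
      apply Rle_trans with (1 := Rabs_triang _ _). lra. }
    destruct H as [H|H].
    - left. apply exp_increasing. apply Rmult_lt_compat_l; lra.
    - rewrite H. lra. }
  assert (Hpc : forall t, continuous phi t).
  { intros t. apply continuity_pt_filterlim. intros eps Heps.
    destruct (pow_half_lt (B (Rabs t + 1)) (pos_div_2 (pos_div_2 (mkposreal eps Heps)))) as [N HN].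
    simpl in HN.
    assert (Hc : continuity_pt (it N) t) by (apply continuity_pt_filterlim; apply Hit).
    destruct (Hc (eps / 2)) as [d [Hd1 Hd2]]. lra.
    exists (Rmin d 1). split. apply Rmin_case; lra.
    simpl. unfold R_dist. intros u [[_ Hu] Hd].
    assert (Hu1 : Rabs (u - t) < d) by (apply Rlt_le_trans with (1 := Hd); apply Rmin_l).
    assert (Hu2 : Rabs (u - t) < 1) by (apply Rlt_le_trans with (1 := Hd); apply Rmin_r).
    assert (A1 := Hphi N u). assert (A2 := Hphi N t).
    assert (B1 := HB t u Hu2). assert (B2 := HB t t). rewrite Rminus_diag, Rabs_R0 in B2.
    specialize (B2 Rlt_0_1).
    assert (A3 : Rabs (it N u - it N t) < eps / 2).
    { apply (Hd2 u). split; trivial. split; trivial. exact I. }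
    assert (P : 0 <= (/ 2) ^ N) by (apply pow_le; lra).
    assert (Q1 := Rmult_le_compat_r _ _ _ P B1). assert (Q2 := Rmult_le_compat_r _ _ _ P B2).
    replace (phi u - phi t) with ((phi u - it N u) + (it N u - it N t) - (phi t - it N t)) by ring.
    apply Rle_lt_trans with (1 := Rabs_triang _ _). rewrite Rabs_Ropp.
    apply Rle_lt_trans with (1 := Rplus_le_compat_r _ _ _ (Rabs_triang _ _)). lra. }
  (* Both sides are within a multiple of 2^-N of the same iterate, for every N; a positive
     difference is contradicted by a large N. *)
  assert (Heq : forall t, phi t = x0 + RInt (fun s => f s (phi s)) 0 t).
  { intros t. apply NNPP. intros Hne.
    assert (Hpos : 0 < Rabs (phi t - (x0 + RInt (fun s => f s (phi s)) 0 t))).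
    { apply Rabs_pos_lt. lra. }
    destruct (pow_half_lt (2 * B t) (mkposreal _ Hpos)) as [N HN]. simpl in HN.
    apply Rlt_not_le in HN. apply HN.
    replace (phi t - (x0 + RInt (fun s => f s (phi s)) 0 t)) with
      ((phi t - it (S N) t) + (RInt (fun s => f s (it N s)) 0 t - RInt (fun s => f s (phi s)) 0 t)).
    2: simpl; ring.
    apply Rle_trans with (1 := Rabs_triang _ _).
    assert (A1 := Hphi (S N) t).
    rewrite <- (RInt_minus (V := R_CompleteNormedModule)) by (apply ex_RInt_cont; auto).
    assert (A2 : Rabs (RInt (fun s => minus (f s (it N s)) (f s (phi s))) 0 t)
        <= L * (2 * C * (/ 2) ^ N) / (2 * L) * exp (2 * L * Rabs t)).
    { apply RInt_exp_bound; trivial.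
      - intros s. apply (continuous_minus (fun s => f s (it N s))); auto.
      - intros s. apply Rle_trans with (1 := HLip _ _ _). rewrite Rmult_assoc.
        apply Rmult_le_compat_l. lra. rewrite Rabs_minus_sym.
        apply Rle_trans with (1 := Hphi N s). unfold B. right; ring. }
    assert (P : 0 <= (/ 2) ^ N) by (apply pow_le; lra).
    assert (P2 : 0 <= B t * (/ 2) ^ N).
    { apply Rle_trans with (2 := Hphi N t). apply Rabs_pos. }
    replace (L * (2 * C * (/ 2) ^ N) / (2 * L) * exp (2 * L * Rabs t)) with (B t * (/ 2) ^ N / 2) in A2.
    2: unfold B; field; lra.
    apply Rle_trans with (1 := Rplus_le_compat _ _ _ _ A1 A2). simpl pow. lra. }
  exists phi. split.
  - rewrite Heq, RInt_point. apply Rplus_0_r.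
  - intros t. apply (is_derive_ext (fun t => x0 + RInt (fun s => f s (phi s)) 0 t)).
    + intros s. now rewrite Heq at 1.
    + now apply HI.
Qed.

Lemma is_derive_cont (f : R -> R) (x l : R) : is_derive f x l -> continuous f x.
Proof. intros H. apply (ex_derive_continuous (V := R_NormedModule)). now exists l. Qed.

(** * Comparison of solutions *)

Lemma derive_le (f g df dg : R -> R) (s t : R) :
  s <= t ->
  (forall x, s <= x <= t -> is_derive f x (df x)) ->
  (forall x, s <= x <= t -> is_derive g x (dg x)) ->
  (forall x, s <= x <= t -> df x <= dg x) ->
  f t - f s <= g t - g s.
Proof.
  intros Hst Hf Hg Hle.
  destruct (MVT_gen (fun x => g x - f x) s t (fun x => dg x - df x)) as [c [Hc E]].
  - rewrite Rmin_left, Rmax_right by trivial. intros x Hx.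
    apply (is_derive_minus g f); [apply Hg|apply Hf]; lra.
  - rewrite Rmin_left, Rmax_right by trivial. intros x Hx.
    apply continuity_pt_filterlim. apply (is_derive_cont (fun x => g x - f x) x (dg x - df x)).
    apply (is_derive_minus g f); auto.
  - rewrite Rmin_left, Rmax_right in Hc by trivial.
    specialize (Hle c Hc). nra.
Qed.

Lemma derive_abs_le (f g df dg : R -> R) (s t : R) :
  s <= t ->
  (forall x, s <= x <= t -> is_derive f x (df x)) ->
  (forall x, s <= x <= t -> is_derive g x (dg x)) ->
  (forall x, s <= x <= t -> Rabs (df x) <= dg x) ->
  Rabs (f t - f s) <= g t - g s.
Proof.
  intros Hst Hf Hg Hle. apply Rabs_le. split.
  - assert (H := derive_le (fun x => - g x) f (fun x => - dg x) df s t Hst).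
    assert (- g t - - g s <= f t - f s); [|lra]. apply H; trivial.
    + intros x Hx. apply (is_derive_opp g); auto.
    + intros x Hx. specialize (Hle x Hx). apply Rabs_le_between in Hle. lra.
  - apply derive_le with df dg; trivial.
    intros x Hx. specialize (Hle x Hx). apply Rabs_le_between in Hle. lra.
Qed.

Lemma derive_lipschitz (f df : R -> R) (K a b x y : R) :
  (forall z, a < z < b -> is_derive f z (df z)) ->
  (forall z, a < z < b -> Rabs (df z) <= K) ->
  a < x < b -> a < y < b -> Rabs (f x - f y) <= K * Rabs (x - y).
Proof.
  intros Hf HK.
  assert (H : forall x y, a < x < b -> a < y < b -> x <= y -> Rabs (f y - f x) <= K * (y - x)).
  { clear x y. intros x y Hx Hy Hxy.
    replace (K * (y - x)) with (K * y - K * x) by ring.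
    apply (derive_abs_le f (fun z => K * z) df (fun _ => K)); trivial.
    - intros z Hz. apply Hf; lra.
    - intros z Hz. auto_derive; trivial; ring.
    - intros z Hz. apply HK; lra. }
  intros Hx Hy. destruct (Rle_dec x y) as [Hxy|Hxy].
  - rewrite Rabs_minus_sym, (Rabs_minus_sym x), (Rabs_pos_eq (y - x)) by lra. auto.
  - rewrite (Rabs_pos_eq (x - y)) by lra. apply H; trivial; lra.
Qed.

Lemma continuous_no_zero_pos (w : R -> R) (a s t : R) :
  (forall x, a < x -> continuous w x) -> (forall x, a < x -> w x <> 0) ->
  a < s -> a < t -> 0 < w s -> 0 < w t.
Proof.
  intros Hc Hn Hs Ht Hw.
  destruct (Rtotal_order (w t) 0) as [H|[H|H]]; trivial; exfalso.
  2: now apply (Hn t).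
  destruct (Rtotal_order s t) as [Hst|[Hst|Hst]].
  - destruct (Ranalysis5.IVT_interv (fun x => - w x) s t) as [z [Hz E]]; trivial; try lra.
    + intros x Hx. apply continuity_pt_opp, continuity_pt_filterlim, Hc. lra.
    + apply (Hn z); lra.
  - subst. lra.
  - destruct (Ranalysis5.IVT_interv w t s) as [z [Hz E]]; trivial; try lra.
    + intros x Hx. apply continuity_pt_filterlim, Hc. lra.
    + apply (Hn z); lra.
Qed.

(** The square of the difference is differentiable where its absolute value may not be. Multiplied
    by exp (- 2 L x) it decreases and by exp (2 L x) it increases; square roots give the estimate
    forwards and backwards. *)
Lemma gronwall_le (y1 y2 d1 d2 : R -> R) (L s t : R) :
  s <= t ->
  (forall x, s <= x <= t -> is_derive y1 x (d1 x)) ->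
  (forall x, s <= x <= t -> is_derive y2 x (d2 x)) ->
  (forall x, s <= x <= t -> Rabs (d1 x - d2 x) <= L * Rabs (y1 x - y2 x)) ->
  Rabs (y1 t - y2 t) <= Rabs (y1 s - y2 s) * exp (L * (t - s)) /\
  Rabs (y1 s - y2 s) <= Rabs (y1 t - y2 t) * exp (L * (t - s)).
Proof.
  intros Hst H1 H2 HL.
  assert (Hprod : forall x, s <= x <= t ->
     Rabs ((y1 x - y2 x) * (d1 x - d2 x)) <= L * (y1 x - y2 x) ^ 2).
  { intros x Hx. rewrite Rabs_mult, <- (pow2_abs (y1 x - y2 x)).
    assert (A := HL x Hx). assert (B := Rabs_pos (y1 x - y2 x)). nra. }
  assert (Hd : forall c x, s <= x <= t ->
     is_derive (fun x => (y1 x - y2 x) ^ 2 * exp (c * x)) x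
      ((2 * ((y1 x - y2 x) * (d1 x - d2 x)) + c * (y1 x - y2 x) ^ 2) * exp (c * x))).
  { intros c x Hx.
    evar_last.
    - apply (is_derive_mult (fun x => (y1 x - y2 x) ^ 2) (fun x => exp (c * x))).
      + apply (is_derive_pow (fun x => y1 x - y2 x) 2).
        apply (is_derive_minus y1 y2); auto.
      + apply (is_derive_comp exp (fun x => c * x)).
        apply is_derive_exp. apply (is_derive_scal (fun x => x)). apply is_derive_id.
      + intros; apply Rmult_comm.
    - unfold plus, mult, scal, minus, opp, plus; simpl. unfold mult; simpl.
      unfold one; simpl. ring. }
  assert (Hc : forall x, is_derive (fun _ : R => 0) x 0) by (intros; apply (is_derive_const 0)).
  assert (A1 : (y1 t - y2 t) ^ 2 * exp (- (2 * L) * t) <= (y1 s - y2 s) ^ 2 * exp (- (2 * L) * s)).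
  { assert (H := derive_le _ _ _ (fun _ => 0) s t Hst (Hd (- (2 * L))) (fun x _ => Hc x)).
    simpl in H. cut ((y1 t - y2 t) ^ 2 * exp (- (2 * L) * t) - (y1 s - y2 s) ^ 2 * exp (- (2 * L) * s) <= 0 - 0).
    - simpl; lra.
    - apply H. intros x Hx. assert (P := Hprod x Hx). apply Rabs_le_between in P.
      assert (E := exp_pos (- (2 * L) * x)). simpl in *. nra. }
  assert (A2 : (y1 s - y2 s) ^ 2 * exp ((2 * L) * s) <= (y1 t - y2 t) ^ 2 * exp ((2 * L) * t)).
  { assert (H := derive_le _ _ (fun _ => 0) _ s t Hst (fun x _ => Hc x) (Hd (2 * L))).
    simpl in H. cut (0 - 0 <= (y1 t - y2 t) ^ 2 * exp ((2 * L) * t) - (y1 s - y2 s) ^ 2 * exp ((2 * L) * s)).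
    - simpl; lra.
    - apply H. intros x Hx. assert (P := Hprod x Hx). apply Rabs_le_between in P.
      assert (E := exp_pos ((2 * L) * x)). simpl in *. nra. }
  assert (Hsq : forall a b c, a ^ 2 * exp (2 * b) <= c ^ 2 -> Rabs a * exp b <= Rabs c).
  { intros a b c H. rewrite <- (Rabs_pos_eq (exp b)) by (left; apply exp_pos).
    rewrite <- Rabs_mult. apply Rsqr_le_abs_0. unfold Rsqr.
    replace (2 * b) with (b + b) in H by ring. rewrite exp_plus in H. nra. }
  assert (Hm : forall u v p q, u * exp p <= v * exp q -> u * exp (p - q) <= v).
  { intros u v p q H. apply (Rmult_le_compat_r (exp (- q))) in H. 2: left; apply exp_pos.
    rewrite !Rmult_assoc, <- !exp_plus in H. rewrite Rplus_opp_r, exp_0, Rmult_1_r in H. exact H. }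
  assert (Hm' : forall u v p, u * exp p <= v -> u <= v * exp (- p)).
  { intros u v p H. apply (Rmult_le_compat_r (exp (- p))) in H. 2: left; apply exp_pos.
    rewrite Rmult_assoc, <- exp_plus, Rplus_opp_r, exp_0, Rmult_1_r in H. exact H. }
  replace (L * (t - s)) with (- (L * s - L * t)) by ring.
  split; apply Hm', Hsq.
  - replace (2 * (L * s - L * t)) with (- (2 * L) * t - - (2 * L) * s) by ring. now apply Hm.
  - replace (2 * (L * s - L * t)) with ((2 * L) * s - (2 * L) * t) by ring. now apply Hm.
Qed.

Lemma gronwall (y1 y2 d1 d2 : R -> R) (L a s t : R) :
  (forall x, a < x -> is_derive y1 x (d1 x)) ->
  (forall x, a < x -> is_derive y2 x (d2 x)) ->
  (forall x, a < x -> Rabs (d1 x - d2 x) <= L * Rabs (y1 x - y2 x)) ->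
  a < s -> a < t ->
  Rabs (y1 t - y2 t) <= Rabs (y1 s - y2 s) * exp (L * Rabs (t - s)).
Proof.
  intros H1 H2 HL Hs Ht. destruct (Rle_dec s t) as [H|H].
  - rewrite (Rabs_pos_eq (t - s)) by lra.
    apply gronwall_le with d1 d2; trivial; intros x Hx; [apply H1|apply H2|apply HL]; lra.
  - replace (Rabs (t - s)) with (s - t) by (rewrite Rabs_left; lra).
    apply gronwall_le with d1 d2; try lra; intros x Hx; [apply H1|apply H2|apply HL]; lra.
Qed.

Lemma continuity_2d_pt_lipschitz (f : R -> R -> R) (x y K : R) :
  continuous (fun u => f u y) x ->
  locally_2d (fun u v => Rabs (f u v - f u y) <= K * Rabs (v - y)) x y ->
  continuity_2d_pt f x y.
Proof.
  intros Hc HK eps.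
  assert (Hk : 0 < eps / 2 / (Rabs K + 1)).
  { apply Rdiv_lt_0_compat. destruct eps; simpl; lra. assert (A := Rabs_pos K); lra. }
  assert (Hc1 := continuity_2d_pt_1 _ x y Hc (pos_div_2 eps)).
  apply locally_2d_impl with (2 := locally_2d_and _ _ _ _ HK (locally_2d_and _ _ _ _ Hc1
     (continuity_2d_pt_id2 x y (mkposreal _ Hk)))).
  apply locally_2d_forall. simpl. intros u v [H1 [H2 H3]].
  replace (f u v - f x y) with ((f u v - f u y) + (f u y - f x y)) by ring.
  apply Rle_lt_trans with (1 := Rabs_triang _ _).
  assert (A : Rabs (v - y) * (Rabs K + 1) < eps / 2).
  { apply Rmult_lt_reg_r with (/ (Rabs K + 1)).
    apply Rinv_0_lt_compat; assert (A := Rabs_pos K); lra.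
    rewrite Rmult_assoc, Rinv_r, Rmult_1_r. exact H3. assert (A := Rabs_pos K); lra. }
  assert (B := Rle_abs K). assert (C := Rabs_pos (v - y)). nra.
Qed.

Lemma continuity_2d_pt_RInt (g : R -> R -> R) (a b c d x y : R) :
  (forall s z, a < s < b -> c < z < d -> continuity_2d_pt g s z) ->
  a < 0 < b -> a < x < b -> c < y < d ->
  continuity_2d_pt (fun t z => RInt (fun s => g s z) 0 t) x y.
Proof.
  intros Hg H0 Hx Hy.
  assert (Hgc : forall s z, a < s < b -> c < z < d -> continuous (fun s => g s z) s).
  { intros s z Hs Hz. apply (continuous_2d_comp g (fun s => s) (fun _ => z)); auto.
    apply continuous_id. apply continuous_const. }
  assert (Hex : forall t u z, a < t < b -> a < u < b -> c < z < d -> ex_RInt (fun s => g s z) t u).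
  { intros t u z Ht Hu Hz. apply (ex_RInt_continuous (V := R_CompleteNormedModule)).
    intros s Hs. apply Hgc; trivial. split.
    - apply Rlt_le_trans with (2 := proj1 Hs). apply Rmin_case; lra.
    - apply Rle_lt_trans with (1 := proj2 Hs). apply Rmax_case; lra. }
  intros eps.
  (* The interval [a', b'] is compact in (a, b) and contains 0 and a neighbourhood of x. Uniform
     continuity is used on it, with a tolerance divided by its length plus one. *)
  set (a' := Rmin 0 ((a + x) / 2)). set (b' := Rmax 0 ((b + x) / 2)).
  assert (Ha' : a < a' <= 0). { split. apply Rmin_case; lra. apply Rmin_l. }
  assert (Hb' : 0 <= b' < b). { split. apply Rmax_l. apply Rmax_case; lra. }
  assert (Ha'' : a' <= (a + x) / 2) by apply Rmin_r.
  assert (Hb'' : (b + x) / 2 <= b') by apply Rmax_r.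
  clearbody a' b'.
  assert (Hl : 0 < b' - a' + 1) by lra.
  assert (He : 0 < eps / 2 / (b' - a' + 1)).
  { apply Rdiv_lt_0_compat; trivial. destruct eps; simpl; lra. }
  destruct (uniform_continuity_2d_1d g a' b' y) with (eps := mkposreal _ He) as [e1 He1].
  { intros s Hs. apply Hg; lra. }
  simpl in He1.
  assert (Hc : continuous (fun t => RInt (fun s => g s y) 0 t) x).
  { apply (continuous_RInt_1 (fun s => g s y) 0 x (fun t => RInt (fun s => g s y) 0 t)).
    assert (Hr : 0 < Rmin (x - a) (b - x)) by (apply Rmin_case; lra).
    exists (mkposreal _ Hr). intros t Ht.
    apply (RInt_correct (V := R_CompleteNormedModule)). apply Hex; trivial.
    change (Rabs (t - x) < Rmin (x - a) (b - x)) in Ht.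
    assert (A1 := Rmin_l (x - a) (b - x)). assert (A2 := Rmin_r (x - a) (b - x)).
    apply Rabs_def2 in Ht. lra. }
  assert (Hc1 := continuity_2d_pt_1 _ x y Hc (pos_div_2 eps)).
  assert (Hr : 0 < Rmin (Rmin ((x - a) / 2) ((b - x) / 2)) (Rmin e1 (Rmin (y - c) (d - y)))).
  { repeat apply Rmin_case; try lra. apply cond_pos. }
  assert (Hloc : locally_2d (fun t z => a' <= t <= b' /\ c < z < d /\ Rabs (z - y) < e1) x y).
  { exists (mkposreal _ Hr). simpl. intros t z Ht Hz.
    assert (A1 := Rlt_le_trans _ _ _ (Rlt_le_trans _ _ _ Ht (Rmin_l _ _)) (Rmin_l _ _)).
    assert (A2 := Rlt_le_trans _ _ _ (Rlt_le_trans _ _ _ Ht (Rmin_l _ _)) (Rmin_r _ _)).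
    assert (B1 := Rlt_le_trans _ _ _ (Rlt_le_trans _ _ _ Hz (Rmin_r _ _)) (Rmin_l _ _)).
    assert (B2 := Rlt_le_trans _ _ _ (Rlt_le_trans _ _ _ Hz (Rmin_r _ _)) (Rmin_r _ _)).
    assert (B3 := Rlt_le_trans _ _ _ B2 (Rmin_l _ _)). assert (B4 := Rlt_le_trans _ _ _ B2 (Rmin_r _ _)).
    apply Rabs_def2 in A1. apply Rabs_def2 in A2. apply Rabs_def2 in B3. apply Rabs_def2 in B4.
    repeat split; try lra. }
  apply locally_2d_impl with (2 := locally_2d_and _ _ _ _ Hloc Hc1).
  apply locally_2d_forall. simpl. intros t z [[Ht [Hz Hze]] H2].
  replace (RInt (fun s => g s z) 0 t - RInt (fun s => g s y) 0 x) with
    ((RInt (fun s => g s z) 0 t - RInt (fun s => g s y) 0 t) + 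
     (RInt (fun s => g s y) 0 t - RInt (fun s => g s y) 0 x)) by ring.
  apply Rle_lt_trans with (1 := Rabs_triang _ _).
  assert (B : Rabs (RInt (fun s => g s z) 0 t - RInt (fun s => g s y) 0 t) <= eps / 2).
  { rewrite <- (RInt_minus (V := R_CompleteNormedModule)) by (apply Hex; lra).
    apply Rle_trans with (Rabs (t - 0) * (eps / 2 / (b' - a' + 1))).
    - assert (Hb : forall s, Rmin 0 t <= s <= Rmax 0 t -> norm (minus (g s z) (g s y)) <= eps / 2 / (b' - a' + 1)).
      { intros s Hs. left. assert (a' <= s <= b').
        { split. apply Rle_trans with (2 := proj1 Hs). apply Rmin_case; lra.
          apply Rle_trans with (1 := proj2 Hs). apply Rmax_case; lra. }
        apply (He1 s y s z); trivial.
        - destruct e1; simpl; lra.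
        - apply Rabs_def2 in Hze. lra.
        - rewrite Rminus_diag, Rabs_R0. apply cond_pos. }
      destruct (Rle_dec 0 t) as [H|H].
      + rewrite (Rabs_pos_eq (t - 0)) by lra.
        apply (norm_RInt_le_const (V := R_NormedModule) (fun s => minus (g s z) (g s y)) 0 t); trivial.
        * intros s Hs. apply Hb. now rewrite Rmin_left, Rmax_right.
        * apply (RInt_correct (V := R_CompleteNormedModule)).
          apply (ex_RInt_minus (V := R_NormedModule)); apply Hex; lra.
      + rewrite <- (opp_RInt_swap (V := R_CompleteNormedModule)).
        2: { apply (ex_RInt_minus (V := R_NormedModule)); apply Hex; lra. }
        rewrite <- (Rabs_Ropp (opp _)). change (opp ?u) with (- u). rewrite Ropp_involutive.
        rewrite (Rabs_left (t - 0)) by lra. replace (- (t - 0)) with (0 - t) by ring.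
        apply (norm_RInt_le_const (V := R_NormedModule) (fun s => minus (g s z) (g s y)) t 0); try lra.
        * intros s Hs. apply Hb. now rewrite Rmin_right, Rmax_left by lra.
        * apply (RInt_correct (V := R_CompleteNormedModule)).
          apply (ex_RInt_minus (V := R_NormedModule)); apply Hex; lra.
    - apply Rle_trans with ((b' - a' + 1) * (eps / 2 / (b' - a' + 1))).
      + apply Rmult_le_compat_r. lra. apply Rabs_le. lra.
      + right. field. lra. }
  lra.
Qed.

Lemma Rmax_Rabs (a b : R) : (a + b + Rabs (a - b)) * / 2 = Rmax a b.
Proof.
  unfold Rmax. destruct (Rle_dec a b).
  - rewrite Rabs_left1 by lra. field.
  - rewrite Rabs_pos_eq by lra. field.
Qed.

Lemma continuous_Rmax (f g : R -> R) (x : R) :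
  continuous f x -> continuous g x -> continuous (fun t => Rmax (f t) (g t)) x.
Proof.
  intros Hf Hg.
  apply (continuous_ext (fun t => (f t + g t + Rabs (f t - g t)) * / 2)).
  - intros t. apply Rmax_Rabs.
  - apply (continuous_scal_l (fun t => f t + g t + Rabs (f t - g t)) (/ 2)).
    + apply (continuous_plus (fun t => f t + g t)).
      * now apply (continuous_plus f g).
      * apply (continuous_comp (fun t => f t - g t) Rabs).
        now apply (continuous_minus f g). apply continuous_Rabs.
Qed.

Lemma continuity_2d_pt_Rmax (f g : R -> R -> R) (x y : R) :
  continuity_2d_pt f x y -> continuity_2d_pt g x y ->
  continuity_2d_pt (fun u v => Rmax (f u v) (g u v)) x y.
Proof.
  intros Hf Hg.
  apply continuity_2d_pt_ext with (fun u v => (f u v + g u v + Rabs (f u v - g u v)) * / 2).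
  - intros u v. apply Rmax_Rabs.
  - apply continuity_2d_pt_mult. 2: apply continuity_2d_pt_const.
    apply continuity_2d_pt_plus. now apply continuity_2d_pt_plus.
    apply (continuity_1d_2d_pt_comp Rabs). apply Rcontinuity_abs.
    now apply continuity_2d_pt_minus.
Qed.

(** * The flow between two orbits *)

Definition clamp (a b r : R) : R := Rmax a (Rmin b r).

Lemma clamp_bounds (a b r : R) : a <= b -> a <= clamp a b r <= b.
Proof.
  intros H. split. apply Rmax_l. apply Rmax_lub; trivial. apply Rmin_l.
Qed.

Lemma clamp_id (a b r : R) : a <= r <= b -> clamp a b r = r.
Proof. intros H. unfold clamp. rewrite Rmin_right, Rmax_right; lra. Qed.

Lemma clamp_lipschitz (a b x y : R) : Rabs (clamp a b x - clamp a b y) <= Rabs (x - y).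
Proof.
  unfold clamp, Rmax, Rmin.
  destruct (Rle_dec b x), (Rle_dec b y); repeat (destruct (Rle_dec _ _));
  repeat (unfold Rabs; destruct (Rcase_abs _)); lra.
Qed.

(** F is controlled only for 0 < r < delta. Clamping r between the orbits [lo] and [up], and
    freezing th at -1/2 on its left, yields a bounded and globally Lipschitz equation to which
    [picard_lindelof] applies. Since [lo] and [up] solve the clamped equation too, a solution that
    starts between them stays there, where both equations agree. The bounds -1 < -1/2 < 0 leave room
    for two-sided derivatives at th = 0. *)
Lemma flow_exists (F Fr : R -> R -> R) (delta L : R) (lo up : R -> R) :
  0 < L ->
  (forall th r, 0 < r < delta -> continuity_2d_pt F th r) ->
  (forall th r, 0 < r < delta -> is_derive (F th) r (Fr th r)) ->
  (forall th r, 0 < r < delta -> Rabs (Fr th r) <= L) ->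
  (forall th r, 0 < r < delta -> Rabs (F th r) <= L * r) ->
  (forall th, -1 < th -> 0 < lo th /\ is_derive lo th (F th (lo th))) ->
  (forall th, -1 < th -> up th < delta /\ is_derive up th (F th (up th))) ->
  (forall th, -1 < th -> lo th < up th) ->
  exists phi : R -> R -> R, forall h, lo 0 <= h <= up 0 ->
    phi 0 h = h /\
    forall th, - / 2 < th -> lo th <= phi th h <= up th /\
      is_derive (fun t => phi t h) th (F th (phi th h)).
Proof.
  intros HL HFc HFd HFr HFb Hlo Hup Hlu.
  set (m := fun th => Rmax th (- / 2)).
  assert (Hm : forall th, -1 < m th) by (intros th; unfold m; apply Rlt_le_trans with (2 := Rmax_r _ _); lra).
  assert (Hmi : forall th, - / 2 < th -> m th = th) by (intros; apply Rmax_left; lra).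
  assert (Hmc : forall th, continuous m th).
  { intros th. apply continuous_Rmax. apply continuous_id. apply continuous_const. }
  set (cl := fun th r => clamp (lo (m th)) (up (m th)) r).
  set (f := fun th r => F (m th) (cl th r)).
  assert (Hcl : forall th r, lo (m th) <= cl th r <= up (m th)).
  { intros th r. apply clamp_bounds. left. apply Hlu, Hm. }
  assert (Hcl2 : forall th r, 0 < cl th r < delta).
  { intros th r. destruct (Hlo _ (Hm th)), (Hup _ (Hm th)). specialize (Hcl th r). lra. }
  assert (Hlc : forall th, continuous (fun th => lo (m th)) th).
  { intros th. apply (continuous_comp m lo); auto. destruct (Hlo _ (Hm th)) as [_ H].
    now apply is_derive_cont with (1 := H). }
  assert (Huc : forall th, continuous (fun th => up (m th)) th).
  { intros th. apply (continuous_comp m up); auto. destruct (Hup _ (Hm th)) as [_ H].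
    now apply is_derive_cont with (1 := H). }
  assert (Hclc : forall th r, continuity_2d_pt cl th r).
  { intros th r. unfold cl, clamp. apply continuity_2d_pt_Rmax.
    - apply (continuity_2d_pt_1 (fun th => lo (m th))); auto.
    - apply continuity_2d_pt_ext with (fun th r => - Rmax (- up (m th)) (- r)).
      { intros u v. rewrite Ropp_Rmax, !Ropp_involutive. reflexivity. }
      apply continuity_2d_pt_opp, continuity_2d_pt_Rmax; apply continuity_2d_pt_opp.
      + apply (continuity_2d_pt_1 (fun th => up (m th))); auto.
      + apply continuity_2d_pt_id2. }
  assert (Hfc : forall th r, continuity_2d_pt f th r).
  { intros th r. apply (continuity_2d_pt_comp F (fun th r => m th) cl); auto.
    apply (continuity_2d_pt_1 m); auto. }
  assert (Hfl : forall th x y, Rabs (f th x - f th y) <= L * Rabs (x - y)).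
  { intros th x y. apply Rle_trans with (L * Rabs (cl th x - cl th y)).
    - apply (derive_lipschitz (F (m th)) (Fr (m th)) L 0 delta); auto.
    - apply Rmult_le_compat_l. lra. apply clamp_lipschitz. }
  assert (Hfb : forall th r, Rabs (f th r) <= L * delta).
  { intros th r. apply Rle_trans with (1 := HFb _ _ (Hcl2 th r)).
    apply Rmult_le_compat_l. lra. left; apply Hcl2. }
  assert (Hex : forall h, exists y : R -> R, y 0 = h /\ forall t, is_derive y t (f t (y t))).
  { intros h. now apply (picard_lindelof f L (L * delta)). }
  destruct (choice _ Hex) as [y Hy].
  exists (fun th h => y h th). intros h Hh.
  destruct (Hy h) as [Hy0 Hyd]. split; trivial.
  assert (Hflo : forall th, - / 2 < th -> f th (lo th) = F th (lo th)).
  { intros th Hth. unfold f, cl. rewrite Hmi, clamp_id; trivial.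
    split. right; reflexivity. left; apply Hlu; lra. }
  assert (Hfup : forall th, - / 2 < th -> f th (up th) = F th (up th)).
  { intros th Hth. unfold f, cl. rewrite Hmi, clamp_id; trivial.
    split. left; apply Hlu; lra. right; reflexivity. }
  (* By Gronwall two solutions that meet once coincide, so their order at 0 persists. *)
  assert (Horder : forall b1 b2 : R -> R,
     (forall th, - / 2 < th -> is_derive b1 th (f th (b1 th))) ->
     (forall th, - / 2 < th -> is_derive b2 th (f th (b2 th))) ->
     b1 0 <= b2 0 -> forall th, - / 2 < th -> b1 th <= b2 th).
  { intros b1 b2 H1 H2 H0 th Hth.
    assert (G : forall s t, - / 2 < s -> - / 2 < t -> Rabs (b2 t - b1 t) <= Rabs (b2 s - b1 s) * exp (L * Rabs (t - s))).
    { intros s t Hs Ht. apply gronwall with (fun x => f x (b2 x)) (fun x => f x (b1 x)) (- / 2); trivial.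
    }
    destruct (Req_dec (b1 0) (b2 0)) as [E|NE].
    - assert (A := G 0 th ltac:(lra) Hth). rewrite E, Rminus_diag, Rabs_R0, Rmult_0_l in A.
      assert (B := Rabs_pos (b2 th - b1 th)). apply Rabs_le_between in A. lra.
    - cut (0 < b2 th - b1 th); [lra|].
      apply (continuous_no_zero_pos (fun x => b2 x - b1 x) (- / 2) 0); trivial; try lra.
      + intros x Hx. apply (continuous_minus b2 b1).
        apply is_derive_cont with (1 := H2 x Hx). apply is_derive_cont with (1 := H1 x Hx).
      + intros x Hx E. assert (A := G x 0 Hx ltac:(lra)). rewrite E, Rabs_R0, Rmult_0_l in A.
        apply Rabs_le_between in A. lra. }
  intros th Hth.
  assert (B : lo th <= y h th <= up th).
  { split; [apply (Horder lo (y h))|apply (Horder (y h) up)]; trivial; try lra.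
    - intros x Hx. rewrite Hflo by trivial. apply Hlo. lra.
    - intros x Hx. rewrite Hfup by trivial. apply Hup. lra. }
  split; trivial.
  replace (F th (y h th)) with (f th (y h th)); trivial.
  unfold f, cl. rewrite Hmi, clamp_id; trivial.
Qed.

Lemma is_derive_RInt_open (g : R -> R) (a t : R) :
  (forall s, a < s -> continuous g s) -> a < 0 -> a < t ->
  is_derive (fun t => RInt g 0 t) t (g t).
Proof.
  intros Hg Ha Ht.
  apply (is_derive_RInt g (fun t => RInt g 0 t) 0 t); auto.
  assert (Hr : 0 < t - a) by lra.
  exists (mkposreal _ Hr). intros u Hu.
  change (Rabs (u - t) < t - a) in Hu. apply Rabs_def2 in Hu.
  apply (RInt_correct (V := R_CompleteNormedModule)).
  apply (ex_RInt_continuous (V := R_CompleteNormedModule)).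
  intros s [Hs _]. apply Hg. apply Rlt_le_trans with (2 := Hs). apply Rmin_case; lra.
Qed.

Lemma is_derive_quadratic (f : R -> R) (x l C d : R) :
  0 < d ->
  (forall y, Rabs (y - x) < d -> Rabs (f y - f x - l * (y - x)) <= C * (y - x) ^ 2) ->
  is_derive f x l.
Proof.
  intros Hd H. apply is_derive_Reals. intros eps Heps.
  assert (HC : 0 < Rabs C + 1) by (assert (A := Rabs_pos C); lra).
  assert (Hr : 0 < Rmin d (eps / (Rabs C + 1))).
  { apply Rmin_case; trivial. now apply Rdiv_lt_0_compat. }
  exists (mkposreal _ Hr). simpl. intros h Hh Hhr.
  assert (H1 := Rlt_le_trans _ _ _ Hhr (Rmin_l _ _)).
  assert (H2 := Rlt_le_trans _ _ _ Hhr (Rmin_r _ _)).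
  assert (A := H (x + h)). replace (x + h - x) with h in A by ring. specialize (A H1).
  replace ((f (x + h) - f x) / h - l) with ((f (x + h) - f x - l * h) / h) by (now field).
  unfold Rdiv. rewrite Rabs_mult, Rabs_inv.
  assert (Hp : 0 < Rabs h) by now apply Rabs_pos_lt.
  apply Rmult_lt_reg_r with (Rabs h); trivial. rewrite Rmult_assoc, Rinv_l, Rmult_1_r by lra.
  apply Rle_lt_trans with (1 := A). rewrite <- (pow2_abs h).
  assert (B : Rabs h * (Rabs C + 1) < eps).
  { apply Rmult_lt_reg_r with (/ (Rabs C + 1)). now apply Rinv_0_lt_compat.
    rewrite Rmult_assoc, Rinv_r, Rmult_1_r by lra. exact H2. }
  assert (D := Rle_abs C). nra.
Qed.

Lemma taylor_quadratic (f f1 f2 : R -> R) (L a b x y : R) :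
  (forall z, a < z < b -> is_derive f z (f1 z)) ->
  (forall z, a < z < b -> is_derive f1 z (f2 z)) ->
  (forall z, a < z < b -> Rabs (f2 z) <= L) ->
  a < x < b -> a < y < b -> Rabs (f x - f y - f1 y * (x - y)) <= L * (x - y) ^ 2.
Proof.
  intros H1 H2 HL Hx Hy.
  assert (Hin : forall z, Rmin y x <= z <= Rmax y x -> a < z < b).
  { intros z [A B]. split.
    - apply Rlt_le_trans with (2 := A). apply Rmin_case; lra.
    - apply Rle_lt_trans with (1 := B). apply Rmax_case; lra. }
  destruct (MVT_gen f y x f1) as [c [Hc E]]; cbv zeta in *.
  - intros z Hz. apply H1, Hin; lra.
  - intros z Hz. apply continuity_pt_filterlim.
    apply (is_derive_cont f z (f1 z)). apply H1, Hin; lra.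
  - rewrite E. replace (f1 c * (x - y) - f1 y * (x - y)) with ((f1 c - f1 y) * (x - y)) by ring.
    rewrite Rabs_mult, <- (pow2_abs (x - y)).
    assert (A := derive_lipschitz f1 f2 L a b c y H2 HL (Hin c Hc) Hy).
    assert (B : Rabs (c - y) <= Rabs (x - y)).
    { destruct (Rle_dec x y) as [H|H].
      - rewrite Rmin_right, Rmax_left in Hc by lra. rewrite (Rabs_left1 (c - y)), (Rabs_left1 (x - y)); lra.
      - rewrite Rmin_left, Rmax_right in Hc by lra. rewrite (Rabs_pos_eq (c - y)), (Rabs_pos_eq (x - y)); lra. }
    assert (0 <= L) by (apply Rle_trans with (2 := HL x Hx); apply Rabs_pos).
    apply Rle_trans with (L * Rabs (x - y) * Rabs (x - y)); [|right; ring].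
    apply Rmult_le_compat_r. apply Rabs_pos.
    apply Rle_trans with (1 := A). now apply Rmult_le_compat_l.
Qed.

Section Strip.

Variables (F Fr Frr : R -> R -> R) (delta L : R) (lo up : R -> R) (phi : R -> R -> R).

Hypothesis L_pos : 0 < L.
Hypothesis F_cont : forall th r, 0 < r < delta -> continuity_2d_pt F th r.
Hypothesis Fr_cont : forall th r, 0 < r < delta -> continuity_2d_pt Fr th r.
Hypothesis Frr_cont : forall th r, 0 < r < delta -> continuity_2d_pt Frr th r.
Hypothesis F_der : forall th r, 0 < r < delta -> is_derive (F th) r (Fr th r).
Hypothesis Fr_der : forall th r, 0 < r < delta -> is_derive (Fr th) r (Frr th r).
Hypothesis Fr_bound : forall th r, 0 < r < delta -> Rabs (Fr th r) <= L.
Hypothesis Frr_bound : forall th r, 0 < r < delta -> Rabs (Frr th r) <= L.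
Hypothesis lo_pos : forall th, -1 < th -> 0 < lo th.
Hypothesis up_lt : forall th, -1 < th -> up th < delta.
Hypothesis phi_0 : forall h, lo 0 <= h <= up 0 -> phi 0 h = h.
Hypothesis phi_strip : forall h th, lo 0 <= h <= up 0 -> - / 2 < th -> lo th <= phi th h <= up th.
Hypothesis phi_der : forall h th, lo 0 <= h <= up 0 -> - / 2 < th ->
  is_derive (fun t => phi t h) th (F th (phi th h)).

Lemma phi_range h th : lo 0 <= h <= up 0 -> - / 2 < th -> 0 < phi th h < delta.
Proof.
  intros Hh Hth. assert (A := phi_strip h th Hh Hth).
  assert (B := lo_pos th ltac:(lra)). assert (C := up_lt th ltac:(lra)). lra.
Qed.

Lemma F_lipschitz th x y : 0 < x < delta -> 0 < y < delta ->
  Rabs (F th x - F th y) <= L * Rabs (x - y).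
Proof. apply (derive_lipschitz (F th) (Fr th) L 0 delta); auto. Qed.

Lemma Fr_lipschitz th x y : 0 < x < delta -> 0 < y < delta ->
  Rabs (Fr th x - Fr th y) <= L * Rabs (x - y).
Proof. apply (derive_lipschitz (Fr th) (Frr th) L 0 delta); auto. Qed.

Lemma phi_lipschitz h k s t :
  lo 0 <= h <= up 0 -> lo 0 <= k <= up 0 -> - / 2 < s -> - / 2 < t ->
  Rabs (phi t h - phi t k) <= Rabs (phi s h - phi s k) * exp (L * Rabs (t - s)).
Proof.
  intros Hh Hk Hs Ht.
  apply (gronwall (fun t => phi t h) (fun t => phi t k) (fun t => F t (phi t h))
     (fun t => F t (phi t k)) L (- / 2) s t); auto.
  intros x Hx. apply F_lipschitz; now apply phi_range.
Qed.

Lemma phi_lipschitz_0 h k t :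
  lo 0 <= h <= up 0 -> lo 0 <= k <= up 0 -> - / 2 < t ->
  Rabs (phi t h - phi t k) <= Rabs (h - k) * exp (L * Rabs t).
Proof.
  intros Hh Hk Ht. assert (A := phi_lipschitz h k 0 t Hh Hk ltac:(lra) Ht).
  rewrite (phi_0 h), (phi_0 k), Rminus_0_r in A; trivial.
Qed.

(** If two trajectories met, the Lipschitz estimate run back to time 0 would identify their initial
    values. *)
Lemma phi_increasing h k th :
  lo 0 <= h <= up 0 -> lo 0 <= k <= up 0 -> h < k -> - / 2 < th -> phi th h < phi th k.
Proof.
  intros Hh Hk Hhk Hth. cut (0 < phi th k - phi th h); [lra|].
  apply (continuous_no_zero_pos (fun t => phi t k - phi t h) (- / 2) 0); trivial; try lra.
  - intros x Hx. apply (continuous_minus (fun t => phi t k) (fun t => phi t h)).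
    + apply is_derive_cont with (1 := phi_der k x Hk Hx).
    + apply is_derive_cont with (1 := phi_der h x Hh Hx).
  - intros x Hx E. assert (A := phi_lipschitz k h x 0 Hk Hh Hx ltac:(lra)).
    rewrite E, Rabs_R0, Rmult_0_l, (phi_0 h), (phi_0 k) in A; trivial.
    apply Rabs_le_between in A. lra.
  - rewrite (phi_0 h), (phi_0 k); trivial. lra.
Qed.

(** The logarithm of the derivative of the flow in its initial value h, as given by the linearised
    equation. The integral makes sense before the flow is known to be differentiable in h. *)
Definition log_variation (th h : R) : R := RInt (fun s => Fr s (phi s h)) 0 th.

Lemma log_variation_der h th : lo 0 <= h <= up 0 -> - / 2 < th ->
  is_derive (fun t => log_variation t h) th (Fr th (phi th h)).
Proof.
  intros Hh Hth. apply (is_derive_RInt_open (fun s => Fr s (phi s h)) (- / 2)); trivial; try lra.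
  intros s Hs. apply (continuous_2d_comp Fr (fun s => s) (fun s => phi s h)).
  - apply Fr_cont. now apply phi_range.
  - apply continuous_id.
  - apply is_derive_cont with (1 := phi_der h s Hh Hs).
Qed.

Lemma log_variation_0 h : log_variation 0 h = 0.
Proof. apply (RInt_point (V := R_CompleteNormedModule)). Qed.

Lemma log_variation_le h th : lo 0 <= h <= up 0 -> - / 2 < th ->
  Rabs (log_variation th h) <= L * Rabs th.
Proof.
  intros Hh Hth.
  replace (log_variation th h) with (log_variation th h - log_variation 0 h)
    by (rewrite log_variation_0; ring).
  rewrite <- (Rminus_0_r th) at 2. assert (Ht := Rabs_pos th). assert (Ha := Rle_abs th).
  apply (derive_lipschitz (fun t => log_variation t h) (fun t => Fr t (phi t h)) L (- / 2) (Rabs th + 1)); try lra.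
  - intros z Hz. apply log_variation_der; lra.
  - intros z Hz. apply Fr_bound, phi_range; lra.
Qed.

Lemma log_variation_lipschitz h k th :
  lo 0 <= h <= up 0 -> lo 0 <= k <= up 0 -> - / 2 < th ->
  Rabs (log_variation th h - log_variation th k)
   <= L * exp (L * (Rabs th + 1)) * Rabs th * Rabs (h - k).
Proof.
  intros Hh Hk Hth. set (T := Rabs th + 1).
  assert (Ht := Rabs_pos th). assert (Ha := Rle_abs th).
  assert (A : Rabs ((log_variation th h - log_variation th k) - (log_variation 0 h - log_variation 0 k))
     <= L * exp (L * T) * Rabs (h - k) * Rabs (th - 0)).
  { apply (derive_lipschitz (fun t => log_variation t h - log_variation t k)
      (fun t => Fr t (phi t h) - Fr t (phi t k)) _ (- / 2) T); unfold T; try lra.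
    - intros z Hz. apply (is_derive_minus (fun t => log_variation t h) (fun t => log_variation t k));
        apply log_variation_der; lra.
    - intros z Hz. apply Rle_trans with (1 := Fr_lipschitz _ _ _ (phi_range h z Hh ltac:(lra)) (phi_range k z Hk ltac:(lra))).
      rewrite Rmult_assoc. apply Rmult_le_compat_l. lra.
      apply Rle_trans with (1 := phi_lipschitz_0 h k z Hh Hk ltac:(lra)).
      rewrite Rmult_comm. apply Rmult_le_compat_r. apply Rabs_pos.
      assert (L * Rabs z < L * (Rabs th + 1)).
      { apply Rmult_lt_compat_l; trivial. apply Rabs_def1; lra. }
      left. now apply exp_increasing. }
  rewrite !log_variation_0, !Rminus_0_r in A. fold T. 
  apply Rle_trans with (1 := A). right; ring.
Qed.

Lemma phi_cont2 h th : lo 0 < h < up 0 -> - / 2 < th -> continuity_2d_pt phi th h.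
Proof.
  intros Hh Hth. apply continuity_2d_pt_lipschitz with (exp (L * (Rabs th + 1))).
  - apply is_derive_cont with (1 := phi_der h th ltac:(lra) Hth).
  - assert (Hr : 0 < Rmin (Rmin 1 (th + / 2)) (Rmin (h - lo 0) (up 0 - h))) by (repeat apply Rmin_case; lra).
    exists (mkposreal _ Hr). simpl. intros u v Hu Hv.
    assert (A1 := Rlt_le_trans _ _ _ (Rlt_le_trans _ _ _ Hu (Rmin_l _ _)) (Rmin_l _ _)).
    assert (A2 := Rlt_le_trans _ _ _ (Rlt_le_trans _ _ _ Hu (Rmin_l _ _)) (Rmin_r _ _)).
    assert (B1 := Rlt_le_trans _ _ _ (Rlt_le_trans _ _ _ Hv (Rmin_r _ _)) (Rmin_l _ _)).
    assert (B2 := Rlt_le_trans _ _ _ (Rlt_le_trans _ _ _ Hv (Rmin_r _ _)) (Rmin_r _ _)).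
    apply Rabs_def2 in B1. apply Rabs_def2 in B2. assert (A3 := Rabs_def2 _ _ A2).
    apply Rle_trans with (1 := phi_lipschitz_0 v h u ltac:(lra) ltac:(lra) ltac:(lra)).
    rewrite Rmult_comm. apply Rmult_le_compat_r. apply Rabs_pos.
    left. apply exp_increasing, Rmult_lt_compat_l; trivial.
    replace u with ((u - th) + th) by ring. apply Rle_lt_trans with (1 := Rabs_triang _ _). lra.
Qed.

Lemma log_variation_cont2 h th : lo 0 < h < up 0 -> - / 2 < th ->
  continuity_2d_pt log_variation th h.
Proof.
  intros Hh Hth.
  apply continuity_2d_pt_lipschitz with (L * exp (L * (Rabs th + 1 + 1)) * (Rabs th + 1)).
  - apply is_derive_cont with (1 := log_variation_der h th ltac:(lra) Hth).
  - assert (Hr : 0 < Rmin (Rmin 1 (th + / 2)) (Rmin (h - lo 0) (up 0 - h))) by (repeat apply Rmin_case; lra).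
    exists (mkposreal _ Hr). simpl. intros u v Hu Hv.
    assert (A1 := Rlt_le_trans _ _ _ (Rlt_le_trans _ _ _ Hu (Rmin_l _ _)) (Rmin_l _ _)).
    assert (A2 := Rlt_le_trans _ _ _ (Rlt_le_trans _ _ _ Hu (Rmin_l _ _)) (Rmin_r _ _)).
    assert (B1 := Rlt_le_trans _ _ _ (Rlt_le_trans _ _ _ Hv (Rmin_r _ _)) (Rmin_l _ _)).
    assert (B2 := Rlt_le_trans _ _ _ (Rlt_le_trans _ _ _ Hv (Rmin_r _ _)) (Rmin_r _ _)).
    apply Rabs_def2 in B1. apply Rabs_def2 in B2. assert (A3 := Rabs_def2 _ _ A2).
    apply Rle_trans with (1 := log_variation_lipschitz v h u ltac:(lra) ltac:(lra) ltac:(lra)).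
    apply Rmult_le_compat_r. apply Rabs_pos.
    assert (Hu' : Rabs u <= Rabs th + 1).
    { replace u with ((u - th) + th) by ring. apply Rle_trans with (1 := Rabs_triang _ _). lra. }
    assert (He : exp (L * (Rabs u + 1)) <= exp (L * (Rabs th + 1 + 1))).
    { destruct (Req_dec (Rabs u) (Rabs th + 1)) as [E|NE]. rewrite E; lra.
      left. apply exp_increasing, Rmult_lt_compat_l; lra. }
    assert (Hp := exp_pos (L * (Rabs u + 1))). assert (Hq := Rabs_pos u).
    apply Rmult_le_compat; try lra. apply Rmult_le_pos; lra.
    apply Rmult_le_compat_l; lra.
Qed.

(** The difference of two trajectories, divided by the solution of the linearised equation, is the
    function [D]. Its derivative is the Taylor remainder of F times a bounded factor, hence O((k -
    h)^2), while its value at 0 is k - h. A quadratic error of this kind determines the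
    derivative. *)
Lemma phi_h_der h th : lo 0 < h < up 0 -> - / 2 < th ->
  is_derive (phi th) h (exp (log_variation th h)).
Proof.
  intros Hh Hth. set (T := Rabs th + 1).
  assert (Ht := Rabs_pos th). assert (Ha := Rle_abs th).
  (* The outer exponential bounds exp (- [log_variation]); the other factor bounds the Taylor
     remainder through the Lipschitz constant exp (L T) of the flow. *)
  set (C := exp (L * T) * (L * (exp (L * T)) ^ 2)).
  apply is_derive_quadratic with (exp (log_variation th h) * (C * Rabs th)) (Rmin (h - lo 0) (up 0 - h)).
  { apply Rmin_case; lra. }
  intros k Hk.
  assert (B1 := Rabs_def2 _ _ (Rlt_le_trans _ _ _ Hk (Rmin_l _ _))).
  assert (B2 := Rabs_def2 _ _ (Rlt_le_trans _ _ _ Hk (Rmin_r _ _))).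
  assert (Hh' : lo 0 <= h <= up 0) by lra. assert (Hk' : lo 0 <= k <= up 0) by lra.
  set (D := fun s => (phi s k - phi s h) * exp (- log_variation s h)).
  assert (A : Rabs (D th - D 0) <= C * (k - h) ^ 2 * Rabs (th - 0)).
  { apply (derive_lipschitz D (fun s => (F s (phi s k) - F s (phi s h) - Fr s (phi s h) * (phi s k - phi s h))
       * exp (- log_variation s h)) _ (- / 2) T); unfold T; try lra.
    - intros z Hz. unfold D. evar_last.
      + apply (is_derive_mult (fun s => phi s k - phi s h) (fun s => exp (- log_variation s h))).
        * apply (is_derive_minus (fun s => phi s k) (fun s => phi s h)); apply phi_der; lra.
        * apply (is_derive_comp exp (fun s => - log_variation s h)). apply is_derive_exp.
          apply (is_derive_opp (fun s => log_variation s h)). apply log_variation_der; lra.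
        * intros; apply Rmult_comm.
      + unfold plus, mult, scal, minus, opp, plus; simpl. unfold mult; simpl. ring.
    - intros z Hz. rewrite Rabs_mult, (Rabs_pos_eq (exp _)) by (left; apply exp_pos).
      assert (Hzk := phi_range k z Hk' ltac:(lra)). assert (Hzh := phi_range h z Hh' ltac:(lra)).
      assert (Q := taylor_quadratic (F z) (Fr z) (Frr z) L 0 delta _ _ (F_der z) (Fr_der z) (Frr_bound z) Hzk Hzh).
      assert (HzT : Rabs z < Rabs th + 1) by (apply Rabs_def1; lra).
      assert (Hexp : exp (L * Rabs z) <= exp (L * T)).
      { left. now apply exp_increasing, Rmult_lt_compat_l. }
      assert (P : Rabs (phi z k - phi z h) <= Rabs (k - h) * exp (L * T)).
      { apply Rle_trans with (1 := phi_lipschitz_0 k h z Hk' Hh' ltac:(lra)).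
        apply Rmult_le_compat_l; trivial. apply Rabs_pos. }
      assert (P2 : (phi z k - phi z h) ^ 2 <= (k - h) ^ 2 * exp (L * T) ^ 2).
      { rewrite <- (pow2_abs (phi z k - phi z h)), <- (pow2_abs (k - h)), <- Rpow_mult_distr.
        apply pow_incr. split; trivial. apply Rabs_pos. }
      assert (P3 : exp (- log_variation z h) <= exp (L * T)).
      { apply Rle_trans with (2 := Hexp).
        assert (X := log_variation_le h z Hh' ltac:(lra)). apply Rabs_le_between in X.
        destruct (Req_dec (- log_variation z h) (L * Rabs z)) as [E|NE]. rewrite E; lra.
        left. apply exp_increasing. lra. }
      rewrite Rmult_comm. unfold C. rewrite !Rmult_assoc.
      apply Rmult_le_compat; trivial. left; apply exp_pos. apply Rabs_pos.
      apply Rle_trans with (1 := Q). apply Rmult_le_compat_l. lra. lra. }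
  unfold D in A. rewrite log_variation_0, Ropp_0, exp_0, Rmult_1_r, (phi_0 h), (phi_0 k), Rminus_0_r in A; trivial.
  replace (phi th k - phi th h - exp (log_variation th h) * (k - h)) with
    (exp (log_variation th h) * ((phi th k - phi th h) * exp (- log_variation th h) - (k - h))).
  - rewrite Rabs_mult, (Rabs_pos_eq (exp _)) by (left; apply exp_pos).
    rewrite Rmult_assoc. apply Rmult_le_compat_l. left; apply exp_pos.
    apply Rle_trans with (1 := A). right; ring.
  - rewrite exp_Ropp. field. apply Rgt_not_eq, exp_pos.
Qed.

Definition log_variation_h (th h : R) : R :=
  RInt (fun s => Frr s (phi s h) * exp (log_variation s h)) 0 th.

Lemma variation_cont2 h th : lo 0 < h < up 0 -> - / 2 < th ->
  continuity_2d_pt (fun s k => exp (log_variation s k)) th h.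
Proof.
  intros Hh Hth. apply (continuity_1d_2d_pt_comp exp).
  - apply derivable_continuous_pt, derivable_pt_exp.
  - now apply log_variation_cont2.
Qed.

Lemma log_variation_h_integrand_cont2 h th : lo 0 < h < up 0 -> - / 2 < th ->
  continuity_2d_pt (fun s k => Frr s (phi s k) * exp (log_variation s k)) th h.
Proof.
  intros Hh Hth. apply continuity_2d_pt_mult.
  - apply (continuity_2d_pt_comp Frr (fun s _ => s) phi).
    + apply Frr_cont, phi_range; lra.
    + apply continuity_2d_pt_id1.
    + now apply phi_cont2.
  - now apply variation_cont2.
Qed.

Lemma log_variation_h_cont2 h th : lo 0 < h < up 0 -> - / 2 < th ->
  continuity_2d_pt log_variation_h th h.
Proof.
  intros Hh Hth. assert (Ht := Rabs_pos th). assert (Ha := Rle_abs th).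
  apply (continuity_2d_pt_RInt (fun s k => Frr s (phi s k) * exp (log_variation s k)) (- / 2) (Rabs th + 1) (lo 0) (up 0)); try lra.
  intros s z Hs Hz. apply log_variation_h_integrand_cont2; lra.
Qed.

Lemma continuity_2d_pt_swap (f : R -> R -> R) (x y : R) :
  continuity_2d_pt f x y -> continuity_2d_pt (fun u v => f v u) y x.
Proof.
  intros H eps. destruct (H eps) as [d Hd]. exists d. intros u v Hu Hv. now apply Hd.
Qed.

Lemma log_variation_h_der h th : lo 0 < h < up 0 -> - / 2 < th ->
  is_derive (log_variation th) h (log_variation_h th h).
Proof.
  intros Hh Hth.
  assert (Hd : forall k s, lo 0 < k < up 0 -> - / 2 < s ->
     is_derive (fun k => Fr s (phi s k)) k (Frr s (phi s k) * exp (log_variation s k))).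
  { intros k s Hk Hs. evar_last.
    - apply (is_derive_comp (Fr s) (phi s)). apply Fr_der, phi_range; lra.
      apply phi_h_der; trivial.
    - unfold scal; simpl; unfold mult; simpl. ring. }
  assert (Hs : forall s, Rmin 0 th <= s <= Rmax 0 th -> - / 2 < s).
  { intros s Hs. apply Rlt_le_trans with (2 := proj1 Hs). apply Rmin_case; lra. }
  assert (Hr : 0 < Rmin (h - lo 0) (up 0 - h)) by (apply Rmin_case; lra).
  assert (Hloc : forall u, Rabs (u - h) < Rmin (h - lo 0) (up 0 - h) -> lo 0 < u < up 0).
  { intros u Hu. assert (B1 := Rabs_def2 _ _ (Rlt_le_trans _ _ _ Hu (Rmin_l _ _))).
    assert (B2 := Rabs_def2 _ _ (Rlt_le_trans _ _ _ Hu (Rmin_r _ _))). lra. }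
  evar_last.
  - apply (is_derive_RInt_param (fun k s => Fr s (phi s k)) 0 th h).
    + exists (mkposreal _ Hr). intros u Hu t Htt. eexists. apply Hd; auto.
    + intros t Htt.
      apply continuity_2d_pt_ext_loc with (fun k s => Frr s (phi s k) * exp (log_variation s k)).
      * assert (Ht := Hs t Htt).
        assert (Hr2 : 0 < Rmin (Rmin (h - lo 0) (up 0 - h)) (t + / 2)) by (apply Rmin_case; lra).
        exists (mkposreal _ Hr2). simpl. intros u v Hu Hv. symmetry.
        apply is_derive_unique, Hd.
        -- apply Hloc. apply Rlt_le_trans with (1 := Hu). apply Rmin_l.
        -- assert (A := Rabs_def2 _ _ (Rlt_le_trans _ _ _ Hv (Rmin_r _ _))). lra.
      * apply (continuity_2d_pt_swap (fun s k => Frr s (phi s k) * exp (log_variation s k))).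
        apply log_variation_h_integrand_cont2; auto.
    + exists (mkposreal _ Hr). intros u Hu.
      apply (ex_RInt_continuous (V := R_CompleteNormedModule)). intros s Hss.
      assert (Hu' := Hloc u Hu).
      apply (continuous_2d_comp Fr (fun s => s) (fun s => phi s u)).
      * apply Fr_cont, phi_range. lra. auto.
      * apply continuous_id.
      * apply is_derive_cont with (1 := phi_der u s ltac:(lra) (Hs s Hss)).
  - apply RInt_ext. intros s Hss. apply is_derive_unique, Hd; trivial. apply Hs. lra.
Qed.

Hypothesis lo_der : forall th, -1 < th -> is_derive lo th (F th (lo th)).
Hypothesis up_der : forall th, -1 < th -> is_derive up th (F th (up th)).

Lemma phi_eq_solution (b : R -> R) th :
  (forall t, -1 < t -> 0 < b t < delta) ->
  (forall t, -1 < t -> is_derive b t (F t (b t))) ->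
  lo 0 <= b 0 <= up 0 -> - / 2 < th -> phi th (b 0) = b th.
Proof.
  intros Hb Hbd Hb0 Hth.
  assert (A : Rabs (phi th (b 0) - b th) <= Rabs (phi 0 (b 0) - b 0) * exp (L * Rabs (th - 0))).
  { apply (gronwall (fun t => phi t (b 0)) b (fun t => F t (phi t (b 0))) (fun t => F t (b t)) L (- / 2)); trivial; try lra.
    - intros x Hx. now apply phi_der.
    - intros x Hx. apply Hbd; lra.
    - intros x Hx. apply F_lipschitz. now apply phi_range. apply Hb; lra. }
  rewrite phi_0, Rminus_diag, Rabs_R0, Rmult_0_l in A by trivial.
  assert (B := Rabs_pos (phi th (b 0) - b th)). apply Rabs_le_between in A. lra.
Qed.

Hypothesis lo_lt_up : forall th, -1 < th -> lo th < up th.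

(** Differentiability in h is available strictly inside the strip only. The intermediate value
    theorem is therefore used between lo 0 + m and up 0 - m, with m so small that, by the Lipschitz
    estimate, the images of these points stay on the two sides of r. *)
Lemma phi_surjective th r : - / 2 < th -> lo th < r < up th ->
  exists h, lo 0 < h < up 0 /\ phi th h = r.
Proof.
  intros Hth Hr.
  assert (H01 := lo_lt_up 0 ltac:(lra)).
  assert (Elo : phi th (lo 0) = lo th).
  { apply phi_eq_solution; trivial; try lra. intros t Ht.
    assert (A := lo_pos t Ht). assert (B := up_lt t Ht). assert (C := lo_lt_up t Ht). lra. }
  assert (Eup : phi th (up 0) = up th).
  { apply phi_eq_solution; trivial; try lra. intros t Ht.
    assert (A := lo_pos t Ht). assert (B := up_lt t Ht). assert (C := lo_lt_up t Ht). lra. }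
  set (E := exp (L * Rabs th)). assert (HE : 0 < E) by apply exp_pos.
  set (m := Rmin ((up 0 - lo 0) / 3) (Rmin ((r - lo th) / E / 2) ((up th - r) / E / 2))).
  assert (Hm : 0 < m).
  { unfold m. repeat apply Rmin_case; try lra;
    (apply Rdiv_lt_0_compat; [|lra]); apply Rdiv_lt_0_compat; lra. }
  assert (M1 : m <= (up 0 - lo 0) / 3) by apply Rmin_l.
  assert (M2 : m * E < r - lo th).
  { assert (m <= (r - lo th) / E / 2) by (apply Rle_trans with (1 := Rmin_r _ _); apply Rmin_l).
    apply Rle_lt_trans with ((r - lo th) / E / 2 * E). apply Rmult_le_compat_r; lra.
    replace ((r - lo th) / E / 2 * E) with ((r - lo th) / 2) by (field; lra). lra. }
  assert (M3 : m * E < up th - r).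
  { assert (m <= (up th - r) / E / 2) by (apply Rle_trans with (1 := Rmin_r _ _); apply Rmin_r).
    apply Rle_lt_trans with ((up th - r) / E / 2 * E). apply Rmult_le_compat_r; lra.
    replace ((up th - r) / E / 2 * E) with ((up th - r) / 2) by (field; lra). lra. }
  assert (A := phi_lipschitz_0 (lo 0 + m) (lo 0) th ltac:(lra) ltac:(lra) Hth).
  assert (B := phi_lipschitz_0 (up 0 - m) (up 0) th ltac:(lra) ltac:(lra) Hth).
  rewrite Elo in A. replace (lo 0 + m - lo 0) with m in A by ring. rewrite (Rabs_pos_eq m) in A by lra.
  rewrite Eup in B. replace (up 0 - m - up 0) with (- m) in B by ring.
  rewrite Rabs_Ropp, (Rabs_pos_eq m) in B by lra.
  fold E in A, B. apply Rabs_le_between in A. apply Rabs_le_between in B.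
  destruct (Ranalysis5.IVT_interv (fun h => phi th h - r) (lo 0 + m) (up 0 - m)) as [h [Hh Eh]]; try lra.
  - intros h Hh. apply continuity_pt_minus.
    + apply continuity_pt_filterlim. apply is_derive_cont with (exp (log_variation th h)).
      apply phi_h_der; trivial; lra.
    + apply continuity_pt_const. now intros ? ?.
  - exists h. split; lra.
Qed.

Variables (Z : R -> R) (Zm k0 k1 : R).
Hypothesis Z_der : forall th, 0 <= th -> is_derive Z th (up th - lo th).
Hypothesis Z_0 : Z 0 = 0.
Hypothesis Z_le : forall th, 0 <= th -> Z th <= Zm.
Hypothesis k_strip : lo 0 < k0 /\ k0 < k1 /\ k1 < up 0.

(** Denjoy's distortion estimate. By the mean value theorem some c in [k0, k1] satisfies (k1 - k0)
    exp ([log_variation] th c) = phi th k1 - phi th k0, which is at most the width of the strip. Two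
    values of [log_variation] at th differ by at most L times the integral Z of that width, because
    [Fr] is Lipschitz in r. So the estimate at c holds everywhere up to the factor exp (L Zm). *)
Lemma variation_bound h th : lo 0 < h < up 0 -> 0 <= th ->
  exp (log_variation th h) <= exp (L * Zm) / (k1 - k0) * (up th - lo th).
Proof.
  intros Hh Hth. assert (Hth' : - / 2 < th) by lra.
  destruct (MVT_gen (phi th) k0 k1 (fun h => exp (log_variation th h))) as [c [Hc E]];
   cbv zeta in *; rewrite Rmin_left, Rmax_right in * by lra.
  - intros x Hx. apply phi_h_der; trivial; lra.
  - intros x Hx. apply continuity_pt_filterlim.
    apply is_derive_cont with (exp (log_variation th x)). apply phi_h_der; trivial; lra.
  - assert (A : Rabs ((log_variation th h - log_variation th c) - (log_variation 0 h - log_variation 0 c))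
       <= L * Z th - L * Z 0).
    { apply (derive_abs_le (fun t => log_variation t h - log_variation t c) (fun t => L * Z t)
       (fun t => Fr t (phi t h) - Fr t (phi t c)) (fun t => L * (up t - lo t))); trivial.
      - intros x Hx. apply (is_derive_minus (fun t => log_variation t h) (fun t => log_variation t c));
          apply log_variation_der; lra.
      - intros x Hx. apply (is_derive_scal Z). apply Z_der; lra.
      - intros x Hx. apply Rle_trans with (L * Rabs (phi x h - phi x c)).
        + apply Fr_lipschitz; apply phi_range; lra.
        + apply Rmult_le_compat_l. lra.
          assert (B1 := phi_strip h x ltac:(lra) ltac:(lra)).
          assert (B2 := phi_strip c x ltac:(lra) ltac:(lra)). apply Rabs_le; lra. }
    rewrite !log_variation_0, Z_0 in A. apply Rabs_le_between in A.
    assert (B := Z_le th Hth). assert (B' := Rmult_le_compat_l L _ _ ltac:(lra) B).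
    assert (C : exp (log_variation th h) <= exp (L * Zm) * exp (log_variation th c)).
    { rewrite <- exp_plus. destruct (Req_dec (log_variation th h) (L * Zm + log_variation th c)) as [X|X].
      rewrite X; lra. left. apply exp_increasing. lra. }
    apply Rle_trans with (1 := C). unfold Rdiv. rewrite Rmult_assoc.
    apply Rmult_le_compat_l. left; apply exp_pos.
    assert (B1 := phi_strip k0 th ltac:(lra) ltac:(lra)).
    assert (B2 := phi_strip k1 th ltac:(lra) ltac:(lra)).
    apply Rmult_le_reg_l with (k1 - k0). lra. rewrite <- Rmult_assoc, Rinv_r, Rmult_1_l by lra. lra.
Qed.

(** By [variation_bound] the integrand is at most a constant times the width of the strip, whose
    integral is bounded by Zm. The bound is uniform in th, hence in the number of turns. *)
Lemma log_variation_h_bound h th : lo 0 < h < up 0 -> 0 <= th ->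
  Rabs (log_variation_h th h) <= L * (exp (L * Zm) / (k1 - k0)) * Zm.
Proof.
  intros Hh Hth. set (K := L * (exp (L * Zm) / (k1 - k0))).
  assert (HK : 0 <= K).
  { apply Rmult_le_pos. lra. apply Rdiv_le_0_compat. left; apply exp_pos. lra. }
  assert (A : Rabs (log_variation_h th h - log_variation_h 0 h) <= K * Z th - K * Z 0).
  { apply (derive_abs_le (fun t => log_variation_h t h) (fun t => K * Z t)
       (fun t => Frr t (phi t h) * exp (log_variation t h)) (fun t => K * (up t - lo t))); trivial.
    - intros x Hx. apply (is_derive_RInt_open (fun t => Frr t (phi t h) * exp (log_variation t h)) (- / 2)); try lra.
      intros s Hs.
      apply (continuous_2d_comp (fun s k => Frr s (phi s k) * exp (log_variation s k)) (fun s => s) (fun _ => h)).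
      + now apply log_variation_h_integrand_cont2.
      + apply continuous_id.
      + apply continuous_const.
    - intros x Hx. apply (is_derive_scal Z). apply Z_der; lra.
    - intros x Hx. rewrite Rabs_mult, (Rabs_pos_eq (exp _)) by (left; apply exp_pos).
      unfold K. rewrite Rmult_assoc. apply Rmult_le_compat.
      + apply Rabs_pos.
      + left; apply exp_pos.
      + apply Frr_bound, phi_range; lra.
      + apply variation_bound; lra. }
  assert (E0 : log_variation_h 0 h = 0) by apply (RInt_point (V := R_CompleteNormedModule)).
  rewrite E0, Z_0, !Rminus_0_r, Rmult_0_r, Rminus_0_r in A.
  apply Rle_trans with (1 := A). apply Rmult_le_compat_l; auto.
Qed.

Variables (v v1 : R -> R).
Hypothesis v_der : forall h, is_derive v h (v1 h).
Hypothesis v1_cont : forall h, continuous v1 h.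

Lemma locally_2d_pos (f : R -> R -> R) (x y : R) :
  continuity_2d_pt f x y -> 0 < f x y -> locally_2d (fun u w => 0 < f u w) x y.
Proof.
  intros Hf Hp. apply locally_2d_impl with (2 := Hf (mkposreal _ Hp)).
  apply locally_2d_forall. simpl. intros u w H. apply Rabs_def2 in H. lra.
Qed.

Lemma strip_locally th r : 0 < th -> lo th < r < up th ->
  locally_2d (fun t s => 0 < t /\ lo t < s < up t) th r.
Proof.
  intros Hth Hr.
  assert (C1 : continuity_2d_pt (fun t s => s - lo t) th r).
  { apply continuity_2d_pt_minus. apply continuity_2d_pt_id2. apply (continuity_2d_pt_1 lo).
    apply is_derive_cont with (1 := lo_der th ltac:(lra)). }
  assert (C2 : continuity_2d_pt (fun t s => up t - s) th r).
  { apply continuity_2d_pt_minus. 2: apply continuity_2d_pt_id2. apply (continuity_2d_pt_1 up).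
    apply is_derive_cont with (1 := up_der th ltac:(lra)). }
  apply locally_2d_impl with (2 := locally_2d_and _ _ _ _ (locally_2d_pos _ _ _ (continuity_2d_pt_id1 th r) Hth)
    (locally_2d_and _ _ _ _ (locally_2d_pos _ _ _ C1 ltac:(lra)) (locally_2d_pos _ _ _ C2 ltac:(lra)))).
  apply locally_2d_forall. intros t s. lra.
Qed.

(** The method of characteristics: the field v(h) d/dh at th = 0 is carried along by the flow, which
    multiplies it by the derivative exp ([log_variation]). Following an orbit, G satisfies the
    linearised equation; differentiating in h and dividing by that derivative gives Gr. The label h
    of the orbit through (th, r) is obtained by choice from surjectivity and then shown to be
    differentiable. *)
Lemma strip_chart : exists G Gr : R -> R -> R, forall th r, 0 < th -> lo th < r < up th ->
  exists h, lo 0 < h < up 0 /\ phi th h = r /\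
    G th r = v h * exp (log_variation th h) /\
    Gr th r = v1 h + v h * log_variation_h th h /\
    differentiable_pt_lim G th r (Fr th r * G th r - F th r * Gr th r) (Gr th r) /\
    continuity_2d_pt Gr th r.
Proof.
  assert (Hex : forall z : R * R, exists h, 0 < fst z -> lo (fst z) < snd z < up (fst z) ->
     lo 0 < h < up 0 /\ phi (fst z) h = snd z).
  { intros [th r]. simpl. destruct (classic (0 < th /\ lo th < r < up th)) as [[H1 H2]|H].
    - destruct (phi_surjective th r ltac:(lra) H2) as [h Hh]. now exists h.
    - exists 0. tauto. }
  destruct (choice _ Hex) as [H' HH'].
  set (H := fun th r => H' (th, r)).
  assert (HH : forall th r, 0 < th -> lo th < r < up th -> lo 0 < H th r < up 0 /\ phi th (H th r) = r).
  { intros th r. apply (HH' (th, r)). }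
  clearbody H. clear H' HH' Hex.
  exists (fun th r => v (H th r) * exp (log_variation th (H th r))),
    (fun th r => v1 (H th r) + v (H th r) * log_variation_h th (H th r)).
  intros th r Hth Hr. exists (H th r).
  destruct (HH th r Hth Hr) as [Hh Eh]. set (h := H th r) in *.
  assert (Hth' : - / 2 < th) by lra.
  split; [trivial|split;[trivial|split;[trivial|split;[trivial|]]]].
  assert (Hloc := strip_locally th r Hth Hr).
  (* Gronwall run back to time 0 bounds |H(t, s) - h| by |s - phi t h| exp (L t), a continuous
     function that vanishes at (th, r). *)
  assert (HHc : continuity_2d_pt H th r).
  { assert (Cq : continuity_2d_pt (fun t s => (s - phi t h) * exp (L * t)) th r).
    { apply continuity_2d_pt_mult.
      - apply continuity_2d_pt_minus. apply continuity_2d_pt_id2.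
        apply (continuity_2d_pt_1 (fun t => phi t h)).
        apply is_derive_cont with (1 := phi_der h th ltac:(lra) Hth').
      - apply (continuity_2d_pt_1 (fun t => exp (L * t))).
        apply (ex_derive_continuous (V := R_NormedModule)). auto_derive; trivial. }
    intros eps. apply locally_2d_impl with (2 := locally_2d_and _ _ _ _ Hloc (Cq eps)).
    apply locally_2d_forall. intros t s [[Ht Hs] Hq].
    rewrite Eh, Rminus_diag, Rmult_0_l, Rminus_0_r in Hq.
    destruct (HH t s Ht Hs) as [Hh2 Eh2].
    apply Rle_lt_trans with (2 := Hq).
    assert (A := phi_lipschitz (H t s) h t 0 ltac:(lra) ltac:(lra) ltac:(lra) ltac:(lra)).
    rewrite Eh2, (phi_0 h), (phi_0 (H t s)) in A by lra.
    rewrite Rabs_mult, (Rabs_pos_eq (exp _)) by (left; apply exp_pos).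
    replace (Rabs (0 - t)) with t in A by (rewrite Rabs_left; lra). exact A. }
  assert (HE := exp_pos (log_variation th h)).
  assert (Dphi : differentiable_pt_lim phi th h (F th r) (exp (log_variation th h))).
  { rewrite <- Eh. apply (differentiable_partials phi (fun t k => F t (phi t k))).
    - assert (Hr2 : 0 < Rmin (th + / 2) (Rmin (h - lo 0) (up 0 - h))) by (repeat apply Rmin_case; lra).
      exists (mkposreal _ Hr2). simpl. intros u w Hu Hw.
      assert (A1 := Rabs_def2 _ _ (Rlt_le_trans _ _ _ Hu (Rmin_l _ _))).
      assert (A2 := Rabs_def2 _ _ (Rlt_le_trans _ _ _ (Rlt_le_trans _ _ _ Hw (Rmin_r _ _)) (Rmin_l _ _))).
      assert (A3 := Rabs_def2 _ _ (Rlt_le_trans _ _ _ (Rlt_le_trans _ _ _ Hw (Rmin_r _ _)) (Rmin_r _ _))).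
      apply phi_der; lra.
    - apply phi_h_der; trivial.
    - apply (continuity_2d_pt_comp F (fun t _ => t) phi).
      + apply F_cont, phi_range; lra.
      + apply continuity_2d_pt_id1.
      + apply phi_cont2; trivial. }
  assert (DH : differentiable_pt_lim H th r (- F th r / exp (log_variation th h)) (/ exp (log_variation th h))).
  { destruct (differentiable_inverse (fun t _ => t) phi (fun t _ => t) H th r 1 0 (F th r) (exp (log_variation th h))) as [_ D]; trivial.
    - apply differentiable_fst.
    - lra.
    - apply continuity_2d_pt_id1.
    - apply locally_2d_impl with (2 := Hloc). apply locally_2d_forall. intros t s [Ht Hs].
      split; trivial. now apply HH.
    - apply differentiable_eq with (1 := D); field; lra. }
  split.
  - set (G0 := fun t k => v k * exp (log_variation t k)).
    assert (DG0 : differentiable_pt_lim G0 th h (v h * (Fr th r * exp (log_variation th h)))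
        ((v1 h + v h * log_variation_h th h) * exp (log_variation th h))).
    { rewrite <- Eh at 1.
      apply (differentiable_partials G0 (fun t k => v k * (Fr t (phi t k) * exp (log_variation t k)))).
      - assert (Hr2 : 0 < Rmin (th + / 2) (Rmin (h - lo 0) (up 0 - h))) by (repeat apply Rmin_case; lra).
        exists (mkposreal _ Hr2). simpl. intros u w Hu Hw.
        assert (A1 := Rabs_def2 _ _ (Rlt_le_trans _ _ _ Hu (Rmin_l _ _))).
        assert (A2 := Rabs_def2 _ _ (Rlt_le_trans _ _ _ (Rlt_le_trans _ _ _ Hw (Rmin_r _ _)) (Rmin_l _ _))).
        assert (A3 := Rabs_def2 _ _ (Rlt_le_trans _ _ _ (Rlt_le_trans _ _ _ Hw (Rmin_r _ _)) (Rmin_r _ _))).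
        apply (is_derive_scal (fun t => exp (log_variation t w))).
        apply (is_derive_comp exp (fun t => log_variation t w)). apply is_derive_exp.
        apply log_variation_der; lra.
      - unfold G0. evar_last.
        + apply (is_derive_mult v (fun k => exp (log_variation th k))).
          * apply v_der.
          * apply (is_derive_comp exp (log_variation th)). apply is_derive_exp.
            apply log_variation_h_der; trivial.
          * intros; apply Rmult_comm.
        + unfold plus, mult, scal; simpl. unfold mult; simpl. ring.
      - apply continuity_2d_pt_mult.
        + apply (continuity_2d_pt_2 v). apply is_derive_cont with (1 := v_der h).
        + apply continuity_2d_pt_mult.
          * apply (continuity_2d_pt_comp Fr (fun t _ => t) phi).
            -- apply Fr_cont, phi_range; lra.
            -- apply continuity_2d_pt_id1.
            -- apply phi_cont2; trivial.
          * apply variation_cont2; trivial. }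
    apply differentiable_eq with (1 := differentiable_pt_lim_comp G0 (fun t _ => t) H th r _ _ _ _ _ _ DG0 (differentiable_fst th r) DH).
    + fold h. field. lra.
    + fold h. field. lra.
  - apply continuity_2d_pt_plus.
    + apply (continuity_1d_2d_pt_comp v1); trivial. apply continuity_pt_filterlim, v1_cont.
    + apply continuity_2d_pt_mult.
      * apply (continuity_1d_2d_pt_comp v); trivial. apply continuity_pt_filterlim.
        apply is_derive_cont with (1 := v_der _).
      * apply (continuity_2d_pt_comp log_variation_h (fun t _ => t) H); trivial.
        -- apply log_variation_h_cont2; trivial.
        -- apply continuity_2d_pt_id1.
Qed.

End Strip.

(** * Periodic solutions of the transport equation *)

Definition pos_part (x : R) : R := Rmax x 0.

Lemma is_derive_pos_part_sq (x : R) : is_derive (fun y => pos_part y ^ 2) x (2 * pos_part x).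
Proof.
  apply is_derive_quadratic with 1 1. lra. intros y _. unfold pos_part, Rmax.
  destruct (Rle_dec y 0) as [H1|H1], (Rle_dec x 0) as [H2|H2];
    try apply Rnot_le_lt in H1; try apply Rnot_le_lt in H2; assert (A := pow2_ge_0 (y - x));
    apply Rabs_le; split; simpl in *; nra.
Qed.

Lemma continuous_pos_part (x : R) : continuous pos_part x.
Proof. apply continuous_Rmax. apply continuous_id. apply continuous_const. Qed.

(** Squares of positive parts have a continuous derivative across a and b, and the bump vanishes
    there together with its derivative. *)
Definition bump (a b h : R) : R := pos_part (h - a) ^ 2 * pos_part (b - h) ^ 2.
Definition bump' (a b h : R) : R :=
  2 * pos_part (h - a) * pos_part (b - h) ^ 2 - pos_part (h - a) ^ 2 * (2 * pos_part (b - h)).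

Lemma is_derive_bump (a b h : R) : is_derive (bump a b) h (bump' a b h).
Proof.
  unfold bump. evar_last.
  - apply (is_derive_mult (fun h => pos_part (h - a) ^ 2) (fun h => pos_part (b - h) ^ 2)).
    + apply (is_derive_comp (fun y => pos_part y ^ 2) (fun h => h - a)).
      apply is_derive_pos_part_sq. auto_derive; trivial.
    + apply (is_derive_comp (fun y => pos_part y ^ 2) (fun h => b - h)).
      apply is_derive_pos_part_sq. auto_derive; trivial.
    + intros; apply Rmult_comm.
  - unfold plus, mult, scal; simpl. unfold mult; simpl. unfold bump'. ring.
Qed.

Lemma continuous_bump' (a b h : R) : continuous (bump' a b) h.
Proof.
  assert (Ha : continuous (fun h => pos_part (h - a)) h).
  { apply (continuous_comp (fun h => h - a) pos_part). 2: apply continuous_pos_part.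
    apply (ex_derive_continuous (V := R_NormedModule)). auto_derive; trivial. }
  assert (Hb : continuous (fun h => pos_part (b - h)) h).
  { apply (continuous_comp (fun h => b - h) pos_part). 2: apply continuous_pos_part.
    apply (ex_derive_continuous (V := R_NormedModule)). auto_derive; trivial. }
  assert (Hm : forall f g : R -> R, continuous f h -> continuous g h -> continuous (fun h => f h * g h) h).
  { intros f g. apply (continuous_mult f g). }
  assert (Hsq : forall f : R -> R, continuous f h -> continuous (fun h => f h ^ 2) h).
  { intros f Hf. apply (Hm f (fun h => f h * 1)); trivial.
    apply (Hm f (fun _ => 1)); trivial. apply continuous_const. }
  assert (Hc : forall f : R -> R, continuous f h -> continuous (fun h => 2 * f h) h).
  { intros f Hf. apply (Hm (fun _ => 2) f); trivial. apply continuous_const. }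
  unfold bump'. apply (continuous_minus (fun h => 2 * pos_part (h - a) * pos_part (b - h) ^ 2)).
  - apply (Hm (fun h => 2 * pos_part (h - a)) (fun h => pos_part (b - h) ^ 2)); auto.
  - apply (Hm (fun h => pos_part (h - a) ^ 2) (fun h => 2 * pos_part (b - h))); auto.
Qed.

Lemma pos_part_bound (x d : R) : 0 <= d -> x <= d -> 0 <= pos_part x <= d.
Proof. intros Hd Hx. split. apply Rmax_r. now apply Rmax_lub. Qed.

Lemma bump_bound (a b h d : R) : 0 <= d -> h - a <= d -> b - h <= d -> Rabs (bump a b h) <= d ^ 4.
Proof.
  intros Hd H1 H2. unfold bump.
  destruct (pos_part_bound _ _ Hd H1) as [A1 A2]. destruct (pos_part_bound _ _ Hd H2) as [B1 B2].
  rewrite Rabs_pos_eq by (apply Rmult_le_pos; apply pow_le; trivial).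
  replace (d ^ 4) with (d ^ 2 * d ^ 2) by ring.
  apply Rmult_le_compat; try (apply pow_le; trivial); apply pow_incr; now split.
Qed.

Lemma bump'_bound (a b h d : R) : 0 <= d -> h - a <= d -> b - h <= d -> Rabs (bump' a b h) <= 4 * d ^ 3.
Proof.
  intros Hd H1 H2. unfold bump'.
  destruct (pos_part_bound _ _ Hd H1) as [A1 A2]. destruct (pos_part_bound _ _ Hd H2) as [B1 B2].
  set (p := pos_part (h - a)) in *. set (q := pos_part (b - h)) in *.
  assert (P : p ^ 2 * q <= d ^ 3).
  { replace (d ^ 3) with (d ^ 2 * d) by ring.
    apply Rmult_le_compat; trivial. apply pow_le; trivial. apply pow_incr; now split. }
  assert (Q : p * q ^ 2 <= d ^ 3).
  { replace (d ^ 3) with (d * d ^ 2) by ring.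
    apply Rmult_le_compat; trivial. apply pow_le; trivial. apply pow_incr; now split. }
  assert (P0 : 0 <= p ^ 2 * q) by (apply Rmult_le_pos; trivial; apply pow_le; trivial).
  assert (Q0 : 0 <= p * q ^ 2) by (apply Rmult_le_pos; trivial; apply pow_le; trivial).
  apply Rabs_le. lra.
Qed.

Lemma bump_pos (a b h : R) : a < h < b -> 0 < bump a b h.
Proof.
  intros H. unfold bump, pos_part. rewrite !Rmax_left by lra.
  apply Rmult_lt_0_compat; apply pow_lt; lra.
Qed.

Lemma bump_zero (a b h : R) : h <= a \/ b <= h -> bump a b h = 0 /\ bump' a b h = 0.
Proof.
  intros [H|H]; unfold bump, bump', pos_part.
  - rewrite (Rmax_right (h - a)) by lra. split; ring.
  - rewrite (Rmax_right (b - h)) by lra. split; ring.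
Qed.

Section Cylinder.

Variables (F Fr Frr : R -> R -> R) (delta L : R) (gam : R -> R).

Hypothesis L_pos : 0 < L.
Hypothesis F_cont : forall th r, 0 < r < delta -> continuity_2d_pt F th r.
Hypothesis Fr_cont : forall th r, 0 < r < delta -> continuity_2d_pt Fr th r.
Hypothesis Frr_cont : forall th r, 0 < r < delta -> continuity_2d_pt Frr th r.
Hypothesis F_der : forall th r, 0 < r < delta -> is_derive (F th) r (Fr th r).
Hypothesis Fr_der : forall th r, 0 < r < delta -> is_derive (Fr th) r (Frr th r).
Hypothesis F_bound : forall th r, 0 < r < delta -> Rabs (F th r) <= L * r.
Hypothesis Fr_bound : forall th r, 0 < r < delta -> Rabs (Fr th r) <= L.
Hypothesis Frr_bound : forall th r, 0 < r < delta -> Rabs (Frr th r) <= L.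
Hypothesis F_per : forall th r, F (th + 2 * PI) r = F th r.
Hypothesis gam_range : forall th, -1 < th -> 0 < gam th < delta.
Hypothesis gam_der : forall th, -1 < th -> is_derive gam th (F th (gam th)).
Hypothesis gam_lim : is_lim gam p_infty 0.

Let T := 2 * PI.

Lemma T_pos : 0 < T.
Proof. unfold T. assert (A := PI_RGT_0). lra. Qed.

Lemma F_per_Z k th r : F (th + T * IZR k) r = F th r.
Proof. apply (periodic_Z (fun th => F th r)). auto. Qed.

Lemma Fr_per_Z k th r : 0 < r < delta -> Fr (th + T * IZR k) r = Fr th r.
Proof.
  intros Hr. assert (A := F_der th r Hr). assert (B := F_der (th + T * IZR k) r Hr).
  apply is_derive_unique in A. apply is_derive_unique in B. rewrite <- A, <- B.
  apply Derive_ext. intros t. apply F_per_Z.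
Qed.

Lemma shift_der (n : nat) th : -1 < th ->
  is_derive (fun t => gam (t + T * INR n)) th (F th (gam (th + T * INR n))).
Proof.
  intros Hth. assert (HT := T_pos). assert (Hn := Rmult_le_pos _ _ (Rlt_le _ _ HT) (pos_INR n)).
  evar_last.
  - apply (is_derive_comp gam (fun t => t + T * INR n)).
    + apply gam_der. lra.
    + auto_derive; trivial.
  - unfold scal; simpl; unfold mult; simpl. rewrite Rmult_1_l.
    rewrite (INR_IZR_INZ n). apply F_per_Z.
Qed.

Lemma shift_range (n : nat) th : -1 < th -> 0 < gam (th + T * INR n) < delta.
Proof.
  intros Hth. apply gam_range.
  assert (HT := T_pos). assert (Hn := Rmult_le_pos _ _ (Rlt_le _ _ HT) (pos_INR n)). lra.
Qed.

Lemma gam_small (e : R) : 0 < e -> exists M, forall th, M < th -> gam th < e.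
Proof.
  intros He. destruct (gam_lim (fun y => Rabs y < e)) as [M HM].
  - exists (mkposreal e He). intros y Hy. change (Rabs (y - 0) < e) in Hy. now rewrite Rminus_0_r in Hy.
  - exists M. intros th Hth. apply Rle_lt_trans with (1 := Rle_abs _). now apply HM.
Qed.

(* Otherwise the sequence gam (th + T n) would be nondecreasing, or constant. *)
Lemma gam_turn_lt th : -1 < th -> gam (th + T) < gam th.
Proof.
  intros Hth. assert (HT := T_pos).
  assert (D1 : forall t, -1 < t -> is_derive (fun t => gam (t + T)) t (F t (gam (t + T)))).
  { intros t Ht. assert (A := shift_der 1 t Ht). simpl in A. now rewrite Rmult_1_r in A. }
  assert (G : forall s t, -1 < s -> -1 < t -> Rabs (gam (t + T) - gam t) <= Rabs (gam (s + T) - gam s) * exp (L * Rabs (t - s))).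
  { intros s t Hs Ht. apply (gronwall (fun t => gam (t + T)) gam (fun t => F t (gam (t + T))) (fun t => F t (gam t)) L (-1)); trivial.
    intros x Hx. apply F_lipschitz with (delta := delta) (Fr := Fr); auto.
    apply gam_range; lra. }
  destruct (Rlt_dec (gam (th + T)) (gam th)) as [H|H]; trivial. exfalso.
  assert (Hge : forall t, -1 < t -> gam t <= gam (t + T)).
  { intros t Ht. destruct (Req_dec (gam (th + T)) (gam th)) as [E|NE].
    - assert (A := G th t Hth Ht). rewrite E, Rminus_diag, Rabs_R0, Rmult_0_l in A.
      assert (B := Rabs_pos (gam (t + T) - gam t)). apply Rabs_le_between in A. lra.
    - left. cut (0 < gam (t + T) - gam t); [lra|].
      apply (continuous_no_zero_pos (fun t => gam (t + T) - gam t) (-1) th); trivial; try lra.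
      + intros x Hx. apply (continuous_minus (fun t => gam (t + T)) gam).
        * apply is_derive_cont with (1 := D1 x Hx).
        * apply is_derive_cont with (1 := gam_der x Hx).
      + intros x Hx E. assert (A := G x th Hx Hth). rewrite E, Rabs_R0, Rmult_0_l in A.
        apply Rabs_le_between in A. lra. }
  assert (Hn : forall n, gam th <= gam (th + T * INR n)).
  { induction n as [|n IH].
    - simpl. rewrite Rmult_0_r, Rplus_0_r. lra.
    - apply Rle_trans with (1 := IH). rewrite S_INR.
      replace (th + T * (INR n + 1)) with (th + T * INR n + T) by ring.
      apply Hge. assert (A := Rmult_le_pos _ _ (Rlt_le _ _ HT) (pos_INR n)). lra. }
  destruct (gam_small (gam th)) as [M HM]. now apply gam_range.
  destruct (INR_unbounded ((M - th) / T)) as [n Hn2].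
  apply Rlt_not_le with (2 := Hn n). apply HM.
  apply Rmult_lt_compat_r with (r := T) in Hn2; trivial.
  unfold Rdiv in Hn2. rewrite Rmult_assoc, Rinv_l, Rmult_1_r in Hn2 by lra. lra.
Qed.

Lemma gam_turns_lt (n : nat) th : -1 < th -> gam (th + T * INR (S n)) < gam th.
Proof.
  intros Hth. assert (HT := T_pos). induction n as [|n IH].
  - simpl. rewrite Rmult_1_r. now apply gam_turn_lt.
  - apply Rlt_trans with (2 := IH). rewrite (S_INR (S n)).
    replace (th + T * (INR (S n) + 1)) with (th + T * INR (S n) + T) by ring.
    apply gam_turn_lt. assert (A := Rmult_le_pos _ _ (Rlt_le _ _ HT) (pos_INR (S n))). lra.
Qed.

(** Gronwall against the zero function: because |F| <= L r, the orbit decays at most exponentially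
    in th. *)
Lemma gam_lower th : 0 <= th -> gam 0 * exp (- (L * th)) <= gam th.
Proof.
  intros Hth.
  assert (A : Rabs (gam 0 - 0) <= Rabs (gam th - 0) * exp (L * Rabs (0 - th))).
  { apply (gronwall gam (fun _ => 0) (fun t => F t (gam t)) (fun _ => 0) L (-1)); trivial; try lra.
    - intros x _. apply (is_derive_const 0).
    - intros x Hx. rewrite !Rminus_0_r. rewrite (Rabs_pos_eq (gam x)).
      now apply F_bound, gam_range. left. now apply gam_range. }
  rewrite !Rminus_0_r in A. replace (Rabs (0 - th)) with th in A by (rewrite Rabs_left1; lra).
  rewrite !Rabs_pos_eq in A by (left; apply gam_range; lra).
  apply (Rmult_le_compat_r (exp (- (L * th)))) in A. 2: left; apply exp_pos.
  rewrite Rmult_assoc, <- exp_plus, Rplus_opp_r, exp_0, Rmult_1_r in A. exact A.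
Qed.

(** The bump is supported in the turn between [c0] and [c1], that is, between the orbit two turns
    later and one turn later. The flow is constructed on the wider strip from three turns later up
    to [gam] itself, which leaves a full turn of margin on both sides of the support. *)
Let c0 th := gam (th + T * INR 2).
Let c1 th := gam (th + T * INR 1).

(** The solution on the half-plane th > 0 that covers the cylinder, before periodicity is imposed:
    one strip followed for all th, with bounds that do not depend on th. *)
Lemma cover_solution : exists (G Gr : R -> R -> R) (C : R), forall th r, 0 < th -> 0 < r < delta ->
  differentiable_pt_lim G th r (Fr th r * G th r - F th r * Gr th r) (Gr th r) /\
  continuity_2d_pt Gr th r /\
  Rabs (G th r) <= C /\ Rabs (Gr th r) <= C /\
  (c0 th < r < c1 th -> G th r <> 0) /\
  (r <= c0 th \/ c1 th <= r -> G th r = 0 /\ Gr th r = 0).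
Proof.
  assert (HT := T_pos).
  set (lo := fun th => gam (th + T * INR 3)).
  assert (lo_der : forall th, -1 < th -> is_derive lo th (F th (lo th))) by (intros; now apply shift_der).
  assert (lo_range : forall th, -1 < th -> 0 < lo th < delta) by (intros; now apply shift_range).
  assert (lo_c0 : forall th, -1 < th -> lo th < c0 th).
  { intros th Hth. unfold lo, c0. replace (th + T * INR 3) with (th + T * INR 2 + T) by (simpl; ring).
    apply gam_turn_lt. simpl; lra. }
  assert (c0_c1 : forall th, -1 < th -> c0 th < c1 th).
  { intros th Hth. unfold c1, c0. replace (th + T * INR 2) with (th + T * INR 1 + T) by (simpl; ring).
    apply gam_turn_lt. simpl; lra. }
  assert (c1_up : forall th, -1 < th -> c1 th < gam th).
  { intros th Hth. apply (gam_turns_lt 0 th Hth). }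
  assert (lo_up : forall th, -1 < th -> lo th < gam th).
  { intros th Hth. apply Rlt_trans with (1 := lo_c0 th Hth). apply Rlt_trans with (1 := c0_c1 th Hth). auto. }
  destruct (flow_exists F Fr delta L lo gam) as [phi Hphi]; auto.
  { intros th Hth. split; [now apply lo_range|now apply lo_der]. }
  { intros th Hth. split; [now apply gam_range|now apply gam_der]. }
  assert (phi_0 : forall h, lo 0 <= h <= gam 0 -> phi 0 h = h) by (intros h Hh; now apply Hphi).
  assert (phi_strip : forall h th, lo 0 <= h <= gam 0 -> - / 2 < th -> lo th <= phi th h <= gam th)
    by (intros h th Hh Hth; now apply Hphi).
  assert (phi_der : forall h th, lo 0 <= h <= gam 0 -> - / 2 < th ->
     is_derive (fun t => phi t h) th (F th (phi th h))) by (intros h th Hh Hth; now apply Hphi).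
  assert (lo_pos : forall th, -1 < th -> 0 < lo th) by (intros th Hth; now apply lo_range).
  assert (up_lt : forall th, -1 < th -> gam th < delta) by (intros th Hth; now apply gam_range).
  assert (gam_cont : forall th, -1 < th -> continuous gam th).
  { intros th Hth. apply is_derive_cont with (1 := gam_der th Hth). }
  set (Gam := fun t => RInt gam 0 t).
  assert (Gam_der : forall t, -1 < t -> is_derive Gam t (gam t)).
  { intros t Ht. apply (is_derive_RInt_open gam (-1)); trivial; lra. }
  (* The width is gam(t) - gam(t + 3 T), so its integral telescopes: it is the integral of gam over
     the first three turns minus the one over the three turns after th. Positivity of gam leaves the
     first as an upper bound. This is the summability of the widths of the turns. *)
  set (Z := fun th => Gam th - (Gam (th + T * INR 3) - Gam (T * INR 3))).
  assert (Z_der : forall th, 0 <= th -> is_derive Z th (gam th - lo th)).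
  { intros th Hth. unfold Z. evar_last.
    - apply (is_derive_minus Gam (fun th => Gam (th + T * INR 3) - Gam (T * INR 3))).
      + apply Gam_der; lra.
      + apply (is_derive_minus (fun th => Gam (th + T * INR 3)) (fun _ => Gam (T * INR 3))).
        * apply (is_derive_comp Gam (fun th => th + T * INR 3)).
          apply Gam_der. simpl; lra. auto_derive; trivial.
        * apply (is_derive_const (Gam (T * INR 3))).
    - unfold scal, minus, plus, opp, zero; simpl; unfold mult; simpl. unfold lo. simpl. ring. }
  assert (Z_0 : Z 0 = 0).
  { unfold Z. rewrite Rplus_0_l. unfold Gam at 1.
    rewrite (RInt_point (V := R_CompleteNormedModule)). unfold zero; simpl. ring. }
  assert (Z_le : forall th, 0 <= th -> Z th <= Gam (T * INR 3)).
  { intros th Hth. unfold Z. cut (Gam th <= Gam (th + T * INR 3)); [lra|].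
    assert (0 - 0 <= Gam (th + T * INR 3) - Gam th); [|lra].
    apply (derive_le (fun _ => 0) Gam (fun _ => 0) gam).
    - simpl; lra.
    - intros x _. apply (is_derive_const 0).
    - intros x Hx. apply Gam_der; lra.
    - intros x Hx. left. apply gam_range; lra. }
  assert (Hk : lo 0 < c0 0 /\ c0 0 < c1 0 /\ c1 0 < gam 0).
  { split; [apply lo_c0|split; [apply c0_c1|apply c1_up]]; lra. }
  destruct (strip_chart F Fr Frr delta L lo gam phi L_pos F_cont Fr_cont Frr_cont F_der Fr_der Fr_bound Frr_bound
     lo_pos up_lt phi_0 phi_strip phi_der lo_der gam_der lo_up _ _ Hk (bump (c0 0) (c1 0)) (bump' (c0 0) (c1 0))
     (is_derive_bump _ _) (continuous_bump' _ _)) as [G [Gr HG]].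
  assert (Hdel : 0 < delta) by (destruct (gam_range 0); lra).
  set (K := exp (L * Gam (T * INR 3)) / (c1 0 - c0 0)).
  assert (HvE : forall th r h, 0 < th -> lo 0 < h < gam 0 -> phi th h = r ->
     Rabs (bump (c0 0) (c1 0) h * exp (log_variation Fr phi th h)) <= delta ^ 4 * (K * delta) /\
     Rabs (bump' (c0 0) (c1 0) h + bump (c0 0) (c1 0) h * log_variation_h Fr Frr phi th h)
      <= 4 * delta ^ 3 + delta ^ 4 * (L * K * Gam (T * INR 3))).
  { intros th r h Hth Hh Hr.
    assert (A1 := variation_bound F Fr Frr delta L lo gam phi L_pos Fr_cont F_der Fr_der Fr_bound Frr_bound
     lo_pos up_lt phi_0 phi_strip phi_der Z (Gam (T * INR 3)) (c0 0) (c1 0) Z_der Z_0 Z_le Hk h th Hh (Rlt_le _ _ Hth)).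
    assert (A2 := log_variation_h_bound F Fr Frr delta L lo gam phi L_pos Fr_cont Frr_cont F_der Fr_der Fr_bound Frr_bound
     lo_pos up_lt phi_0 phi_strip phi_der Z (Gam (T * INR 3)) (c0 0) (c1 0) Z_der Z_0 Z_le Hk h th Hh (Rlt_le _ _ Hth)).
    fold K in A1, A2.
    assert (HK : 0 <= K). { apply Rdiv_le_0_compat. left; apply exp_pos. lra. }
    destruct (lo_range 0) as [B1 B2]; try lra. destruct (gam_range 0) as [B3 B4]; try lra.
    assert (V1 : Rabs (bump (c0 0) (c1 0) h) <= delta ^ 4) by (apply bump_bound; lra).
    assert (V2 : Rabs (bump' (c0 0) (c1 0) h) <= 4 * delta ^ 3) by (apply bump'_bound; lra).
    split.
    - rewrite Rabs_mult, (Rabs_pos_eq (exp _)) by (left; apply exp_pos).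
      apply Rmult_le_compat; trivial. apply Rabs_pos. left; apply exp_pos.
      apply Rle_trans with (1 := A1). apply Rmult_le_compat_l; trivial.
      destruct (lo_range th), (gam_range th); lra.
    - apply Rle_trans with (1 := Rabs_triang _ _). apply Rplus_le_compat; trivial.
      rewrite Rabs_mult. apply Rmult_le_compat; trivial; apply Rabs_pos. }
  set (S := fun th r => 0 < th /\ lo th < r < gam th).
  (* Extension by zero outside the wide strip. The functions already vanish between the support of
     the bump and the boundary of that strip, so smoothness is preserved. *)
  set (cut := fun (g : R -> R -> R) th r => if excluded_middle_informative (S th r) then g th r else 0).
  assert (cut_in : forall g th r, S th r -> cut g th r = g th r).
  { intros g th r H. unfold cut. now destruct (excluded_middle_informative (S th r)). }
  assert (cut_out : forall g th r, ~ S th r -> cut g th r = 0).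
  { intros g th r H. unfold cut. now destruct (excluded_middle_informative (S th r)). }
  assert (c0_phi : forall th, - / 2 < th -> phi th (c0 0) = c0 th).
  { intros th Hth. apply (phi_eq_solution F Fr delta L lo gam phi) with (b := c0); trivial; try lra.
    - intros t Ht. now apply shift_range.
    - intros t Ht. now apply shift_der. }
  assert (c1_phi : forall th, - / 2 < th -> phi th (c1 0) = c1 th).
  { intros th Hth. apply (phi_eq_solution F Fr delta L lo gam phi) with (b := c1); trivial; try lra.
    - intros t Ht. now apply shift_range.
    - intros t Ht. now apply shift_der. }
  assert (phi_lt : forall h k th, lo 0 <= h <= gam 0 -> lo 0 <= k <= gam 0 -> - / 2 < th -> phi th h < phi th k -> h < k).
  { intros h k th Hh Hkk Hth H. destruct (Rlt_dec h k) as [X|X]; trivial. exfalso.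
    destruct (Req_dec h k) as [E|NE]. subst; lra.
    assert (A : phi th k < phi th h); [|lra].
    apply (phi_increasing F Fr delta L lo gam phi); trivial. lra. }
  assert (Hzero : forall th r, 0 < th -> r <= c0 th \/ c1 th <= r -> cut G th r = 0 /\ cut Gr th r = 0).
  { intros th r Hth Hr. destruct (classic (S th r)) as [HS|HS].
    - rewrite !cut_in by trivial. destruct (HG th r Hth (proj2 HS)) as (h & Hh & Eh & EG & EGr & _).
      rewrite EG, EGr.
      destruct (bump_zero (c0 0) (c1 0) h) as [Z1 Z2].
      { destruct Hr as [Hr|Hr]; [left|right]; apply Rnot_lt_le; intros X.
        - assert (A : phi th (c0 0) < phi th h).
          { apply (phi_increasing F Fr delta L lo gam phi); trivial; lra. }
          rewrite c0_phi in A; lra.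
        - assert (A : phi th h < phi th (c1 0)).
          { apply (phi_increasing F Fr delta L lo gam phi); trivial; lra. }
          rewrite c1_phi in A; lra. }
      rewrite Z1, Z2. split; ring.
    - rewrite !cut_out; auto. }
  exists (cut G), (cut Gr), (delta ^ 4 * (K * delta) + (4 * delta ^ 3 + delta ^ 4 * (L * K * Gam (T * INR 3)))).
  assert (HC1 : 0 <= delta ^ 4 * (K * delta)).
  { destruct (HG 1 ((lo 1 + gam 1) / 2)) as (h & Hh & Eh & _). lra. specialize (lo_up 1). lra.
    destruct (HvE 1 _ h Rlt_0_1 Hh Eh) as [A _]. apply Rle_trans with (2 := A). apply Rabs_pos. }
  assert (HC2 : 0 <= 4 * delta ^ 3 + delta ^ 4 * (L * K * Gam (T * INR 3))).
  { destruct (HG 1 ((lo 1 + gam 1) / 2)) as (h & Hh & Eh & _). lra. specialize (lo_up 1). lra.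
    destruct (HvE 1 _ h Rlt_0_1 Hh Eh) as [_ A]. apply Rle_trans with (2 := A). apply Rabs_pos. }
  intros th r Hth Hr.
  assert (Hth1 : -1 < th) by lra. assert (Hth2 : - / 2 < th) by lra.
  assert (B0 := lo_c0 th Hth1). assert (B1 := c0_c1 th Hth1). assert (B2 := c1_up th Hth1).
  destruct (classic (S th r)) as [HS|HS].
  - destruct (HG th r Hth (proj2 HS)) as (h & Hh & Eh & EG & EGr & HD & HCt).
    assert (Hloc : locally_2d S th r).
    { apply (strip_locally F lo gam); trivial. apply HS. }
    rewrite !cut_in by trivial.
    split; [|split; [|split; [|split; [|split]]]].
    + apply differentiable_pt_lim_ext with (2 := HD).
      apply locally_2d_impl with (2 := Hloc). apply locally_2d_forall. intros; symmetry; auto.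
    + apply continuity_2d_pt_ext_loc with (2 := HCt).
      apply locally_2d_impl with (2 := Hloc). apply locally_2d_forall. intros; symmetry; auto.
    + rewrite EG. destruct (HvE th r h Hth Hh Eh). lra.
    + rewrite EGr. destruct (HvE th r h Hth Hh Eh). lra.
    + intros Hc. rewrite EG. apply Rmult_integral_contrapositive_currified.
      * apply Rgt_not_eq, bump_pos. split; apply phi_lt with th; trivial; try lra.
        rewrite c0_phi; lra. rewrite c1_phi; lra.
      * apply Rgt_not_eq, exp_pos.
    + intros Hc. rewrite <- (cut_in G), <- (cut_in Gr) by trivial. auto.
  - rewrite !cut_out by trivial.
    (* A point outside the open wide strip is strictly below [c0] or strictly above [c1], hence has
       a neighbourhood on which both functions are zero. *)
    assert (Hout : r < c0 th \/ c1 th < r).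
    { destruct (Rlt_dec r (c0 th)); [now left|right]. apply Rnot_le_lt. intros X. apply HS. unfold S. lra. }
    assert (Hloc : locally_2d (fun t s => 0 = cut G t s /\ 0 = cut Gr t s) th r).
    { assert (Hcc : forall n, continuity_2d_pt (fun t s => s - gam (t + T * INR n)) th r).
      { intros n. apply continuity_2d_pt_minus. apply continuity_2d_pt_id2.
        apply (continuity_2d_pt_1 (fun t => gam (t + T * INR n))).
        apply is_derive_cont with (1 := shift_der n th Hth1). }
      assert (Hlth := locally_2d_pos _ _ _ (continuity_2d_pt_id1 th r) Hth).
      destruct Hout as [X|X].
      - assert (Hc := locally_2d_pos _ _ _ (continuity_2d_pt_opp _ _ _ (Hcc 2%nat)) ltac:(unfold c0 in X; lra)).
        apply locally_2d_impl with (2 := locally_2d_and _ _ _ _ Hlth Hc). apply locally_2d_forall.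
        intros t s [Ht Hs]. destruct (Hzero t s Ht) as [E1 E2]. left. unfold c0; lra. now rewrite E1, E2.
      - assert (Hc := locally_2d_pos _ _ _ (Hcc 1%nat) ltac:(unfold c1 in X; lra)).
        apply locally_2d_impl with (2 := locally_2d_and _ _ _ _ Hlth Hc). apply locally_2d_forall.
        intros t s [Ht Hs]. destruct (Hzero t s Ht) as [E1 E2]. right. unfold c1; lra. now rewrite E1, E2. }
    rewrite Rabs_R0.
    split; [|split; [|split; [|split; [|split]]]]; try lra.
    + apply differentiable_pt_lim_ext with (fun _ _ => 0).
      { apply locally_2d_impl with (2 := Hloc). apply locally_2d_forall. tauto. }
      rewrite !Rmult_0_r, Rminus_0_r. apply (differentiable_pt_lim_proj1_0 (fun _ => 0)).
      apply derivable_pt_lim_const.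
    + apply continuity_2d_pt_ext_loc with (fun _ _ => 0).
      { apply locally_2d_impl with (2 := Hloc). apply locally_2d_forall. tauto. }
      apply continuity_2d_pt_const.
Qed.

(** The turn of the universal cover in which the point of the cylinder falls into the fundamental
    strip. The strip contains its lower boundary but not its upper one, so that consecutive turns do
    not overlap. *)
Definition is_lift (th r s : R) : Prop :=
  0 < s /\ (exists k : Z, s = th + T * IZR k) /\ c0 s <= r < c1 s.

(** By [gam_lower] the orbit stays above this level during its first three turns. A point below it
    is thus reached late enough for its lift to be positive. *)
Let eps := gam 0 * exp (- (L * (3 * T))).

Lemma eps_range : 0 < eps < delta.
Proof.
  assert (HT := T_pos). destruct (gam_range 0) as [A B]; try lra.
  assert (E := exp_pos (- (L * (3 * T)))).
  assert (E1 : exp (- (L * (3 * T))) < 1).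
  { rewrite <- exp_0. apply exp_increasing. assert (0 < L * (3 * T)) by (apply Rmult_lt_0_compat; lra). lra. }
  unfold eps. split. now apply Rmult_lt_0_compat. nra.
Qed.

Lemma eps_le s : 0 <= s <= 3 * T -> eps <= gam s.
Proof.
  intros Hs. apply Rle_trans with (2 := gam_lower s (proj1 Hs)). unfold eps.
  apply Rmult_le_compat_l. left; apply gam_range; lra.
  assert (L * s <= L * (3 * T)) by (apply Rmult_le_compat_l; lra).
  destruct (Req_dec (L * s) (L * (3 * T))) as [E|E]. rewrite E; lra.
  left. apply exp_increasing. lra.
Qed.

(** The least number of turns after which gam is at most r exists because gam tends to 0, and it is
    at least 2 because r < [eps]. *)
Lemma lift_exists th r : 0 < r < eps -> exists s, is_lift th r s.
Proof.
  intros Hr. assert (HT := T_pos).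
  destruct (angle_reduce th) as [k Hk]. fold T in Hk.
  set (t := th + T * IZR k) in *.
  destruct (gam_small r (proj1 Hr)) as [M HM].
  set (P := fun n : nat => gam (t + T * INR n) <= r).
  assert (Hex : exists n, P n).
  { destruct (INR_unbounded ((M - t) / T)) as [n Hn]. exists n. left. apply HM.
    apply Rmult_lt_compat_r with (r := T) in Hn; trivial.
    unfold Rdiv in Hn. rewrite Rmult_assoc, Rinv_l, Rmult_1_r in Hn by lra. lra. }
  destruct (dec_inh_nat_subset_has_unique_least_element P) as [n [[Hn Hmin] _]]; trivial.
  { intros n. apply classic. }
  assert (Hlow : forall m, P m -> (2 <= m)%nat).
  { intros m Hm. destruct m as [|[|m]]; try lia; exfalso; unfold P in Hm; simpl in Hm.
    - assert (A := eps_le (t + T * 0) ltac:(lra)). lra.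
    - assert (A := eps_le (t + T * 1) ltac:(lra)). lra. }
  destruct n as [|[|n]]; [specialize (Hlow _ Hn); lia..|].
  (* The least number of turns is n + 2 here. Two turns are taken back because [c0] and [c1] look
     two turns and one turn ahead. *)
  exists (t + T * INR n). 
  assert (Hn0 := Rmult_le_pos _ _ (Rlt_le _ _ HT) (pos_INR n)).
  split; [lra|split].
  - exists (k + Z.of_nat n)%Z. rewrite plus_IZR, <- INR_IZR_INZ. unfold t. ring.
  - unfold c0, c1. split.
    + unfold P in Hn. rewrite !S_INR in Hn.
      replace (t + T * INR n + T * INR 2) with (t + T * (INR n + 1 + 1)) by (simpl; ring). exact Hn.
    + apply Rnot_le_lt. intros X.
      assert (Y : (S (S n) <= S n)%nat); [|lia]. apply Hmin. unfold P. rewrite S_INR.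
      replace (t + T * (INR n + 1)) with (t + T * INR n + T * INR 1) by (simpl; ring). exact X.
Qed.

(** The values gam(s + T j) decrease with j, so the upper boundary of the strip at a later lift is
    at most the lower boundary at an earlier one. *)
Lemma lift_unique th r s s' : is_lift th r s -> is_lift th r s' -> s = s'.
Proof.
  assert (HT := T_pos).
  assert (H : forall s s', is_lift th r s -> is_lift th r s' -> s' <= s).
  { clear s s'. intros s s' (Hs & [k Hk] & Hc) (Hs' & [k' Hk'] & Hc').
    destruct (Z.le_gt_cases k' k) as [H|H].
    - rewrite Hk, Hk'. apply IZR_le in H. assert (A := Rmult_le_compat_l T _ _ ltac:(lra) H). lra.
    - exfalso. assert (E : s' = s + T * INR (S (Z.to_nat (k' - k - 1)))).
      { rewrite S_INR, INR_IZR_INZ, Z2Nat.id by lia. rewrite !minus_IZR. rewrite Hk, Hk'. ring. }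
      unfold c0, c1 in *.
      assert (A : gam (s' + T * INR 1) <= gam (s + T * INR 2)).
      { destruct (Z.to_nat (k' - k - 1)) as [|n].
        - rewrite E. simpl. replace (s + T * 1 + T * 1) with (s + T * (1 + 1)) by ring. lra.
        - left. rewrite E. rewrite S_INR.
          replace (s + T * (INR (S n) + 1) + T * INR 1) with (s + T * INR 2 + T * INR (S n)) by (simpl; ring).
          apply gam_turns_lt. simpl; lra. }
      lra. }
  intros H1 H2. apply Rle_antisym; now apply H.
Qed.

(** V(th, r) is the value of G at the lift of the point. The lift jumps across the spiral, but near
    any point only two consecutive lifts occur, and V coincides there with the sum of the two
    corresponding translates of G, at least one of which vanishes. This sum carries the regularity
    and the equation over to V. *)
Lemma cylinder_solution :
  exists (V Vr : R -> R -> R) (C e : R), 0 < e < delta /\ forall th r, 0 < r < e ->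
    differentiable_pt_lim V th r (Fr th r * V th r - F th r * Vr th r) (Vr th r) /\
    continuity_2d_pt Vr th r /\
    Rabs (V th r) <= C /\ Rabs (Vr th r) <= C /\
    V (th + 2 * PI) r = V th r /\ Vr (th + 2 * PI) r = Vr th r /\
    (forall eta, 0 < eta -> exists r', r - eta < r' < r /\ 0 < r' /\ V th r' <> 0).
Proof.
  assert (HT := T_pos). assert (Heps := eps_range).
  destruct cover_solution as (G & Gr & C & HG).
  assert (Hex : forall z : R * R, exists s, 0 < snd z < eps -> is_lift (fst z) (snd z) s).
  { intros [th r]. simpl. destruct (classic (0 < r < eps)) as [H|H].
    - destruct (lift_exists th r H) as [s Hs]. now exists s.
    - exists 0. tauto. }
  destruct (choice _ Hex) as [S' HS'].
  set (S := fun th r => S' (th, r)).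
  assert (HS : forall th r, 0 < r < eps -> is_lift th r (S th r)) by (intros th r; apply (HS' (th, r))).
  clearbody S. clear S' HS' Hex.
  assert (HSe : forall th r s, 0 < r < eps -> is_lift th r s -> S th r = s).
  { intros th r s Hr Hs. apply lift_unique with th r; auto. }
  exists (fun th r => G (S th r) r), (fun th r => Gr (S th r) r), C, eps.
  split; trivial. intros th r Hr.
  destruct (HS th r Hr) as (Hs & [k Hk] & Hc). set (s := S th r) in *.
  assert (Hrd : 0 < r < delta) by lra.
  assert (Hs1 : -1 < s) by lra.
  set (a := T * IZR k) in *.
  (* Close to (th, r) the lift of (t, q) is t + a or t + a + T: q remains below [c1] for the first
     and above [c0] for the second. The term of the other lift vanishes because q is outside the
     support at that lift. *)
  assert (Hloc : locally_2d (fun t q =>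
      G (t + a) q + G (t + (a + T)) q = G (S t q) q /\ Gr (t + a) q + Gr (t + (a + T)) q = Gr (S t q) q) th r).
  { assert (Hcc : forall n, continuity_2d_pt (fun t q => q - gam (t + a + T * INR n)) th r).
    { intros n. apply continuity_2d_pt_minus. apply continuity_2d_pt_id2.
      apply (continuity_2d_pt_1 (fun t => gam (t + a + T * INR n))).
      apply (continuous_comp (fun t => t + a) (fun t => gam (t + T * INR n))).
      - apply (continuous_plus (fun t : R => t) (fun _ => a)). apply continuous_id. apply continuous_const.
      - refine (eq_rect s (continuous (fun t => gam (t + T * INR n))) _ (th + a) Hk).
        apply is_derive_cont with (1 := shift_der n s Hs1). }
    assert (H0 : continuity_2d_pt (fun t _ => t + a) th r).
    { apply continuity_2d_pt_plus. apply continuity_2d_pt_id1. apply continuity_2d_pt_const. }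
    assert (P0 := locally_2d_pos _ _ _ H0 ltac:(simpl; lra)).
    assert (I1 : 0 < - (r - gam (th + a + T * INR 1))) by (rewrite <- Hk; unfold c1 in Hc; lra).
    assert (P1 := locally_2d_pos _ _ _ (continuity_2d_pt_opp _ _ _ (Hcc 1%nat)) I1).
    assert (Hlt : gam (s + T * INR 3) < gam (s + T * INR 2)).
    { replace (s + T * INR 3) with (s + T * INR 2 + T) by (simpl; ring). apply gam_turn_lt. simpl; lra. }
    assert (I3 : 0 < r - gam (th + a + T * INR 3)) by (rewrite <- Hk; unfold c0 in Hc; lra).
    assert (P3 := locally_2d_pos _ _ _ (Hcc 3%nat) I3).
    assert (Pr := locally_2d_pos _ _ _ (continuity_2d_pt_id2 th r) (proj1 Hr)).
    assert (Pe := locally_2d_pos _ _ _ (continuity_2d_pt_minus _ _ _ _ (continuity_2d_pt_const th r eps) (continuity_2d_pt_id2 th r))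
      ltac:(lra)).
    apply locally_2d_impl with (2 := locally_2d_and _ _ _ _ (locally_2d_and _ _ _ _ P0 P1)
       (locally_2d_and _ _ _ _ P3 (locally_2d_and _ _ _ _ Pr Pe))).
    apply locally_2d_forall. intros t q [[Q0 Q1] [Q3 [Qr Qe]]].
    replace (t + (a + T)) with (t + a + T) by ring.
    set (u := t + a) in *.
    assert (Hq : 0 < q < delta) by lra. assert (Hqe : 0 < q < eps) by lra.
    destruct (HG u q Q0 Hq) as (_ & _ & _ & _ & _ & Z1).
    destruct (HG (u + T) q ltac:(lra) Hq) as (_ & _ & _ & _ & _ & Z2).
    unfold c0, c1 in Z1, Z2.
    replace (u + T + T * INR 1) with (u + T * INR 2) in Z2 by (simpl; ring).
    replace (u + T + T * INR 2) with (u + T * INR 3) in Z2 by (simpl; ring).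
    destruct (Rle_dec (gam (u + T * INR 2)) q) as [X|X].
    - rewrite (HSe t q u).
      + destruct Z2 as [-> ->]. now right. now rewrite !Rplus_0_r.
      + trivial.
      + split; [trivial|split]. now exists k. unfold c0, c1. lra.
    - rewrite (HSe t q (u + T)).
      + destruct Z1 as [-> ->]. left; lra. now rewrite !Rplus_0_l.
      + trivial.
      + split; [lra|split]. exists (k + 1)%Z. rewrite plus_IZR. unfold u, a; ring.
        unfold c0, c1. replace (u + T + T * INR 1) with (u + T * INR 2) by (simpl; ring).
        replace (u + T + T * INR 2) with (u + T * INR 3) by (simpl; ring). lra. }
  assert (Hval := locally_2d_singleton _ _ _ Hloc). cbv beta in Hval. fold s in Hval.
  assert (Hsh : forall b, differentiable_pt_lim (fun t (_ : R) => t + b) th r 1 0).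
  { intros b. apply differentiable_eq with (1 := differentiable_plus _ _ _ _ _ _ _ _ (differentiable_fst th r)
     (differentiable_pt_lim_proj1_0 (fun _ => b) _ r _ (derivable_pt_lim_const b th))); ring. }
  assert (HD : forall j, 0 < th + T * IZR j -> 
     differentiable_pt_lim (fun t q => G (t + T * IZR j) q) th r
       (Fr th r * G (th + T * IZR j) r - F th r * Gr (th + T * IZR j) r) (Gr (th + T * IZR j) r) /\
     continuity_2d_pt (fun t q => Gr (t + T * IZR j) q) th r).
  { intros j Hj. destruct (HG (th + T * IZR j) r Hj Hrd) as (D1 & D2 & _).
    rewrite Fr_per_Z, F_per_Z in D1 by trivial. split.
    - apply differentiable_eq with (1 := differentiable_pt_lim_comp G (fun t _ => t + T * IZR j) (fun _ q => q) th r
        _ _ _ _ _ _ D1 (Hsh _) (differentiable_snd th r)); ring.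
    - apply (continuity_2d_pt_comp Gr (fun t _ => t + T * IZR j) (fun _ q => q)); trivial.
      + apply differentiable_continuity with (1 := Hsh _).
      + apply continuity_2d_pt_id2. }
  assert (Ha1 : a + T = T * IZR (k + 1)) by (rewrite plus_IZR; unfold a; ring).
  destruct (HD k) as [D1 C1]. { fold a; lra. }
  destruct (HD (k + 1)%Z) as [D2 C2]. { rewrite <- Ha1; lra. }
  fold a in D1, C1. rewrite <- Ha1 in D2, C2.
  split; [|split; [|split; [|split; [|split; [|split]]]]].
  - apply differentiable_pt_lim_ext with (fun t q => G (t + a) q + G (t + (a + T)) q).
    { apply locally_2d_impl with (2 := Hloc). apply locally_2d_forall. tauto. }
    destruct Hval as [V1 V2].
    apply differentiable_eq with (1 := differentiable_plus _ _ _ _ _ _ _ _ D1 D2); rewrite <- V2, <- ?V1; ring.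
  - apply continuity_2d_pt_ext_loc with (fun t q => Gr (t + a) q + Gr (t + (a + T)) q).
    { apply locally_2d_impl with (2 := Hloc). apply locally_2d_forall. tauto. }
    now apply continuity_2d_pt_plus.
  - now apply HG.
  - now apply HG.
  - f_equal. fold T. apply HSe; trivial. split; [trivial|split; trivial].
    exists (k - 1)%Z. rewrite minus_IZR. rewrite Hk. unfold a. ring.
  - f_equal. fold T. apply HSe; trivial. split; [trivial|split; trivial].
    exists (k - 1)%Z. rewrite minus_IZR. rewrite Hk. unfold a. ring.
  (* Immediately below r the bump is positive at the same lift, unless r lies on the lower boundary
     [c0 s]; then the points below belong to the next lift s + T. *)
  - intros eta Heta. destruct (Rle_lt_or_eq_dec _ _ (proj1 Hc)) as [X|X].
    + assert (Y : Rmax (r - eta) (c0 s) < r) by (apply Rmax_case; lra).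
      assert (Y1 := Rmax_l (r - eta) (c0 s)). assert (Y2 := Rmax_r (r - eta) (c0 s)).
      assert (Hc0 : 0 < c0 s) by (apply shift_range; lra).
      exists ((Rmax (r - eta) (c0 s) + r) / 2). set (r' := (Rmax (r - eta) (c0 s) + r) / 2).
      assert (Hr' : Rmax (r - eta) (c0 s) < r' < r) by (unfold r'; lra).
      split; [lra|split;[lra|]].
      rewrite (HSe th r' s).
      * apply HG; lra.
      * lra.
      * split; [trivial|split]. now exists k. lra.
    + assert (Hlt : c0 (s + T) < r).
      { rewrite <- X. unfold c0. replace (s + T + T * INR 2) with (s + T * INR 2 + T) by ring.
        apply gam_turn_lt. simpl; lra. }
      assert (Hc1 : c1 (s + T) = r).
      { rewrite <- X. unfold c0, c1. f_equal. simpl. ring. }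
      assert (Y : Rmax (r - eta) (c0 (s + T)) < r) by (apply Rmax_case; lra).
      assert (Y1 := Rmax_l (r - eta) (c0 (s + T))). assert (Y2 := Rmax_r (r - eta) (c0 (s + T))).
      assert (Hc0 : 0 < c0 (s + T)) by (apply shift_range; lra).
      exists ((Rmax (r - eta) (c0 (s + T)) + r) / 2). set (r' := (Rmax (r - eta) (c0 (s + T)) + r) / 2).
      assert (Hr' : Rmax (r - eta) (c0 (s + T)) < r' < r) by (unfold r'; lra).
      split; [lra|split;[lra|]].
      rewrite (HSe th r' (s + T)).
      * apply HG; lra.
      * lra.
      * split; [lra|split]. exists (k + 1)%Z. rewrite plus_IZR. rewrite Hk. unfold a. ring. lra.
Qed.

End Cylinder.

(** * Weighted polar coordinates *)

Lemma sin2_cos2_pow (x : R) : cos x ^ 2 + sin x ^ 2 = 1.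
Proof. assert (A := sin2_cos2 x). unfold Rsqr in A. simpl. lra. Qed.

Lemma angle_exists (u w : R) : u ^ 2 + w ^ 2 = 1 -> exists th, cos th = u /\ sin th = w.
Proof.
  intros H. assert (Hu : -1 <= u <= 1) by (split; nra).
  assert (Hs : sqrt (1 - u²) = Rabs w).
  { replace (1 - u²) with (w²) by (unfold Rsqr; nra). apply sqrt_Rsqr_abs. }
  destruct (Rle_dec 0 w) as [Hw|Hw].
  - exists (acos u). split. now apply cos_acos. rewrite sin_acos by trivial.
    rewrite Hs. now apply Rabs_pos_eq.
  - exists (- acos u). split. rewrite cos_neg. now apply cos_acos.
    rewrite sin_neg, sin_acos, Hs by trivial. rewrite Rabs_left by lra. ring.
Qed.

Lemma angle_unique (t t' : R) : cos t = cos t' -> sin t = sin t' -> exists k : Z, t' = t + 2 * PI * IZR k.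
Proof.
  intros Hc Hs. assert (HP := PI_RGT_0).
  destruct (angle_reduce (t' - t)) as [k Hk].
  set (u := t' - t + 2 * PI * IZR k) in *.
  assert (Hu : cos u = 1).
  { unfold u. rewrite (periodic_Z cos) by apply cos_2PI_period_aux || (intros; rewrite cos_plus, cos_2PI, sin_2PI; ring).
    rewrite cos_minus, Hc, Hs. assert (A := sin2_cos2_pow t'). nra. }
  assert (Hs2 : sin (u / 2) = 0).
  { replace u with (2 * (u / 2)) in Hu by field. rewrite cos_2a_sin in Hu. nra. }
  exists (1 - k)%Z. rewrite minus_IZR.
  destruct (Req_dec u (2 * PI)) as [E|NE].
  - unfold u in E. lra.
  - assert (0 < sin (u / 2)) by (apply sin_gt_0; lra). lra.
Qed.

Section Polar.

(* The weight of y is N + 1, so that [x = r cos th], [y = r^(N+1) sin th]. *)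
Variable N : nat.

(** For a fixed point, (x / r)^2 + (y / r^(N+1))^2 decreases in r at least as fast as r^-2. The
    weighted radius is the value of r where it equals 1; this monotonicity replaces an explicit
    formula for that radius. *)
Lemma polar_norm_decr (r r' x y : R) : 0 < r < r' ->
  (x / r') ^ 2 + (y / r' ^ S N) ^ 2 <= (r / r') ^ 2 * ((x / r) ^ 2 + (y / r ^ S N) ^ 2).
Proof.
  intros Hr. rewrite Rmult_plus_distr_l. apply Rplus_le_compat.
  - right. field. lra.
  - assert (P : 0 < r ^ N) by (apply pow_lt; lra). assert (P' : 0 < r' ^ N) by (apply pow_lt; lra).
    replace (y / r' ^ S N) with ((r / r') * (r / r') ^ N * (y / r ^ S N)).
    2: { unfold Rdiv at 2. rewrite Rpow_mult_distr, pow_inv. simpl. field. repeat split; lra. }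
    rewrite !Rpow_mult_distr. apply Rmult_le_compat_r. apply pow2_ge_0.
    rewrite <- (Rmult_1_r ((r / r') ^ 2)) at 2. apply Rmult_le_compat_l. apply pow2_ge_0.
    assert (Q : 0 <= r / r' <= 1).
    { split. apply Rdiv_le_0_compat; lra. apply Rmult_le_reg_r with r'. lra. unfold Rdiv. rewrite Rmult_assoc, Rinv_l; lra. }
    assert (Q2 : 0 <= (r / r') ^ N <= 1).
    { split. apply pow_le; lra. rewrite <- (pow1 N). apply pow_incr; lra. }
    simpl. nra.
Qed.

Lemma polar_norm_lt (r r' x y : R) : 0 < r < r' ->
  (x / r) ^ 2 + (y / r ^ S N) ^ 2 <= 1 -> (x / r') ^ 2 + (y / r' ^ S N) ^ 2 < 1.
Proof.
  intros Hr H. apply Rle_lt_trans with (1 := polar_norm_decr r r' x y Hr).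
  assert (Q : 0 <= r / r' < 1).
  { split. apply Rdiv_le_0_compat; lra. apply Rmult_lt_reg_r with r'. lra. unfold Rdiv. rewrite Rmult_assoc, Rinv_l; lra. }
  assert (A := pow2_ge_0 (x / r)). assert (B := pow2_ge_0 (y / r ^ S N)).
  set (z := (x / r) ^ 2 + (y / r ^ S N) ^ 2) in *. set (q := r / r') in *.
  apply Rle_lt_trans with (q ^ 2 * 1); [apply Rmult_le_compat_l; [apply pow2_ge_0|lra]|nra].
Qed.

Lemma polar_norm_1 (r th : R) : 0 < r ->
  (r * cos th / r) ^ 2 + (r ^ S N * sin th / r ^ S N) ^ 2 = 1.
Proof.
  intros Hr. assert (P : 0 < r ^ S N) by (apply pow_lt; lra).
  replace (r * cos th / r) with (cos th) by (field; lra).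
  replace (r ^ S N * sin th / r ^ S N) with (sin th) by (field; lra). apply sin2_cos2_pow.
Qed.

(** After multiplication by r^(2N+2) the radius is a positive root of a polynomial, found by the
    intermediate value theorem between 0 and 1 + |x| + |y|. If y = 0 the polynomial vanishes at 0 as
    well, and the radius is |x|. *)
Lemma polar_exists (x y : R) : (x, y) <> (0, 0) ->
  exists r th, 0 < r /\ x = r * cos th /\ y = r ^ S N * sin th.
Proof.
  intros Hxy.
  assert (Hr : exists r, 0 < r /\ (x / r) ^ 2 + (y / r ^ S N) ^ 2 = 1).
  { destruct (Req_dec y 0) as [Hy|Hy].
    - assert (Hx : x <> 0) by (intros ->; apply Hxy; now rewrite Hy).
      assert (Hp := Rabs_pos_lt _ Hx). exists (Rabs x). split; trivial.
      rewrite Hy. unfold Rdiv at 2. rewrite Rmult_0_l, pow_i, Rplus_0_r by lia.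
      unfold Rdiv. rewrite Rpow_mult_distr, pow_inv, pow2_abs. field. exact Hx.
    - set (R0 := 1 + Rabs x + Rabs y).
      assert (Hx0 := Rabs_pos x). assert (Hy0 := Rabs_pos_lt _ Hy).
      destruct (Ranalysis5.IVT_interv (fun r => r ^ (2 * S N) - x ^ 2 * r ^ (2 * N) - y ^ 2) 0 R0) as [r [Hr Er]].
      + intros a _. apply continuity_pt_filterlim.
        apply (ex_derive_continuous (V := R_NormedModule) (fun r => r ^ (2 * S N) - x ^ 2 * r ^ (2 * N) - y ^ 2)).
        auto_derive; trivial.
      + unfold R0; lra.
      + rewrite (pow_i (2 * S N)) by lia.
        assert (0 <= x ^ 2 * 0 ^ (2 * N)).
        { apply Rmult_le_pos. apply pow2_ge_0. apply pow_le; lra. }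
        assert (0 < y ^ 2) by (rewrite <- pow2_abs; now apply pow_lt). lra.
      + replace (2 * S N)%nat with (2 + 2 * N)%nat by lia. rewrite pow_add.
        assert (P : 1 <= R0 ^ (2 * N)) by (apply pow_R1_Rle; unfold R0; lra).
        rewrite <- (pow2_abs x), <- (pow2_abs y).
        assert (Rabs y ^ 2 < R0 ^ 2 - Rabs x ^ 2) by (unfold R0; simpl; nra).
        assert (0 < Rabs y ^ 2) by now apply pow_lt.
        replace (R0 ^ 2 * R0 ^ (2 * N) - Rabs x ^ 2 * R0 ^ (2 * N) - Rabs y ^ 2) with
          ((R0 ^ 2 - Rabs x ^ 2) * R0 ^ (2 * N) - Rabs y ^ 2) by ring. nra.
      + assert (Hr0 : 0 < r).
        { destruct Hr as [[H|H] _]; trivial. subst r. rewrite (pow_i (2 * S N)) in Er by lia.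
          assert (0 <= x ^ 2 * 0 ^ (2 * N)).
          { apply Rmult_le_pos. apply pow2_ge_0. apply pow_le; lra. }
          assert (0 < y ^ 2) by (rewrite <- pow2_abs; now apply pow_lt). lra. }
        exists r. split; trivial.
        assert (P := pow_lt r N Hr0).
        replace (2 * S N)%nat with (S N + S N)%nat in Er by lia.
        replace (2 * N)%nat with (N + N)%nat in Er by lia. rewrite !pow_add in Er. simpl in Er. simpl.
        apply Rmult_eq_reg_r with ((r * r ^ N) * (r * r ^ N)).
        2: { apply Rgt_not_eq. repeat apply Rmult_lt_0_compat; trivial. }
        field_simplify; [|lra..]. simpl. nra. }
  destruct Hr as [r [Hr E]]. destruct (angle_exists _ _ E) as [th [Hc Hs]].
  exists r, th. split; trivial. rewrite Hc, Hs. assert (P := pow_lt r (S N) Hr). split; field; lra.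
Qed.

Lemma polar_unique (r r' th th' : R) : 0 < r -> 0 < r' ->
  r * cos th = r' * cos th' -> r ^ S N * sin th = r' ^ S N * sin th' ->
  r = r' /\ exists k : Z, th' = th + 2 * PI * IZR k.
Proof.
  intros Hr Hr' H1 H2.
  assert (A := polar_norm_1 r th Hr). assert (B := polar_norm_1 r' th' Hr').
  assert (E : r = r').
  { destruct (Rtotal_order r r') as [H|[H|H]]; trivial; exfalso.
    - assert (C := polar_norm_lt r r' (r * cos th) (r ^ S N * sin th) (conj Hr H) (Req_le _ _ A)).
      rewrite H1, H2 in C. lra.
    - assert (C := polar_norm_lt r' r (r' * cos th') (r' ^ S N * sin th') (conj Hr' H) (Req_le _ _ B)).
      rewrite <- H1, <- H2 in C. lra. }
  split; trivial. subst r'. assert (P := pow_lt r (S N) Hr).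
  apply angle_unique.
  - apply Rmult_eq_reg_l with r; trivial. lra.
  - apply Rmult_eq_reg_l with (r ^ S N); trivial. lra.
Qed.

(** In this box each of the two terms of the weighted norm at radius e is below 1/4, so the radius
    at which the norm equals 1 is smaller than e. *)
Lemma polar_small (e x y r th : R) : 0 < e -> 0 < r -> x = r * cos th -> y = r ^ S N * sin th ->
  Rabs x < e / 2 -> Rabs y < e ^ S N / 2 -> r < e.
Proof.
  intros He Hr Hx Hy Bx By. apply Rnot_le_lt. intros H.
  assert (P := pow_lt e (S N) He).
  assert (C : (x / e) ^ 2 + (y / e ^ S N) ^ 2 < 1).
  { rewrite <- (pow2_abs (x / e)), <- (pow2_abs (y / e ^ S N)). unfold Rdiv. rewrite !Rabs_mult, !Rabs_inv.
    rewrite (Rabs_pos_eq e), (Rabs_pos_eq (e ^ S N)) by lra.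
    assert (A1 : 0 <= Rabs x * / e < / 2).
    { split. apply Rmult_le_pos. apply Rabs_pos. left; now apply Rinv_0_lt_compat.
      apply Rmult_lt_reg_r with e; trivial. rewrite Rmult_assoc, Rinv_l; lra. }
    assert (A2 : 0 <= Rabs y * / e ^ S N < / 2).
    { split. apply Rmult_le_pos. apply Rabs_pos. left; now apply Rinv_0_lt_compat.
      apply Rmult_lt_reg_r with (e ^ S N); trivial. rewrite Rmult_assoc, Rinv_l; lra. }
    nra. }
  assert (A := polar_norm_1 r th Hr). rewrite <- Hx, <- Hy in A.
  destruct H as [H|H].
  - assert (D := polar_norm_lt e r x y (conj He H) (Rlt_le _ _ C)). lra.
  - subst r. lra.
Qed.

(** The weighted norm is below 1 at radius r0 + e and above 1 at radius r0 - e. Both strict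
    inequalities persist near (x0, y0) and confine the radius to (r0 - e, r0 + e). *)
Lemma radius_continuous (rad : R -> R -> R) (x0 y0 : R) :
  (forall x y, (x, y) <> (0, 0) -> 0 < rad x y /\ (x / rad x y) ^ 2 + (y / rad x y ^ S N) ^ 2 = 1) ->
  (x0, y0) <> (0, 0) -> continuity_2d_pt rad x0 y0.
Proof.
  intros Hrad H0 eps.
  destruct (Hrad x0 y0 H0) as [Hr0 E0]. set (r0 := rad x0 y0) in *.
  assert (Hc : forall r1, 0 < r1 -> continuity_2d_pt (fun x y => (x / r1) ^ 2 + (y / r1 ^ S N) ^ 2) x0 y0).
  { intros r1 Hr1. apply continuity_2d_pt_plus; simpl; repeat apply continuity_2d_pt_mult;
      try apply continuity_2d_pt_id1; try apply continuity_2d_pt_id2; apply continuity_2d_pt_const. }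
  assert (Hne : locally_2d (fun x y => (x, y) <> (0, 0)) x0 y0).
  { destruct (Req_dec x0 0) as [Ex|Ex].
    - assert (Hy0 : y0 <> 0) by (intros Ey; apply H0; now rewrite Ex, Ey).
      apply locally_2d_impl with (2 := continuity_2d_pt_neq_0 _ _ _ (continuity_2d_pt_id2 x0 y0) Hy0).
      apply locally_2d_forall. intros x y H E. now injection E.
    - apply locally_2d_impl with (2 := continuity_2d_pt_neq_0 _ _ _ (continuity_2d_pt_id1 x0 y0) Ex).
      apply locally_2d_forall. intros x y H E. now injection E. }
  set (e := Rmin eps (r0 / 2)).
  assert (He : 0 < e) by (apply Rmin_case; [apply cond_pos|lra]).
  assert (He1 : e <= eps) by apply Rmin_l. assert (He2 : e <= r0 / 2) by apply Rmin_r.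
  assert (L1 : locally_2d (fun x y => 0 < 1 - ((x / (r0 + e)) ^ 2 + (y / (r0 + e) ^ S N) ^ 2)) x0 y0).
  { apply (locally_2d_pos (fun x y => 1 - ((x / (r0 + e)) ^ 2 + (y / (r0 + e) ^ S N) ^ 2))).
    - apply continuity_2d_pt_minus. apply continuity_2d_pt_const. apply Hc. lra.
    - cut ((x0 / (r0 + e)) ^ 2 + (y0 / (r0 + e) ^ S N) ^ 2 < 1); [lra|].
      apply polar_norm_lt with r0; lra. }
  assert (L2 : locally_2d (fun x y => 0 < ((x / (r0 - e)) ^ 2 + (y / (r0 - e) ^ S N) ^ 2) - 1) x0 y0).
  { apply (locally_2d_pos (fun x y => ((x / (r0 - e)) ^ 2 + (y / (r0 - e) ^ S N) ^ 2) - 1)).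
    - apply continuity_2d_pt_minus. apply Hc. lra. apply continuity_2d_pt_const.
    - cut (1 < (x0 / (r0 - e)) ^ 2 + (y0 / (r0 - e) ^ S N) ^ 2); [lra|].
      apply Rnot_le_lt. intros H. assert (A := polar_norm_lt (r0 - e) r0 x0 y0 ltac:(lra) H). lra. }
  apply locally_2d_impl with (2 := locally_2d_and _ _ _ _ Hne (locally_2d_and _ _ _ _ L1 L2)).
  apply locally_2d_forall. intros x y [Hn [A1 A2]].
  destruct (Hrad x y Hn) as [Hr E]. set (r := rad x y) in *.
  apply Rabs_def1.
  - apply Rlt_le_trans with e; trivial. apply Rnot_le_lt. intros H.
    destruct (Req_dec r (r0 + e)) as [X|X]. rewrite X in E; lra.
    assert (B := polar_norm_lt (r0 + e) r x y ltac:(lra) ltac:(lra)). lra.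
  - apply Rle_lt_trans with (- e). lra. apply Rnot_le_lt. intros H.
    destruct (Req_dec r (r0 - e)) as [X|X]. rewrite X in E; lra.
    assert (B := polar_norm_lt r (r0 - e) x y ltac:(lra) ltac:(lra)). lra.
Qed.

(** The radius is defined globally and the angle only near th0, by an arctangent. J is the absolute
    value of the Jacobian determinant of (th, r) -> (x, y), and the partial derivatives are the
    entries of the inverse matrix. *)
Lemma polar_chart (r0 th0 : R) : 0 < r0 ->
  let x0 := r0 * cos th0 in let y0 := r0 ^ S N * sin th0 in
  let J := r0 ^ S N * (cos th0 ^ 2 + INR (S N) * sin th0 ^ 2) in
  exists ang rad : R -> R -> R, ang x0 y0 = th0 /\ rad x0 y0 = r0 /\
    differentiable_pt_lim ang x0 y0 (- (INR (S N) * r0 ^ N * sin th0 / J)) (cos th0 / J) /\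
    differentiable_pt_lim rad x0 y0 (r0 ^ S N * cos th0 / J) (r0 * sin th0 / J) /\
    locally_2d (fun x y => 0 < rad x y /\ rad x y * cos (ang x y) = x /\
       rad x y ^ S N * sin (ang x y) = y) x0 y0.
Proof.
  intros Hr0 x0 y0 J.
  assert (HP := pow_lt r0 (S N) Hr0).
  assert (H0 : (x0, y0) <> (0, 0)).
  { intros E. injection E as E1 E2. unfold x0 in E1. unfold y0 in E2.
    assert (cos th0 = 0) by (apply Rmult_integral in E1; destruct E1; lra).
    assert (sin th0 = 0) by (apply Rmult_integral in E2; destruct E2; lra).
    assert (A := sin2_cos2_pow th0). rewrite H, H0 in A. lra. }
  assert (Hex : forall z : R * R, exists r, z <> (0, 0) -> 0 < r /\ (fst z / r) ^ 2 + (snd z / r ^ S N) ^ 2 = 1).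
  { intros [x y]. destruct (classic ((x, y) <> (0, 0))) as [H|H].
    - destruct (polar_exists x y H) as (r & th & Hr & Hx & Hy). exists r. intros _. split; trivial.
      simpl fst; simpl snd. rewrite Hx, Hy. now apply polar_norm_1.
    - exists 0. tauto. }
  destruct (choice _ Hex) as [rad' Hrad'].
  set (rad := fun x y => rad' (x, y)).
  assert (Hrad : forall x y, (x, y) <> (0, 0) -> 0 < rad x y /\ (x / rad x y) ^ 2 + (y / rad x y ^ S N) ^ 2 = 1).
  { intros x y. apply (Hrad' (x, y)). }
  clearbody rad. clear rad' Hrad' Hex.
  assert (Er0 : rad x0 y0 = r0).
  { destruct (Hrad x0 y0 H0) as [A B]. assert (C := polar_norm_1 r0 th0 Hr0). fold x0 y0 in C.
    destruct (Rtotal_order (rad x0 y0) r0) as [H|[H|H]]; trivial; exfalso.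
    - assert (D := polar_norm_lt _ _ x0 y0 (conj A H) (Req_le _ _ B)). lra.
    - assert (D := polar_norm_lt _ _ x0 y0 (conj Hr0 H) (Req_le _ _ C)). lra. }
  assert (Crad : continuity_2d_pt rad x0 y0) by now apply radius_continuous.
  assert (Cinv : forall k, continuity_2d_pt (fun x y => / rad x y ^ k) x0 y0).
  { intros k. apply continuity_2d_pt_inv.
    - induction k as [|k IH]; simpl. apply continuity_2d_pt_const. now apply continuity_2d_pt_mult.
    - rewrite Er0. apply pow_nonzero. lra. }
  set (c0 := cos th0). set (s0 := sin th0).
  (* [D] and [E] are the cosine and the sine of the angle measured from th0. Near the base point D >
     0, so th0 + atan (E / D) is a determination of the angle. *)
  set (D := fun x y => x * / rad x y ^ 1 * c0 + y * / rad x y ^ S N * s0).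
  set (E := fun x y => y * / rad x y ^ S N * c0 - x * / rad x y ^ 1 * s0).
  set (ang := fun x y => th0 + atan (E x y * / D x y)).
  assert (Ex : x0 * / r0 ^ 1 = c0) by (unfold x0, c0; simpl; field; lra).
  assert (Ey : y0 * / r0 ^ S N = s0) by (unfold y0, s0; field; lra).
  assert (Hcs := sin2_cos2_pow th0). fold c0 s0 in Hcs.
  assert (CD : continuity_2d_pt D x0 y0).
  { apply continuity_2d_pt_plus; repeat apply continuity_2d_pt_mult; auto; try apply continuity_2d_pt_const.
    apply continuity_2d_pt_id1. apply continuity_2d_pt_id2. }
  assert (CE : continuity_2d_pt E x0 y0).
  { apply continuity_2d_pt_minus; repeat apply continuity_2d_pt_mult; auto; try apply continuity_2d_pt_const.
    apply continuity_2d_pt_id2. apply continuity_2d_pt_id1. }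
  assert (D0 : D x0 y0 = 1) by (unfold D; rewrite Er0, Ex, Ey; lra).
  assert (E0 : E x0 y0 = 0) by (unfold E; rewrite Er0, Ex, Ey; lra).
  assert (Cang : continuity_2d_pt ang x0 y0).
  { apply continuity_2d_pt_plus. apply continuity_2d_pt_const.
    apply (continuity_1d_2d_pt_comp atan).
    - apply derivable_continuous_pt, derivable_pt_atan.
    - apply continuity_2d_pt_mult; trivial. apply continuity_2d_pt_inv; trivial. rewrite D0. lra. }
  assert (Eang : ang x0 y0 = th0).
  { unfold ang. rewrite E0, Rmult_0_l, atan_0. ring. }
  assert (Hne : locally_2d (fun x y => rad x y <> 0 /\ (x, y) <> (0, 0)) x0 y0).
  { apply locally_2d_and. apply continuity_2d_pt_neq_0; trivial. rewrite Er0; lra.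
    destruct (Req_dec x0 0) as [Exx|Exx].
    - assert (Hy0 : y0 <> 0) by (intros Eyy; apply H0; now rewrite Exx, Eyy).
      apply locally_2d_impl with (2 := continuity_2d_pt_neq_0 _ _ _ (continuity_2d_pt_id2 x0 y0) Hy0).
      apply locally_2d_forall. intros x y H X. now injection X.
    - apply locally_2d_impl with (2 := continuity_2d_pt_neq_0 _ _ _ (continuity_2d_pt_id1 x0 y0) Exx).
      apply locally_2d_forall. intros x y H X. now injection X. }
  assert (Hloc : locally_2d (fun x y => 0 < rad x y /\ rad x y * cos (ang x y) = x /\
       rad x y ^ S N * sin (ang x y) = y) x0 y0).
  { assert (LD := locally_2d_pos D x0 y0 CD ltac:(rewrite D0; lra)).
    apply locally_2d_impl with (2 := locally_2d_and _ _ _ _ Hne LD).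
    apply locally_2d_forall. intros x y [[_ Hn] HD].
    destruct (Hrad x y Hn) as [Hr Hu]. split; trivial.
    assert (Pn := pow_lt _ (S N) Hr).
    set (u := x / rad x y) in *. set (w := y / rad x y ^ S N) in *.
    assert (ED : D x y = u * c0 + w * s0) by (unfold D, u, w, Rdiv; now rewrite pow_1).
    assert (EE : E x y = w * c0 - u * s0) by (unfold E, u, w, Rdiv; now rewrite pow_1).
    assert (H1 : D x y ^ 2 + E x y ^ 2 = 1).
    { rewrite ED, EE. replace ((u * c0 + w * s0) ^ 2 + (w * c0 - u * s0) ^ 2) with
        ((u ^ 2 + w ^ 2) * (c0 ^ 2 + s0 ^ 2)) by ring. rewrite Hu, Hcs. ring. }
    assert (Hsq : sqrt (1 + (E x y * / D x y)²) = / D x y).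
    { replace (1 + (E x y * / D x y)²) with ((/ D x y)²).
      - apply sqrt_Rsqr. left. now apply Rinv_0_lt_compat.
      - unfold Rsqr. apply Rmult_eq_reg_r with (D x y ^ 2). 2: apply pow_nonzero; lra.
        field_simplify; lra. }
    assert (Hca : cos (atan (E x y * / D x y)) = D x y).
    { rewrite cos_atan, Hsq. field. lra. }
    assert (Hsa : sin (atan (E x y * / D x y)) = E x y).
    { rewrite sin_atan, Hsq. field. lra. }
    unfold ang. rewrite cos_plus, sin_plus, Hca, Hsa. fold c0 s0. rewrite ED, EE. split.
    - replace (c0 * (u * c0 + w * s0) - s0 * (w * c0 - u * s0)) with (u * (c0 ^ 2 + s0 ^ 2)) by ring.
      rewrite Hcs. unfold u. field. lra.
    - replace (s0 * (u * c0 + w * s0) + c0 * (w * c0 - u * s0)) with (w * (c0 ^ 2 + s0 ^ 2)) by ring.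
      rewrite Hcs. unfold w. field. lra. }
  exists ang, rad. split; trivial. split; trivial.
  assert (HJ : 0 < cos th0 ^ 2 + INR (S N) * sin th0 ^ 2).
  { fold c0 s0. assert (A : 1 <= INR (S N)). { rewrite S_INR. assert (B := pos_INR N). lra. }
    assert (B := pow2_ge_0 s0). assert (C := pow2_ge_0 c0). nra. }
  assert (HJ' : 0 < J) by (unfold J; now apply Rmult_lt_0_compat).
  assert (D1 : differentiable_pt_lim (fun th r => r * cos th) th0 r0 (- (r0 * sin th0)) (cos th0)).
  { apply differentiable_eq with (1 := differentiable_mult _ _ _ _ _ _ _ _ (differentiable_snd th0 r0)
      (differentiable_pt_lim_proj1_0 cos th0 r0 _ (derivable_pt_lim_cos th0))); cbv beta; ring. }
  assert (D2 : differentiable_pt_lim (fun th r => r ^ S N * sin th) th0 r0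
      (r0 ^ S N * cos th0) (INR (S N) * r0 ^ N * sin th0)).
  { assert (Dp : is_derive (fun r => r ^ S N) r0 (INR (S N) * r0 ^ N)).
    { evar_last. apply (is_derive_pow (fun r => r) (S N) r0 1). apply (is_derive_id (K := R_AbsRing)).
      simpl Init.Nat.pred. ring. }
    apply differentiable_eq with (1 := differentiable_mult _ _ _ _ _ _ _ _ 
      (differentiable_comp1 (fun r => r ^ S N) _ _ _ _ _ _ Dp (differentiable_snd th0 r0))
      (differentiable_pt_lim_proj1_0 sin th0 r0 _ (derivable_pt_lim_sin th0))); cbv beta; ring. }
  destruct (differentiable_inverse (fun th r => r * cos th) (fun th r => r ^ S N * sin th) ang rad x0 y0
     (- (r0 * sin th0)) (cos th0) (r0 ^ S N * cos th0) (INR (S N) * r0 ^ N * sin th0)) as [I1 I2]; trivial.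
  - rewrite Eang, Er0. exact D1.
  - rewrite Eang, Er0. exact D2.
  - replace (- (r0 * sin th0) * (INR (S N) * r0 ^ N * sin th0) - cos th0 * (r0 ^ S N * cos th0)) with (- J).
    lra. unfold J. simpl pow. ring.
  - apply locally_2d_impl with (2 := Hloc). apply locally_2d_forall. tauto.
  - assert (EJ : - (r0 * sin th0) * (INR (S N) * r0 ^ N * sin th0) - cos th0 * (r0 ^ S N * cos th0) = - J).
    { unfold J. simpl pow. ring. }
    rewrite EJ in I1, I2. split; [|split; [|exact Hloc]].
    + apply differentiable_eq with (1 := I1); unfold s0, c0; field; lra.
    + apply differentiable_eq with (1 := I2); unfold s0, c0; field; lra.
Qed.

End Polar.

(** * From the cylinder to the plane *)

(** Negative r is included so that r = 0 is an interior line: regularity of the coefficients up to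
    the origin becomes regularity on an open set. *)
Definition strip (d : R) : R -> R -> Prop := fun _ r => Rabs r < d.

Lemma strip_open (d : R) : open_2d (strip d).
Proof.
  intros x y H. unfold strip in *. assert (Hr : 0 < d - Rabs y) by lra.
  exists (mkposreal _ Hr). simpl. intros u v _ Hv.
  replace v with ((v - y) + y) by ring. apply Rle_lt_trans with (1 := Rabs_triang _ _). lra.
Qed.

Lemma Ck_periodic (k : nat) (d : R) (f : R -> R -> R) :
  Ck (S k) (strip d) f -> (forall th r, f (th + 2 * PI) r = f th r) ->
  exists ft fr, (forall th r, Rabs r < d -> differentiable_pt_lim f th r (ft th r) (fr th r)) /\
    Ck k (strip d) ft /\ Ck k (strip d) fr /\
    (forall th r, Rabs r < d -> ft (th + 2 * PI) r = ft th r) /\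
    (forall th r, Rabs r < d -> fr (th + 2 * PI) r = fr th r).
Proof.
  intros (ft & fr & H & Ht & Hr) Hp. exists ft, fr.
  assert (D : forall th r, Rabs r < d -> ft (th + 2 * PI) r = ft th r /\ fr (th + 2 * PI) r = fr th r).
  { intros th r Hrd.
    destruct (differentiable_is_derive _ _ _ _ _ (H th r Hrd)) as [A1 A2].
    destruct (differentiable_is_derive _ _ _ _ _ (H (th + 2 * PI) r Hrd)) as [B1 B2].
    split.
    - apply is_derive_unique in A1. rewrite <- A1. symmetry. apply is_derive_unique.
      apply (is_derive_ext (fun t => f (t + 2 * PI) r)). { intros t. apply Hp. }
      evar_last.
      + apply (is_derive_comp (fun t => f t r) (fun t => t + 2 * PI)). exact B1. auto_derive; trivial.
      + unfold scal; simpl; unfold mult; simpl. ring.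
    - apply is_derive_unique in A2. rewrite <- A2. symmetry. apply is_derive_unique.
      apply (is_derive_ext (f (th + 2 * PI))). { intros t. apply Hp. } exact B2. }
  repeat split; trivial; intros th r Hrd; now apply D.
Qed.

(** Periodicity reduces the bound to one period, and halving the width makes the remaining rectangle
    compact inside the strip. *)
Lemma strip_bounded (d : R) (f : R -> R -> R) :
  0 < d -> Ck 0 (strip d) f -> (forall th r, Rabs r < d -> f (th + 2 * PI) r = f th r) ->
  exists M, 0 < M /\ forall th r, Rabs r <= d / 2 -> Rabs (f th r) <= M.
Proof.
  intros Hd Hf Hp.
  destruct (bounded_rectangle f 0 (2 * PI) (- (d / 2)) (d / 2)) as [M HM].
  { intros x y _ Hy. apply Hf. unfold strip. apply Rabs_def1; lra. }
  exists (Rabs M + 1). assert (A := Rabs_pos M). split. lra.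
  intros th r Hr. destruct (angle_reduce th) as [k Hk].
  assert (Hrd : Rabs r < d) by lra.
  rewrite <- (periodic_Z (fun t => f t r) k th) by auto.
  apply Rle_trans with M.
  - apply HM. lra. now apply Rabs_le_between.
  - assert (B := Rle_abs M). lra.
Qed.

Section Planar.

Variables (N m : nat) (P Q Px Py Qx Qy A B : R -> R -> R) (delta : R).

(** The order in r of the angular expression below. The Jacobian has order N + 1, so the
    y-derivative of r^k B V has order at least k - N - 1 = m + 1; being positive, it gives class C^1
    at the origin. *)
Let k := (N + 2 + m)%nat.

Hypothesis delta_range : 0 < delta <= 1.
Hypothesis P_diff : forall x y, Rabs x < delta -> Rabs y < delta ->
  differentiable_pt_lim P x y (Px x y) (Py x y).
Hypothesis Q_diff : forall x y, Rabs x < delta -> Rabs y < delta ->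
  differentiable_pt_lim Q x y (Qx x y) (Qy x y).
Hypothesis A_C2 : Ck 2 (strip delta) A.
Hypothesis B_C2 : Ck 2 (strip delta) B.
Hypothesis B_neq_0 : forall th r, Rabs r < delta -> B th r <> 0.
Hypothesis A_per : forall th r, A (th + 2 * PI) r = A th r.
Hypothesis B_per : forall th r, B (th + 2 * PI) r = B th r.
Hypothesis angular_part : forall th r, 0 < r < delta ->
  cos th * Q (r * cos th) (r ^ S N * sin th) -
  INR (S N) * r ^ N * sin th * P (r * cos th) (r ^ S N * sin th) = r ^ k * B th r.
Hypothesis radial_part : forall th r, 0 < r < delta ->
  r ^ S N * cos th * P (r * cos th) (r ^ S N * sin th) +
  r * sin th * Q (r * cos th) (r ^ S N * sin th) = r ^ S k * A th r.

Definition slope (th r : R) : R := r * (A th r / B th r).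

Lemma slope_per th r : slope (th + 2 * PI) r = slope th r.
Proof. unfold slope. now rewrite A_per, B_per. Qed.

Lemma slope_C2 : Ck 2 (strip delta) slope.
Proof.
  assert (O := strip_open delta).
  apply (Ck_mult 2 _ (fun _ r => r)). apply Ck_snd. apply Ck_div; auto.
Qed.

Lemma slope_regular : exists (Fr Frr : R -> R -> R) (L : R), 0 < L /\ forall th r, Rabs r <= delta / 2 ->
  continuity_2d_pt slope th r /\ continuity_2d_pt Fr th r /\ continuity_2d_pt Frr th r /\
  is_derive (slope th) r (Fr th r) /\ is_derive (Fr th) r (Frr th r) /\
  Rabs (slope th r) <= L * Rabs r /\ Rabs (Fr th r) <= L /\ Rabs (Frr th r) <= L.
Proof.
  assert (O := strip_open delta).
  destruct (Ck_periodic 1 delta slope slope_C2 slope_per) as (Ft & Fr & HF & _ & CFr & _ & PFr).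
  assert (CFr' := CFr). destruct CFr' as (Frt & Frr & HFr & _ & CFrr).
  assert (PFrr : forall th r, Rabs r < delta -> Frr (th + 2 * PI) r = Frr th r).
  { intros th r Hr.
    destruct (differentiable_is_derive _ _ _ _ _ (HFr th r Hr)) as [_ A2].
    destruct (differentiable_is_derive _ _ _ _ _ (HFr (th + 2 * PI) r Hr)) as [_ B2].
    apply is_derive_unique in A2. rewrite <- A2. symmetry. apply is_derive_unique.
    apply is_derive_ext_loc with (2 := B2).
    assert (Hd : 0 < delta - Rabs r) by lra. exists (mkposreal _ Hd). intros y Hy.
    apply PFr. change (Rabs (y - r) < delta - Rabs r) in Hy.
    replace y with ((y - r) + r) by ring. apply Rle_lt_trans with (1 := Rabs_triang _ _). lra. }
  assert (CAB : Ck 0 (strip delta) (fun th r => A th r / B th r)).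
  { apply (Ck_0 2). apply Ck_div; auto. }
  destruct (strip_bounded delta _ (proj1 delta_range) CAB) as [M0 [HM0 B0]].
  { intros; now rewrite A_per, B_per. }
  destruct (strip_bounded delta _ (proj1 delta_range) (Ck_0 _ _ _ CFr) PFr) as [M1 [HM1 B1]].
  destruct (strip_bounded delta _ (proj1 delta_range) (Ck_0 _ _ _ CFrr) PFrr) as [M2 [HM2 B2]].
  exists Fr, Frr, (M0 + M1 + M2). split. lra. intros th r Hr.
  assert (Hrd : Rabs r < delta) by lra.
  split; [|split; [|split; [|split; [|split; [|split; [|split]]]]]].
  - apply (Ck_0 _ _ _ slope_C2 th r Hrd).
  - apply (Ck_0 _ _ _ CFr th r Hrd).
  - apply (Ck_0 _ _ _ CFrr th r Hrd).
  - apply (differentiable_is_derive _ _ _ _ _ (HF th r Hrd)).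
  - apply (differentiable_is_derive _ _ _ _ _ (HFr th r Hrd)).
  - unfold slope. rewrite Rabs_mult, Rmult_comm. apply Rmult_le_compat_r. apply Rabs_pos.
    specialize (B0 th r Hr). lra.
  - specialize (B1 th r Hr). lra.
  - specialize (B2 th r Hr). lra.
Qed.

(** For sg = -1 the angle is reversed, so that the spiral always approaches the origin with
    increasing angle. The solution found for the reflected slope is reflected back. *)
Lemma planar_cylinder (sg : R) (gam : R -> R) :
  sg = 1 \/ sg = -1 ->
  (forall th, -1 < th -> 0 < gam th < delta / 2) ->
  (forall th, -1 < th -> is_derive gam th (sg * slope (sg * th) (gam th))) ->
  is_lim gam p_infty 0 ->
  exists (V Vr Fr : R -> R -> R) (C e : R), 0 < e < delta / 2 /\ forall th r, 0 < r < e ->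
    is_derive (slope th) r (Fr th r) /\ Rabs (Fr th r) <= C /\ continuity_2d_pt Fr th r /\
    differentiable_pt_lim V th r (Fr th r * V th r - slope th r * Vr th r) (Vr th r) /\
    continuity_2d_pt Vr th r /\
    Rabs (V th r) <= C /\ Rabs (Vr th r) <= C /\
    V (th + 2 * PI) r = V th r /\ Vr (th + 2 * PI) r = Vr th r /\
    (forall eta, 0 < eta -> exists r', r - eta < r' < r /\ 0 < r' /\ V th r' <> 0).
Proof.
  intros Hsg Hg Hgd Hgl.
  destruct slope_regular as (Fr & Frr & L & HL & HF).
  assert (Hsg2 : sg * sg = 1) by (destruct Hsg as [-> | ->]; ring).
  assert (Hsga : Rabs sg = 1) by (destruct Hsg as [-> | ->]; [apply Rabs_R1|rewrite Rabs_left; lra]).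
  assert (HF' : forall th r, 0 < r < delta / 2 ->
    continuity_2d_pt slope th r /\ continuity_2d_pt Fr th r /\ continuity_2d_pt Frr th r /\
    is_derive (slope th) r (Fr th r) /\ is_derive (Fr th) r (Frr th r) /\
    Rabs (slope th r) <= L * Rabs r /\ Rabs (Fr th r) <= L /\ Rabs (Frr th r) <= L).
  { intros th r Hr. apply HF. rewrite Rabs_pos_eq; lra. }
  assert (Hc : forall f : R -> R -> R, (forall th r, 0 < r < delta / 2 -> continuity_2d_pt f th r) ->
     forall th r, 0 < r < delta / 2 -> continuity_2d_pt (fun th r => sg * f (sg * th) r) th r).
  { intros f Hf th r Hr. apply continuity_2d_pt_mult. apply continuity_2d_pt_const.
    apply (continuity_2d_pt_comp f (fun t _ => sg * t) (fun _ r => r)); auto.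
    - apply continuity_2d_pt_mult. apply continuity_2d_pt_const. apply continuity_2d_pt_id1.
    - apply continuity_2d_pt_id2. }
  destruct (cylinder_solution (fun th r => sg * slope (sg * th) r) (fun th r => sg * Fr (sg * th) r)
     (fun th r => sg * Frr (sg * th) r) (delta / 2) L gam) as (V & Vr & C & e & He & HV); trivial.
  - apply Hc. intros; now apply HF'.
  - apply Hc. intros; now apply HF'.
  - apply Hc. intros; now apply HF'.
  - intros th r Hr. apply (is_derive_scal (slope (sg * th))). now apply HF'.
  - intros th r Hr. apply (is_derive_scal (Fr (sg * th))). now apply HF'.
  - intros th r Hr. rewrite Rabs_mult, Hsga, Rmult_1_l. rewrite <- (Rabs_pos_eq r) at 2 by lra. now apply HF'.
  - intros th r Hr. rewrite Rabs_mult, Hsga, Rmult_1_l. now apply HF'.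
  - intros th r Hr. rewrite Rabs_mult, Hsga, Rmult_1_l. now apply HF'.
  - intros th r. f_equal. destruct Hsg as [-> | ->].
    + rewrite Rmult_plus_distr_l, (Rmult_1_l (2 * PI)). apply slope_per.
    + rewrite <- slope_per. f_equal. ring.
  - exists (fun th r => V (sg * th) r), (fun th r => Vr (sg * th) r), Fr, (Rabs C + L), e.
    split; trivial. intros th r Hr.
    destruct (HV (sg * th) r Hr) as (D1 & D2 & D3 & D4 & D5 & D6 & D7).
    assert (Hr2 : 0 < r < delta / 2) by lra.
    assert (HC := Rle_abs C). assert (HC0 := Rabs_pos C).
    split; [now apply HF'|]. split.
    { destruct (HF' th r Hr2) as (_ & _ & _ & _ & _ & _ & X & _). lra. }
    split; [now apply HF'|].
    split; [|split; [|split; [|split; [|split; [|split]]]]]; trivial.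
    + assert (Dm : differentiable_pt_lim (fun t (_ : R) => sg * t) th r sg 0).
      { apply (differentiable_pt_lim_proj1_0 (fun t => sg * t)). apply is_derive_Reals.
        auto_derive; trivial; ring. }
      apply differentiable_eq with (1 := differentiable_pt_lim_comp V (fun t _ => sg * t) (fun _ r => r) th r _ _ _ _ _ _ D1 Dm
        (differentiable_snd th r)).
      * replace (sg * (sg * th)) with th by (rewrite <- Rmult_assoc, Hsg2; ring).
        replace ((sg * Fr th r * V (sg * th) r - sg * slope th r * Vr (sg * th) r) * sg + Vr (sg * th) r * 0)
          with ((sg * sg) * (Fr th r * V (sg * th) r - slope th r * Vr (sg * th) r)) by ring.
        rewrite Hsg2. ring.
      * ring.
    + apply (continuity_2d_pt_comp Vr (fun t _ => sg * t) (fun _ r => r)); auto.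
      * apply continuity_2d_pt_mult. apply continuity_2d_pt_const. apply continuity_2d_pt_id1.
      * apply continuity_2d_pt_id2.
    + lra.
    + lra.
    + destruct Hsg as [-> | ->].
      * rewrite Rmult_plus_distr_l, (Rmult_1_l (2 * PI)). trivial.
      * destruct (HV (-1 * (th + 2 * PI)) r Hr) as (_ & _ & _ & _ & E & _). rewrite <- E. f_equal. ring.
    + destruct Hsg as [-> | ->].
      * rewrite Rmult_plus_distr_l, (Rmult_1_l (2 * PI)). trivial.
      * destruct (HV (-1 * (th + 2 * PI)) r Hr) as (_ & _ & _ & _ & _ & E & _). rewrite <- E. f_equal. ring.
Qed.

(** The divergence in weighted polar coordinates: [angular_part] is differentiated in th,
    [radial_part] in r, and the results are added. The terms in the values of P and Q and the mixed
    derivatives cancel; the divergence times the Jacobian remains. *)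
Lemma divergence_identity (At Ar Bt Br : R -> R -> R) th r :
  (forall th r, Rabs r < delta -> differentiable_pt_lim A th r (At th r) (Ar th r)) ->
  (forall th r, Rabs r < delta -> differentiable_pt_lim B th r (Bt th r) (Br th r)) ->
  0 < r < delta ->
  let x := r * cos th in let y := r ^ S N * sin th in
  r * r ^ m * (Bt th r + INR (S k) * A th r + r * Ar th r) =
  (cos th ^ 2 + INR (S N) * sin th ^ 2) * (Px x y + Qy x y).
Proof.
  intros HA HB Hr x y. set (nu := INR (S N)).
  assert (Hrd : Rabs r < delta) by (rewrite Rabs_pos_eq; lra).
  assert (HpN : 0 < r ^ N) by (apply pow_lt; lra).
  assert (Hx : Rabs x < delta).
  { unfold x. rewrite Rabs_mult, (Rabs_pos_eq r) by lra.
    assert (X := COS_bound th). assert (Y : Rabs (cos th) <= 1) by (apply Rabs_le; lra).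
    assert (Z := Rabs_pos (cos th)). nra. }
  assert (Hy : Rabs y < delta).
  { unfold y. rewrite Rabs_mult, (Rabs_pos_eq (r ^ S N)) by (apply pow_le; lra).
    assert (X := SIN_bound th). assert (Y : Rabs (sin th) <= 1) by (apply Rabs_le; lra).
    assert (Z := Rabs_pos (sin th)).
    assert (U : r ^ N <= 1) by (rewrite <- (pow1 N); apply pow_incr; lra).
    assert (U2 : r ^ N * Rabs (sin th) <= 1) by nra. simpl. nra. }
  assert (DP := P_diff x y Hx Hy). assert (DQ := Q_diff x y Hx Hy).
  assert (Dc : forall a, is_derive (fun t => a * cos t) th (- (a * sin th))).
  { intros a. auto_derive; trivial. ring. }
  assert (Ds : forall a, is_derive (fun t => a * sin t) th (a * cos th)).
  { intros a. auto_derive; trivial. ring. }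
  assert (Dpow : forall j a, is_derive (fun s => s ^ S j * a) r (INR (S j) * r ^ j * a)).
  { intros j a. evar_last.
    - apply (is_derive_mult (fun s => s ^ S j) (fun _ => a)).
      + apply (is_derive_pow (fun s => s) (S j) r 1). apply (is_derive_id (K := R_AbsRing)).
      + apply (is_derive_const a).
      + intros; apply Rmult_comm.
    - unfold plus, mult, zero; simpl Init.Nat.pred; simpl. ring. }
  assert (Dlin : forall a, is_derive (fun s => s * a) r a).
  { intros a. auto_derive; trivial. ring. }
  assert (E1 : - sin th * Q x y + cos th * (Qx x y * - (r * sin th) + Qy x y * (r ^ S N * cos th))
      - (nu * r ^ N * cos th * P x y + nu * r ^ N * sin th * (Px x y * - (r * sin th) + Py x y * (r ^ S N * cos th)))
      = r ^ k * Bt th r).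
  { transitivity (Derive (fun t => r ^ k * B t r) th).
    - symmetry. apply is_derive_unique.
      apply (is_derive_ext (fun t => cos t * Q (r * cos t) (r ^ S N * sin t) -
          nu * r ^ N * sin t * P (r * cos t) (r ^ S N * sin t))).
      { intros t. now apply angular_part. }
      evar_last.
      + apply (is_derive_minus (fun t => cos t * Q (r * cos t) (r ^ S N * sin t))
           (fun t => nu * r ^ N * sin t * P (r * cos t) (r ^ S N * sin t))).
        * apply (is_derive_mult cos (fun t => Q (r * cos t) (r ^ S N * sin t))).
          -- apply is_derive_cos.
          -- apply (is_derive_comp_2d Q (fun t => r * cos t) (fun t => r ^ S N * sin t) th _ _ _ _ DQ (Dc r) (Ds _)).
          -- intros; apply Rmult_comm.
        * apply (is_derive_mult (fun t => nu * r ^ N * sin t) (fun t => P (r * cos t) (r ^ S N * sin t))).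
          -- apply Ds.
          -- apply (is_derive_comp_2d P (fun t => r * cos t) (fun t => r ^ S N * sin t) th _ _ _ _ DP (Dc r) (Ds _)).
          -- intros; apply Rmult_comm.
      + unfold minus, plus, opp, mult; simpl. unfold x, y. simpl. ring.
    - apply is_derive_unique. apply (is_derive_scal (fun t => B t r)).
      apply (differentiable_is_derive _ _ _ _ _ (HB th r Hrd)). }
  assert (E2 : nu * r ^ N * cos th * P x y + r ^ S N * cos th * (Px x y * cos th + Py x y * (nu * r ^ N * sin th))
      + (sin th * Q x y + r * sin th * (Qx x y * cos th + Qy x y * (nu * r ^ N * sin th)))
      = INR (S k) * r ^ k * A th r + r ^ S k * Ar th r).
  { transitivity (Derive (fun s => s ^ S k * A th s) r).
    - symmetry. apply is_derive_unique.
      apply (is_derive_ext_loc (fun s => s ^ S N * cos th * P (s * cos th) (s ^ S N * sin th) +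
         s * sin th * Q (s * cos th) (s ^ S N * sin th))).
      { assert (Hd : 0 < Rmin r (delta - r)) by (apply Rmin_case; lra).
        exists (mkposreal _ Hd). intros s Hs. change (Rabs (s - r) < Rmin r (delta - r)) in Hs.
        assert (X1 := Rabs_def2 _ _ (Rlt_le_trans _ _ _ Hs (Rmin_l _ _))).
        assert (X2 := Rabs_def2 _ _ (Rlt_le_trans _ _ _ Hs (Rmin_r _ _))).
        apply radial_part. lra. }
      evar_last.
      + apply (is_derive_plus (fun s => s ^ S N * cos th * P (s * cos th) (s ^ S N * sin th))
           (fun s => s * sin th * Q (s * cos th) (s ^ S N * sin th))).
        * apply (is_derive_mult (fun s => s ^ S N * cos th) (fun s => P (s * cos th) (s ^ S N * sin th))).
          -- apply Dpow.
          -- apply (is_derive_comp_2d P (fun s => s * cos th) (fun s => s ^ S N * sin th) r _ _ _ _ DP (Dlin _) (Dpow _ _)).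
          -- intros; apply Rmult_comm.
        * apply (is_derive_mult (fun s => s * sin th) (fun s => Q (s * cos th) (s ^ S N * sin th))).
          -- apply Dlin.
          -- apply (is_derive_comp_2d Q (fun s => s * cos th) (fun s => s ^ S N * sin th) r _ _ _ _ DQ (Dlin _) (Dpow _ _)).
          -- intros; apply Rmult_comm.
      + unfold plus, mult; simpl. unfold x, y. reflexivity.
    - apply is_derive_unique. evar_last.
      + apply (is_derive_mult (fun s => s ^ S k) (fun s => A th s)).
        * apply (is_derive_ext (fun s => s ^ S k * 1)). intros; simpl; ring. apply Dpow.
        * apply (differentiable_is_derive _ _ _ _ _ (HA th r Hrd)).
        * intros; apply Rmult_comm.
      + unfold plus, mult; simpl. ring. }
  assert (Hk : r ^ k = r ^ N * r * (r * r ^ m)).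
  { unfold k. rewrite !pow_add. simpl. ring. }
  apply Rmult_eq_reg_l with (r ^ N * r). 2: apply Rgt_not_eq, Rmult_lt_0_compat; lra.
  assert (E : r ^ k * Bt th r + (INR (S k) * r ^ k * A th r + r ^ S k * Ar th r) =
     r ^ N * r * ((cos th ^ 2 + nu * sin th ^ 2) * (Px x y + Qy x y))).
  { rewrite <- E1, <- E2. simpl pow. ring. }
  fold nu. rewrite <- E. replace (r ^ S k) with (r * r ^ k) by reflexivity. rewrite Hk. ring.
Qed.

Let jac th := cos th ^ 2 + INR (S N) * sin th ^ 2.

Lemma jac_ge_1 th : 1 <= jac th.
Proof.
  unfold jac. assert (X := sin2_cos2_pow th). rewrite S_INR.
  assert (Y := pow2_ge_0 (sin th)). assert (Z := pos_INR N).
  assert (W := Rmult_le_pos _ _ Z Y). lra.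
Qed.

(* In the coordinates (th, r) the factor is r^k B V, where V solves
   [V_th + F V_r = F_r V] for the slope F = dr/dth of the orbits. *)
Lemma planar_inverse_integrating_factor (V Vr Fr : R -> R -> R) (C e eta : R) :
  0 < e < delta / 2 -> 0 < eta ->
  (forall th r, 0 < r < e ->
    is_derive (slope th) r (Fr th r) /\ Rabs (Fr th r) <= C /\ continuity_2d_pt Fr th r /\
    differentiable_pt_lim V th r (Fr th r * V th r - slope th r * Vr th r) (Vr th r) /\
    continuity_2d_pt Vr th r /\
    Rabs (V th r) <= C /\ Rabs (Vr th r) <= C /\
    V (th + 2 * PI) r = V th r /\ Vr (th + 2 * PI) r = Vr th r /\
    (forall eta, 0 < eta -> exists r', r - eta < r' < r /\ 0 < r' /\ V th r' <> 0)) ->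
  exists (V0 : R -> R -> R) (e0 : R), 0 < e0 <= eta /\
    inverse_integrating_factor (fun z => Rabs (fst z) < e0 /\ Rabs (snd z) < e0) P Q V0.
Proof.
  intros He Heta HV.
  assert (O := strip_open delta).
  destruct (Ck_periodic 1 delta A A_C2 A_per) as (At & Ar & HA & CAt & CAr & PAt & PAr).
  destruct (Ck_periodic 1 delta B B_C2 B_per) as (Bt & Br & HB & CBt & CBr & PBt & PBr).
  assert (Hd := proj1 delta_range).
  destruct (strip_bounded delta B Hd (Ck_0 _ _ _ B_C2) (fun th r _ => B_per th r)) as [MB [HMB BB]].
  destruct (strip_bounded delta Bt Hd (Ck_0 _ _ _ CBt) PBt) as [MBt [HMBt BBt]].
  destruct (strip_bounded delta Br Hd (Ck_0 _ _ _ CBr) PBr) as [MBr [HMBr BBr]].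
  destruct slope_regular as (Fr' & Frr' & L & HL & Hslope).
  set (nu := INR (S N)).
  assert (Hnu : 1 <= nu). { unfold nu. rewrite S_INR. assert (X := pos_INR N). lra. }
  (* [W] is the factor in polar coordinates. Its derivatives are r^k [wt] in th and r^(k-1) [wr] in
     r; in [wt] the th-derivative of V has been replaced by means of the transport equation. [X1]
     and [X2] are the partial derivatives in x and y, by the chain rule with the inverse Jacobian
     matrix. *)
  set (wt := fun th r => Bt th r * V th r + B th r * (Fr th r * V th r - slope th r * Vr th r)).
  set (wr := fun th r => INR k * (B th r * V th r) + r * (Br th r * V th r + B th r * Vr th r)).
  set (W := fun th r => r ^ k * (B th r * V th r)).
  set (X1 := fun th r => r ^ N * r * r ^ m * (wr th r * cos th - nu * wt th r * sin th) / jac th).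
  set (X2 := fun th r => r * r ^ m * (wr th r * sin th + wt th r * cos th) / jac th).
  assert (Hk : forall r, r ^ k = r ^ N * r * (r * r ^ m)).
  { intros r. unfold k. rewrite !pow_add. simpl. ring. }
  assert (Hrad : forall r, 0 < r < e -> Rabs r < delta /\ Rabs r <= delta / 2).
  { intros r Hr. rewrite Rabs_pos_eq; lra. }
  assert (W_diff : forall th r, 0 < r < e ->
     differentiable_pt_lim W th r (r ^ k * wt th r) (r ^ N * r * r ^ m * wr th r)).
  { intros th r Hr. destruct (HV th r Hr) as (_ & _ & _ & DV & _). destruct (Hrad r Hr) as [Hr1 Hr2].
    assert (Dp : is_derive (fun s => s ^ k) r (INR k * (r ^ N * r * r ^ m))).
    { evar_last. apply (is_derive_pow (fun s => s) k r 1). apply (is_derive_id (K := R_AbsRing)).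
      replace (Init.Nat.pred k) with (N + 1 + m)%nat by (unfold k; lia). rewrite !pow_add. simpl. ring. }
    apply differentiable_eq with (1 := differentiable_mult _ _ _ _ _ _ _ _
      (differentiable_comp1 (fun s => s ^ k) _ _ _ _ _ _ Dp (differentiable_snd th r))
      (differentiable_mult _ _ _ _ _ _ _ _ (HB th r Hr1) DV)); cbv beta.
    - unfold wt. ring.
    - unfold wr. rewrite Hk. ring. }
  assert (W_per : forall th r, 0 < r < e -> W (th + 2 * PI) r = W th r).
  { intros th r Hr. unfold W. rewrite B_per. destruct (HV th r Hr) as (_ & _ & _ & _ & _ & _ & _ & E & _).
    now rewrite E. }
  assert (W_per_Z : forall j th r, 0 < r < e -> W (th + 2 * PI * IZR j) r = W th r).
  { intros j th r Hr. apply (periodic_Z (fun th => W th r)). intros t. now apply W_per. }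
  assert (Hex : forall z : R * R, exists p : R * R, z <> (0, 0) ->
     0 < snd p /\ fst z = snd p * cos (fst p) /\ snd z = snd p ^ S N * sin (fst p)).
  { intros [x y]. destruct (classic ((x, y) <> (0, 0))) as [H|H].
    - destruct (polar_exists N x y H) as (r & th & H1 & H2 & H3). now exists (th, r).
    - exists (0, 0). tauto. }
  destruct (choice _ Hex) as [pol Hpol].
  set (V0 := fun x y => if excluded_middle_informative ((x, y) = (0, 0)) then 0
     else W (fst (pol (x, y))) (snd (pol (x, y)))).
  assert (V0_0 : V0 0 0 = 0).
  { unfold V0. destruct (excluded_middle_informative _) as [H|H]; trivial. now elim H. }
  assert (Hnz : forall th r, 0 < r -> (r * cos th, r ^ S N * sin th) <> (0, 0)).
  { intros th r Hr E. injection E as E1 E2. assert (X := sin2_cos2_pow th).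
    assert (Y := pow_lt r (S N) Hr).
    apply Rmult_integral in E1. apply Rmult_integral in E2.
    destruct E1 as [E1|E1]; [lra|]. destruct E2 as [E2|E2]; [simpl in *; lra|]. rewrite E1, E2 in X. lra. }
  assert (V0_polar : forall th r, 0 < r < e -> V0 (r * cos th) (r ^ S N * sin th) = W th r).
  { intros th r Hr. unfold V0. destruct (excluded_middle_informative _) as [H|H].
    - exfalso. now apply (Hnz th r (proj1 Hr)).
    - destruct (Hpol _ H) as (H1 & H2 & H3). cbn [fst snd] in H2, H3.
      destruct (polar_unique N _ _ _ _ (proj1 Hr) H1 H2 H3) as [E [j Ej]].
      rewrite <- E, Ej. now apply W_per_Z. }
  assert (V0_diff : forall th r, 0 < r < e ->
     differentiable_pt_lim V0 (r * cos th) (r ^ S N * sin th) (X1 th r) (X2 th r)).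
  { intros th r Hr. destruct (polar_chart N r th (proj1 Hr)) as (ang & rad & Ea & Er & Da & Dr & Hloc).
    fold (jac th) nu in Da, Dr.
    assert (Cr := differentiable_continuity _ _ _ _ _ Dr).
    assert (Lr0 : 0 < e - rad (r * cos th) (r ^ S N * sin th)) by (rewrite Er; lra).
    assert (Lr := locally_2d_pos _ _ _ (continuity_2d_pt_minus _ _ _ _ (continuity_2d_pt_const _ _ e) Cr) Lr0).
    apply differentiable_pt_lim_ext with (fun x y => W (ang x y) (rad x y)).
    { apply locally_2d_impl with (2 := locally_2d_and _ _ _ _ Hloc Lr). apply locally_2d_forall.
      intros x y [(R1 & R2 & R3) R4]. assert (E := V0_polar (ang x y) (rad x y) ltac:(lra)). now rewrite R2, R3 in E. }
    assert (DW : differentiable_pt_lim W (ang (r * cos th) (r ^ S N * sin th)) (rad (r * cos th) (r ^ S N * sin th))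
       (r ^ k * wt th r) (r ^ N * r * r ^ m * wr th r)) by (rewrite Ea, Er; now apply W_diff).
    assert (J1 := jac_ge_1 th). assert (PN := pow_lt r N (proj1 Hr)).
    apply differentiable_eq with (1 := differentiable_pt_lim_comp W ang rad _ _ _ _ _ _ _ _ DW Da Dr).
    - rewrite Hk. unfold X1. simpl pow. field. lra.
    - rewrite Hk. unfold X2. simpl pow. field. lra. }
  assert (X_cont : forall th r, 0 < r < e -> continuity_2d_pt X1 th r /\ continuity_2d_pt X2 th r).
  { intros th r Hr. destruct (Hrad r Hr) as [Hr1 Hr2].
    destruct (HV th r Hr) as (_ & _ & CFr & DV & CVr & _).
    assert (CV := differentiable_continuity _ _ _ _ _ DV).
    assert (CB := Ck_0 _ _ _ B_C2 th r Hr1). assert (CBt' := Ck_0 _ _ _ CBt th r Hr1).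
    assert (CBr' := Ck_0 _ _ _ CBr th r Hr1).
    destruct (Hslope th r Hr2) as (CF & _).
    assert (Cc : continuity_2d_pt (fun t _ => cos t) th r) by (apply (continuity_2d_pt_1 cos), continuous_cos).
    assert (Cs : continuity_2d_pt (fun t _ => sin t) th r) by (apply (continuity_2d_pt_1 sin), continuous_sin).
    assert (Cr := continuity_2d_pt_id2 th r).
    assert (Cp : forall j f, continuity_2d_pt f th r -> continuity_2d_pt (fun t s => f t s ^ j) th r).
    { intros j f Hf. induction j as [|j IH]; simpl. apply continuity_2d_pt_const. now apply continuity_2d_pt_mult. }
    assert (Cj : continuity_2d_pt (fun t _ => / jac t) th r).
    { apply (continuity_2d_pt_inv (fun t _ => jac t)). unfold jac. apply continuity_2d_pt_plus.
      now apply (Cp 2%nat (fun t _ => cos t)). apply continuity_2d_pt_mult. apply continuity_2d_pt_const.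
      now apply (Cp 2%nat (fun t _ => sin t)). assert (X := jac_ge_1 th). lra. }
    assert (Cwt : continuity_2d_pt wt th r).
    { apply continuity_2d_pt_plus. now apply continuity_2d_pt_mult. apply continuity_2d_pt_mult; trivial.
      apply continuity_2d_pt_minus; now apply continuity_2d_pt_mult. }
    assert (Cwr : continuity_2d_pt wr th r).
    { apply continuity_2d_pt_plus; apply continuity_2d_pt_mult; trivial. apply continuity_2d_pt_const.
      now apply continuity_2d_pt_mult. apply continuity_2d_pt_plus; now apply continuity_2d_pt_mult. }
    split; apply continuity_2d_pt_mult; trivial; apply continuity_2d_pt_mult.
    - repeat apply continuity_2d_pt_mult; trivial; now apply (Cp _ (fun _ s => s)).
    - apply continuity_2d_pt_minus; repeat apply continuity_2d_pt_mult; trivial. apply continuity_2d_pt_const.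
    - repeat apply continuity_2d_pt_mult; trivial; now apply (Cp _ (fun _ s => s)).
    - apply continuity_2d_pt_plus; apply continuity_2d_pt_mult; trivial. }
  assert (HC : 0 <= C).
  { destruct (HV 0 (e / 2) ltac:(lra)) as (_ & H & _). apply Rle_trans with (2 := H). apply Rabs_pos. }
  assert (Hsmall : forall r, 0 < r < e -> 0 < r < 1) by (intros r Hr; lra).
  set (K1 := MBt * C + MB * (C * C + L * C)).
  set (K2 := INR k * (MB * C) + (MBr * C + MB * C)).
  assert (HK1 : 0 <= K1).
  { unfold K1. assert (X1' := Rmult_le_pos _ _ (Rlt_le _ _ HMBt) HC). assert (X2' := Rmult_le_pos _ _ HC HC).
    assert (X3' := Rmult_le_pos _ _ (Rlt_le _ _ HL) HC).
    assert (X4' := Rmult_le_pos MB (C * C + L * C)). lra. }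
  assert (HK2 : 0 <= K2).
  { unfold K2. assert (X1' := Rmult_le_pos _ _ (Rlt_le _ _ HMBr) HC).
    assert (X2' := Rmult_le_pos _ _ (Rlt_le _ _ HMB) HC). assert (X3' := Rmult_le_pos _ _ (pos_INR k) X2'). lra. }
  assert (Hmul : forall a b a' b', Rabs a <= a' -> Rabs b <= b' -> Rabs (a * b) <= a' * b').
  { intros a b a' b' H1 H2. rewrite Rabs_mult. apply Rmult_le_compat; trivial; apply Rabs_pos. }
  assert (Hadd : forall a b a' b', Rabs a <= a' -> Rabs b <= b' -> Rabs (a + b) <= a' + b').
  { intros a b a' b' H1 H2. apply Rle_trans with (1 := Rabs_triang _ _). lra. }
  assert (Hsub : forall a b a' b', Rabs a <= a' -> Rabs b <= b' -> Rabs (a - b) <= a' + b').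
  { intros a b a' b' H1 H2. apply Hadd; trivial. now rewrite Rabs_Ropp. }
  assert (HcosB : forall t, Rabs (cos t) <= 1) by (intros t; apply Rabs_le; assert (X := COS_bound t); lra).
  assert (HsinB : forall t, Rabs (sin t) <= 1) by (intros t; apply Rabs_le; assert (X := SIN_bound t); lra).
  assert (Hbw : forall th r, 0 < r < e -> Rabs (wt th r) <= K1 /\ Rabs (wr th r) <= K2).
  { intros th r Hr. destruct (Hrad r Hr) as [Hr1 Hr2]. destruct (Hsmall r Hr) as [Hr3 Hr4].
    destruct (HV th r Hr) as (_ & BF & _ & _ & _ & BV & BVr & _).
    assert (B1 := BB th r Hr2). assert (B2 := BBt th r Hr2). assert (B3 := BBr th r Hr2).
    destruct (Hslope th r Hr2) as (_ & _ & _ & _ & _ & BS & _).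
    assert (BS' : Rabs (slope th r) <= L).
    { apply Rle_trans with (1 := BS). rewrite <- (Rmult_1_r L) at 2. apply Rmult_le_compat_l. lra.
      rewrite Rabs_pos_eq; lra. }
    assert (BV' : Rabs (B th r * V th r) <= MB * C) by now apply Hmul.
    split.
    - apply Hadd. now apply Hmul. apply Hmul; trivial. apply Hsub; now apply Hmul.
    - apply Hadd. apply Hmul; trivial. rewrite Rabs_pos_eq. lra. apply pos_INR.
      rewrite <- (Rmult_1_l (MBr * C + MB * C)). apply Hmul. rewrite Rabs_pos_eq; lra.
      apply Hadd; now apply Hmul. }
  set (K := K2 + nu * K1 + K1 + MB * C).
  assert (HK : K2 + nu * K1 <= K /\ K2 + K1 <= K /\ MB * C <= K /\ 0 <= K).
  { assert (Y1 := Rmult_le_pos _ _ (Rlt_le _ _ HMB) HC). assert (Y2 : 0 <= nu * K1) by (apply Rmult_le_pos; lra).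
    unfold K. lra. }
  assert (Hpow1 : forall r j, 0 < r < e -> 0 <= r ^ j <= 1).
  { intros r j Hr. split. apply pow_le; lra. rewrite <- (pow1 j). apply pow_incr; lra. }
  assert (Hjac : forall t, Rabs (/ jac t) <= 1).
  { intros t. assert (X := jac_ge_1 t). rewrite Rabs_pos_eq.
    - rewrite <- Rinv_1. apply Rinv_le_contravar; lra.
    - left. apply Rinv_0_lt_compat. lra. }
  assert (BX : forall th r, 0 < r < e -> Rabs (W th r) <= K * r ^ k /\ Rabs (X1 th r) <= K * r /\ Rabs (X2 th r) <= K * r).
  { intros th r Hr. destruct (Hbw th r Hr) as [H1 H2]. destruct (Hrad r Hr) as [Hr1 Hr2].
    destruct (Hpow1 r N Hr) as [P1 P2]. destruct (Hpow1 r m Hr) as [P3 P4].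
    destruct (HV th r Hr) as (_ & _ & _ & _ & _ & BV & _). assert (B1 := BB th r Hr2).
    split; [|split].
    - unfold W. rewrite Rmult_comm. apply Hmul.
      + apply Rle_trans with (MB * C). now apply Hmul. apply HK.
      + rewrite Rabs_pos_eq. lra. apply pow_le; lra.
    - unfold X1, Rdiv.
      apply Rle_trans with (1 * r * 1 * (K2 * 1 + nu * K1 * 1) * 1).
      + apply Hmul; [|apply Hjac]. apply Hmul.
        * repeat apply Hmul; rewrite Rabs_pos_eq; lra.
        * apply Hsub; repeat apply Hmul; trivial. rewrite Rabs_pos_eq; lra.
      + replace (1 * r * 1 * (K2 * 1 + nu * K1 * 1) * 1) with ((K2 + nu * K1) * r) by ring.
        apply Rmult_le_compat_r. lra. apply HK.
    - unfold X2, Rdiv.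
      apply Rle_trans with (r * 1 * (K2 * 1 + K1 * 1) * 1).
      + apply Hmul; [|apply Hjac]. apply Hmul.
        * repeat apply Hmul; rewrite Rabs_pos_eq; lra.
        * apply Hadd; apply Hmul; trivial.
      + replace (r * 1 * (K2 * 1 + K1 * 1) * 1) with ((K2 + K1) * r) by ring.
        apply Rmult_le_compat_r. lra. apply HK. }
  set (e0 := Rmin eta (Rmin (e / 2) (e ^ S N / 2))).
  assert (HeN := pow_lt e (S N) (proj1 He)).
  assert (He0 : 0 < e0) by (unfold e0; repeat apply Rmin_case; lra).
  assert (He0a : e0 <= e / 2) by (apply Rle_trans with (1 := Rmin_r _ _); apply Rmin_l).
  assert (He0b : e0 <= e ^ S N / 2) by (apply Rle_trans with (1 := Rmin_r _ _); apply Rmin_r).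
  assert (Hpolar : forall x y e1, 0 < e1 -> (x, y) <> (0, 0) -> Rabs x < e1 / 2 -> Rabs y < e1 ^ S N / 2 ->
     exists th r, 0 < r < e1 /\ x = r * cos th /\ y = r ^ S N * sin th).
  { intros x y e1 He1 Hxy Hx Hy. destruct (polar_exists N x y Hxy) as (r & th & H1 & H2 & H3).
    exists th, r. split; [split|split]; trivial. now apply (polar_small N e1 x y r th). }
  assert (HD0 : forall f : R -> R, f 0 = 0 -> 
     (forall eps, 0 < eps -> exists d, 0 < d /\ forall x, Rabs x < d -> Rabs (f x) <= eps * Rabs x) -> is_derive f 0 0).
  { intros f Hf H. apply is_derive_Reals. intros eps Heps.
    destruct (H (eps / 2) ltac:(lra)) as [d [Hd0 Hd1]]. exists (mkposreal d Hd0). simpl. intros h Hh Hhd.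
    rewrite Rplus_0_l, Hf, !Rminus_0_r. unfold Rdiv. rewrite Rabs_mult, Rabs_inv.
    assert (X := Rabs_pos_lt _ Hh). apply Rmult_lt_reg_r with (Rabs h); trivial.
    rewrite Rmult_assoc, Rinv_l, Rmult_1_r by lra. apply Rle_lt_trans with (1 := Hd1 h Hhd).
    apply Rmult_lt_compat_r; lra. }
  assert (Hsmall_eps : forall eps, 0 < eps -> exists e1, 0 < e1 < e /\ K * e1 <= eps).
  { intros eps Heps. exists (Rmin (e / 2) (eps / (K + 1))).
    assert (X : 0 < eps / (K + 1)) by (apply Rdiv_lt_0_compat; lra).
    split.
    - split. apply Rmin_case; lra. apply Rle_lt_trans with (1 := Rmin_l _ _). lra.
    - apply Rle_trans with (K * (eps / (K + 1))). apply Rmult_le_compat_l. apply HK. apply Rmin_r.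
      apply Rmult_le_reg_r with (K + 1). lra. replace (K * (eps / (K + 1)) * (K + 1)) with (K * eps) by (field; lra).
      nra. }
  assert (V0x0 : is_derive (fun u => V0 u 0) 0 0).
  { apply HD0; trivial. intros eps Heps. destruct (Hsmall_eps eps Heps) as [e1 [He1 HKe]].
    exists (e1 / 2). split. lra. intros x Hx.
    destruct (Req_dec x 0) as [->|Hx0]. rewrite V0_0, Rabs_R0. lra.
    destruct (Hpolar x 0 e1) as (th & r & Hr & Ex & Ey); trivial; try lra.
    { intros E. now injection E. }
    { rewrite Rabs_R0. assert (X := pow_lt e1 (S N) (proj1 He1)). lra. }
    assert (Hre : 0 < r < e) by lra.
    assert (Hs : sin th = 0).
    { assert (X := pow_lt r (S N) (proj1 Hr)). symmetry in Ey. apply Rmult_integral in Ey. destruct Ey; lra. }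
    assert (Hxr : Rabs x = r).
    { rewrite Ex, Rabs_mult, (Rabs_pos_eq r) by lra.
      assert (X := sin2_cos2_pow th). rewrite Hs in X. rewrite <- pow2_abs in X.
      assert (Y := Rabs_pos (cos th)). assert (Rabs (cos th) = 1) by nra. rewrite H; ring. }
    rewrite Hxr. rewrite Ex, Ey, V0_polar by trivial.
    apply Rle_trans with (1 := proj1 (BX th r Hre)).
    rewrite Hk. destruct (Hpow1 r N Hre), (Hpow1 r m Hre).
    apply Rle_trans with (K * r * r). 2: apply Rmult_le_compat_r; [lra|].
    - replace (K * (r ^ N * r * (r * r ^ m))) with ((r ^ N * r ^ m) * (K * r * r)) by ring.
      rewrite <- (Rmult_1_l (K * r * r)) at 2. apply Rmult_le_compat_r.
      apply Rmult_le_pos; [apply Rmult_le_pos; lra|lra]. nra.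
    - apply Rle_trans with (2 := HKe). apply Rmult_le_compat_l; lra. }
  (* On the y-axis |y| = r^(N+1), so k >= N + 2 is what makes V0 = O(r^k) negligible with respect to
     y. *)
  assert (V0y0 : is_derive (fun v => V0 0 v) 0 0).
  { apply HD0; trivial. intros eps Heps. destruct (Hsmall_eps eps Heps) as [e1 [He1 HKe]].
    exists (e1 ^ S N / 2). assert (HeN1 := pow_lt e1 (S N) (proj1 He1)). split. lra. intros y Hy.
    destruct (Req_dec y 0) as [->|Hy0]. rewrite V0_0, Rabs_R0. lra.
    destruct (Hpolar 0 y e1) as (th & r & Hr & Ex & Ey); trivial; try lra.
    { intros E. now injection E. }
    { rewrite Rabs_R0. lra. }
    assert (Hre : 0 < r < e) by lra.
    assert (Hc : cos th = 0).
    { symmetry in Ex. apply Rmult_integral in Ex. destruct Ex; lra. }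
    assert (HpS := pow_lt r (S N) (proj1 Hr)).
    assert (Hyr : Rabs y = r ^ N * r).
    { rewrite Ey, Rabs_mult, (Rabs_pos_eq (r ^ S N)) by lra.
      assert (X := sin2_cos2_pow th). rewrite Hc in X. rewrite <- (pow2_abs (sin th)) in X.
      assert (Y := Rabs_pos (sin th)). assert (Rabs (sin th) = 1) by nra. rewrite H; simpl; ring. }
    rewrite Hyr. rewrite Ex, Ey, V0_polar by trivial.
    apply Rle_trans with (1 := proj1 (BX th r Hre)).
    rewrite Hk. destruct (Hpow1 r N Hre), (Hpow1 r m Hre).
    replace (K * (r ^ N * r * (r * r ^ m))) with ((K * r * r ^ m) * (r ^ N * r)) by ring.
    apply Rmult_le_compat_r. apply Rmult_le_pos; lra.
    apply Rle_trans with (K * r * 1). apply Rmult_le_compat_l. apply Rmult_le_pos; lra. lra.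
    apply Rle_trans with (2 := HKe). rewrite Rmult_1_r. apply Rmult_le_compat_l; lra. }
  assert (V0_d : forall th r, 0 < r < e ->
     Defs.d1 V0 (r * cos th) (r ^ S N * sin th) = X1 th r /\ Defs.d2 V0 (r * cos th) (r ^ S N * sin th) = X2 th r).
  { intros th r Hr. destruct (differentiable_is_derive _ _ _ _ _ (V0_diff th r Hr)) as [D1 D2].
    split; now apply is_derive_unique. }
  assert (V0_d0 : Defs.d1 V0 0 0 = 0 /\ Defs.d2 V0 0 0 = 0).
  { split; now apply is_derive_unique. }
  assert (HdS : forall x y, Rabs x < e0 -> Rabs y < e0 -> (x, y) <> (0, 0) ->
     exists th r, 0 < r < e /\ x = r * cos th /\ y = r ^ S N * sin th).
  { intros x y Hx Hy Hxy. apply Hpolar; trivial; lra. }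
  assert (Hcont0 : forall f X : R -> R -> R, f 0 0 = 0 ->
     (forall th r, 0 < r < e -> f (r * cos th) (r ^ S N * sin th) = X th r /\ Rabs (X th r) <= K * r) ->
     continuity_2d_pt f 0 0).
  { intros f X Hf0 HfX eps. destruct (Hsmall_eps (eps / 2)) as [e1 [He1 HKe]]. destruct eps; simpl; lra.
    assert (HeN1 := pow_lt e1 (S N) (proj1 He1)).
    assert (Hm : 0 < Rmin (e1 / 2) (e1 ^ S N / 2)) by (apply Rmin_case; lra).
    exists (mkposreal _ Hm). simpl. intros x y Hx Hy. rewrite Rminus_0_r in Hx, Hy.
    rewrite Hf0, Rminus_0_r.
    destruct (classic ((x, y) = (0, 0))) as [E|Hxy].
    { injection E as -> ->. rewrite Hf0, Rabs_R0. apply cond_pos. }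
    destruct (Hpolar x y e1) as (th & r & Hr & -> & ->); trivial; try lra.
    { apply Rlt_le_trans with (1 := Hx). apply Rmin_l. }
    { apply Rlt_le_trans with (1 := Hy). apply Rmin_r. }
    destruct (HfX th r ltac:(lra)) as [-> HX]. apply Rle_lt_trans with (1 := HX).
    apply Rle_lt_trans with (K * e1). apply Rmult_le_compat_l; lra.
    destruct eps as [ep Hep]; simpl in *; lra. }
  assert (Hcont1 : forall f X : R -> R -> R, 
     (forall th r, 0 < r < e -> f (r * cos th) (r ^ S N * sin th) = X th r) ->
     (forall th r, 0 < r < e -> continuity_2d_pt X th r) ->
     forall th r, 0 < r < e -> continuity_2d_pt f (r * cos th) (r ^ S N * sin th)).
  { intros f X HfX HX th r Hr.
    destruct (polar_chart N r th (proj1 Hr)) as (ang & rad & Ea & Er & Da & Dr & Hloc).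
    assert (Ca := differentiable_continuity _ _ _ _ _ Da).
    assert (Cr := differentiable_continuity _ _ _ _ _ Dr).
    assert (Lr0 : 0 < e - rad (r * cos th) (r ^ S N * sin th)) by (rewrite Er; lra).
    assert (Lr := locally_2d_pos _ _ _ (continuity_2d_pt_minus _ _ _ _ (continuity_2d_pt_const _ _ e) Cr) Lr0).
    apply continuity_2d_pt_ext_loc with (fun x y => X (ang x y) (rad x y)).
    { apply locally_2d_impl with (2 := locally_2d_and _ _ _ _ Hloc Lr). apply locally_2d_forall.
      intros x y [(R1 & R2 & R3) R4]. assert (E := HfX (ang x y) (rad x y) ltac:(lra)). now rewrite R2, R3 in E. }
    apply (continuity_2d_pt_comp X ang rad); trivial. rewrite Ea, Er. now apply HX. }
  exists V0, e0. split. { split; trivial. apply Rmin_l. }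
  split; [|split].
  - intros x y [Hx Hy]. simpl in Hx, Hy.
    destruct (classic ((x, y) = (0, 0))) as [E|Hxy].
    + injection E as -> ->. split; [|split; [|split]].
      * now exists 0.
      * now exists 0.
      * apply Hcont0 with X1. apply V0_d0. intros th r Hr. split. now apply V0_d. now apply BX.
      * apply Hcont0 with X2. apply V0_d0. intros th r Hr. split. now apply V0_d. now apply BX.
    + destruct (HdS x y Hx Hy Hxy) as (th & r & Hr & -> & ->).
      destruct (differentiable_is_derive _ _ _ _ _ (V0_diff th r Hr)) as [D1 D2].
      split; [|split; [|split]].
      * eexists; exact D1.
      * eexists; exact D2.
      * apply Hcont1 with X1; trivial. intros t s Hs. now apply V0_d. intros t s Hs. now apply X_cont.
      * apply Hcont1 with X2; trivial. intros t s Hs. now apply V0_d. intros t s Hs. now apply X_cont.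
  (* Any non-empty open set contains a point other than the origin; along the curve of constant th
     through it there are points arbitrarily close to it where V is non-zero. *)
  - intros Wo HWo [[x0 y0] Hz0] HWU.
    assert (Hne : exists x y, Wo (x, y) /\ (x, y) <> (0, 0)).
    { destruct (classic ((x0, y0) = (0, 0))) as [E|H].
      - injection E as -> ->. destruct (HWo (0, 0) Hz0) as [d Hd0].
        exists (d / 2), 0. split.
        + apply Hd0. split; simpl.
          * change (Rabs (d / 2 - 0) < d). rewrite Rminus_0_r, Rabs_pos_eq; destruct d; simpl; lra.
          * change (Rabs (0 - 0) < d). rewrite Rminus_diag, Rabs_R0. apply cond_pos.
        + intros E. injection E as E. destruct d; simpl in *; lra.
      - now exists x0, y0. }
    destruct Hne as (x & y & HW & Hxy).
    destruct (HWU _ HW) as [Hx Hy]. simpl in Hx, Hy.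
    destruct (HdS x y Hx Hy Hxy) as (th & r & Hr & -> & ->).
    destruct (HWo _ HW) as [d0 Hd0].
    assert (C1 : continuous (fun s => s * cos th) r).
    { apply (ex_derive_continuous (V := R_NormedModule)). auto_derive; trivial. }
    assert (C2 : continuous (fun s => s ^ S N * sin th) r).
    { apply (ex_derive_continuous (V := R_NormedModule)). auto_derive; trivial. }
    assert (F1 : locally r (fun s => ball (r * cos th) d0 (s * cos th))) by (apply (C1 (ball _ d0)), locally_ball).
    assert (F2 : locally r (fun s => ball (r ^ S N * sin th) d0 (s ^ S N * sin th)))
      by (apply (C2 (ball _ d0)), locally_ball).
    destruct (filter_and _ _ F1 F2) as [d Hdd].
    destruct (HV th r Hr) as (_ & _ & _ & _ & _ & _ & _ & _ & _ & Hden).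
    destruct (Hden d (cond_pos d)) as (r' & Hr' & Hr'0 & HVn).
    exists (r' * cos th), (r' ^ S N * sin th). split.
    + destruct (Hdd r') as [H1 H2]. change (Rabs (r' - r) < d). rewrite Rabs_left; lra.
      apply Hd0. now split.
    + rewrite V0_polar by lra. unfold W.
      apply Rmult_integral_contrapositive_currified. apply pow_nonzero. lra.
      apply Rmult_integral_contrapositive_currified; trivial. apply B_neq_0. rewrite Rabs_pos_eq; lra.
  - intros x y [Hx Hy]. simpl in Hx, Hy.
    destruct (classic ((x, y) = (0, 0))) as [E|Hxy].
    { injection E as -> ->. destruct V0_d0 as [-> ->]. rewrite V0_0. ring. }
    destruct (HdS x y Hx Hy Hxy) as (th & r & Hr & Ex & Ey).
    assert (He0d : e0 < delta) by lra.
    destruct (differentiable_is_derive _ _ _ _ _ (P_diff x y ltac:(lra) ltac:(lra))) as [DPx _].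
    destruct (differentiable_is_derive _ _ _ _ _ (Q_diff x y ltac:(lra) ltac:(lra))) as [_ DQy].
    replace (Defs.d1 P x y) with (Px x y) by (symmetry; now apply is_derive_unique).
    replace (Defs.d2 Q x y) with (Qy x y) by (symmetry; now apply is_derive_unique).
    assert (Hrd : 0 < r < delta) by lra. destruct (Hrad r Hr) as [Hr1 Hr2].
    assert (Ediv := divergence_identity At Ar Bt Br th r HA HB Hrd).
    cbv zeta in Ediv. rewrite <- Ex, <- Ey in Ediv. fold (jac th) in Ediv.
    assert (Ea := angular_part th r Hrd). assert (Eb := radial_part th r Hrd).
    rewrite <- Ex, <- Ey in Ea, Eb. fold nu in Ea.
    assert (Ed1 : Defs.d1 V0 x y = X1 th r) by (rewrite Ex, Ey; now apply V0_d).
    assert (Ed2 : Defs.d2 V0 x y = X2 th r) by (rewrite Ex, Ey; now apply V0_d).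
    assert (EV : V0 x y = W th r) by (rewrite Ex, Ey; now apply V0_polar).
    rewrite Ed1, Ed2, EV.
    assert (EFr : Fr th r = A th r / B th r + r * ((Ar th r * B th r - A th r * Br th r) / B th r ^ 2)).
    { destruct (HV th r Hr) as (DF & _). apply is_derive_unique in DF. rewrite <- DF. apply is_derive_unique.
      unfold slope. assert (HBn := B_neq_0 th r Hr1).
      destruct (differentiable_is_derive _ _ _ _ _ (HA th r Hr1)) as [_ DA].
      destruct (differentiable_is_derive _ _ _ _ _ (HB th r Hr1)) as [_ DB].
      evar_last.
      - apply (is_derive_mult (fun s => s) (fun s => A th s / B th s)).
        + apply (is_derive_id (K := R_AbsRing)).
        + apply (is_derive_div (A th) (B th)); trivial. exact DA. exact DB.
        + intros; apply Rmult_comm.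
      - unfold plus, mult, one; simpl. field. trivial. }
    assert (HBn := B_neq_0 th r Hr1).
    assert (J1 := jac_ge_1 th). assert (PN := pow_lt r N (proj1 Hr)).
    assert (Eb' : r ^ N * cos th * P x y + sin th * Q x y = r ^ k * A th r).
    { apply Rmult_eq_reg_l with r. 2: lra. transitivity (r ^ S k * A th r).
      - rewrite <- Eb. change (r ^ S N) with (r * r ^ N). ring.
      - change (r ^ S k) with (r * r ^ k). ring. }
    (* The derivative along the field in polar form. The two brackets are r^k A and r^k B; since
       [slope] = r A / B the terms in Vr cancel, and the rest is V B times the left-hand side of
       [Ediv]. *)
    transitivity (r * r ^ m / jac th * (wr th r * (r ^ N * cos th * P x y + sin th * Q x y)
      + wt th r * (cos th * Q x y - nu * r ^ N * sin th * P x y))).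
    { unfold X1, X2. field. lra. }
    rewrite Ea, Eb'.
    transitivity (r ^ k / jac th * (V th r * B th r) * (r * r ^ m * (Bt th r + INR (S k) * A th r + r * Ar th r))).
    { unfold wr, wt, slope. rewrite EFr, S_INR. field. split; trivial. lra. }
    rewrite Ediv. unfold W. field. lra.
Qed.

(** The inverse is chosen by the intermediate value theorem and is continuous by monotonicity. Its
    derivative comes from the two-dimensional inverse lemma, with a second coordinate that is left
    fixed. *)
Lemma inverse_reparametrization (s s' : R -> R) (a t1 : R) :
  (forall t, a < t -> is_derive s t (s' t)) -> (forall t, a < t -> 0 < s' t) ->
  (forall M, exists t, a < t /\ M < s t) -> a < t1 ->
  (forall t t', a < t -> t < t' -> s t < s t') /\
  exists g : R -> R, forall y, s t1 < y -> t1 < g y /\ s (g y) = y /\ is_derive g y (/ s' (g y)).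
Proof.
  intros Hs Hs' Hinf Ht1.
  assert (Hmono : forall t t', a < t -> t < t' -> s t < s t').
  { intros t t' Ht Htt'.
    destruct (MVT_gen s t t' s') as [c [Hc E]]; cbv zeta in *; rewrite Rmin_left, Rmax_right in * by lra.
    - intros x Hx. apply Hs; lra.
    - intros x Hx. apply continuity_pt_filterlim. apply is_derive_cont with (s' x). apply Hs; lra.
    - assert (X := Hs' c ltac:(lra)). nra. }
  split; trivial.
  assert (Hex : forall y, exists t, s t1 < y -> t1 < t /\ s t = y).
  { intros y. destruct (Rlt_dec (s t1) y) as [Hy|Hy]. 2: exists 0; tauto.
    destruct (Hinf y) as [t2 [Ht2 Hy2]].
    assert (H12 : t1 < t2).
    { destruct (Rlt_dec t1 t2) as [X|X]; trivial. exfalso.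
      destruct (Req_dec t1 t2) as [->|Y]. lra. assert (Z := Hmono t2 t1 Ht2 ltac:(lra)). lra. }
    destruct (Ranalysis5.IVT_interv (fun t => s t - y) t1 t2) as [t [Ht Et]]; try lra.
    - intros t Ht. apply continuity_pt_minus. 2: apply continuity_pt_const; now intros ? ?.
      apply continuity_pt_filterlim. apply is_derive_cont with (s' t). apply Hs; lra.
    - exists t. intros _. split. 2: lra. destruct (Req_dec t t1) as [->|X]; lra. }
  destruct (choice _ Hex) as [g Hg]. exists g. intros y Hy.
  destruct (Hg y Hy) as [H1 H2]. split; trivial. split; trivial.
  assert (Hc : continuity_2d_pt (fun u _ => g u) y 0).
  { intros eps. set (e := Rmin eps ((g y - t1) / 2)).
    assert (He : 0 < e) by (apply Rmin_case; [apply cond_pos|lra]).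
    assert (He1 : e <= eps) by apply Rmin_l. assert (He2 : e <= (g y - t1) / 2) by apply Rmin_r.
    assert (A1 := Hmono (g y - e) (g y) ltac:(lra) ltac:(lra)).
    assert (A2 := Hmono (g y) (g y + e) ltac:(lra) ltac:(lra)).
    assert (A0 := Hmono t1 (g y - e) ltac:(lra) ltac:(lra)).
    assert (Hd : 0 < Rmin (y - s (g y - e)) (s (g y + e) - y)) by (apply Rmin_case; lra).
    exists (mkposreal _ Hd). simpl. intros u _ Hu _.
    assert (B1 := Rabs_def2 _ _ (Rlt_le_trans _ _ _ Hu (Rmin_l _ _))).
    assert (B2 := Rabs_def2 _ _ (Rlt_le_trans _ _ _ Hu (Rmin_r _ _))).
    destruct (Hg u ltac:(lra)) as [C1 C2].
    apply Rabs_def1.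
    - apply Rlt_le_trans with e; trivial. apply Rnot_le_lt. intros X.
      destruct (Req_dec (g u) (g y + e)) as [Y|Y]. rewrite <- Y in B2; lra.
      assert (Z := Hmono (g y + e) (g u) ltac:(lra) ltac:(lra)). lra.
    - apply Rle_lt_trans with (- e). lra. apply Rnot_le_lt. intros X.
      destruct (Req_dec (g u) (g y - e)) as [Y|Y]. rewrite <- Y in B1; lra.
      assert (Z := Hmono (g u) (g y - e) ltac:(lra) ltac:(lra)). lra. }
  assert (Hsp := Hs' (g y) ltac:(lra)).
  destruct (differentiable_inverse (fun u _ => s u) (fun _ v => v) (fun u _ => g u) (fun _ v => v) y 0
     (s' (g y)) 0 0 1) as [D _]; trivial.
  - apply (differentiable_pt_lim_proj1_0 s). apply is_derive_Reals. apply Hs. lra.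
  - apply differentiable_snd.
  - lra.
  - apply continuity_2d_pt_id2.
  - assert (Hd : 0 < y - s t1) by lra. exists (mkposreal _ Hd). simpl. intros u v Hu _.
    split; trivial. apply Hg. apply Rabs_def2 in Hu. lra.
  - destruct (differentiable_is_derive _ _ _ _ _ D) as [D1 _].
    evar_last. exact D1. field. lra.
Qed.

(** The angle must be differentiable and adapted to the weights, so it is constructed anew: the
    weighted cosine u and sine w satisfy u' = - w om and w' = u om, and the angle is a primitive of
    om. The angular velocity om is r^k B over the Jacobian, up to sign, and vanishes nowhere because
    B does not. *)
Lemma orbit_angle (sg : R) (x y : R -> R) (t0 : R) :
  sg = 1 \/ sg = -1 ->
  (forall t, t0 < t -> (x t, y t) <> (0, 0) /\ Rabs (x t) < delta / 2 / 2 /\ Rabs (y t) < (delta / 2) ^ S N / 2 /\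
     is_derive x t (sg * P (x t) (y t)) /\ is_derive y t (sg * Q (x t) (y t))) ->
  exists r th om : R -> R, forall t, t0 < t ->
    0 < r t < delta / 2 /\ x t = r t * cos (th t) /\ y t = r t ^ S N * sin (th t) /\
    om t <> 0 /\ continuous om t /\ is_derive th t (om t) /\
    is_derive r t (slope (th t) (r t) * om t).
Proof.
  intros Hsg Hxy.
  set (nu := INR (S N)).
  assert (Hnu : 1 <= nu). { unfold nu. rewrite S_INR. assert (X := pos_INR N). lra. }
  assert (Hex : forall z : R * R, exists r, z <> (0, 0) -> 0 < r /\ (fst z / r) ^ 2 + (snd z / r ^ S N) ^ 2 = 1).
  { intros [u v]. destruct (classic ((u, v) <> (0, 0))) as [H|H].
    - destruct (polar_exists N u v H) as (r & th & Hr & Hx & Hy). exists r. intros _. split; trivial.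
      cbn [fst snd]. rewrite Hx, Hy. now apply polar_norm_1.
    - exists 0. tauto. }
  destruct (choice _ Hex) as [rad Hrad].
  set (r := fun t => rad (x t, y t)).
  assert (Hpol : forall t, t0 < t -> exists th, 0 < r t /\ x t = r t * cos th /\ y t = r t ^ S N * sin th).
  { intros t Ht. destruct (Hxy t Ht) as (Hn & _). destruct (Hrad _ Hn) as [H1 H2].
    destruct (angle_exists _ _ H2) as [th [Hc Hs]]. exists th. fold (r t) in *. split; trivial.
    assert (X := pow_lt _ (S N) H1). cbn [fst snd] in Hc, Hs. rewrite Hc, Hs. split; field; lra. }
  assert (Hdel : 0 < delta / 2) by lra.
  assert (Hr : forall t, t0 < t -> 0 < r t < delta / 2).
  { intros t Ht. destruct (Hpol t Ht) as (th & H1 & H2 & H3). split; trivial.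
    destruct (Hxy t Ht) as (_ & B1 & B2 & _).
    now apply (polar_small N (delta / 2) (x t) (y t) (r t) th). }
  set (u := fun t => x t / r t). set (w := fun t => y t / r t ^ S N).
  set (j := fun t => u t ^ 2 + nu * w t ^ 2).
  set (om := fun t => sg * (u t * Q (x t) (y t) - nu * r t ^ N * w t * P (x t) (y t)) / (r t ^ S N * j t)).
  set (rd := fun t => sg * (r t ^ S N * u t * P (x t) (y t) + r t * w t * Q (x t) (y t)) / (r t ^ S N * j t)).
  assert (Huw : forall t, t0 < t -> u t ^ 2 + w t ^ 2 = 1 /\ x t = r t * u t /\ y t = r t ^ S N * w t /\ 1 <= j t).
  { intros t Ht. destruct (Hxy t Ht) as (Hn & _). destruct (Hrad _ Hn) as [H1 H2]. fold (r t) in *.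
    cbn [fst snd] in H2. fold (u t) (w t) in H2. assert (X := pow_lt _ (S N) H1).
    split; trivial. split; [|split]. unfold u; field; lra. unfold w; field; lra.
    unfold j. assert (Y := pow2_ge_0 (w t)). nra. }
  assert (Hrd : forall t, t0 < t -> is_derive r t (rd t)).
  { intros t Ht. destruct (Hpol t Ht) as (th & H1 & H2 & H3).
    destruct (Huw t Ht) as (_ & Hu & Hw & Hj).
    destruct (Hxy t Ht) as (_ & _ & _ & Dx & Dy).
    destruct (polar_chart N (r t) th H1) as (ang & rd0 & Ea & Er & _ & Dr & Hloc).
    assert (X := pow_lt _ (S N) H1).
    assert (Hc : cos th = u t) by (unfold u; rewrite H2; field; lra).
    assert (Hs : sin th = w t) by (unfold w; rewrite H3; field; lra).
    rewrite <- H2, <- H3 in Dr, Hloc. rewrite Hc, Hs in Dr. fold nu in Dr. fold (j t) in Dr.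
    apply (is_derive_ext_loc (fun t => rd0 (x t) (y t))).
    - assert (Cx := is_derive_cont _ _ _ Dx). assert (Cy := is_derive_cont _ _ _ Dy).
      destruct Hloc as [d Hd].
      assert (F1 : locally t (fun s => ball (x t) d (x s))) by (apply (Cx (ball _ d)), locally_ball).
      assert (F2 : locally t (fun s => ball (y t) d (y s))) by (apply (Cy (ball _ d)), locally_ball).
      assert (F3 : locally t (fun s => t0 < s)) by now apply (open_gt t0).
      generalize (filter_and _ _ F1 (filter_and _ _ F2 F3)). apply filter_imp. intros s [B1 [B2 B3]].
      destruct (Hd _ _ B1 B2) as (G1 & G2 & G3).
      destruct (Hpol s B3) as (th2 & K1 & K2 & K3).
      destruct (polar_unique N (rd0 (x s) (y s)) (r s) (ang (x s) (y s)) th2 G1 K1) as [E _]; congruence.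
    - evar_last. apply (is_derive_comp_2d rd0 x y t _ _ _ _ Dr Dx Dy). unfold rd. field.
      split; lra. }
  assert (Hpowr : forall t i, t0 < t -> is_derive (fun t => r t ^ S i) t (INR (S i) * rd t * r t ^ i)).
  { intros t i Ht. apply (is_derive_pow r (S i) t (rd t)). auto. }
  assert (Hud : forall t, t0 < t -> is_derive u t (- w t * om t)).
  { intros t Ht. destruct (Huw t Ht) as (E1 & Hu & Hw & Hj). destruct (Hr t Ht) as [Hr1 _].
    destruct (Hxy t Ht) as (_ & _ & _ & Dx & Dy). assert (PN := pow_lt _ N Hr1).
    evar_last. apply (is_derive_div x r t _ _ Dx (Hrd t Ht)). lra.
    unfold rd, om. simpl pow.
    apply Rmult_eq_reg_r with (r t * r t ^ N * j t). 2: { apply Rgt_not_eq. repeat apply Rmult_lt_0_compat; lra. }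
    set (Pv := P (x t) (y t)). set (Qv := Q (x t) (y t)).
    rewrite Hu.
    transitivity (sg * (r t ^ N * j t * Pv - u t * (r t ^ N * u t * Pv + w t * Qv))).
    - field. repeat split; lra.
    - unfold j. transitivity (sg * (nu * w t ^ 2 * r t ^ N * Pv - u t * w t * Qv)). ring. field.
      repeat split; try lra. unfold j in Hj. simpl in Hj. lra. }
  assert (Hwd : forall t, t0 < t -> is_derive w t (u t * om t)).
  { intros t Ht. destruct (Huw t Ht) as (E1 & Hu & Hw & Hj). destruct (Hr t Ht) as [Hr1 _].
    destruct (Hxy t Ht) as (_ & _ & _ & Dx & Dy). assert (PN := pow_lt _ N Hr1).
    evar_last. apply (is_derive_div y (fun t => r t ^ S N) t _ _ Dy (Hpowr t N Ht)).
    apply pow_nonzero; lra.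
    fold nu. unfold rd, om. simpl pow.
    apply Rmult_eq_reg_r with (r t * r t ^ N * j t). 2: { apply Rgt_not_eq. repeat apply Rmult_lt_0_compat; lra. }
    set (Pv := P (x t) (y t)). set (Qv := Q (x t) (y t)).
    rewrite Hw. change (r t ^ S N) with (r t * r t ^ N).
    transitivity (sg * (j t * Qv - nu * w t * (r t ^ N * u t * Pv + w t * Qv))).
    - field. repeat split; lra.
    - unfold j. transitivity (sg * (u t ^ 2 * Qv - nu * w t * u t * r t ^ N * Pv)). ring. field.
      repeat split; try lra. unfold j in Hj. simpl in Hj. lra. }
  assert (Hbox : forall t, t0 < t -> Rabs (x t) < delta /\ Rabs (y t) < delta).
  { intros t Ht. destruct (Hxy t Ht) as (_ & B1 & B2 & _). split. lra.
    apply Rlt_le_trans with (1 := B2). assert (X : (delta / 2) ^ N <= 1).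
    { rewrite <- (pow1 N). apply pow_incr; lra. }
    assert (Y : 0 < (delta / 2) ^ N) by (apply pow_lt; lra). simpl. nra. }
  assert (Hom : forall t, t0 < t -> continuous om t).
  { intros t Ht. destruct (Huw t Ht) as (E1 & Hu & Hw & Hj). destruct (Hr t Ht) as [Hr1 _].
    destruct (Hxy t Ht) as (_ & _ & _ & Dx & Dy). destruct (Hbox t Ht) as [B1 B2].
    assert (Cx := is_derive_cont _ _ _ Dx). assert (Cy := is_derive_cont _ _ _ Dy).
    assert (Cu := is_derive_cont _ _ _ (Hud t Ht)). assert (Cw := is_derive_cont _ _ _ (Hwd t Ht)).
    assert (Cr := is_derive_cont _ _ _ (Hrd t Ht)).
    assert (CP : continuous (fun t => P (x t) (y t)) t).
    { apply (continuous_2d_comp P x y); trivial. apply differentiable_continuity with (1 := P_diff _ _ B1 B2). }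
    assert (CQ : continuous (fun t => Q (x t) (y t)) t).
    { apply (continuous_2d_comp Q x y); trivial. apply differentiable_continuity with (1 := Q_diff _ _ B1 B2). }
    assert (Cm : forall f g : R -> R, continuous f t -> continuous g t -> continuous (fun t => f t * g t) t).
    { intros f g. apply (continuous_mult f g). }
    assert (Cp : forall i f, continuous f t -> continuous (fun t => f t ^ i) t).
    { intros i f Hf. induction i as [|i IH]; simpl. apply continuous_const. now apply Cm. }
    unfold om, Rdiv. apply Cm; [apply (Cm (fun _ => sg))|].
    - apply continuous_const.
    - apply (continuous_minus (fun t => u t * Q (x t) (y t)) (fun t => nu * r t ^ N * w t * P (x t) (y t))).
      + now apply Cm.
      + apply (Cm (fun t => nu * r t ^ N * w t)); trivial. apply (Cm (fun t => nu * r t ^ N)); trivial.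
        apply (Cm (fun _ => nu)). apply continuous_const. auto.
    - assert (C0 : continuous (fun t => r t ^ S N * j t) t).
      { apply Cm. auto. unfold j. apply (continuous_plus (fun t => u t ^ 2) (fun t => nu * w t ^ 2)); auto.
        apply (Cm (fun _ => nu)); auto. apply continuous_const. }
      apply (continuous_comp (fun t => r t ^ S N * j t) Rinv); trivial.
      apply continuous_Rinv. apply Rgt_not_eq. apply Rmult_lt_0_compat; [apply pow_lt|]; lra. }
  set (t1 := t0 + 1).
  destruct (Huw t1 ltac:(unfold t1; lra)) as (E1 & _).
  destruct (angle_exists _ _ E1) as [th1 [Hc1 Hs1]].
  set (th := fun t => th1 + RInt om t1 t).
  assert (Hthd : forall t, t0 < t -> is_derive th t (om t)).
  { intros t Ht. unfold th. evar_last.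
    - apply (is_derive_plus (fun _ => th1) (fun t => RInt om t1 t)). apply (is_derive_const th1).
      apply (is_derive_RInt om (fun t => RInt om t1 t) t1 t); auto.
      assert (F3 : locally t (fun s => t0 < s)) by now apply (open_gt t0).
      revert F3. apply filter_imp. intros s Hs. apply (RInt_correct (V := R_CompleteNormedModule)).
      apply (ex_RInt_continuous (V := R_CompleteNormedModule)). intros z [Hz _]. apply Hom.
      apply Rlt_le_trans with (2 := Hz). apply Rmin_case; unfold t1; lra.
    - unfold plus, zero; simpl. ring. }
  (* [p] and [q] are the cosine and the sine of the difference between the true angle and the
     primitive. Both are constant, equal to 1 and 0 at t1. *)
  set (p := fun t => u t * cos (th t) + w t * sin (th t)).
  set (q := fun t => w t * cos (th t) - u t * sin (th t)).
  assert (Dc : forall t, t0 < t -> is_derive (fun t => cos (th t)) t (- sin (th t) * om t)).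
  { intros t Ht. evar_last. apply (is_derive_comp cos th). apply is_derive_cos. apply Hthd; trivial.
    unfold scal; simpl; unfold mult; simpl. ring. }
  assert (Ds : forall t, t0 < t -> is_derive (fun t => sin (th t)) t (cos (th t) * om t)).
  { intros t Ht. evar_last. apply (is_derive_comp sin th). apply is_derive_sin. apply Hthd; trivial.
    unfold scal; simpl; unfold mult; simpl. ring. }
  assert (Hprod : forall f g f' g' t, is_derive f t f' -> is_derive g t g' -> is_derive (fun t : R => f t * g t) t (f' * g t + f t * g')).
  { intros f g f' g' t Hf Hg. apply (is_derive_mult f g); trivial. intros; apply Rmult_comm. }
  assert (Dp : forall t, t0 < t -> is_derive p t 0).
  { intros t Ht. evar_last.
    - apply (is_derive_plus (fun t => u t * cos (th t)) (fun t => w t * sin (th t))); apply Hprod; auto.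
    - unfold plus; simpl. ring. }
  assert (Dq : forall t, t0 < t -> is_derive q t 0).
  { intros t Ht. evar_last.
    - apply (is_derive_minus (fun t => w t * cos (th t)) (fun t => u t * sin (th t))); apply Hprod; auto.
    - unfold minus, plus, opp; simpl. ring. }
  assert (Hconst : forall f : R -> R, (forall t, t0 < t -> is_derive f t 0) -> forall t, t0 < t -> f t = f t1).
  { intros f Hf t Ht. 
    assert (A0 : Rabs (f t - f t1) <= 0 * Rabs (t - t1)).
    { apply (derive_lipschitz f (fun _ => 0) 0 t0 (Rmax t t1 + 1)).
      - intros z Hz. apply Hf; lra.
      - intros z _. rewrite Rabs_R0; lra.
      - assert (X := Rmax_l t t1). lra.
      - assert (X := Rmax_r t t1). unfold t1 in *; lra. }
    assert (X := Rabs_pos (f t - f t1)). rewrite Rmult_0_l in A0. apply Rabs_le_between in A0. lra. }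
  assert (Hth1 : th t1 = th1).
  { unfold th. rewrite (RInt_point (V := R_CompleteNormedModule)). apply Rplus_0_r. }
  assert (Hp1 : p t1 = 1). { unfold p. rewrite Hth1, Hc1, Hs1. simpl in E1. lra. }
  assert (Hq1 : q t1 = 0). { unfold q. rewrite Hth1, Hc1, Hs1. ring. }
  assert (Hcs : forall t, t0 < t -> cos (th t) = u t /\ sin (th t) = w t).
  { intros t Ht. assert (A1 := Hconst p Dp t Ht). assert (A2 := Hconst q Dq t Ht).
    rewrite Hp1 in A1. rewrite Hq1 in A2. unfold p in A1. unfold q in A2.
    assert (A3 := sin2_cos2_pow (th t)).
    split.
    - transitivity (u t * (cos (th t) ^ 2 + sin (th t) ^ 2)); [|rewrite A3; ring].
      transitivity ((u t * cos (th t) + w t * sin (th t)) * cos (th t) - (w t * cos (th t) - u t * sin (th t)) * sin (th t)).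
      rewrite A1, A2; ring. ring.
    - transitivity (w t * (cos (th t) ^ 2 + sin (th t) ^ 2)); [|rewrite A3; ring].
      transitivity ((u t * cos (th t) + w t * sin (th t)) * sin (th t) + (w t * cos (th t) - u t * sin (th t)) * cos (th t)).
      rewrite A1, A2; ring. ring. }
  exists r, th, om. intros t Ht.
  destruct (Hcs t Ht) as [Hc Hs]. destruct (Huw t Ht) as (E & Hu & Hw & Hj).
  assert (Hrt := Hr t Ht). assert (PN := pow_lt _ N (proj1 Hrt)). assert (PSN := pow_lt _ (S N) (proj1 Hrt)).
  assert (Hrd2 : 0 < r t < delta) by lra.
  assert (Ea := angular_part (th t) (r t) Hrd2). assert (Eb := radial_part (th t) (r t) Hrd2).
  rewrite Hc, Hs, <- Hu, <- Hw in Ea, Eb. fold nu in Ea.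
  assert (HBn := B_neq_0 (th t) (r t) ltac:(rewrite Rabs_pos_eq; lra)).
  assert (Eom : om t = sg * (r t ^ k * B (th t) (r t)) / (r t ^ S N * j t)) by (unfold om; now rewrite Ea).
  assert (Hsn : sg <> 0) by (destruct Hsg; lra).
  assert (Pk := pow_lt _ k (proj1 Hrt)).
  split; [trivial|]. split; [now rewrite Hc|]. split; [now rewrite Hs|].
  split; [|split; [auto|split; [auto|]]].
  - rewrite Eom. unfold Rdiv. repeat apply Rmult_integral_contrapositive_currified; trivial; try lra.
    apply Rinv_neq_0_compat. apply Rmult_integral_contrapositive_currified; lra.
  - evar_last. now apply Hrd. rewrite Eom. unfold rd, slope. rewrite Eb.
    replace (r t ^ S k) with (r t * r t ^ k) by reflexivity. field. repeat split; lra.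
Qed.

(** The angular velocity has a constant sign, so the angle, reversed if necessary, is a parameter of
    the orbit. It is unbounded because ln r tends to minus infinity at a rate of at most L with
    respect to the angle. Along this parameter r becomes the graph of a solution of the scalar
    equation. *)
Lemma orbit_graph (sg : R) (x y : R -> R) :
  sg = 1 \/ sg = -1 ->
  (forall t, 0 <= t -> (x t, y t) <> (0, 0) /\
     is_derive x t (sg * P (x t) (y t)) /\ is_derive y t (sg * Q (x t) (y t))) ->
  is_lim x p_infty 0 -> is_lim y p_infty 0 ->
  exists (sg' : R) (gam : R -> R), (sg' = 1 \/ sg' = -1) /\
    (forall th, -1 < th -> 0 < gam th < delta / 2) /\
    (forall th, -1 < th -> is_derive gam th (sg' * slope (sg' * th) (gam th))) /\
    is_lim gam p_infty 0.
Proof.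
  intros Hsg Hxy Hlx Hly.
  assert (Hlim : forall (f : R -> R) e, is_lim f p_infty 0 -> 0 < e -> exists M, forall t, M < t -> Rabs (f t) < e).
  { intros f e Hf He. destruct (Hf (fun z => Rabs z < e)) as [M HM].
    - exists (mkposreal e He). intros z Hz. change (Rabs (z - 0) < e) in Hz. now rewrite Rminus_0_r in Hz.
    - now exists M. }
  assert (Hsmall : forall e, 0 < e -> exists M, 0 <= M /\ forall t, M < t -> Rabs (x t) < e / 2 /\ Rabs (y t) < e ^ S N / 2).
  { intros e He. destruct (Hlim x (e / 2) Hlx ltac:(lra)) as [M1 H1].
    assert (X := pow_lt e (S N) He). destruct (Hlim y (e ^ S N / 2) Hly ltac:(lra)) as [M2 H2].
    exists (Rmax 0 (Rmax M1 M2)). split. apply Rmax_l. intros t Ht.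
    assert (Y := Rmax_r 0 (Rmax M1 M2)). assert (Y1 := Rmax_l M1 M2). assert (Y2 := Rmax_r M1 M2).
    split; [apply H1|apply H2]; lra. }
  destruct (Hsmall (delta / 2) ltac:(lra)) as [t0 [Ht00 Ht0]].
  destruct (orbit_angle sg x y t0 Hsg) as (r & th & om & H).
  { intros t Ht. destruct (Ht0 t Ht) as [B1 B2]. destruct (Hxy t ltac:(lra)) as (A1 & A2 & A3). tauto. }
  assert (Hsig : exists sg', (sg' = 1 \/ sg' = -1) /\ forall t, t0 < t -> 0 < sg' * om t).
  { destruct (H (t0 + 1) ltac:(lra)) as (_ & _ & _ & Hn & _).
    assert (X : forall c, c = 1 \/ c = -1 -> 0 < c * om (t0 + 1) -> forall t, t0 < t -> 0 < c * om t).
    { intros c Hc Hp t Ht. apply (continuous_no_zero_pos (fun t => c * om t) t0 (t0 + 1)); trivial; try lra.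
      - intros z Hz. destruct (H z Hz) as (_ & _ & _ & _ & Hco & _).
        apply (continuous_scal_r c om). exact Hco.
      - intros z Hz. destruct (H z Hz) as (_ & _ & _ & Hnz & _).
        apply Rmult_integral_contrapositive_currified; trivial. destruct Hc; lra. }
    destruct (Rlt_dec 0 (om (t0 + 1))) as [Y|Y].
    - exists 1. split. now left. apply X. now left. lra.
    - exists (-1). split. now right. apply X. now right. lra. }
  destruct Hsig as [sg' [Hsg' Hpos]].
  assert (Hsg2 : sg' * sg' = 1) by (destruct Hsg' as [-> | ->]; ring).
  destruct slope_regular as (Fr & Frr & L & HL & Hslope).
  set (s := fun t => sg' * th t).
  assert (Hsd : forall t, t0 < t -> is_derive s t (sg' * om t)).
  { intros t Ht. apply (is_derive_scal th). now apply H. }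
  set (t1 := t0 + 1).
  (* |dr/r| <= L ds, so s is unbounded as r tends to 0. *)
  assert (Hinf : forall M, exists t, t0 < t /\ M < s t).
  { intros M.
    assert (Hlog : forall t, t1 <= t -> ln (r t1) - ln (r t) <= L * s t - L * s t1).
    { intros t Ht. replace (ln (r t1) - ln (r t)) with (- ln (r t) - - ln (r t1)) by ring.
      apply (derive_le (fun t => - ln (r t)) (fun t => L * s t)
        (fun t => - (slope (th t) (r t) * om t / r t)) (fun t => L * (sg' * om t))); trivial.
      - intros z Hz. destruct (H z ltac:(unfold t1 in *; lra)) as (Hrz & _ & _ & _ & _ & _ & Dr).
        apply (is_derive_opp (fun t => ln (r t))). evar_last.
        apply (is_derive_comp ln r). apply is_derive_ln. apply Hrz. exact Dr.
        unfold scal; simpl; unfold mult; simpl. field. lra.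
      - intros z Hz. apply (is_derive_scal s). apply Hsd. unfold t1 in *; lra.
      - intros z Hz. assert (Hz0 : t0 < z) by (unfold t1 in *; lra).
        destruct (H z Hz0) as (Hrz & _). assert (Hp := Hpos z Hz0).
        destruct (Hslope (th z) (r z)) as (_ & _ & _ & _ & _ & HS & _).
        { rewrite Rabs_pos_eq; lra. }
        rewrite (Rabs_pos_eq (r z)) in HS by lra.
        apply Rle_trans with (1 := Rle_abs _). rewrite Rabs_Ropp. unfold Rdiv.
        rewrite !Rabs_mult, Rabs_inv, (Rabs_pos_eq (r z)) by lra.
        assert (Ho : Rabs (om z) = sg' * om z).
        { destruct Hsg' as [-> | ->]. rewrite Rabs_pos_eq; lra. rewrite Rabs_left; lra. }
        rewrite Ho. apply Rmult_le_reg_r with (r z). lra.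
        rewrite Rmult_assoc, Rinv_l, Rmult_1_r by lra.
        replace (L * (sg' * om z) * r z) with (L * r z * (sg' * om z)) by ring.
        apply Rmult_le_compat_r; lra. }
    (* A radius below this value forces s t > M through [Hlog]. *)
    set (e := exp (ln (r t1) - L * (M - s t1))).
    destruct (Hsmall e (exp_pos _)) as [t2 [_ Ht2]].
    set (t := Rmax t1 t2 + 1).
    assert (Hta : t1 < t) by (unfold t; assert (X := Rmax_l t1 t2); lra).
    assert (Htb : t2 < t) by (unfold t; assert (X := Rmax_r t1 t2); lra).
    assert (Htc : t0 < t) by (unfold t1 in Hta; lra).
    exists t. split; trivial.
    destruct (H t Htc) as (Hrt & Ex & Ey & _). destruct (Ht2 t Htb) as [B1 B2].
    assert (Hre : r t < e) by (apply (polar_small N e (x t) (y t) (r t) (th t)); trivial; [apply exp_pos|lra]).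
    apply ln_increasing in Hre. 2: lra. unfold e in Hre. rewrite ln_exp in Hre.
    assert (X := Hlog t ltac:(lra)). nra. }
  destruct (inverse_reparametrization s (fun t => sg' * om t) t0 t1 Hsd Hpos Hinf ltac:(unfold t1; lra)) as [Hmono [g Hg]].
  assert (HT : 0 < 2 * PI) by (assert (X := PI_RGT_0); lra).
  (* A shift by n full turns, harmless for the periodic [slope], makes the graph start before th =
     -1. *)
  destruct (INR_unbounded ((s t1 + 1) / (2 * PI))) as [n Hn].
  assert (Hn' : s t1 + 1 < 2 * PI * INR n).
  { apply Rmult_lt_compat_r with (r := 2 * PI) in Hn; trivial.
    unfold Rdiv in Hn. rewrite Rmult_assoc, Rinv_l, Rmult_1_r in Hn by lra. lra. }
  exists sg', (fun z => r (g (z + 2 * PI * INR n))). split; trivial.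
  assert (Hgz : forall z, -1 < z -> t1 < g (z + 2 * PI * INR n) /\ s (g (z + 2 * PI * INR n)) = z + 2 * PI * INR n /\
      is_derive g (z + 2 * PI * INR n) (/ (sg' * om (g (z + 2 * PI * INR n))))).
  { intros z Hz. apply Hg. lra. }
  split; [|split].
  - intros z Hz. destruct (Hgz z Hz) as [G1 _]. apply H. unfold t1 in G1; lra.
  - intros z Hz. destruct (Hgz z Hz) as (G1 & G2 & G3).
    set (t := g (z + 2 * PI * INR n)) in *. assert (Ht : t0 < t) by (unfold t1 in G1; lra).
    destruct (H t Ht) as (_ & _ & _ & Hn0 & _ & _ & Dr).
    evar_last.
    + apply (is_derive_comp r (fun z => g (z + 2 * PI * INR n))). exact Dr.
      apply (is_derive_comp g (fun z => z + 2 * PI * INR n)). exact G3. auto_derive; trivial.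
    + fold t. assert (Eth : th t = sg' * z + 2 * PI * (sg' * INR n)).
      { replace (th t) with (sg' * (sg' * th t)) by (rewrite <- Rmult_assoc, Hsg2; ring).
        fold (s t). rewrite G2. ring. }
      assert (Esl : slope (th t) (r t) = slope (sg' * z) (r t)).
      { rewrite Eth, INR_IZR_INZ. destruct Hsg' as [-> | ->].
        - rewrite !Rmult_1_l. apply (periodic_Z (fun a => slope a (r t))). intros a. apply slope_per.
        - replace (-1 * IZR (Z.of_nat n)) with (IZR (- Z.of_nat n)) by (rewrite opp_IZR; ring).
          apply (periodic_Z (fun a => slope a (r t))). intros a. apply slope_per. }
      rewrite Esl. unfold scal; simpl; unfold mult; simpl.
      assert (Hs0 : sg' <> 0) by (destruct Hsg'; lra).
      apply Rmult_eq_reg_r with sg'; trivial.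
      replace (sg' * slope (sg' * z) (r t) * sg') with ((sg' * sg') * slope (sg' * z) (r t)) by ring.
      rewrite Hsg2. field. split; trivial.
  - assert (X : forall e, 0 < e -> exists M, forall z, M < z -> Rabs (r (g (z + 2 * PI * INR n))) < e).
    { intros e He. destruct (Hsmall e He) as [t2 [_ Ht2]]. set (t3 := Rmax t1 t2 + 1).
      assert (Y1 : t1 < t3) by (unfold t3; assert (X := Rmax_l t1 t2); lra).
      assert (Y2 : t2 < t3) by (unfold t3; assert (X := Rmax_r t1 t2); lra).
      exists (Rmax (-1) (s t3)). intros z Hz.
      assert (Hz1 := Rle_lt_trans _ _ _ (Rmax_l _ _) Hz). assert (Hz2 := Rle_lt_trans _ _ _ (Rmax_r _ _) Hz).
      destruct (Hgz z Hz1) as (G1 & G2 & _). set (t := g (z + 2 * PI * INR n)) in *.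
      assert (Ht : t0 < t) by (unfold t1 in G1; lra).
      assert (Ht3 : t3 < t).
      { apply Rnot_le_lt. intros W. assert (Hns := Rmult_le_pos _ _ (Rlt_le _ _ HT) (pos_INR n)).
        destruct (Req_dec t t3) as [E|NE]. rewrite E in G2; lra.
        assert (V := Hmono t t3 Ht ltac:(lra)). lra. }
      destruct (H t Ht) as (Hrt & Ex & Ey & _). destruct (Ht2 t ltac:(lra)) as [B1 B2].
      rewrite Rabs_pos_eq by lra. apply (polar_small N e (x t) (y t) (r t) (th t)); trivial; lra. }
    intros Pn [e He]. destruct (X e (cond_pos e)) as [M HM]. exists M. intros z Hz.
    apply He. change (Rabs (r (g (z + 2 * PI * INR n)) - 0) < e). rewrite Rminus_0_r. now apply HM.
Qed.

Lemma planar_conclusion (sg : R) (x y : R -> R) (eta : R) :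
  0 < eta -> sg = 1 \/ sg = -1 ->
  (forall t, 0 <= t -> (x t, y t) <> (0, 0) /\
     is_derive x t (sg * P (x t) (y t)) /\ is_derive y t (sg * Q (x t) (y t))) ->
  is_lim x p_infty 0 -> is_lim y p_infty 0 ->
  exists (V0 : R -> R -> R) (e0 : R), 0 < e0 <= eta /\
    inverse_integrating_factor (fun z => Rabs (fst z) < e0 /\ Rabs (snd z) < e0) P Q V0.
Proof.
  intros Heta Hsg Hxy Hlx Hly.
  destruct (orbit_graph sg x y Hsg Hxy Hlx Hly) as (sg' & gam & H1 & H2 & H3 & H4).
  destruct (planar_cylinder sg' gam H1 H2 H3 H4) as (V & Vr & Fr & C & e & He & HV).
  now apply (planar_inverse_integrating_factor V Vr Fr C e eta).
Qed.

End Planar.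

(** * Double power series *)

Definition fnorm (n : nat) (c : nat -> R) : R := sum_n (fun i => Rabs (c i)) n.

Lemma sum_n_S (u : nat -> R) (n : nat) : sum_n u (S n) = sum_n u n + u (S n).
Proof. apply (sum_Sn u n). Qed.

Lemma sum_n_0 (u : nat -> R) : sum_n u 0 = u O.
Proof. apply (sum_O u). Qed.

Lemma form_ext (n : nat) (c c' : nat -> R) (x y : R) :
  (forall i, (i <= n)%nat -> c i = c' i) -> form n c x y = form n c' x y.
Proof. intros H. apply sum_n_ext_loc. intros i Hi. now rewrite H. Qed.

Lemma form_0 (c : nat -> R) (x y : R) : form 0 c x y = c O.
Proof. unfold form. rewrite sum_n_0. simpl. ring. Qed.

Lemma form_S (n : nat) (c : nat -> R) (x y : R) :
  form (S n) c x y = y * form n c x y + c (S n) * x ^ S n.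
Proof.
  unfold form. rewrite sum_n_S. rewrite Nat.sub_diag. f_equal.
  - rewrite <- (sum_n_mult_l (K := R_Ring) y). apply sum_n_ext_loc. intros i Hi.
    replace (S n - i)%nat with (S (n - i)) by lia. simpl pow. unfold mult; simpl. ring.
  - simpl. ring.
Qed.

Lemma fnorm_S (n : nat) (c : nat -> R) : fnorm (S n) c = fnorm n c + Rabs (c (S n)).
Proof. apply sum_n_S. Qed.

Lemma fnorm_0 (c : nat -> R) : fnorm 0 c = Rabs (c O).
Proof. apply sum_n_0. Qed.

Lemma fnorm_pos (n : nat) (c : nat -> R) : 0 <= fnorm n c.
Proof.
  induction n as [|n IH]. rewrite fnorm_0. apply Rabs_pos.
  rewrite fnorm_S. assert (A := Rabs_pos (c (S n))). lra.
Qed.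

Lemma fnorm_ext (n : nat) (c c' : nat -> R) :
  (forall i, (i <= n)%nat -> c i = c' i) -> fnorm n c = fnorm n c'.
Proof. intros H. apply sum_n_ext_loc. intros i Hi. now rewrite H. Qed.

Lemma fnorm_le (n : nat) (c c' : nat -> R) (k : R) :
  0 <= k -> (forall i, (i <= n)%nat -> Rabs (c' i) <= k * Rabs (c i)) -> fnorm n c' <= k * fnorm n c.
Proof.
  intros Hk. induction n as [|n IH]; intros H.
  - rewrite !fnorm_0. auto.
  - rewrite !fnorm_S. assert (A := IH ltac:(intros; apply H; lia)). assert (B := H (S n) (Nat.le_refl _)). lra.
Qed.

Lemma form_bound (n : nat) (c : nat -> R) (R0 x y : R) :
  Rabs x <= R0 -> Rabs y <= R0 -> Rabs (form n c x y) <= fnorm n c * R0 ^ n.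
Proof.
  intros Hx Hy. assert (H0 : 0 <= R0) by (apply Rle_trans with (2 := Hx); apply Rabs_pos).
  induction n as [|n IH].
  - rewrite form_0, fnorm_0. simpl. lra.
  - rewrite form_S, fnorm_S. apply Rle_trans with (1 := Rabs_triang _ _).
    rewrite !Rabs_mult, <- RPow_abs.
    assert (A : Rabs y * Rabs (form n c x y) <= R0 * (fnorm n c * R0 ^ n)).
    { apply Rmult_le_compat; trivial; apply Rabs_pos. }
    assert (B : Rabs (c (S n)) * Rabs x ^ S n <= Rabs (c (S n)) * R0 ^ S n).
    { apply Rmult_le_compat_l. apply Rabs_pos. apply pow_incr. split; trivial. apply Rabs_pos. }
    simpl in *. lra.
Qed.

Lemma form_plus (n : nat) (c d : nat -> R) (x y : R) :
  form n c x y + form n d x y = form n (fun i => c i + d i) x y.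
Proof.
  unfold form. rewrite <- (sum_n_plus (G := R_AbelianMonoid)). apply sum_n_ext. intros i.
  unfold plus; simpl. ring.
Qed.

Lemma form_scal (n : nat) (k : R) (c : nat -> R) (x y : R) :
  k * form n c x y = form n (fun i => k * c i) x y.
Proof.
  unfold form. rewrite <- (sum_n_mult_l (K := R_Ring) k). apply sum_n_ext. intros i.
  unfold mult; simpl. ring.
Qed.

Definition coef_x (c : nat -> R) : nat -> R := fun i => INR (S i) * c (S i).
Definition coef_y (n : nat) (c : nat -> R) : nat -> R := fun i => INR (S n - i) * c i.

Definition form_dx (n : nat) (c : nat -> R) (x y : R) : R :=
  match n with O => 0 | S n => form n (coef_x c) x y end.
Definition form_dy (n : nat) (c : nat -> R) (x y : R) : R :=
  match n with O => 0 | S n => form n (coef_y n c) x y end.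

Lemma form_dx_S (n : nat) (c : nat -> R) (x y : R) :
  form_dx (S n) c x y = y * form_dx n c x y + c (S n) * (INR (S n) * x ^ n).
Proof.
  destruct n as [|n]; unfold form_dx.
  - rewrite form_0. unfold coef_x. simpl. ring.
  - rewrite form_S. unfold coef_x at 2. ring.
Qed.

Lemma form_dy_S (n : nat) (c : nat -> R) (x y : R) :
  form_dy (S n) c x y = form n c x y + y * form_dy n c x y.
Proof.
  destruct n as [|n]; unfold form_dy.
  - rewrite !form_0. unfold coef_y. simpl. ring.
  - assert (E : y * form n (coef_y n c) x y = form (S n) (fun i => INR (S n - i) * c i) x y).
    { rewrite form_S, Nat.sub_diag. change (INR 0) with 0.
      unfold coef_y. ring. }
    rewrite E, form_plus. apply form_ext. intros i Hi. unfold coef_y.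
    replace (S (S n) - i)%nat with (S (S n - i)) by lia. rewrite S_INR. ring.
Qed.

Lemma pow_diff_bounds (n : nat) (R0 x x' : R) : 0 < R0 -> Rabs x <= R0 -> Rabs x' <= R0 ->
  Rabs (x' ^ n - x ^ n) <= INR n * R0 ^ n * (Rabs (x' - x) / R0) /\
  Rabs (x' ^ S n - x ^ S n - INR (S n) * x ^ n * (x' - x)) <= INR (S n) ^ 2 * R0 ^ S n * (Rabs (x' - x) / R0) ^ 2.
Proof.
  intros HR Hx Hx'. set (s := Rabs (x' - x)). assert (Hs : 0 <= s) by apply Rabs_pos.
  assert (Hp : forall j, Rabs (x ^ j) <= R0 ^ j /\ 0 <= R0 ^ j).
  { intros j. split. rewrite <- RPow_abs. apply pow_incr. split; trivial. apply Rabs_pos. apply pow_le; lra. }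
  assert (Hsr : 0 <= s / R0) by (apply Rdiv_le_0_compat; lra).
  induction n as [|n [IH1 IH2]].
  - simpl. split. rewrite Rminus_diag, Rabs_R0. lra.
    replace (x' * 1 - x * 1 - 1 * 1 * (x' - x)) with 0 by ring. rewrite Rabs_R0.
    assert (A := pow2_ge_0 (s / R0)). simpl in A. assert (B := Rmult_le_pos _ _ (Rlt_le _ _ HR) A). lra.
  - assert (D1 : Rabs (x' ^ S n - x ^ S n) <= INR (S n) * R0 ^ S n * (s / R0)).
    { replace (x' ^ S n - x ^ S n) with (x' * (x' ^ n - x ^ n) + (x' - x) * x ^ n) by (simpl; ring).
      apply Rle_trans with (1 := Rabs_triang _ _). rewrite !Rabs_mult. fold s.
      apply Rle_trans with (R0 * (INR n * R0 ^ n * (s / R0)) + s * R0 ^ n).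
      - apply Rplus_le_compat; apply Rmult_le_compat; try apply Rabs_pos; trivial. lra. apply Hp.
      - right. rewrite S_INR. simpl pow. field. lra. }
    split; trivial.
    replace (x' ^ S (S n) - x ^ S (S n) - INR (S (S n)) * x ^ S n * (x' - x)) with
      (x * (x' ^ S n - x ^ S n - INR (S n) * x ^ n * (x' - x)) + (x' - x) * (x' ^ S n - x ^ S n)).
    2: { rewrite (S_INR (S n)). simpl pow. ring. }
    apply Rle_trans with (1 := Rabs_triang _ _). rewrite !Rabs_mult. fold s.
    apply Rle_trans with (R0 * (INR (S n) ^ 2 * R0 ^ S n * (s / R0) ^ 2) + s * (INR (S n) * R0 ^ S n * (s / R0))).
    + apply Rplus_le_compat; apply Rmult_le_compat; try apply Rabs_pos; trivial. lra.
    + replace (R0 * (INR (S n) ^ 2 * R0 ^ S n * (s / R0) ^ 2) + s * (INR (S n) * R0 ^ S n * (s / R0)))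
        with ((INR (S n) ^ 2 + INR (S n)) * (R0 ^ S (S n) * (s / R0) ^ 2)).
      2: { simpl pow. field. lra. }
      rewrite Rmult_assoc. apply Rmult_le_compat_r.
      * apply Rmult_le_pos. apply Hp. apply pow2_ge_0.
      * rewrite (S_INR (S n)). assert (A := pos_INR (S n)). set (z := INR (S n)) in *. nra.
Qed.

(** First and second order Taylor bounds, proved together by the Horner step [form_S]: the product
    with y makes the second bound use the first. Scaling by R0 puts the increments in s, so that the
    sums over n only involve n^2 times the coefficient norm times R0^n. *)
Lemma form_diff_bounds (n : nat) (c : nat -> R) (R0 x y x' y' : R) :
  0 < R0 -> Rabs x <= R0 -> Rabs y <= R0 -> Rabs x' <= R0 -> Rabs y' <= R0 ->
  let s := (Rabs (x' - x) + Rabs (y' - y)) / R0 in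
  Rabs (form n c x' y' - form n c x y) <= fnorm n c * INR n * R0 ^ n * s /\
  Rabs (form n c x' y' - form n c x y - (form_dx n c x y * (x' - x) + form_dy n c x y * (y' - y)))
    <= fnorm n c * INR n ^ 2 * R0 ^ n * s ^ 2.
Proof.
  intros HR Hx Hy Hx' Hy' s.
  assert (Ax := Rabs_pos (x' - x)). assert (Ay := Rabs_pos (y' - y)).
  assert (Hs : 0 <= s) by (apply Rdiv_le_0_compat; lra).
  assert (Hsx : 0 <= Rabs (x' - x) / R0 <= s).
  { split. apply Rdiv_le_0_compat; lra. apply Rmult_le_compat_r. left; now apply Rinv_0_lt_compat. lra. }
  assert (Hsy : Rabs (y' - y) <= s * R0).
  { unfold s. replace ((Rabs (x' - x) + Rabs (y' - y)) / R0 * R0) with (Rabs (x' - x) + Rabs (y' - y)) by (field; lra). lra. }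
  induction n as [|n [IH1 IH2]].
  - rewrite !form_0. simpl. split.
    + rewrite Rminus_diag, Rabs_R0. lra.
    + replace (c O - c O - (0 * (x' - x) + 0 * (y' - y))) with 0 by ring. rewrite Rabs_R0. lra.
  - destruct (pow_diff_bounds (S n) R0 x x' HR Hx Hx') as [P1 _].
    destruct (pow_diff_bounds n R0 x x' HR Hx Hx') as [_ P2].
    assert (HP : 0 <= R0 ^ S n) by (apply pow_le; lra). assert (HP' : 0 <= R0 ^ n) by (apply pow_le; lra).
    assert (Hc := Rabs_pos (c (S n))). assert (Hn := pos_INR (S n)). assert (Hnn := pos_INR n).
    assert (Hfn := fnorm_pos n c).
    split.
    + rewrite !form_S.
      replace (y' * form n c x' y' + c (S n) * x' ^ S n - (y * form n c x y + c (S n) * x ^ S n)) with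
        ((y' * (form n c x' y' - form n c x y) + (y' - y) * form n c x y) + c (S n) * (x' ^ S n - x ^ S n)) by ring.
      apply Rle_trans with (1 := Rabs_triang _ _).
      apply Rle_trans with (1 := Rplus_le_compat_r _ _ _ (Rabs_triang _ _)). rewrite !Rabs_mult.
      apply Rle_trans with ((R0 * (fnorm n c * INR n * R0 ^ n * s) + s * R0 * (fnorm n c * R0 ^ n)) +
         Rabs (c (S n)) * (INR (S n) * R0 ^ S n * s)).
      * apply Rplus_le_compat; [apply Rplus_le_compat|]; apply Rmult_le_compat; try apply Rabs_pos; trivial; try lra.
        apply form_bound; trivial.
        apply Rle_trans with (1 := P1). apply Rmult_le_compat_l; [|apply Hsx]. now apply Rmult_le_pos.
      * right. rewrite fnorm_S, S_INR. simpl pow. ring.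
    + rewrite !form_S, form_dx_S, form_dy_S.
      replace (y' * form n c x' y' + c (S n) * x' ^ S n - (y * form n c x y + c (S n) * x ^ S n) -
        ((y * form_dx n c x y + c (S n) * (INR (S n) * x ^ n)) * (x' - x) + (form n c x y + y * form_dy n c x y) * (y' - y)))
       with ((y * (form n c x' y' - form n c x y - (form_dx n c x y * (x' - x) + form_dy n c x y * (y' - y)))
         + (y' - y) * (form n c x' y' - form n c x y)) + c (S n) * (x' ^ S n - x ^ S n - INR (S n) * x ^ n * (x' - x))) by ring.
      apply Rle_trans with (1 := Rabs_triang _ _).
      apply Rle_trans with (1 := Rplus_le_compat_r _ _ _ (Rabs_triang _ _)). rewrite !Rabs_mult.
      apply Rle_trans with ((R0 * (fnorm n c * INR n ^ 2 * R0 ^ n * s ^ 2) + s * R0 * (fnorm n c * INR n * R0 ^ n * s)) +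
         Rabs (c (S n)) * (INR (S n) ^ 2 * R0 ^ S n * s ^ 2)).
      * apply Rplus_le_compat; [apply Rplus_le_compat|]; apply Rmult_le_compat; try apply Rabs_pos; trivial; try lra.
        apply Rle_trans with (1 := P2). apply Rmult_le_compat_l. apply Rmult_le_pos; trivial. apply pow2_ge_0.
        apply pow_incr; trivial.
      * rewrite fnorm_S. set (X := R0 ^ S n * s ^ 2).
        assert (HX : 0 <= X) by (apply Rmult_le_pos; trivial; apply pow2_ge_0).
        replace (R0 * (fnorm n c * INR n ^ 2 * R0 ^ n * s ^ 2) + s * R0 * (fnorm n c * INR n * R0 ^ n * s) +
          Rabs (c (S n)) * (INR (S n) ^ 2 * R0 ^ S n * s ^ 2)) with
          ((fnorm n c * (INR n ^ 2 + INR n) + Rabs (c (S n)) * INR (S n) ^ 2) * X) by (unfold X; simpl pow; ring).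
        replace ((fnorm n c + Rabs (c (S n))) * INR (S n) ^ 2 * R0 ^ S n * s ^ 2) with
          ((fnorm n c * INR (S n) ^ 2 + Rabs (c (S n)) * INR (S n) ^ 2) * X) by (unfold X; ring).
        apply Rmult_le_compat_r; trivial. apply Rplus_le_compat_r. apply Rmult_le_compat_l; trivial.
        rewrite S_INR. set (z := INR n) in *. nra.
Qed.

(** All n + 1 terms of 1 + q + ... + q^n are at least q^n, and the whole sum is at most 1 / (1 -
    q). *)
Lemma INR_pow_bounded (q : R) (n : nat) : 0 <= q < 1 -> INR (S n) * q ^ n <= / (1 - q).
Proof.
  intros Hq.
  assert (H : INR (S n) * q ^ n <= sum_f_R0 (fun k => q ^ k) n).
  { induction n as [|n IH]; [simpl; lra|].
    rewrite S_INR. simpl sum_f_R0. simpl pow.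
    assert (A := pow_le q n (proj1 Hq)). assert (B := pos_INR (S n)). 
    assert (INR (S n) * (q * q ^ n) <= INR (S n) * q ^ n).
    { apply Rmult_le_compat_l; trivial. nra. }
    lra. }
  apply Rle_trans with (1 := H). rewrite tech3 by lra.
  apply Rmult_le_reg_r with (1 - q). lra. unfold Rdiv. rewrite Rmult_assoc, Rinv_l by lra.
  assert (A := pow_le q (S n) (proj1 Hq)). lra.
Qed.

(** * Series with geometrically bounded coefficients *)

(** The growth rate K is strictly below 1 / rho. The gap absorbs polynomial factors in n, so the
    same rho survives differentiation, sums and products. *)
Definition geometric (rho : R) (a : nat -> nat -> R) : Prop :=
  0 < rho /\ exists C K, 0 <= C /\ 0 < K /\ K * rho < 1 /\ forall n, fnorm n (a n) <= C * K ^ n.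

Definition Ev (a : nat -> nat -> R) (x y : R) : R := Series (fun n => form n (a n) x y).

Definition box (rho : R) : R -> R -> Prop := fun x y => Rabs x < rho /\ Rabs y < rho.

Lemma box_open (rho : R) : open_2d (box rho).
Proof.
  intros x y [Hx Hy]. assert (Hd : 0 < Rmin (rho - Rabs x) (rho - Rabs y)) by (apply Rmin_case; lra).
  exists (mkposreal _ Hd). simpl. intros u v Hu Hv.
  assert (A := Rlt_le_trans _ _ _ Hu (Rmin_l _ _)). assert (B := Rlt_le_trans _ _ _ Hv (Rmin_r _ _)).
  split.
  - replace u with ((u - x) + x) by ring. apply Rle_lt_trans with (1 := Rabs_triang _ _). lra.
  - replace v with ((v - y) + y) by ring. apply Rle_lt_trans with (1 := Rabs_triang _ _). lra.
Qed.

Lemma geometric_abs (rho : R) (a : nat -> nat -> R) (x y : R) :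
  geometric rho a -> box rho x y -> ex_series (fun n => Rabs (form n (a n) x y)).
Proof.
  intros (Hr & C & K & HC & HK & HKr & H) [Hx Hy].
  apply (ex_series_le (V := R_CompleteNormedModule) _ (fun n => C * (K * rho) ^ n)).
  - intros n. unfold norm; simpl. unfold abs; simpl. rewrite Rabs_Rabsolu.
    apply Rle_trans with (1 := form_bound n (a n) rho x y (Rlt_le _ _ Hx) (Rlt_le _ _ Hy)).
    rewrite Rpow_mult_distr, <- Rmult_assoc. apply Rmult_le_compat_r; trivial. apply pow_le; lra.
  - apply (ex_series_scal_l C (fun n => (K * rho) ^ n)). apply ex_series_geom.
    rewrite Rabs_pos_eq; trivial. apply Rmult_le_pos; lra.
Qed.

Lemma geometric_series (rho : R) (a : nat -> nat -> R) (x y : R) :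
  geometric rho a -> box rho x y -> is_series (fun n => form n (a n) x y) (Ev a x y).
Proof.
  intros Ha Hxy. apply Series_correct. apply ex_series_Rabs. now apply geometric_abs with rho.
Qed.

Definition dx_coefs (a : nat -> nat -> R) : nat -> nat -> R := fun n => coef_x (a (S n)).
Definition dy_coefs (a : nat -> nat -> R) : nat -> nat -> R := fun n => coef_y n (a (S n)).

Lemma fnorm_shift (n : nat) (c : nat -> R) : fnorm n (fun i => c (S i)) <= fnorm (S n) c.
Proof.
  induction n as [|n IH].
  - rewrite fnorm_S, !fnorm_0. assert (A := Rabs_pos (c O)). lra.
  - rewrite (fnorm_S (S n) c), (fnorm_S n). lra.
Qed.

(** The new rate K' is halfway between K and 1 / rho, and the factor n + 1 is absorbed by (K /
    K')^n. *)
Lemma geometric_derivative (rho : R) (a b : nat -> nat -> R) :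
  geometric rho a -> (forall n, fnorm n (b n) <= INR (S n) * fnorm (S n) (a (S n))) -> geometric rho b.
Proof.
  intros (Hr & C & K & HC & HK & HKr & H) Hb. split; trivial.
  set (K' := (K + / rho) / 2).
  assert (Hir : K < / rho).
  { apply Rmult_lt_reg_r with rho; trivial. rewrite Rinv_l; lra. }
  assert (HK' : K < K' < / rho) by (unfold K'; lra).
  set (q := K / K'). assert (Hq : 0 <= q < 1).
  { split. apply Rdiv_le_0_compat; lra. apply Rmult_lt_reg_r with K'. lra.
    unfold q, Rdiv. rewrite Rmult_assoc, Rinv_l; lra. }
  exists (C * K * / (1 - q)), K'. repeat split.
  - apply Rmult_le_pos. apply Rmult_le_pos; lra. left. apply Rinv_0_lt_compat. lra.
  - lra.
  - apply Rmult_lt_reg_r with (/ rho). now apply Rinv_0_lt_compat. rewrite Rmult_assoc, Rinv_r by lra. lra.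
  - intros n. apply Rle_trans with (1 := Hb n).
    apply Rle_trans with (INR (S n) * (C * K ^ S n)).
    { apply Rmult_le_compat_l; trivial. apply pos_INR. }
    assert (E : K ^ n = q ^ n * K' ^ n).
    { rewrite <- Rpow_mult_distr. f_equal. unfold q. field. lra. }
    simpl pow. rewrite E.
    replace (INR (S n) * (C * (K * (q ^ n * K' ^ n)))) with ((C * K) * (INR (S n) * q ^ n) * K' ^ n) by ring.
    apply Rmult_le_compat_r. apply pow_le; lra. apply Rmult_le_compat_l. apply Rmult_le_pos; lra.
    now apply INR_pow_bounded.
Qed.

Lemma geometric_dx (rho : R) (a : nat -> nat -> R) : geometric rho a -> geometric rho (dx_coefs a).
Proof.
  intros Ha. apply geometric_derivative with (1 := Ha). intros n.
  apply Rle_trans with (INR (S n) * fnorm n (fun i => a (S n) (S i))).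
  - apply fnorm_le. apply pos_INR. intros i Hi. unfold dx_coefs, coef_x. rewrite Rabs_mult.
    apply Rmult_le_compat_r. apply Rabs_pos. rewrite Rabs_pos_eq by apply pos_INR. apply le_INR. lia.
  - apply Rmult_le_compat_l. apply pos_INR. apply fnorm_shift.
Qed.

Lemma geometric_dy (rho : R) (a : nat -> nat -> R) : geometric rho a -> geometric rho (dy_coefs a).
Proof.
  intros Ha. apply geometric_derivative with (1 := Ha). intros n.
  apply Rle_trans with (INR (S n) * fnorm n (a (S n))).
  - apply fnorm_le. apply pos_INR. intros i Hi. unfold dy_coefs, coef_y. rewrite Rabs_mult.
    apply Rmult_le_compat_r. apply Rabs_pos. rewrite Rabs_pos_eq by apply pos_INR. apply le_INR. lia.
  - apply Rmult_le_compat_l. apply pos_INR. rewrite fnorm_S. assert (A := Rabs_pos (a (S n) (S n))). lra.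
Qed.

Lemma Ev_dx (rho : R) (a : nat -> nat -> R) (x y : R) : geometric rho a -> box rho x y ->
  is_series (fun n => form_dx n (a n) x y) (Ev (dx_coefs a) x y).
Proof.
  intros Ha Hxy. apply is_series_decr_1. simpl.
  evar_last. apply (geometric_series rho (dx_coefs a)); trivial. now apply geometric_dx.
  unfold plus, opp; simpl. ring.
Qed.

Lemma Ev_dy (rho : R) (a : nat -> nat -> R) (x y : R) : geometric rho a -> box rho x y ->
  is_series (fun n => form_dy n (a n) x y) (Ev (dy_coefs a) x y).
Proof.
  intros Ha Hxy. apply is_series_decr_1. simpl.
  evar_last. apply (geometric_series rho (dy_coefs a)); trivial. now apply geometric_dy.
  unfold plus, opp; simpl. ring.
Qed.

Lemma is_series_bound (u v : nat -> R) (l m : R) :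
  is_series u l -> is_series v m -> (forall n, Rabs (u n) <= v n) -> Rabs l <= m.
Proof.
  intros Hu Hv H. 
  assert (Hv' : ex_series (fun n => Rabs (u n))).
  { apply (ex_series_le (V := R_CompleteNormedModule) _ v).
    - intros n. unfold norm; simpl; unfold abs; simpl. rewrite Rabs_Rabsolu. apply H.
    - now exists m. }
  rewrite <- (is_series_unique _ _ Hu), <- (is_series_unique _ _ Hv).
  apply Rle_trans with (1 := Series_Rabs _ Hv').
  apply Series_le. intros n. split. apply Rabs_pos. apply H. now exists m.
Qed.

(** Read as a form of degree n + 1 with zero top coefficient, the part of degree n turns into a
    series whose derivative bound dominates multiplication by n. *)
Lemma geometric_INR (rho : R) (a : nat -> nat -> R) :
  geometric rho a -> geometric rho (fun n i => INR n * a n i).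
Proof.
  intros Ha.
  set (b := fun n i => match n with O => 0 | S n => if Nat.eq_dec i (S n) then 0 else a n i end).
  assert (Hb : forall n, fnorm (S n) (b (S n)) = fnorm n (a n)).
  { intros n. rewrite fnorm_S. unfold b at 2. destruct (Nat.eq_dec (S n) (S n)) as [_|X]; [|lia].
    rewrite Rabs_R0, Rplus_0_r. apply fnorm_ext. intros i Hi. unfold b.
    destruct (Nat.eq_dec i (S n)); trivial. lia. }
  apply geometric_derivative with b.
  - destruct Ha as (Hr & C & K & HC & HK & HKr & H). split; trivial.
    exists (C / K), K. repeat split; trivial. apply Rdiv_le_0_compat; lra.
    intros [|n].
    + rewrite fnorm_0. unfold b. rewrite Rabs_R0. simpl. rewrite Rmult_1_r. apply Rdiv_le_0_compat; lra.
    + rewrite Hb. apply Rle_trans with (1 := H n). right. simpl pow. field. lra.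
  - intros n. rewrite Hb. apply fnorm_le. apply pos_INR. intros i _.
    rewrite Rabs_mult, Rabs_pos_eq by apply pos_INR.
    apply Rmult_le_compat_r. apply Rabs_pos. rewrite S_INR; lra.
Qed.

(** The second order bounds of the homogeneous parts are summed. Their coefficients n^2 rho^n times
    the norm form a convergent series with sum M, so the remainder is at most s^2 M. *)
Lemma Ev_differentiable (rho : R) (a : nat -> nat -> R) (x y : R) :
  geometric rho a -> box rho x y ->
  differentiable_pt_lim (Ev a) x y (Ev (dx_coefs a) x y) (Ev (dy_coefs a) x y).
Proof.
  intros Ha Hxy.
  assert (Hser : ex_series (fun n => fnorm n (a n) * INR n ^ 2 * rho ^ n)).
  { assert (G2 := geometric_INR _ _ (geometric_INR _ _ Ha)).
    destruct G2 as (Hr & C & K & HC & HK & HKr & H).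
    apply (ex_series_le (V := R_CompleteNormedModule) _ (fun n => C * (K * rho) ^ n)).
    - intros n. unfold norm; simpl. unfold abs; simpl.
      assert (Hf := fnorm_pos n (a n)). assert (Hn := pos_INR n). assert (Hp := pow_le rho n (Rlt_le _ _ Hr)).
      rewrite Rabs_pos_eq.
      2: { apply Rmult_le_pos; trivial. apply Rmult_le_pos; trivial. repeat apply Rmult_le_pos; trivial; lra. }
      rewrite Rpow_mult_distr. replace (C * (K ^ n * rho ^ n)) with (C * K ^ n * rho ^ n) by ring.
      apply Rmult_le_compat_r; trivial. apply Rle_trans with (2 := H n). right. unfold fnorm.
      rewrite Rmult_1_r, Rmult_comm.
      assert (E : forall k, 0 <= k -> k * sum_n (fun i => Rabs (a n i)) n = sum_n (fun i => Rabs (k * a n i)) n).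
      { intros k Hk. rewrite <- (sum_n_mult_l (K := R_Ring) k). apply sum_n_ext. intros i.
        apply (eq_trans (y := k * Rabs (a n i))); [reflexivity|]. rewrite Rabs_mult, (Rabs_pos_eq k); trivial. }
      rewrite E by now apply Rmult_le_pos. apply sum_n_ext. intros i. f_equal. ring.
    - apply (ex_series_scal_l C (fun n => (K * rho) ^ n)). apply ex_series_geom.
      rewrite Rabs_pos_eq; trivial. apply Rmult_le_pos; lra. }
  assert (Hr := proj1 Ha).
  set (M := Series (fun n => fnorm n (a n) * INR n ^ 2 * rho ^ n)).
  assert (HM : is_series (fun n => fnorm n (a n) * INR n ^ 2 * rho ^ n) M) by now apply Series_correct.
  assert (HM0 : 0 <= M).
  { apply Rle_trans with (Rabs 0). rewrite Rabs_R0; lra.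
    apply (is_series_bound (fun _ => 0) (fun n => fnorm n (a n) * INR n ^ 2 * rho ^ n)); trivial.
    - apply (filterlim_ext (fun _ => 0)).
      + intros n. induction n as [|n IH]. now rewrite sum_O. rewrite sum_Sn, <- IH. unfold plus; simpl. ring.
      + apply filterlim_const.
    - intros n. rewrite Rabs_R0. apply Rmult_le_pos. apply Rmult_le_pos. apply fnorm_pos. apply pow2_ge_0. apply pow_le; lra. }
  intros eps.
  (* Since s <= 2 m / rho, the remainder is at most (4 M / rho^2) m^2; this radius turns one factor
     m into eps. *)
  assert (Hd : 0 < eps * rho ^ 2 / (4 * (M + 1))).
  { apply Rdiv_lt_0_compat. apply Rmult_lt_0_compat. apply cond_pos. now apply pow_lt. lra. }
  assert (Hloc : locally_2d (fun u v => Rabs (u - x) < eps * rho ^ 2 / (4 * (M + 1)) /\ Rabs (v - y) < eps * rho ^ 2 / (4 * (M + 1))) x y).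
  { exists (mkposreal _ Hd). simpl. auto. }
  apply locally_2d_impl with (2 := locally_2d_and _ _ _ _ (box_open rho x y Hxy) Hloc).
  apply locally_2d_forall. intros u v [Huv [Hu Hv]].
  assert (S1 := geometric_series rho a u v Ha Huv). assert (S2 := geometric_series rho a x y Ha Hxy).
  assert (S3 := Ev_dx rho a x y Ha Hxy). assert (S4 := Ev_dy rho a x y Ha Hxy).
  set (s := (Rabs (u - x) + Rabs (v - y)) / rho).
  assert (B : Rabs (Ev a u v - Ev a x y - (Ev (dx_coefs a) x y * (u - x) + Ev (dy_coefs a) x y * (v - y))) <= s ^ 2 * M).
  { apply (is_series_bound (fun n => form n (a n) u v - form n (a n) x y -
       (form_dx n (a n) x y * (u - x) + form_dy n (a n) x y * (v - y)))
       (fun n => s ^ 2 * (fnorm n (a n) * INR n ^ 2 * rho ^ n))).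
    - apply (is_series_minus (fun n => form n (a n) u v - form n (a n) x y)).
      + apply (is_series_minus (fun n => form n (a n) u v)); trivial.
      + apply (is_series_plus (fun n => form_dx n (a n) x y * (u - x))).
        * apply (is_series_scal_r (u - x) (fun n => form_dx n (a n) x y)); trivial.
        * apply (is_series_scal_r (v - y) (fun n => form_dy n (a n) x y)); trivial.
    - exact (is_series_scal_l (s ^ 2) _ _ HM).
    - intros n. destruct Hxy as [Hx Hy]. destruct Huv as [Hu' Hv'].
      destruct (form_diff_bounds n (a n) rho x y u v Hr) as [_ D]; try lra.
      apply Rle_trans with (1 := D). fold s. right; ring. }
  apply Rle_trans with (1 := B).
  set (m := Rmax (Rabs (u - x)) (Rabs (v - y))).
  assert (Hm : Rabs (u - x) <= m /\ Rabs (v - y) <= m) by (split; [apply Rmax_l|apply Rmax_r]).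
  assert (Hm0 : 0 <= m) by (apply Rle_trans with (2 := proj1 Hm); apply Rabs_pos).
  assert (Hm1 : m <= eps * rho ^ 2 / (4 * (M + 1))) by (apply Rmax_lub; lra).
  assert (Hs : 0 <= s <= 2 * m / rho).
  { assert (A1 := Rabs_pos (u - x)). assert (A2 := Rabs_pos (v - y)).
    split. apply Rdiv_le_0_compat; lra. apply Rmult_le_compat_r. left; now apply Rinv_0_lt_compat. lra. }
  apply Rle_trans with ((2 * m / rho) ^ 2 * M).
  { apply Rmult_le_compat_r; trivial. apply pow_incr; trivial. }
  replace ((2 * m / rho) ^ 2 * M) with (4 * M / rho ^ 2 * m * m) by (field; lra).
  apply Rmult_le_compat_r; trivial.
  apply Rle_trans with (4 * M / rho ^ 2 * (eps * rho ^ 2 / (4 * (M + 1)))).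
  { apply Rmult_le_compat_l; trivial. apply Rdiv_le_0_compat. lra. now apply pow_lt. }
  replace (4 * M / rho ^ 2 * (eps * rho ^ 2 / (4 * (M + 1)))) with (eps * (M / (M + 1))) by (field; split; lra).
  rewrite <- (Rmult_1_r eps) at 2. apply Rmult_le_compat_l. left; apply cond_pos.
  apply Rmult_le_reg_r with (M + 1). lra. unfold Rdiv. rewrite Rmult_assoc, Rinv_l; lra.
Qed.

Lemma Ev_Ck (k : nat) (rho : R) (a : nat -> nat -> R) : geometric rho a -> Ck k (box rho) (Ev a).
Proof.
  revert a; induction k as [|k IH]; intros a Ha.
  - intros x y Hxy. apply differentiable_continuity with (1 := Ev_differentiable rho a x y Ha Hxy).
  - exists (Ev (dx_coefs a)), (Ev (dy_coefs a)). split; [|split].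
    + intros x y Hxy. now apply Ev_differentiable with rho.
    + apply IH. now apply geometric_dx.
    + apply IH. now apply geometric_dy.
Qed.

Lemma geometric_linear (rho C K : R) (a : nat -> nat -> R) :
  0 < rho -> 0 <= C -> 0 < K -> K * rho < 1 ->
  (forall n, fnorm n (a n) <= INR (S n) * (C * K ^ n)) -> geometric rho a.
Proof.
  intros Hr HC HK HKr H. split; trivial.
  set (K' := (K + / rho) / 2).
  assert (Hir : K < / rho) by (apply Rmult_lt_reg_r with rho; trivial; rewrite Rinv_l; lra).
  assert (HK' : K < K' < / rho) by (unfold K'; lra).
  set (q := K / K'). assert (Hq : 0 <= q < 1).
  { split. apply Rdiv_le_0_compat; lra. apply Rmult_lt_reg_r with K'. lra.
    unfold q, Rdiv. rewrite Rmult_assoc, Rinv_l; lra. }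
  exists (C * / (1 - q)), K'. repeat split.
  - apply Rmult_le_pos; trivial. left. apply Rinv_0_lt_compat. lra.
  - lra.
  - apply Rmult_lt_reg_r with (/ rho). now apply Rinv_0_lt_compat. rewrite Rmult_assoc, Rinv_r by lra. lra.
  - intros n. apply Rle_trans with (1 := H n).
    assert (E : K ^ n = q ^ n * K' ^ n).
    { rewrite <- Rpow_mult_distr. f_equal. unfold q. field. lra. }
    rewrite E. replace (INR (S n) * (C * (q ^ n * K' ^ n))) with (C * (INR (S n) * q ^ n) * K' ^ n) by ring.
    apply Rmult_le_compat_r. apply pow_le; lra. apply Rmult_le_compat_l; trivial.
    now apply INR_pow_bounded.
Qed.

Lemma geometric_shrink (rho rho' : R) (a : nat -> nat -> R) :
  0 < rho' <= rho -> geometric rho a -> geometric rho' a.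
Proof.
  intros Hr (H0 & C & K & HC & HK & HKr & H). split. lra. exists C, K. repeat split; trivial.
  apply Rle_lt_trans with (K * rho); trivial. apply Rmult_le_compat_l; lra.
Qed.

(** At the point (r / 2, r / 2) the series of absolute values has the terms norm times (r / 2)^n,
    which are bounded because they tend to 0. This gives the rate K = 2 / r, and rho = r / 4
    satisfies K rho = 1/2. *)
Lemma has_expansion_geometric (f : R -> R -> R) (a : nat -> nat -> R) :
  has_expansion f 0 0 a -> exists rho, geometric rho a /\ forall x y, box rho x y -> f x y = Ev a x y.
Proof.
  intros [r [Hr H]]. exists (r / 4).
  assert (Hr2 : Rabs (r / 2) < r) by (rewrite Rabs_pos_eq; lra).
  destruct (H (r / 2) (r / 2) Hr2 Hr2) as [He _]. rewrite Rabs_pos_eq in He by lra.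
  assert (Hb : exists M, forall n, form n (fun i => Rabs (a n i)) (r / 2) (r / 2) <= M).
  { apply ex_series_lim_0 in He. destruct (filterlim_bounded _ (ex_intro _ 0 He)) as [M HM].
    exists M. intros n. apply Rle_trans with (1 := Rle_abs _). apply HM. }
  destruct Hb as [M HM].
  assert (HM0 : 0 <= M).
  { apply Rle_trans with (2 := HM O). rewrite form_0. apply Rabs_pos. }
  assert (E : forall n c, form n (fun i => Rabs (c i)) (r / 2) (r / 2) = fnorm n c * (r / 2) ^ n).
  { intros n c. induction n as [|n IH].
    - rewrite form_0, fnorm_0. simpl. ring.
    - rewrite form_S, fnorm_S, IH. simpl. ring. }
  assert (Hp : forall n, 0 < (r / 2) ^ n) by (intros n; apply pow_lt; lra).
  split.
  - split. lra. exists M, (2 / r). repeat split; trivial.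
    + apply Rdiv_lt_0_compat; lra.
    + replace (2 / r * (r / 4)) with (/ 2) by (field; lra). lra.
    + intros n. assert (X := HM n). rewrite E in X.
      apply Rmult_le_reg_r with ((r / 2) ^ n); trivial. apply Rle_trans with (1 := X).
      rewrite Rmult_assoc, <- Rpow_mult_distr. replace (2 / r * (r / 2)) with 1 by (field; lra).
      rewrite pow1. lra.
  - intros x y [Hx Hy]. destruct (H x y) as [_ Hs]; try lra.
    rewrite !Rplus_0_l in Hs. symmetry. now apply is_series_unique.
Qed.

(** * Products of homogeneous parts and analytic functions *)

(** A bound on the coefficients is attached to a function whose coefficient list stays hidden, so
    that products are handled without index manipulations. *)
Definition homogeneous (n : nat) (B : R) (f : R -> R -> R) : Prop :=
  exists c, (forall x y, f x y = form n c x y) /\ fnorm n c <= B.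

Lemma homogeneous_le (n : nat) (B B' : R) (f : R -> R -> R) :
  B <= B' -> homogeneous n B f -> homogeneous n B' f.
Proof. intros H [c [H1 H2]]. exists c. split; trivial. lra. Qed.

Lemma homogeneous_ext (n : nat) (B : R) (f g : R -> R -> R) :
  (forall x y, f x y = g x y) -> homogeneous n B f -> homogeneous n B g.
Proof. intros H [c [H1 H2]]. exists c. split; trivial. intros x y. now rewrite <- H. Qed.

Lemma homogeneous_plus (n : nat) (B B' : R) (f g : R -> R -> R) :
  homogeneous n B f -> homogeneous n B' g -> homogeneous n (B + B') (fun x y => f x y + g x y).
Proof.
  intros [c [H1 H2]] [d [H3 H4]]. exists (fun i => c i + d i). split.
  - intros x y. rewrite H1, H3. apply form_plus.
  - apply Rle_trans with (fnorm n c + fnorm n d); [|lra]. clear.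
    induction n as [|n IH].
    + rewrite !fnorm_0. apply Rabs_triang.
    + rewrite !fnorm_S. assert (A := Rabs_triang (c (S n)) (d (S n))). lra.
Qed.

Lemma homogeneous_scal (n : nat) (k B : R) (f : R -> R -> R) :
  homogeneous n B f -> homogeneous n (Rabs k * B) (fun x y => k * f x y).
Proof.
  intros [c [H1 H2]]. exists (fun i => k * c i). split.
  - intros x y. rewrite H1. apply form_scal.
  - apply Rle_trans with (Rabs k * fnorm n c).
    + apply fnorm_le. apply Rabs_pos. intros i _. rewrite Rabs_mult. lra.
    + apply Rmult_le_compat_l; trivial. apply Rabs_pos.
Qed.

Lemma homogeneous_mult_y (n : nat) (B : R) (f : R -> R -> R) :
  homogeneous n B f -> homogeneous (S n) B (fun x y => y * f x y).
Proof.
  intros [c [H1 H2]]. exists (fun i => if Nat.eq_dec i (S n) then 0 else c i).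
  assert (E : forall i, (i <= n)%nat -> (if Nat.eq_dec i (S n) then 0 else c i) = c i).
  { intros i Hi. destruct (Nat.eq_dec i (S n)); trivial. lia. }
  split.
  - intros x y. rewrite form_S, (form_ext n _ c), H1 by exact E.
    destruct (Nat.eq_dec (S n) (S n)); [ring|lia].
  - rewrite fnorm_S, (fnorm_ext n _ c) by exact E.
    destruct (Nat.eq_dec (S n) (S n)); [rewrite Rabs_R0; lra|lia].
Qed.

Lemma homogeneous_mult_x (n : nat) (B : R) (f : R -> R -> R) :
  homogeneous n B f -> homogeneous (S n) B (fun x y => x * f x y).
Proof.
  intros [c [H1 H2]]. exists (fun i => match i with O => 0 | S i => c i end).
  split.
  - intros x y. rewrite H1. clear. induction n as [|n IH].
    + rewrite form_S, !form_0. simpl. ring.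
    + rewrite (form_S (S n) (fun i => match i with O => 0 | S i => c i end)), <- IH, form_S. simpl pow. ring.
  - apply Rle_trans with (2 := H2). right. clear. induction n as [|n IH].
    + rewrite fnorm_S, !fnorm_0, Rabs_R0. ring.
    + now rewrite fnorm_S, IH, fnorm_S.
Qed.

Lemma homogeneous_mult (n m : nat) (B B' : R) (f g : R -> R -> R) :
  homogeneous n B f -> homogeneous m B' g -> homogeneous (n + m) (B * B') (fun x y => f x y * g x y).
Proof.
  intros [c [H1 H2]] Hg.
  assert (HB' : 0 <= B') by (destruct Hg as [d [_ Hd]]; apply Rle_trans with (2 := Hd); apply fnorm_pos).
  apply homogeneous_le with (fnorm n c * B'). { now apply Rmult_le_compat_r. }
  apply homogeneous_ext with (fun x y => form n c x y * g x y). { intros x y. now rewrite H1. }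
  clear f B H1 H2. induction n as [|n IH].
  - rewrite fnorm_0. apply homogeneous_ext with (fun x y => c O * g x y).
    intros x y. now rewrite form_0. now apply homogeneous_scal.
  - rewrite fnorm_S.
    apply homogeneous_ext with (fun x y => y * (form n c x y * g x y) + c (S n) * (x ^ S n * g x y)).
    { intros x y. rewrite form_S. ring. }
    rewrite Rmult_plus_distr_r. apply homogeneous_plus.
    + now apply homogeneous_mult_y.
    + apply homogeneous_scal.
      assert (Hx : forall k, homogeneous (k + m) B' (fun x y => x ^ k * g x y)).
      { induction k as [|k IHk].
        - apply homogeneous_ext with (2 := Hg). intros; simpl; ring.
        - apply homogeneous_ext with (2 := homogeneous_mult_x _ _ _ IHk). intros; simpl; ring. }
      apply Hx.
Qed.

(** The sum over j < n, which may be empty; the degree by degree recursion of the division starts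
    with an empty sum. *)
Fixpoint psum (F : nat -> R) (n : nat) : R :=
  match n with O => 0 | S n => psum F n + F n end.

Lemma psum_S (F : nat -> R) (n : nat) : psum F (S n) = psum F n + F n.
Proof. reflexivity. Qed.

Lemma psum_sum_f_R0 (F : nat -> R) (n : nat) : sum_f_R0 F n = psum F (S n).
Proof. induction n as [|n IH]. simpl; ring. simpl sum_f_R0. rewrite IH. reflexivity. Qed.

Lemma homogeneous_psum (d : nat) (B : nat -> R) (F : nat -> R -> R -> R) (n : nat) :
  (forall j, (j < n)%nat -> homogeneous d (B j) (F j)) ->
  homogeneous d (psum B n) (fun x y => psum (fun j => F j x y) n).
Proof.
  induction n as [|n IH]; intros H.
  - exists (fun _ => 0). split.
    + intros x y. simpl. clear. induction d as [|d IH]. now rewrite form_0. rewrite form_S, <- IH. ring.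
    + clear. simpl. induction d as [|d IH]. rewrite fnorm_0, Rabs_R0; lra. rewrite fnorm_S, Rabs_R0; lra.
  - simpl. apply homogeneous_plus. apply IH. intros; apply H; lia. apply H; lia.
Qed.

Lemma psum_ext (F G : nat -> R) (n : nat) : (forall j, (j < n)%nat -> F j = G j) -> psum F n = psum G n.
Proof.
  induction n as [|n IH]; intros H; simpl; trivial. rewrite IH. now rewrite H by lia. intros; apply H; lia.
Qed.

Lemma psum_scal (k : R) (F : nat -> R) (n : nat) : psum (fun j => k * F j) n = k * psum F n.
Proof. induction n as [|n IH]; simpl. ring. rewrite IH. ring. Qed.

Lemma psum_const (k : R) (n : nat) : psum (fun _ => k) n = INR n * k.
Proof. induction n as [|n IH]; [simpl; ring|]. rewrite S_INR. simpl. rewrite IH. ring. Qed.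

(** Analyticity at the origin with an explicit box, the same for a function, its derivatives, and
    sums and products. *)
Definition Ana (rho : R) (f : R -> R -> R) : Prop :=
  exists a, geometric rho a /\ forall x y, box rho x y -> f x y = Ev a x y.

Lemma Ana_Ck (k : nat) (rho : R) (f : R -> R -> R) : Ana rho f -> Ck k (box rho) f.
Proof.
  intros [a [Ha Hf]]. apply Ck_ext with (Ev a). apply box_open. intros; symmetry; now apply Hf.
  now apply Ev_Ck.
Qed.

Lemma Ana_shrink (rho rho' : R) (f : R -> R -> R) : 0 < rho' <= rho -> Ana rho f -> Ana rho' f.
Proof.
  intros Hr [a [Ha Hf]]. exists a. split. now apply geometric_shrink with rho.
  intros x y [Hx Hy]. apply Hf. split; lra.
Qed.

Lemma Ana_derivatives (rho : R) (f : R -> R -> R) : Ana rho f ->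
  exists fx fy, Ana rho fx /\ Ana rho fy /\
    forall x y, box rho x y -> differentiable_pt_lim f x y (fx x y) (fy x y).
Proof.
  intros [a [Ha Hf]]. exists (Ev (dx_coefs a)), (Ev (dy_coefs a)).
  split; [|split].
  - exists (dx_coefs a). split; trivial. now apply geometric_dx.
  - exists (dy_coefs a). split; trivial. now apply geometric_dy.
  - intros x y Hxy. apply differentiable_pt_lim_ext with (Ev a).
    + apply locally_2d_impl with (2 := box_open rho x y Hxy). apply locally_2d_forall.
      intros u v Huv. symmetry. now apply Hf.
    + now apply Ev_differentiable with rho.
Qed.

(** The factor n + 1 allows for the number of terms in the degree n part of a Cauchy product. *)
Lemma Ana_of_homogeneous (rho C K : R) (g : nat -> R -> R -> R) (f : R -> R -> R) :
  0 < rho -> 0 <= C -> 0 < K -> K * rho < 1 ->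
  (forall n, homogeneous n (INR (S n) * (C * K ^ n)) (g n)) ->
  (forall x y, box rho x y -> is_series (fun n => g n x y) (f x y)) -> Ana rho f.
Proof.
  intros Hr HC HK HKr Hg Hf. destruct (choice _ Hg) as [a Ha].
  exists a. split.
  - apply (geometric_linear rho C K); trivial. intros n. apply Ha.
  - intros x y Hxy. symmetry. apply is_series_unique. apply (is_series_ext (fun n => g n x y)); auto.
    intros n. apply Ha.
Qed.

Lemma geometric_homogeneous (rho : R) (a : nat -> nat -> R) : geometric rho a ->
  exists C K, 0 <= C /\ 0 < K /\ K * rho < 1 /\ forall n, homogeneous n (C * K ^ n) (form n (a n)).
Proof.
  intros (Hr & C & K & HC & HK & HKr & H). exists C, K. repeat split; trivial.
  intros n. now exists (a n).
Qed.

Lemma Ana_plus (rho : R) (f g : R -> R -> R) : Ana rho f -> Ana rho g -> Ana rho (fun x y => f x y + g x y).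
Proof.
  intros [a [Ha Hf]] [b [Hb Hg]].
  destruct (geometric_homogeneous _ _ Ha) as (C1 & K1 & HC1 & HK1 & HKr1 & H1).
  destruct (geometric_homogeneous _ _ Hb) as (C2 & K2 & HC2 & HK2 & HKr2 & H2).
  set (K := Rmax K1 K2). assert (HK : K1 <= K /\ K2 <= K) by (split; [apply Rmax_l|apply Rmax_r]).
  assert (Hr := proj1 Ha).
  apply (Ana_of_homogeneous rho (C1 + C2) K (fun n x y => form n (a n) x y + form n (b n) x y)); try lra.
  - unfold K. apply Rmax_case; trivial.
  - intros n. apply homogeneous_le with (C1 * K1 ^ n + C2 * K2 ^ n).
    + assert (P1 : K1 ^ n <= K ^ n) by (apply pow_incr; lra). assert (P2 : K2 ^ n <= K ^ n) by (apply pow_incr; lra).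
      assert (P3 : 0 <= K ^ n) by (apply pow_le; lra).
      apply Rle_trans with ((C1 + C2) * K ^ n).
      * rewrite Rmult_plus_distr_r. apply Rplus_le_compat; now apply Rmult_le_compat_l.
      * rewrite <- (Rmult_1_l ((C1 + C2) * K ^ n)) at 1. apply Rmult_le_compat_r.
        apply Rmult_le_pos; lra. rewrite S_INR. assert (Q := pos_INR n). lra.
    + now apply homogeneous_plus.
  - intros x y Hxy. rewrite Hf, Hg by trivial.
    apply (is_series_plus (fun n => form n (a n) x y)); now apply geometric_series with rho.
Qed.

Lemma Ana_mult (rho : R) (f g : R -> R -> R) : Ana rho f -> Ana rho g -> Ana rho (fun x y => f x y * g x y).
Proof.
  intros [a [Ha Hf]] [b [Hb Hg]].
  destruct (geometric_homogeneous _ _ Ha) as (C1 & K1 & HC1 & HK1 & HKr1 & H1).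
  destruct (geometric_homogeneous _ _ Hb) as (C2 & K2 & HC2 & HK2 & HKr2 & H2).
  set (K := Rmax K1 K2). assert (HK : K1 <= K /\ K2 <= K) by (split; [apply Rmax_l|apply Rmax_r]).
  assert (Hr := proj1 Ha). 
  apply (Ana_of_homogeneous rho (C1 * C2) K
    (fun n x y => psum (fun k => form k (a k) x y * form (n - k) (b (n - k)%nat) x y) (S n))); try lra.
  - now apply Rmult_le_pos.
  - unfold K. apply Rmax_case; trivial.
  - intros n. rewrite <- psum_const. apply homogeneous_psum. intros j Hj.
    replace n with (j + (n - j))%nat at 1 by lia.
    apply homogeneous_le with ((C1 * K1 ^ j) * (C2 * K2 ^ (n - j))).
    + replace (C1 * C2 * K ^ n) with ((C1 * K ^ j) * (C2 * K ^ (n - j))).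
      2: { replace n with (j + (n - j))%nat at 2 by lia. rewrite pow_add. ring. }
      assert (P1 : 0 <= K1 ^ j <= K ^ j) by (split; [apply pow_le; lra|apply pow_incr; lra]).
      assert (P2 : 0 <= K2 ^ (n - j) <= K ^ (n - j)) by (split; [apply pow_le; lra|apply pow_incr; lra]).
      apply Rmult_le_compat; try apply Rmult_le_pos; try apply Rmult_le_compat_l; tauto.
    + now apply homogeneous_mult.
  - intros x y Hxy. rewrite Hf, Hg by trivial.
    apply (is_series_ext (fun n => sum_f_R0 (fun k => form k (a k) x y * form (n - k) (b (n - k)%nat) x y) n)).
    { intros n. apply psum_sum_f_R0. }
    apply (is_series_mult (fun n => form n (a n) x y) (fun n => form n (b n) x y)).
    + now apply geometric_series with rho.
    + now apply geometric_series with rho.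
    + now apply geometric_abs with rho.
    + now apply geometric_abs with rho.
Qed.

(** Course-of-values recursion with choice. The table [st n] holds the first n values and the
    default d elsewhere; the first hypothesis says that step n only looks at values of index below
    n, so completing the table later does no harm. *)
Lemma strong_choice (X : Type) (d : X) (Rel : nat -> (nat -> X) -> X -> Prop) :
  (forall n s s' x, (forall k, (k < n)%nat -> s k = s' k) -> Rel n s x -> Rel n s' x) ->
  (forall n s, (forall k, (k < n)%nat -> Rel k s (s k)) -> exists x, Rel n s x) ->
  exists s, forall n, Rel n s (s n).
Proof.
  intros Hext Hex.
  assert (HF : forall p : nat * (nat -> X), exists x, (exists x', Rel (fst p) (snd p) x') -> Rel (fst p) (snd p) x).
  { intros p. destruct (classic (exists x', Rel (fst p) (snd p) x')) as [[x Hx]|H].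
    - now exists x.
    - exists d. tauto. }
  destruct (choice _ HF) as [F HF'].
  set (st := fix st (n : nat) : nat -> X :=
     match n with O => fun _ => d | S n => fun k => if Nat.eq_dec k n then F (n, st n) else st n k end).
  set (s := fun n => st (S n) n).
  assert (Hst : forall n k, (k < n)%nat -> st n k = s k).
  { induction n as [|n IH]; intros k Hk. lia.
    simpl. destruct (Nat.eq_dec k n) as [->|H].
    - unfold s. simpl. now destruct (Nat.eq_dec n n).
    - apply IH. lia. }
  exists s. intros n. induction n as [n IH] using lt_wf_ind.
  apply Hext with (st n). { intros k Hk. now apply Hst. }
  assert (E : s n = F (n, st n)) by (unfold s; simpl; now destruct (Nat.eq_dec n n)).
  rewrite E. apply (HF' (n, st n)). apply Hex. cbn [fst snd]. intros k Hk. rewrite Hst by trivial.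
  apply Hext with s. { intros j Hj. symmetry. apply Hst. lia. } now apply IH.
Qed.

(** A power series in x alone, presented as a double series: in degree n only the monomial x^n
    occurs. *)
Definition diag (c : nat -> R) : nat -> nat -> R := fun n i => if Nat.eq_dec i n then c n else 0.

Lemma form_diag (c : nat -> R) (n : nat) (x y : R) : form n (diag c n) x y = c n * x ^ n.
Proof.
  destruct n as [|n].
  - rewrite form_0. unfold diag. simpl. ring.
  - rewrite form_S. rewrite (form_ext n _ (fun _ => 0)).
    + unfold diag. destruct (Nat.eq_dec (S n) (S n)); [|lia].
      assert (E : form n (fun _ => 0) x y = 0).
      { clear. induction n as [|n IH]. now rewrite form_0. rewrite form_S, IH. ring. }
      rewrite E. ring.
    + intros i Hi. unfold diag. destruct (Nat.eq_dec i (S n)); trivial. lia.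
Qed.

Lemma fnorm_diag (c : nat -> R) (n : nat) : fnorm n (diag c n) = Rabs (c n).
Proof.
  destruct n as [|n].
  - rewrite fnorm_0. reflexivity.
  - rewrite fnorm_S. rewrite (fnorm_ext n _ (fun _ => 0)).
    + unfold diag. destruct (Nat.eq_dec (S n) (S n)); [|lia].
      assert (E : fnorm n (fun _ => 0) = 0).
      { clear. induction n as [|n IH]. now rewrite fnorm_0, Rabs_R0. rewrite fnorm_S, IH, Rabs_R0. ring. }
      rewrite E. ring.
    + intros i Hi. unfold diag. destruct (Nat.eq_dec i (S n)); trivial. lia.
Qed.

(** The terms form a geometric progression of ratio K / kappa >= 2 in j, so the sum is at most twice
    its last term kappa^2 K^(n-1). Both sides are multiplied by K to include n = 0. *)
Lemma convolution_bound (kappa K : R) (n : nat) : 0 < kappa -> 2 * kappa <= K ->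
  psum (fun j => kappa ^ (S n - j) * K ^ j) n * K <= 2 * kappa ^ 2 * K ^ n.
Proof.
  intros Hk HK. induction n as [|n IH].
  - simpl. nra.
  - rewrite psum_S. rewrite (psum_ext _ (fun j => kappa * (kappa ^ (S n - j) * K ^ j))).
    2: { intros j Hj. replace (S (S n) - j)%nat with (S (S n - j)) by lia. simpl pow. ring. }
    rewrite psum_scal. replace (S (S n) - n)%nat with 2%nat by lia.
    set (S0 := psum (fun j => kappa ^ (S n - j) * K ^ j) n) in *.
    assert (P : 0 <= K ^ n) by (apply pow_le; lra).
    replace ((kappa * S0 + kappa ^ 2 * K ^ n) * K) with (kappa * (S0 * K) + kappa ^ 2 * K ^ n * K) by ring.
    apply Rle_trans with (kappa * (2 * kappa ^ 2 * K ^ n) + kappa ^ 2 * K ^ n * K).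
    + apply Rplus_le_compat_r. apply Rmult_le_compat_l; lra.
    + replace (2 * kappa ^ 2 * K ^ S n) with (kappa ^ 2 * K ^ n * K + K * (kappa ^ 2 * K ^ n)) by (simpl; ring).
      replace (kappa * (2 * kappa ^ 2 * K ^ n)) with ((2 * kappa) * (kappa ^ 2 * K ^ n)) by ring.
      assert (Q : 0 <= kappa ^ 2 * K ^ n) by (apply Rmult_le_pos; trivial; apply pow2_ge_0).
      assert (W := Rmult_le_compat_r _ _ _ Q HK). lra.
Qed.

(** * Weierstrass division *)

(* The quotient is computed degree by degree: since [p] starts in degree 2, the
   part of degree n of [p A] involves only the parts of [A] of degree < n - 1. *)
Lemma weierstrass_division (rho : R) (a p : nat -> nat -> R) :
  geometric rho a -> geometric rho p ->
  (forall n i, (n < 2)%nat -> (i <= n)%nat -> p n i = 0) ->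
  exists (rho' : R) (c : nat -> R) (b : nat -> nat -> R), 0 < rho' <= rho /\
    geometric rho' (diag c) /\ geometric rho' b /\ c O = a O O /\
    forall x y, box rho' x y -> Ev a x y = Ev (diag c) x y + (y + Ev p x y) * Ev b x y.
Proof.
  intros Ha Hp Hp0.
  assert (Hr := proj1 Ha).
  assert (Ha' := Ha). destruct Ha' as (_ & Cg & Kg & HCg & HKg & _ & HG).
  assert (Hp' := Hp). destruct Hp' as (_ & Cp & Kp & HCp & HKp & _ & HP).
  set (kap := Rmax Kg Kp). assert (Hkap : Kg <= kap /\ Kp <= kap) by (split; [apply Rmax_l|apply Rmax_r]).
  assert (Hkap0 : 0 < kap) by lra.
  set (K := Rmax (2 * kap) (4 * Cp * kap ^ 2)).
  (* The first bound is the condition of [convolution_bound]. The second makes the contribution of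
     the earlier parts at most half of C K^n; with C = 2 Cg kap the given series contributes at most
     the other half. *)
  assert (HK1 : 2 * kap <= K) by apply Rmax_l. assert (HK2 : 4 * Cp * kap ^ 2 <= K) by apply Rmax_r.
  set (C := 2 * Cg * kap). assert (HC : 0 <= C) by (unfold C; apply Rmult_le_pos; lra).
  assert (HKn : forall n, 0 <= K ^ n) by (intros n; apply pow_le; lra).
  (* Step n finds the part of degree n of the quotient together with the coefficient of x^(n+1) in
     the remainder. The sum stops at j < n because p has no parts of degree 0 and 1. *)
  set (Rel := fun n (s : nat -> (nat -> R) * R) (z : (nat -> R) * R) =>
    fnorm n (fst z) <= C * K ^ n /\ Rabs (snd z) <= C * K ^ n /\
    forall x y, form (S n) (a (S n)) x y =
      y * form n (fst z) x y + psum (fun j => form j (fst (s j)) x y * form (S n - j) (p (S n - j)%nat) x y) n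
      + snd z * x ^ S n).
  destruct (strong_choice ((nat -> R) * R) (fun _ => 0, 0) Rel) as [s Hs].
  { intros n s s' z Hss (H1 & H2 & H3). split; [trivial|split; trivial].
    intros x y. rewrite H3. f_equal. f_equal. apply psum_ext. intros j Hj. now rewrite Hss. }
  { intros n s Hprev.
    assert (Hh : homogeneous (S n) (Cg * kap ^ S n + Cp * C * psum (fun j => kap ^ (S n - j) * K ^ j) n)
       (fun x y => form (S n) (a (S n)) x y + -1 * psum (fun j => form j (fst (s j)) x y * form (S n - j) (p (S n - j)%nat) x y) n)).
    { apply homogeneous_plus.
      - exists (a (S n)). split; trivial. apply Rle_trans with (1 := HG (S n)).
        apply Rmult_le_compat_l; trivial. apply pow_incr; lra.
      - rewrite <- psum_scal.
        apply homogeneous_le with (Rabs (-1) * psum (fun j => Cp * C * (kap ^ (S n - j) * K ^ j)) n).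
        { rewrite Rabs_left by lra. lra. }
        apply homogeneous_scal, homogeneous_psum. intros j Hj.
        destruct (Hprev j Hj) as (N1 & _ & _).
        replace (S n) with (j + (S n - j))%nat at 1 by lia.
        apply homogeneous_le with ((C * K ^ j) * (Cp * kap ^ (S n - j))). right; ring.
        apply homogeneous_mult.
        + now exists (fst (s j)).
        + exists (p (S n - j)%nat). split; trivial. apply Rle_trans with (1 := HP _).
          apply Rmult_le_compat_l; trivial. apply pow_incr; lra. }
    (* A form of degree n + 1 is y times the form of degree n with the same lower coefficients, plus
       its top coefficient times x^(n+1). *)
    destruct Hh as [e [He1 He2]]. exists (e, e (S n)).
    assert (HB : fnorm (S n) e <= C * K ^ n).
    { apply Rle_trans with (1 := He2).
      assert (B1 := convolution_bound kap K n Hkap0 HK1).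
      set (S0 := psum (fun j => kap ^ (S n - j) * K ^ j) n) in *.
      assert (B2 : kap ^ n <= K ^ n) by (apply pow_incr; lra).
      assert (B3 : Cg * kap ^ S n <= C * K ^ n / 2).
      { unfold C. simpl pow. replace (2 * Cg * kap * K ^ n / 2) with (Cg * kap * K ^ n) by field.
        rewrite <- Rmult_assoc. apply Rmult_le_compat_l; trivial. apply Rmult_le_pos; lra. }
      assert (B4 : Cp * C * S0 <= C * K ^ n / 2).
      { apply Rmult_le_reg_r with K. lra.
        apply Rle_trans with (Cp * C * (2 * kap ^ 2 * K ^ n)).
        - rewrite Rmult_assoc. apply Rmult_le_compat_l; trivial. now apply Rmult_le_pos.
        - replace (Cp * C * (2 * kap ^ 2 * K ^ n)) with ((4 * Cp * kap ^ 2) * (C * K ^ n / 2)) by field.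
          replace (C * K ^ n / 2 * K) with (K * (C * K ^ n / 2)) by ring.
          apply Rmult_le_compat_r; trivial. assert (X := Rmult_le_pos _ _ HC (HKn n)). lra. }
      lra. }
    rewrite fnorm_S in HB.
    split; [|split]; simpl fst; simpl snd.
    - assert (X := Rabs_pos (e (S n))). lra.
    - assert (X := fnorm_pos n e). lra.
    - intros x y. assert (X := He1 x y). rewrite (form_S n e) in X. cbn beta in X. lra. }
  set (b := fun n => fst (s n)). set (c := fun n => match n with O => a O O | S n => snd (s n) end).
  set (rho' := Rmin rho (/ (2 * K))).
  assert (Hr' : 0 < rho' <= rho).
  { split. apply Rmin_case; trivial. apply Rinv_0_lt_compat; lra. apply Rmin_l. }
  assert (HKr : K * rho' < 1).
  { apply Rle_lt_trans with (K * / (2 * K)). apply Rmult_le_compat_l. lra. apply Rmin_r.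
    replace (K * / (2 * K)) with (/ 2) by (field; lra). lra. }
  assert (Hb : geometric rho' b).
  { split. lra. exists C, K. repeat split; trivial. lra. intros n. apply Hs. }
  assert (Hc : geometric rho' (diag c)).
  { split. lra. exists (Rabs (a O O) + C / K), K. repeat split; trivial.
    - assert (X := Rabs_pos (a O O)). assert (Y : 0 <= C / K) by (apply Rdiv_le_0_compat; lra). lra.
    - lra.
    - intros n. rewrite fnorm_diag. destruct n as [|n].
      + simpl. assert (Y : 0 <= C / K) by (apply Rdiv_le_0_compat; lra). lra.
      + simpl c. destruct (Hs n) as (_ & X & _). apply Rle_trans with (1 := X).
        simpl pow. rewrite Rmult_plus_distr_r. replace (C / K * (K * K ^ n)) with (C * K ^ n) by (field; lra).
        assert (Y : 0 <= Rabs (a O O) * (K * K ^ n)).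
        { apply Rmult_le_pos. apply Rabs_pos. apply Rmult_le_pos; trivial. lra. }
        lra. }
  exists rho', c, b. repeat split; try apply Hr'; try apply Hb; try apply Hc.
  intros x y Hxy.
  assert (Ha1 := geometric_shrink rho rho' a Hr' Ha). assert (Hp1 := geometric_shrink rho rho' p Hr' Hp).
  assert (Sb := geometric_series rho' b x y Hb Hxy).
  assert (Sp := geometric_series rho' p x y Hp1 Hxy).
  assert (Sc := geometric_series rho' (diag c) x y Hc Hxy).
  assert (Sbp := is_series_mult _ _ _ _ Sb Sp (geometric_abs rho' b x y Hb Hxy) (geometric_abs rho' p x y Hp1 Hxy)).
  assert (P0 : forall n, (n < 2)%nat -> form n (p n) x y = 0).
  { intros n Hn. rewrite (form_ext n _ (fun _ => 0)) by (intros; now apply Hp0).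
    clear. induction n as [|n IH]. now rewrite form_0. rewrite form_S, IH. ring. }
  set (u := fun n => match n with O => 0 | S n => y * form n (b n) x y end).
  assert (Su : is_series u (y * Ev b x y)).
  { apply is_series_decr_1. evar_last.
    - exact (is_series_scal_l y _ _ Sb).
    - unfold plus, opp, scal; simpl. unfold mult; simpl. ring. }
  apply is_series_unique.
  apply (is_series_ext (fun n => plus (form n (diag c n) x y) (plus (u n) (sum_f_R0 (fun k => form k (b k) x y * form (n - k) (p (n - k)%nat) x y) n)))).
  - intros n. rewrite psum_sum_f_R0, form_diag. unfold plus; cbn -[psum form pow u c].
    destruct n as [|n].
    + rewrite form_0. rewrite psum_S, Nat.sub_diag, (P0 O) by lia. unfold c, u, psum. cbn. ring.
    + destruct (Hs n) as (_ & _ & E). rewrite E. unfold u. rewrite !psum_S. simpl c.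
      rewrite Nat.sub_diag. rewrite (P0 O) by lia. replace (S n - n)%nat with 1%nat by lia.
      rewrite (P0 1%nat) by lia. fold b. unfold b. ring.
  - evar_last. exact (is_series_plus _ _ _ _ Sc (is_series_plus _ _ _ _ Su Sbp)).
    unfold plus; simpl. ring.
Qed.

Lemma Ev_diag_factor (rho : R) (c : nat -> R) (k : nat) :
  geometric rho (diag c) -> (forall j, (j < k)%nat -> c j = 0) ->
  geometric rho (diag (fun n => c (n + k)%nat)) /\
  forall x y, box rho x y -> Ev (diag c) x y = x ^ k * Ev (diag (fun n => c (n + k)%nat)) x y.
Proof.
  intros Hc H0.
  assert (Hg : geometric rho (diag (fun n => c (n + k)%nat))).
  { destruct Hc as (Hr & C & K & HC & HK & HKr & H). split; trivial. exists (C * K ^ k), K.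
    repeat split; trivial. apply Rmult_le_pos; trivial. apply pow_le; lra.
    intros n. rewrite fnorm_diag. assert (X := H (n + k)%nat). rewrite fnorm_diag in X.
    apply Rle_trans with (1 := X). rewrite pow_add. right; ring. }
  split; trivial. intros x y Hxy.
  assert (S1 := geometric_series rho _ x y Hc Hxy). assert (S2 := geometric_series rho _ x y Hg Hxy).
  apply is_series_unique.
  apply (is_series_ext (fun n => c n * x ^ n)). { intros n. now rewrite form_diag. }
  apply (is_series_ext _ (fun n => c (n + k)%nat * x ^ n)) in S2. 2: { intros n. now rewrite (form_diag (fun j => c (j + k)%nat)). }
  clear S1 Hg Hc. revert c H0 S2. induction k as [|k IH]; intros c H0 S2.
  - apply (is_series_ext (fun n => c (n + 0)%nat * x ^ n)). { intros n. now rewrite Nat.add_0_r. }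
    simpl. rewrite Rmult_1_l. exact S2.
  - assert (T := IH (fun n => c (S n))). apply is_series_decr_1.
    apply (is_series_ext (fun n => scal x (c (S n) * x ^ n))).
    { intros n. unfold scal; simpl; unfold mult; simpl. ring. }
    evar_last.
    + apply (is_series_scal_l x (fun n => c (S n) * x ^ n)). apply T.
      * intros j Hj. apply H0. lia.
      * apply (is_series_ext (fun n => c (n + S k)%nat * x ^ n)).
        { intros n. now rewrite Nat.add_succ_r. }
        replace (Ev (diag (fun n => c (S (n + k)))) x y) with (Ev (diag (fun n => c (n + S k)%nat)) x y).
        { exact S2. }
        apply Series_ext. intros n. apply form_ext. intros i _. unfold diag. now rewrite Nat.add_succ_r.
    + rewrite (H0 O) by lia. unfold plus, opp, scal; simpl; unfold mult; simpl.
      replace (Ev (diag (fun n => c (S (n + k)))) x y) with (Ev (diag (fun n => c (n + S k)%nat)) x y).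
      { ring. }
      apply Series_ext. intros n. apply form_ext. intros i _. unfold diag. now rewrite Nat.add_succ_r.
Qed.

(** * Foci without characteristic directions *)

Lemma cos_2PI_shift (th : R) : cos (th + 2 * PI) = cos th.
Proof. replace (th + 2 * PI) with (th + 2 * INR 1 * PI) by (simpl; ring). apply cos_period. Qed.

Lemma sin_2PI_shift (th : R) : sin (th + 2 * PI) = sin th.
Proof. replace (th + 2 * PI) with (th + 2 * INR 1 * PI) by (simpl; ring). apply sin_period. Qed.

Lemma box_polar (rho th r : R) : Rabs r < rho -> box rho (r * cos th) (r * sin th).
Proof.
  intros Hr. assert (Hc := COS_bound th). assert (Hs := SIN_bound th).
  assert (H : forall u, -1 <= u <= 1 -> Rabs (r * u) < rho).
  { intros u Hu. rewrite Rabs_mult. apply Rle_lt_trans with (2 := Hr).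
    rewrite <- (Rmult_1_r (Rabs r)) at 2. apply Rmult_le_compat_l. apply Rabs_pos. apply Rabs_le; lra. }
  split; apply H; lra.
Qed.

(** The factor r^k is extracted one degree at a time: a form of degree n + 1 is y times a form of
    degree n plus x times a multiple of x^n, and x and y each contain a factor r. No division by r
    occurs, so the quotient is regular at r = 0. *)
Lemma Ev_polar (rho : R) (a : nat -> nat -> R) (k : nat) :
  geometric rho a -> (forall n i, (n < k)%nat -> (i <= n)%nat -> a n i = 0) ->
  exists f, Ck 2 (strip rho) f /\ (forall th r, f (th + 2 * PI) r = f th r) /\
    forall th r, Rabs r < rho -> Ev a (r * cos th) (r * sin th) = r ^ k * f th r.
Proof.
  revert a; induction k as [|k IH]; intros a Ha H0.
  - exists (fun th r => Ev a (r * cos th) (r * sin th)). split; [|split].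
    + apply Ck_comp with (box rho).
      * now apply Ev_Ck.
      * apply Ck_mult. apply Ck_snd. apply Ck_cos_sin.
      * apply Ck_mult. apply Ck_snd. apply Ck_cos_sin.
      * intros th r Hr. now apply box_polar.
    + intros th r. now rewrite cos_2PI_shift, sin_2PI_shift.
    + intros. simpl. ring.
  - set (b := fun n => a (S n)). set (c := diag (fun n => a (S n) (S n))).
    assert (Hb : geometric rho b /\ geometric rho c).
    { destruct Ha as (Hr & C & K & HC & HK & HKr & H).
      assert (X : forall n, fnorm n (a (S n)) + Rabs (a (S n) (S n)) <= C * K * K ^ n).
      { intros n. rewrite <- fnorm_S. apply Rle_trans with (1 := H (S n)). simpl. right; ring. }
      split; (split; [trivial|]); exists (C * K), K; (split; [apply Rmult_le_pos; lra|]); (split; [trivial|]); (split; [trivial|]); intros n.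
      - assert (Y := X n). assert (Z := Rabs_pos (a (S n) (S n))). unfold b. lra.
      - assert (Y := X n). assert (Z := fnorm_pos n (a (S n))). unfold c. rewrite fnorm_diag. lra. }
    destruct Hb as [Hb Hc].
    destruct (IH b Hb) as (f & Hf1 & Hf2 & Hf3). { intros n i Hn Hi. apply H0; lia. }
    destruct (IH c Hc) as (g & Hg1 & Hg2 & Hg3).
    { intros n i Hn Hi. unfold c, diag. destruct (Nat.eq_dec i n); trivial. apply H0; lia. }
    exists (fun th r => sin th * f th r + cos th * g th r). split; [|split].
    + apply Ck_plus; apply Ck_mult; trivial; apply Ck_cos_sin.
    + intros th r. now rewrite cos_2PI_shift, sin_2PI_shift, Hf2, Hg2.
    + intros th r Hr.
      replace (r ^ S k * (sin th * f th r + cos th * g th r))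
        with (r * sin th * (r ^ k * f th r) + r * cos th * (r ^ k * g th r)) by (simpl; ring).
      rewrite <- Hf3, <- Hg3 by trivial. assert (Hx := box_polar rho th r Hr).
      set (x := r * cos th) in *. set (y := r * sin th) in *.
      assert (Sb := geometric_series rho b x y Hb Hx). assert (Sc := geometric_series rho c x y Hc Hx).
      apply is_series_unique. apply is_series_decr_1.
      apply (is_series_ext (fun n => plus (scal y (form n (b n) x y)) (scal x (form n (c n) x y)))).
      { intros n. rewrite form_S. unfold c. rewrite form_diag. unfold plus, scal; simpl; unfold mult; simpl. unfold b. ring. }
      evar_last.
      * apply (is_series_plus (fun n => scal y (form n (b n) x y))).
        exact (is_series_scal_l y _ _ Sb). exact (is_series_scal_l x _ _ Sc).
      * rewrite form_0, (H0 O O) by lia. unfold plus, scal, opp; simpl; unfold mult; simpl. ring.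
Qed.

Lemma form_polar (n : nat) (c : nat -> R) (r x y : R) : form n c (r * x) (r * y) = r ^ n * form n c x y.
Proof.
  induction n as [|n IH].
  - rewrite !form_0. simpl. ring.
  - rewrite !form_S, IH, Rpow_mult_distr. simpl. ring.
Qed.

Lemma Ck_form (k n : nat) (c : nat -> R) : Ck k (fun _ _ => True) (form n c).
Proof.
  assert (HO : open_2d (fun _ _ => True)) by (intros x y _; now apply locally_2d_forall).
  induction n as [|n IH].
  - apply Ck_ext with (fun _ _ => c O); trivial. { intros; now rewrite form_0. } apply Ck_const.
  - apply Ck_ext with (fun x y => y * form n c x y + c (S n) * x ^ S n); trivial.
    { intros; now rewrite form_S. }
    apply Ck_plus; apply Ck_mult; trivial. apply Ck_snd. apply Ck_const. apply Ck_pow, Ck_fst.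
Qed.

Lemma form_append (n : nat) (e : nat -> R) (k : R) :
  exists e', forall x y, y * form n e x y + k * x ^ S n = form (S n) e' x y.
Proof.
  exists (fun i => if Nat.eq_dec i (S n) then k else e i). intros x y. rewrite form_S.
  rewrite (form_ext n (fun i => if Nat.eq_dec i (S n) then k else e i) e).
  - destruct (Nat.eq_dec (S n) (S n)); [ring|lia].
  - intros i Hi. destruct (Nat.eq_dec i (S n)); [lia|trivial].
Qed.

Lemma form_shift (n : nat) (g : nat -> R) (x y : R) : g O = 0 ->
  form (S n) g x y = x * form n (fun i => g (S i)) x y.
Proof.
  intros H. induction n as [|n IH].
  - rewrite form_S, !form_0, H. simpl. ring.
  - rewrite form_S, IH, form_S. simpl. ring.
Qed.

(** If x0 is non-zero, division by y0 x - x0 y leaves a remainder k x^(n+1), and evaluation at the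
    zero (x0, y0) gives k = 0. If x0 = 0 the coefficient of y^(n+1) vanishes, and x factors out. *)
Lemma form_linear_factor (n : nat) (g : nat -> R) (x0 y0 : R) :
  x0 <> 0 \/ y0 <> 0 -> form (S n) g x0 y0 = 0 ->
  exists e, forall x y, form (S n) g x y = (y0 * x - x0 * y) * form n e x y.
Proof.
  intros H0 Hg. destruct (Req_dec x0 0) as [Hx|Hx].
  - assert (Hy : y0 <> 0) by tauto. subst x0.
    assert (E : g O = 0).
    { assert (X : forall m, form m g 0 y0 = g O * y0 ^ m).
      { induction m as [|m IH]. rewrite form_0. simpl. ring. rewrite form_S, IH. simpl. ring. }
      rewrite X in Hg. apply Rmult_integral in Hg. destruct Hg as [Hg|Hg]; trivial.
      exfalso. now apply (pow_nonzero y0 (S n)). }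
    exists (fun i => / y0 * g (S i)). intros x y. rewrite <- form_scal, form_shift by trivial. now field.
  - assert (X : exists e k, forall x y, form (S n) g x y = (y0 * x - x0 * y) * form n e x y + k * x ^ S n).
    { clear Hg. induction n as [|n (e & k & IH)].
      - exists (fun _ => - g O / x0), (g 1%nat + y0 * g O / x0). intros x y. rewrite form_S, !form_0. simpl. now field.
      - destruct (form_append n e (- (k / x0))) as [e' He'].
        exists e', (k * y0 / x0 + g (S (S n))). intros x y. rewrite form_S, IH, <- He'. simpl. now field. }
    destruct X as (e & k & X). exists e. intros x y. rewrite X in Hg |- *.
    assert (k = 0); [|subst k; ring].
    assert (E : k * x0 ^ S n = 0) by lra. apply Rmult_integral in E. destruct E as [E|E]; trivial.
    exfalso. now apply (pow_nonzero x0 (S n)).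
Qed.

(** A non-trivial zero (x, y) of the form gives the linear factor with coefficients (y, - x), which
    is a characteristic direction. *)
Lemma no_characteristic_direction (d : nat) (p q : nat -> R) :
  ~ (exists a b, characteristic_direction d p q a b) ->
  forall x y, x <> 0 \/ y <> 0 -> x * form d q x y - y * form d p x y <> 0.
Proof.
  intros H x y Hxy E. apply H.
  assert (Hh : homogeneous (S d) (fnorm d q + Rabs (-1) * fnorm d p)
     (fun x y => x * form d q x y + -1 * (y * form d p x y))).
  { apply homogeneous_plus.
    - apply homogeneous_mult_x. exists q. split; trivial. lra.
    - apply homogeneous_scal, homogeneous_mult_y. exists p. split; trivial. lra. }
  destruct Hh as [g [Hg _]].
  destruct (form_linear_factor d g x y Hxy) as [e He].
  { rewrite <- Hg. lra. }
  exists y, (- x). split. { destruct Hxy; [right|left]; lra. }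
  exists e. intros u v. assert (X := Hg u v). rewrite He in X. cbn beta in X. lra.
Qed.

(** By periodicity 1 / B(th, 0) is bounded by some L, and B is Lipschitz in r with some constant M.
    A zero at height r would require |r| >= 1 / (M L). *)
Lemma nonvanishing_strip (rho : R) (B : R -> R -> R) : 0 < rho -> Ck 2 (strip rho) B ->
  (forall th r, B (th + 2 * PI) r = B th r) -> (forall th, B th 0 <> 0) ->
  exists delta, 0 < delta <= rho /\ forall th r, Rabs r < delta -> B th r <> 0.
Proof.
  intros Hrho HB Hper H0.
  destruct (Ck_periodic 1 rho B HB Hper) as (ft & fr & HD & _ & Hfr & _ & Pfr).
  destruct (strip_bounded rho fr Hrho (Ck_0 _ _ _ Hfr) Pfr) as (M & HM & HfM).
  assert (Hz : Rabs 0 < rho) by (rewrite Rabs_R0; lra).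
  destruct (strip_bounded rho (fun th _ => / B th 0) Hrho) as (L & HL & HBL).
  { intros th r Hr. apply continuity_2d_pt_inv; trivial.
    apply (continuity_2d_pt_comp B (fun th _ => th) (fun _ _ => 0)).
    - apply (Ck_0 _ _ _ HB). exact Hz.
    - apply continuity_2d_pt_id1.
    - apply continuity_2d_pt_const. }
  { intros th r _. now rewrite Hper. }
  exists (Rmin (rho / 2) (/ (2 * M * L))).
  assert (HML : 0 < 2 * M * L) by (apply Rmult_lt_0_compat; lra).
  split.
  { split. apply Rmin_case. lra. now apply Rinv_0_lt_compat. apply Rle_trans with (1 := Rmin_l _ _). lra. }
  intros th r Hr E.
  assert (R1 := Rlt_le_trans _ _ _ Hr (Rmin_l _ _)). assert (R2 := Rlt_le_trans _ _ _ Hr (Rmin_r _ _)).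
  assert (Lip : Rabs (B th r - B th 0) <= M * Rabs (r - 0)).
  { apply (derive_lipschitz (fun r => B th r) (fun r => fr th r) M (- (rho / 2)) (rho / 2)).
    - intros u Hu. apply differentiable_is_derive with (ft th u). apply HD.
      apply Rle_lt_trans with (rho / 2). apply Rabs_le; lra. lra.
    - intros u Hu. apply HfM. apply Rabs_le; lra.
    - apply Rabs_def2 in R1. lra.
    - lra. }
  rewrite E, Rminus_0_r, Rminus_0_l, Rabs_Ropp in Lip.
  assert (Z : Rabs (/ B th 0) <= L). { apply (HBL th 0). rewrite Rabs_R0. lra. }
  assert (One : Rabs (/ B th 0) * Rabs (B th 0) = 1).
  { rewrite <- Rabs_mult, Rinv_l by trivial. apply Rabs_R1. }
  assert (W : 1 <= L * (M * Rabs r)).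
  { rewrite <- One. apply Rmult_le_compat; trivial; apply Rabs_pos. }
  assert (Y : L * M * Rabs r < L * M * / (2 * M * L)) by (apply Rmult_lt_compat_l; trivial; now apply Rmult_lt_0_compat).
  replace (L * M * / (2 * M * L)) with (/ 2) in Y by (field; lra). lra.
Qed.

Lemma locally_pair (W : R * R -> Prop) (x y : R) : locally (x, y) W <-> locally_2d (fun u v => W (u, v)) x y.
Proof.
  rewrite locally_2d_locally. split; apply filter_imp; now intros [u v].
Qed.

(** Both directions of time in one notion: for sg = -1 it is a negative half-orbit parametrised
    backwards. The orbit avoids the origin and tends to it. *)
Definition signed_orbit (P Q : R -> R -> R) (sg : R) (x y : R -> R) : Prop :=
  (sg = 1 \/ sg = -1) /\
  (forall t, 0 <= t -> (x t, y t) <> (0, 0) /\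
     is_derive x t (sg * P (x t) (y t)) /\ is_derive y t (sg * Q (x t) (y t))) /\
  is_lim x p_infty 0 /\ is_lim y p_infty 0.

Lemma focus_orbit (D : R * R -> Prop) (P Q : R -> R -> R) : is_focus D P Q ->
  exists sg x y, signed_orbit P Q sg x y /\ spirals_to_origin x y.
Proof.
  intros [_ Hf]. apply locally_pair in Hf. destruct Hf as [d Hd]. cbn [fst snd] in Hd.
  assert (Hd2 : 0 < d / 2) by (assert (X := cond_pos d); lra).
  destruct (Hd (d / 2) 0) as (x & y & _ & _ & Hsp & Hor).
  { rewrite Rminus_0_r, Rabs_pos_eq; lra. }
  { rewrite Rminus_0_r, Rabs_R0. apply cond_pos. }
  { intros E. injection E. lra. }
  assert (Hs := Hsp). destruct Hs as (r & th & H1 & H2 & H3).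
  assert (Hxy : forall t, 0 <= t -> (x t, y t) <> (0, 0)).
  { intros t Ht E. destruct (H1 t Ht) as (A & _ & B & C). injection E as E1 E2.
    assert (S2 := sin2_cos2_pow (th t)).
    assert (Hc : cos (th t) = 0) by (rewrite E1 in B; symmetry in B; apply Rmult_integral in B; lra).
    assert (Hss : sin (th t) = 0) by (rewrite E2 in C; symmetry in C; apply Rmult_integral in C; lra).
    rewrite Hc, Hss in S2. lra. }
  assert (Hlim : forall u v : R -> R, (forall t, 0 <= t -> u t = r t * v t) -> (forall t, Rabs (v t) <= 1) -> is_lim u p_infty 0).
  { intros u v Hu Hv. apply is_lim_spec. apply is_lim_spec in H2. intros eps.
    destruct (H2 eps) as [T HT]. exists (Rmax T 0). intros t Ht.
    assert (A := Rle_lt_trans _ _ _ (Rmax_l _ _) Ht). assert (B := Rle_lt_trans _ _ _ (Rmax_r _ _) Ht).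
    rewrite Hu by lra. apply Rle_lt_trans with (2 := HT t A). rewrite !Rminus_0_r, Rabs_mult.
    rewrite <- (Rmult_1_r (Rabs (r t))) at 2. apply Rmult_le_compat_l; trivial. apply Rabs_pos. }
  assert (Lx : is_lim x p_infty 0).
  { apply (Hlim x (fun t => cos (th t))). intros; now apply H1. intros t. apply Rabs_le, COS_bound. }
  assert (Ly : is_lim y p_infty 0).
  { apply (Hlim y (fun t => sin (th t))). intros; now apply H1. intros t. apply Rabs_le, SIN_bound. }
  destruct Hor as [Hor|Hor]; [exists 1|exists (-1)]; exists x, y; (split; [|trivial]);
    (split; [auto|]); (split; [|now split]); intros t Ht; destruct (Hor t Ht) as (_ & A & B);
    (split; [now apply Hxy|]); split; (evar_last; [eassumption|cbn beta; ring]).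
Qed.

Lemma box_in_open (D : R * R -> Prop) : open D -> D (0, 0) ->
  exists eta, 0 < eta /\ forall x y, box eta x y -> D (x, y).
Proof.
  intros HD H0. assert (H := HD (0, 0) H0). apply locally_pair in H. destruct H as [d Hd].
  exists d. split. apply cond_pos. intros x y [Hx Hy]. apply (Hd x y); now rewrite Rminus_0_r.
Qed.

Lemma iif_on_box (D : R * R -> Prop) (P Q V0 : R -> R -> R) (e0 : R) : 0 < e0 ->
  (forall x y, box e0 x y -> D (x, y)) ->
  inverse_integrating_factor (fun z => Rabs (fst z) < e0 /\ Rabs (snd z) < e0) P Q V0 ->
  has_inverse_integrating_factor D P Q.
Proof.
  intros He HD HV. exists (fun z => Rabs (fst z) < e0 /\ Rabs (snd z) < e0), V0.
  split; [|split; [|split]]; trivial.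
  - intros [x y] Hz. apply locally_pair. exact (box_open e0 x y Hz).
  - cbn [fst snd]. rewrite Rabs_R0. auto.
  - intros [x y] Hz. now apply HD.
Qed.

(** With equal weights both components are r^d times the functions [ph] and [qh], regular up to r =
    0, where they reduce to p_d and q_d on the unit circle. Hence B(th, 0) is x q_d - y p_d on that
    circle. *)
Lemma degenerate_focus (D : R * R -> Prop) (d : nat) (p q : nat -> R) (P1 Q1 : R -> R -> R) :
  open D -> D (0, 0) -> (1 < d)%nat ->
  order_at_least (d + 1) P1 -> order_at_least (d + 1) Q1 ->
  ~ (exists a b : R, characteristic_direction d p q a b) ->
  is_focus D (fun x y => form d p x y + P1 x y) (fun x y => form d q x y + Q1 x y) ->
  has_inverse_integrating_factor D (fun x y => form d p x y + P1 x y) (fun x y => form d q x y + Q1 x y).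
Proof.
  intros HDo HD0 Hd (a & Ha & Ha0) (b & Hb & Hb0) Hchar Hfoc.
  destruct (has_expansion_geometric _ _ Ha) as (r1 & Hg1 & HE1).
  destruct (has_expansion_geometric _ _ Hb) as (r2 & Hg2 & HE2).
  set (rho := Rmin r1 r2).
  assert (Hr : 0 < rho /\ rho <= r1 /\ rho <= r2).
  { split; [|split; [apply Rmin_l|apply Rmin_r]]. apply Rmin_case. apply Hg1. apply Hg2. }
  apply geometric_shrink with (rho' := rho) in Hg1; [|lra].
  apply geometric_shrink with (rho' := rho) in Hg2; [|lra].
  assert (HP1 : forall x y, box rho x y -> P1 x y = Ev a x y).
  { intros x y [Hx Hy]. apply HE1. split; lra. }
  assert (HQ1 : forall x y, box rho x y -> Q1 x y = Ev b x y).
  { intros x y [Hx Hy]. apply HE2. split; lra. }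
  destruct (Ev_polar rho a (d + 1) Hg1 Ha0) as (f & Hf1 & Hf2 & Hf3).
  destruct (Ev_polar rho b (d + 1) Hg2 Hb0) as (g & Hh1 & Hh2 & Hh3).
  set (ph := fun th r => form d p (cos th) (sin th) + r * f th r).
  set (qh := fun th r => form d q (cos th) (sin th) + r * g th r).
  assert (Hform : forall c, Ck 2 (strip rho) (fun th _ => form d c (cos th) (sin th))).
  { intros c. apply Ck_comp with (fun _ _ => True); trivial. apply Ck_form. apply Ck_cos_sin. apply Ck_cos_sin. }
  assert (Cp : Ck 2 (strip rho) ph).
  { apply Ck_plus. apply Hform. apply Ck_mult; trivial. apply Ck_snd. }
  assert (Cq : Ck 2 (strip rho) qh).
  { apply Ck_plus. apply Hform. apply Ck_mult; trivial. apply Ck_snd. }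
  assert (Pp : forall th r, ph (th + 2 * PI) r = ph th r).
  { intros. unfold ph. now rewrite cos_2PI_shift, sin_2PI_shift, Hf2. }
  assert (Pq : forall th r, qh (th + 2 * PI) r = qh th r).
  { intros. unfold qh. now rewrite cos_2PI_shift, sin_2PI_shift, Hh2. }
  set (A := fun th r => cos th * ph th r + sin th * qh th r).
  set (B := fun th r => cos th * qh th r - sin th * ph th r).
  assert (CA : Ck 2 (strip rho) A).
  { apply Ck_plus; apply Ck_mult; trivial; apply Ck_cos_sin. }
  assert (CB : Ck 2 (strip rho) B).
  { apply Ck_minus; [apply strip_open| |]; apply Ck_mult; trivial; apply Ck_cos_sin. }
  destruct (nonvanishing_strip rho B) as (delta & Hdel & HB); [tauto|trivial| | |].
  { intros. unfold B. now rewrite cos_2PI_shift, sin_2PI_shift, Pp, Pq. }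
  { intros th. unfold B, ph, qh. rewrite !Rmult_0_l, !Rplus_0_r.
    apply no_characteristic_direction; trivial. assert (X := sin2_cos2_pow th).
    destruct (Req_dec (cos th) 0) as [E|E]; [right|left]; trivial. intros E'. rewrite E, E' in X. lra. }
  destruct (focus_orbit D _ _ Hfoc) as (sg & x & y & (Hsg & Hor & Lx & Ly) & _).
  destruct (box_in_open D HDo HD0) as (eta & Heta & HDe).
  destruct (Ck_form 1 d p) as (px & py & Dp & _). destruct (Ck_form 1 d q) as (qx & qy & Dq & _).
  assert (AP : Ana rho P1) by (exists a; auto). assert (AQ : Ana rho Q1) by (exists b; auto).
  destruct (Ana_derivatives rho P1 AP) as (P1x & P1y & _ & _ & DP1).
  destruct (Ana_derivatives rho Q1 AQ) as (Q1x & Q1y & _ & _ & DQ1).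
  set (dl := Rmin delta 1).
  assert (Hdl : 0 < dl /\ dl <= delta /\ dl <= 1).
  { split; [|split; [apply Rmin_l|apply Rmin_r]]. apply Rmin_case; lra. }
  assert (Hsub : forall th r, strip dl th r -> strip rho th r) by (unfold strip; intros; lra).
  assert (HPp : forall th r, 0 < r < dl -> form d p (r * cos th) (r ^ 1 * sin th) + P1 (r * cos th) (r ^ 1 * sin th) = r ^ d * ph th r).
  { intros th r Hrr. rewrite pow_1. assert (X : Rabs r < rho) by (rewrite Rabs_pos_eq; lra).
    rewrite HP1, Hf3, form_polar by (trivial; now apply box_polar).
    unfold ph. replace (d + 1)%nat with (S d) by lia. simpl. ring. }
  assert (HQq : forall th r, 0 < r < dl -> form d q (r * cos th) (r ^ 1 * sin th) + Q1 (r * cos th) (r ^ 1 * sin th) = r ^ d * qh th r).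
  { intros th r Hrr. rewrite pow_1. assert (X : Rabs r < rho) by (rewrite Rabs_pos_eq; lra).
    rewrite HQ1, Hh3, form_polar by (trivial; now apply box_polar).
    unfold qh. replace (d + 1)%nat with (S d) by lia. simpl. ring. }
  (* The choice N = 0, m = d - 2 makes the exponent k equal to d; here d > 1 is used. *)
  destruct (planar_conclusion 0 (d - 2)
    (fun x y => form d p x y + P1 x y) (fun x y => form d q x y + Q1 x y)
    (fun x y => px x y + P1x x y) (fun x y => py x y + P1y x y)
    (fun x y => qx x y + Q1x x y) (fun x y => qy x y + Q1y x y) A B dl) with (sg := sg) (x := x) (y := y) (eta := eta)
    as (V0 & e0 & He0 & HV); trivial; try lra.
  - intros u v Hu Hv. apply differentiable_plus. now apply Dp. apply DP1. split; lra.
  - intros u v Hu Hv. apply differentiable_plus. now apply Dq. apply DQ1. split; lra.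
  - now apply Ck_subset with (strip rho).
  - now apply Ck_subset with (strip rho).
  - intros th r Hrr. apply HB. lra.
  - intros th r. unfold A. now rewrite cos_2PI_shift, sin_2PI_shift, Pp, Pq.
  - intros th r. unfold B. now rewrite cos_2PI_shift, sin_2PI_shift, Pp, Pq.
  - intros th r Hrr. cbv beta. rewrite HPp, HQq by trivial. replace (0 + 2 + (d - 2))%nat with d by lia.
    unfold B. simpl. ring.
  - intros th r Hrr. cbv beta. rewrite HPp, HQq by trivial. replace (0 + 2 + (d - 2))%nat with d by lia.
    unfold A. simpl. ring.
  - apply iif_on_box with V0 e0; trivial; try lra.
    intros u v [Hu Hv]. apply HDe. split; lra.
Qed.

(** * Barriers *)

Lemma is_derive_sign (f : R -> R) (s l : R) : is_derive f s l -> 0 < l ->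
  exists d, 0 < d /\ forall u, Rabs (u - s) < d -> (s < u -> f s < f u) /\ (u < s -> f u < f s).
Proof.
  intros Hf Hl. apply is_derive_Reals in Hf. destruct (Hf (l / 2)) as [d Hd]. lra.
  exists d. split. apply cond_pos. intros u Hu.
  destruct (Req_dec u s) as [->|Hn]. { split; intros; lra. }
  assert (X := Hd (u - s)). replace (s + (u - s)) with u in X by ring.
  assert (Y : Rabs ((f u - f s) / (u - s) - l) < l / 2) by (apply X; trivial; lra).
  apply Rabs_def2 in Y.
  assert (Z : f u - f s = (f u - f s) / (u - s) * (u - s)) by (field; lra).
  set (q := (f u - f s) / (u - s)) in *.
  split; intros Hs.
  - assert (0 < q * (u - s)) by (apply Rmult_lt_0_compat; lra). lra.
  - assert (0 < q * (s - u)) by (apply Rmult_lt_0_compat; lra). nra.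
Qed.

(* [w] can only vanish upwards while [0 < X], and at [X = 0] the two functions
   satisfy [X' = w]: the quadrant is invariant because the corner is avoided. *)
Lemma quadrant_invariant (X w dX dw : R -> R) (t1 : R) :
  (forall t, t1 <= t -> is_derive X t (dX t) /\ is_derive w t (dw t)) ->
  (forall t, t1 <= t -> X t = 0 -> dX t = w t) ->
  (forall t, t1 <= t -> 0 < X t -> w t = 0 -> 0 < dw t) ->
  (forall t, t1 <= t -> ~ (X t = 0 /\ w t = 0)) ->
  0 <= X t1 -> 0 < w t1 ->
  forall t, t1 <= t -> 0 <= X t /\ 0 < w t.
Proof.
  intros HD HX Hw Hc HX1 Hw1.
  assert (CX : forall t, t1 <= t -> continuous X t).
  { intros t Ht. apply (ex_derive_continuous X). exists (dX t). now apply HD. }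
  assert (Cw : forall t, t1 <= t -> continuous w t).
  { intros t Ht. apply (ex_derive_continuous w). exists (dw t). now apply HD. }
  intros t2 Ht2. apply NNPP. intros Hbad.
  (* The times up to which the solution has stayed in the quadrant. Membership passes to their least
     upper bound s by continuity and then extends beyond s, which is the contradiction. *)
  set (E := fun s => t1 <= s <= t2 /\ forall u, t1 <= u <= s -> 0 <= X u /\ 0 < w u).
  destruct (completeness E) as [s [Hub Hlub]].
  { exists t2. intros s [Hs _]. lra. }
  { exists t1. split. lra. intros u Hu. replace u with t1 by lra. now split. }
  assert (Hs : t1 <= s <= t2).
  { split. apply Hub. split. lra. intros u Hu. replace u with t1 by lra. now split.
    apply Hlub. intros v [Hv _]. lra. }
  assert (Hbelow : forall u, t1 <= u < s -> 0 <= X u /\ 0 < w u).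
  { intros u Hu. apply NNPP. intros Hn.
    assert (s <= u); [|lra]. apply Hlub. intros v [Hv HG]. apply Rnot_lt_le. intros Huv.
    apply Hn, HG. lra. }
  assert (Hclosed : forall f : R -> R, continuous f s -> (forall u, t1 <= u < s -> 0 <= f u) -> 0 <= f t1 -> 0 <= f s).
  { intros f Cf Hf Hf1. destruct (Req_dec s t1) as [->|Hne]; trivial.
    apply Rnot_lt_le. intros Hneg.
    assert (L : locally s (fun u => f u < 0)).
    { apply (Cf (fun z => z < 0)). apply open_lt. exact Hneg. }
    destruct L as [d Hd]. assert (X0 := cond_pos d).
    set (u := Rmax t1 (s - d / 2)).
    assert (Hu : t1 <= u < s) by (split; [apply Rmax_l|apply Rmax_lub_lt; lra]).
    assert (Hu2 : s - d / 2 <= u) by apply Rmax_r.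
    assert (Y := Hf u Hu). assert (Z : f u < 0); [|lra].
    apply Hd. unfold ball; simpl; unfold AbsRing_ball, abs, minus, plus, opp; simpl. apply Rabs_def1; lra. }
  assert (X0 : 0 <= X s). { apply Hclosed; auto. apply CX; lra. intros u Hu. now apply Hbelow. }
  assert (w0 : 0 <= w s). { apply Hclosed; auto. apply Cw; lra. intros u Hu. apply Rlt_le. now apply Hbelow. lra. }
  assert (Hds := HD s (proj1 Hs)).
  assert (w1 : 0 < w s).
  { destruct (Req_dec (w s) 0) as [E0|E0]; [exfalso|lra].
    assert (Xs : 0 < X s).
    { destruct (Req_dec (X s) 0) as [E1|E1]; [|lra]. exfalso. now apply (Hc s). }
    destruct (is_derive_sign w s (dw s)) as (d & Hd & Hdd). apply Hds. now apply Hw.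
    assert (s <> t1) by (intros ->; lra).
    set (u := Rmax t1 (s - d / 2)).
    assert (Hu : t1 <= u < s) by (split; [apply Rmax_l|apply Rmax_lub_lt; lra]).
    assert (Hu2 : s - d / 2 <= u) by apply Rmax_r.
    destruct (Hdd u) as [_ Y]. { apply Rabs_def1; lra. }
    assert (Z := proj2 (Hbelow u Hu)). assert (Y' := Y (proj2 Hu)). lra. }
  assert (Hafter : exists d, 0 < d /\ forall u, s < u < s + d -> 0 <= X u /\ 0 < w u).
  { assert (Lw : locally s (fun u => 0 < w u)). { apply (Cw s (proj1 Hs)). apply open_gt. exact w1. }
    destruct Lw as [d1 Hd1].
    assert (Hb : forall u (d : posreal), s < u < s + d -> ball s d u).
    { intros u d Hu. unfold ball; simpl; unfold AbsRing_ball, abs, minus, plus, opp; simpl. apply Rabs_def1; lra. }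
    assert (LX : exists d2 : posreal, forall u, s < u < s + d2 -> 0 <= X u).
    { destruct (Req_dec (X s) 0) as [E0|E0].
      (* On the edge X = 0 the relation X' = w > 0 pushes the solution back inside. *)
      - destruct (is_derive_sign X s (dX s)) as (d & Hd & Hdd). apply Hds. rewrite HX; lra.
        exists (mkposreal d Hd). simpl. intros u Hu. destruct (Hdd u) as [Y _]. apply Rabs_def1; lra.
        assert (Y' := Y (proj1 Hu)). lra.
      - assert (LX : locally s (fun u => 0 < X u)). { apply (CX s (proj1 Hs)). apply open_gt. lra. }
        destruct LX as [d2 Hd2]. exists d2. intros u Hu. left. apply Hd2, Hb, Hu. }
    destruct LX as [d2 Hd2]. exists (Rmin d1 d2). split. { apply Rmin_case; apply cond_pos. }
    intros u Hu. assert (A := Rmin_l d1 d2). assert (B := Rmin_r d1 d2). split.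
    apply Hd2; lra. apply Hd1, Hb; lra. }
  destruct Hafter as (d & Hd & Hafter).
  assert (HG : forall u, t1 <= u < s + d -> 0 <= X u /\ 0 < w u).
  { intros u Hu. destruct (Rtotal_order u s) as [H|[H|H]]. apply Hbelow; lra. now subst. apply Hafter; lra. }
  destruct (Rlt_dec t2 (s + d)) as [H|H].
  - apply Hbad, HG. lra.
  - assert (s + d / 2 <= s); [|lra]. apply Hub. split. lra. intros u Hu. apply HG. lra.
Qed.

(** What is retained of spiralling: both halves of the y-axis are visited at arbitrarily late times.
    In this form the property is easily transferred to the coordinates (x, Y). *)
Definition crosses (x y : R -> R) : Prop :=
  forall T s, s = 1 \/ s = -1 -> exists t, T <= t /\ x t = 0 /\ 0 < s * y t.

(** In the half-plane e x > 0 the curve y = psi(x) is crossed in one direction only. Starting from a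
    late visit to one half of the y-axis, X = e x and w = sg e (y - psi(x)) satisfy the hypotheses
    of [quadrant_invariant]; the equality X' = w at X = 0 is the equation x' = sg y together with
    psi 0 = 0. Then w stays positive, whereas on the other half of the axis, visited later, it is
    negative. *)
Lemma barrier (N : R -> R -> R) (sg : R) (x y psi dpsi : R -> R) (e x0 : R) :
  signed_orbit (fun _ v => v) N sg x y -> crosses x y -> e = 1 \/ e = -1 -> 0 < x0 ->
  (forall u, Rabs u < x0 -> is_derive psi u (dpsi u)) -> psi 0 = 0 ->
  (forall u, 0 < e * u < x0 -> 0 < e * (N u (psi u) - dpsi u * psi u)) -> False.
Proof.
  intros (Hsg & Hor & Lx & Ly) Hcr He Hx0 Hpsi Hp0 Hbar.
  assert (Hse : sg * e = 1 \/ sg * e = -1) by (destruct Hsg, He; subst; lra).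
  assert (Hee : e * e = 1) by (destruct He; subst; lra).
  assert (Hss : sg * sg = 1) by (destruct Hsg; subst; lra).
  apply is_lim_spec in Lx. destruct (Lx (mkposreal x0 Hx0)) as [T HT]. cbn [pos] in HT.
  assert (HT' : forall t, T < t -> Rabs (x t) < x0).
  { intros t Ht. rewrite <- (Rminus_0_r (x t)). now apply HT. }
  destruct (Hcr (Rmax 0 (T + 1)) (sg * e) Hse) as (t1 & Ht1 & X1 & Y1).
  assert (A := Rmax_l 0 (T + 1)). assert (B := Rmax_r 0 (T + 1)).
  destruct (Hcr t1 (- (sg * e))) as (t2 & Ht2 & X2 & Y2). lra.
  destruct (quadrant_invariant (fun t => e * x t) (fun t => sg * e * (y t - psi (x t)))
     (fun t => e * (sg * y t)) (fun t => sg * e * (sg * N (x t) (y t) - sg * y t * dpsi (x t))) t1) with (t := t2)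
     as [_ C]; trivial.
  - intros t Ht. destruct (Hor t) as (_ & Dx & Dy). lra. split.
    + evar_last. apply (is_derive_scal x t e _ Dx). cbn beta. reflexivity.
    + evar_last.
      * apply (is_derive_scal (fun t => y t - psi (x t)) t (sg * e) (minus (sg * N (x t) (y t)) (scal (sg * y t) (dpsi (x t))))).
        apply (is_derive_minus y (fun t => psi (x t)) t (sg * N (x t) (y t)) (scal (sg * y t) (dpsi (x t)))); trivial.
        assert (Ht' : T < t) by lra.
        apply (is_derive_comp psi x t (dpsi (x t)) (sg * y t)); trivial. now apply Hpsi, HT'.
      * unfold minus, plus, opp, scal; simpl; unfold mult; simpl. ring.
  - intros t Ht H0. assert (H1 : x t = 0).
    { replace (x t) with (e * (e * x t)) by (rewrite <- Rmult_assoc, Hee; ring). rewrite H0. ring. }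
    cbv beta. rewrite H1, Hp0. ring.
  - intros t Ht HX Hw.
    assert (E : y t = psi (x t)).
    { assert (Z : sg * e * (sg * e * (y t - psi (x t))) = 0) by (rewrite Hw; ring).
      replace (sg * e * (sg * e * (y t - psi (x t)))) with ((sg * sg) * (e * e) * (y t - psi (x t))) in Z by ring.
      rewrite Hss, Hee in Z. lra. }
    assert (Z : 0 < e * (N (x t) (psi (x t)) - dpsi (x t) * psi (x t))).
    { apply Hbar. split; trivial. assert (W := HT' t ltac:(lra)). apply Rabs_def2 in W.
      destruct He; subst e; lra. }
    rewrite E. replace (sg * e * (sg * N (x t) (psi (x t)) - sg * psi (x t) * dpsi (x t)))
      with ((sg * sg) * (e * (N (x t) (psi (x t)) - dpsi (x t) * psi (x t)))) by ring.
    rewrite Hss. lra.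
  - intros t Ht [H0 H1].
    assert (H2 : x t = 0).
    { replace (x t) with (e * (e * x t)) by (rewrite <- Rmult_assoc, Hee; ring). rewrite H0. ring. }
    rewrite H2, Hp0 in H1.
    destruct (Hor t) as (Hn & _). lra. apply Hn. f_equal; trivial.
    replace (y t) with ((sg * sg) * (e * e) * y t) by (rewrite Hss, Hee; ring).
    replace (sg * sg * (e * e) * y t) with (sg * e * (sg * e * (y t - 0))) by ring. rewrite H1. ring.
  - rewrite X1. lra.
  - rewrite X1, Hp0, Rminus_0_r. exact Y1.
  - rewrite X2, Hp0, Rminus_0_r in C. lra.
Qed.

Lemma angle_between (a b al : R) : a + 2 * PI <= b -> exists k : Z, a <= al + 2 * PI * IZR k <= b.
Proof.
  intros H. destruct (angle_reduce (al - a)) as [k Hk]. exists k. lra.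
Qed.

(** Since |th| eventually exceeds its value at T by a full turn, th sweeps an interval of length at
    least 2 PI, which contains a representative of al. *)
Lemma spiral_angle (th : R -> R) (T al : R) : 0 <= T -> (forall t, 0 <= t -> continuous th t) ->
  is_lim (fun t => Rabs (th t)) p_infty p_infty ->
  exists t (k : Z), T <= t /\ th t = al + 2 * PI * IZR k.
Proof.
  intros HT Hc Hl. apply is_lim_spec in Hl. destruct (Hl (Rabs (th T) + 2 * PI)) as [T1 HT1].
  set (t1 := Rmax T T1 + 1). assert (A := Rmax_l T T1). assert (B := Rmax_r T T1).
  assert (X := HT1 t1 ltac:(unfold t1; lra)). cbn beta in X.
  assert (Hlt : T < t1) by (unfold t1; lra).
  assert (C : forall f, (forall t, 0 <= t -> continuous f t) -> forall a, T <= a <= t1 -> continuity_pt f a).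
  { intros f Hf a Ha. apply continuity_pt_filterlim, Hf. lra. }
  assert (Y1 := Rle_abs (th T)). assert (Y2 := Rle_abs (- th T)). rewrite Rabs_Ropp in Y2.
  assert (HP := PI_RGT_0).
  destruct (Rle_dec 0 (th t1)) as [Hs|Hs].
  - rewrite (Rabs_pos_eq (th t1)) in X by trivial.
    destruct (angle_between (th T) (th t1) al) as [k Hk]. lra.
    destruct (Req_dec (th T) (al + 2 * PI * IZR k)) as [E|E]. { exists T, k. split. lra. trivial. }
    destruct (Req_dec (th t1) (al + 2 * PI * IZR k)) as [E'|E']. { exists t1, k. split. lra. trivial. }
    destruct (Ranalysis5.IVT_interv (fun t => th t - (al + 2 * PI * IZR k)) T t1) as (z & Hz & Ez); try lra.
    { apply C. intros t Ht. apply (continuous_minus th); auto. apply continuous_const. }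
    exists z, k. split; lra.
  - rewrite (Rabs_left (th t1)) in X by lra.
    destruct (angle_between (th t1) (th T) al) as [k Hk]. lra.
    destruct (Req_dec (th T) (al + 2 * PI * IZR k)) as [E|E]. { exists T, k. split. lra. trivial. }
    destruct (Req_dec (th t1) (al + 2 * PI * IZR k)) as [E'|E']. { exists t1, k. split. lra. trivial. }
    destruct (Ranalysis5.IVT_interv (fun t => (al + 2 * PI * IZR k) - th t) T t1) as (z & Hz & Ez); try lra.
    { apply C. intros t Ht. apply (continuous_minus (fun _ => al + 2 * PI * IZR k) th); auto. apply continuous_const. }
    exists z, k. split; lra.
Qed.

Lemma spirals_crosses (x y : R -> R) : spirals_to_origin x y -> crosses x y.
Proof.
  intros (r & th & H1 & _ & H3) T s Hs.
  destruct (spiral_angle th (Rmax 0 T) (s * (PI / 2))) as (t & k & Ht & E).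
  - apply Rmax_l.
  - intros t Ht. now apply H1.
  - trivial.
  - exists t. assert (A := Rmax_l 0 T). assert (B := Rmax_r 0 T).
    destruct (H1 t) as (Hr & _ & Hx & Hy). lra.
    assert (Ec : cos (th t) = 0 /\ sin (th t) = s).
    { rewrite E. 
      rewrite (periodic_Z cos k (s * (PI / 2)) cos_2PI_shift).
      rewrite (periodic_Z sin k (s * (PI / 2)) sin_2PI_shift).
      destruct Hs as [->| ->].
      - rewrite Rmult_1_l. split. apply cos_PI2. apply sin_PI2.
      - replace (-1 * (PI / 2)) with (- (PI / 2)) by ring. rewrite cos_neg, sin_neg, cos_PI2, sin_PI2. lra. }
    destruct Ec as [Ec Es]. rewrite Hx, Hy, Ec, Es. split; [lra|split; [ring|]].
    destruct Hs as [->| ->]; lra.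
Qed.

(** * Leading exponents of a nilpotent focus *)

Section Exponents.

Variables (N g : R -> R -> R) (F G x y : R -> R) (sg a b M delta : R).

Hypothesis orbit : signed_orbit (fun _ v => v) N sg x y.
Hypothesis crossing : crosses x y.
Hypothesis delta_pos : 0 < delta <= 1.
Hypothesis M_pos : 0 <= M.
Hypothesis F_bound : forall u, Rabs u < delta -> Rabs (F u - a) <= M * Rabs u.
Hypothesis G_bound : forall u, Rabs u < delta -> Rabs (G u - b) <= M * Rabs u.
Hypothesis g_bound : forall u v, Rabs u < delta -> Rabs v < delta -> Rabs (g u v) <= M.

(** The barrier is the axis v = 0, on which N has the sign of u^al a. For a > 0 it blocks the right
    half-plane; for a < 0 and al even it blocks the left one. *)
Lemma restoring_force (al : nat) : a <> 0 ->
  (forall u, Rabs u < delta -> N u 0 = u ^ al * F u) -> a < 0 /\ Nat.Odd al.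
Proof.
  intros Ha HN.
  assert (Hbar : forall e x0, e = 1 \/ e = -1 -> 0 < x0 -> (forall u, 0 < e * u < x0 -> 0 < e * N u 0) -> False).
  { intros e x0 He Hx0 H. apply (barrier N sg x y (fun _ => 0) (fun _ => 0) e x0 orbit crossing He Hx0); trivial.
    - intros u _. apply (is_derive_const 0).
    - intros u Hu. rewrite Rmult_0_l, Rminus_0_r. now apply H. }
  set (x0 := Rmin delta (Rabs a / (M + 1))).
  assert (HA : 0 < Rabs a) by now apply Rabs_pos_lt.
  assert (Hx0 : 0 < x0). { apply Rmin_case. lra. apply Rdiv_lt_0_compat; lra. }
  assert (HF : forall u, 0 < Rabs u < x0 -> 0 < a * F u).
  { intros u Hu. assert (A := Rmin_l delta (Rabs a / (M + 1))). assert (B := Rmin_r delta (Rabs a / (M + 1))).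
    fold x0 in A, B. assert (X := F_bound u ltac:(lra)).
    assert (Y : (M + 1) * Rabs u < Rabs a).
    { apply Rmult_lt_reg_r with (/ (M + 1)). apply Rinv_0_lt_compat; lra.
      replace ((M + 1) * Rabs u * / (M + 1)) with (Rabs u) by (field; lra).
      change (Rabs a * / (M + 1)) with (Rabs a / (M + 1)). lra. }
    assert (Z : Rabs (F u - a) < Rabs a) by nra. apply Rabs_def2 in Z.
    destruct (Rlt_dec 0 a) as [Hp|Hp].
    - rewrite Rabs_pos_eq in Z by lra. apply Rmult_lt_0_compat; lra.
    - rewrite Rabs_left in Z by lra. nra. }
  assert (Neg : a < 0).
  { apply Rnot_le_lt. intros Hp. apply (Hbar 1 x0); auto. intros u Hu. rewrite Rmult_1_l in Hu |- *.
    assert (Hau : Rabs u = u) by (apply Rabs_pos_eq; lra).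
    assert (Hud : Rabs u < delta). { rewrite Hau. apply Rlt_le_trans with x0. lra. apply Rmin_l. }
    rewrite HN by trivial. assert (X := HF u ltac:(lra)). apply Rmult_lt_0_compat. apply pow_lt; lra.
    apply Rmult_lt_reg_l with a; lra. }
  split; trivial.
  destruct (Nat.Even_or_Odd al) as [[k Hk]|]; trivial. exfalso.
  apply (Hbar (-1) x0); auto. intros u Hu.
  assert (Hau : Rabs u = - u) by (apply Rabs_left; lra).
  assert (Hud : Rabs u < delta). { rewrite Hau. apply Rlt_le_trans with x0. lra. apply Rmin_l. }
  rewrite HN by trivial. assert (X := HF u ltac:(lra)).
  rewrite Hk, pow_mult. assert (P : 0 < (u ^ 2) ^ k) by (apply pow_lt; nra).
  assert (F u < 0) by nra. assert (0 < (u ^ 2) ^ k * - F u) by (apply Rmult_lt_0_compat; lra). lra.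
Qed.

(** The exponent of f is 2 n - 1 with n = k + 2 + j, whereas the damping starts in degree k < n - 1.
    Along the barrier v = b u^n the damping term b^2 u^(k+n) dominates: the force, the inertial term
    psi' psi and the quadratic term in v are all of higher order. *)
Lemma strong_damping (k j : nat) : b <> 0 ->
  (forall u v, Rabs u < delta -> Rabs v < delta ->
     N u v = u ^ (S j + k + (k + 2 + j)) * F u + u ^ k * G u * v + v ^ 2 * g u v) -> False.
Proof.
  intros Hb HN. set (n := (k + 2 + j)%nat) in *.
  assert (HB : 0 < b ^ 2) by (apply pow2_gt_0; trivial).
  assert (HBa := Rabs_pos b). assert (HAa := Rabs_pos a). assert (Hn := pos_INR n).
  set (C := Rabs b * M + Rabs a + M + INR n * b ^ 2 + b ^ 2 * M + 1).
  assert (HC : 0 < C).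
  { unfold C. assert (0 <= Rabs b * M) by now apply Rmult_le_pos.
    assert (0 <= INR n * b ^ 2) by (apply Rmult_le_pos; lra).
    assert (0 <= b ^ 2 * M) by (apply Rmult_le_pos; lra). lra. }
  set (x0 := Rmin (delta / (Rabs b + 1)) (b ^ 2 / C)).
  assert (Hx0 : 0 < x0). { apply Rmin_case; apply Rdiv_lt_0_compat; lra. }
  apply (barrier N sg x y (fun u => b * u ^ n) (fun u => b * (INR n * u ^ (k + 1 + j))) 1 x0); auto.
  - intros u _. auto_derive; trivial. replace (Nat.pred n) with (k + 1 + j)%nat by (unfold n; lia). ring.
  - unfold n. replace (k + 2 + j)%nat with (S (k + 1 + j)) by lia. simpl. ring.
  - intros u Hu. rewrite Rmult_1_l in Hu |- *.
    assert (A := Rmin_l (delta / (Rabs b + 1)) (b ^ 2 / C)). assert (B := Rmin_r (delta / (Rabs b + 1)) (b ^ 2 / C)).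
    fold x0 in A, B.
    assert (U1 : (Rabs b + 1) * u < delta).
    { apply Rmult_lt_reg_r with (/ (Rabs b + 1)). apply Rinv_0_lt_compat; lra.
      replace ((Rabs b + 1) * u * / (Rabs b + 1)) with u by (field; lra).
      change (delta * / (Rabs b + 1)) with (delta / (Rabs b + 1)). lra. }
    assert (U2 : C * u < b ^ 2).
    { apply Rmult_lt_reg_r with (/ C). now apply Rinv_0_lt_compat.
      replace (C * u * / C) with u by (field; lra). change (b ^ 2 * / C) with (b ^ 2 / C). lra. }
    assert (Hud : u < delta) by nra. assert (Hu1 : u < 1) by lra.
    assert (Hau : Rabs u = u) by (apply Rabs_pos_eq; lra).
    assert (Pw : forall i, 0 < u ^ S i <= u).
    { intros i. split. apply pow_lt; lra. simpl. rewrite <- (Rmult_1_r u) at 3. apply Rmult_le_compat_l. lra.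
      rewrite <- (pow1 i). apply pow_incr. lra. }
    assert (Hpsi : Rabs (b * u ^ n) < delta).
    { rewrite Rabs_mult. replace n with (S (k + 1 + j)) by (unfold n; lia).
      rewrite (Rabs_pos_eq (u ^ S (k + 1 + j))) by apply Rlt_le, Pw. assert (X := Pw (k + 1 + j)%nat).
      assert (Rabs b * u ^ S (k + 1 + j) <= Rabs b * u) by (apply Rmult_le_compat_l; lra). lra. }
    rewrite HN by lra.
    set (gg := g u (b * u ^ n)). assert (Hg : Rabs gg <= M) by (apply g_bound; lra).
    assert (E : u ^ (S j + k + n) * F u + u ^ k * G u * (b * u ^ n) + (b * u ^ n) ^ 2 * gg -
      b * (INR n * u ^ (k + 1 + j)) * (b * u ^ n) =
      (u ^ k * u ^ n) * (b ^ 2 + (b * (G u - b) + u ^ S j * (a + (F u - a) + b ^ 2 * u * gg - INR n * b ^ 2)))).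
    { replace ((b * u ^ n) ^ 2) with (b ^ 2 * u ^ n * (u ^ k * u ^ S j * u)).
      2: { replace (u ^ k * u ^ S j * u) with (u ^ n). ring. unfold n. rewrite !pow_add. simpl. ring. }
      replace (u ^ (k + 1 + j)) with (u ^ k * u ^ S j) by (rewrite !pow_add; simpl; ring).
      rewrite !pow_add. ring. }
    rewrite E. apply Rmult_lt_0_compat.
    { apply Rmult_lt_0_compat; apply pow_lt; lra. }
    assert (R1 : Rabs (b * (G u - b)) <= Rabs b * M * u).
    { rewrite Rabs_mult, Rmult_assoc. apply Rmult_le_compat_l; trivial. rewrite <- Hau at 2. apply G_bound. lra. }
    assert (R2 : Rabs (u ^ S j * (a + (F u - a) + b ^ 2 * u * gg - INR n * b ^ 2)) <= u * (Rabs a + M + b ^ 2 * M + INR n * b ^ 2)).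
    { rewrite Rabs_mult. rewrite (Rabs_pos_eq (u ^ S j)) by apply Rlt_le, Pw.
      apply Rmult_le_compat. apply Rlt_le, Pw. apply Rabs_pos. apply Pw.
      assert (T1 := F_bound u ltac:(lra)). rewrite Hau in T1.
      assert (T2 : Rabs (b ^ 2 * u * gg) <= b ^ 2 * M).
      { rewrite !Rabs_mult, Hau, (Rabs_pos_eq (b ^ 2)) by lra. rewrite Rmult_assoc. apply Rmult_le_compat_l. lra.
        assert (0 <= Rabs gg) by apply Rabs_pos. nra. }
      assert (T3 : M * u <= M) by nra.
      assert (Q : 0 <= INR n * b ^ 2) by (apply Rmult_le_pos; lra).
      assert (Q2 := Rle_abs a). assert (Q3 := Rle_abs (- a)). rewrite Rabs_Ropp in Q3.
      apply Rabs_le_between in T1, T2. apply Rabs_le. lra. }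
    apply Rabs_le_between in R1, R2. unfold C in U2. nra.
Qed.

(** The maximum over c of the leading coefficient a + b c - n c^2 is the discriminant divided by 4
    n. A non-negative discriminant with a < 0 forces b, and hence the maximising c, to be non-zero,
    which the correction of the barrier requires. *)
Lemma real_separatrix (m : nat) : a < 0 -> 0 <= b ^ 2 + 4 * a * INR (S m) ->
  (forall u v, Rabs u < delta -> Rabs v < delta ->
     N u v = u ^ (m + S m) * F u + u ^ m * G u * v + v ^ 2 * g u v) -> False.
Proof.
  intros Ha Hdisc HN. set (n := S m) in *. assert (Hn : 0 < INR n) by apply lt_0_INR, Nat.lt_0_succ.
  assert (Hb : 0 < b ^ 2) by nra.
  (* [c] maximises [a + b c - n c^2], the leading coefficient along [v = c u^n];
     the term [- K c u^(n+1)] of the barrier settles the case of a zero maximum. *)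
  set (c := b / (2 * INR n)).
  assert (Ec : b = 2 * INR n * c) by (unfold c; field; lra).
  assert (Hc0 : c <> 0).
  { intros E. rewrite E in Ec. rewrite Ec in Hb. simpl in Hb. lra. }
  assert (Hc : 0 < c ^ 2) by now apply pow2_gt_0.
  assert (Hca := Rabs_pos c).
  (* K c^2 / 2 exceeds by one the coefficient of u in the bounds for the errors of F and G and for
     g. The quadratic term C2 u^2 stays below this surplus u as long as C2 u < 1. *)
  set (K := 2 * (M * (1 + Rabs c + c ^ 2) + 1) / c ^ 2).
  assert (HK : 0 < K).
  { apply Rdiv_lt_0_compat; trivial. assert (0 <= M * (1 + Rabs c + c ^ 2)) by (apply Rmult_le_pos; lra). lra. }
  assert (EK : K * c ^ 2 = 2 * (M * (1 + Rabs c + c ^ 2) + 1)) by (unfold K; field; trivial).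
  set (C1 := 2 * K). set (C2 := INR n * K ^ 2 * c ^ 2).
  assert (HC2 : 0 < C2).
  { unfold C2. apply Rmult_lt_0_compat; trivial. apply Rmult_lt_0_compat; trivial. apply pow_lt; trivial. }
  set (x0 := Rmin (Rmin delta (delta / (Rabs c + 1))) (Rmin (/ C1) (/ C2))).
  assert (Hx0 : 0 < x0).
  { repeat apply Rmin_case; try lra. apply Rdiv_lt_0_compat; lra. apply Rinv_0_lt_compat. unfold C1. lra. now apply Rinv_0_lt_compat. }
  set (v := fun u => c - K * c * u).
  apply (barrier N sg x y (fun u => u ^ n * v u) (fun u => u ^ m * (INR n * v u - K * c * u)) 1 x0); auto.
  - intros u _. unfold v. auto_derive; trivial. unfold n. replace (Nat.pred (S m)) with m by lia. change (match m with O => 1 | S _ => INR m + 1 end) with (INR (S m)). simpl pow. ring.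
  - unfold n. simpl. ring.
  - intros u Hu. rewrite Rmult_1_l in Hu |- *.
    assert (Hx : u < delta /\ u < delta / (Rabs c + 1) /\ u < / C1 /\ u < / C2).
    { repeat split; apply Rlt_le_trans with (1 := proj2 Hu); unfold x0.
      apply Rle_trans with (1 := Rmin_l _ _), Rmin_l. apply Rle_trans with (1 := Rmin_l _ _), Rmin_r.
      apply Rle_trans with (1 := Rmin_r _ _), Rmin_l. apply Rle_trans with (1 := Rmin_r _ _), Rmin_r. }
    destruct Hx as (Hud & H1 & H2 & H3).
    assert (U1 : (Rabs c + 1) * u < delta).
    { apply Rmult_lt_reg_r with (/ (Rabs c + 1)). apply Rinv_0_lt_compat; lra.
      replace ((Rabs c + 1) * u * / (Rabs c + 1)) with u by (field; lra).
      change (delta * / (Rabs c + 1)) with (delta / (Rabs c + 1)). lra. }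
    assert (U2 : 2 * K * u < 1).
    { apply Rmult_lt_reg_r with (/ C1). apply Rinv_0_lt_compat. unfold C1. lra.
      replace (2 * K * u * / C1) with u by (unfold C1; field; lra). lra. }
    assert (U3 : C2 * u < 1).
    { apply Rmult_lt_reg_r with (/ C2). now apply Rinv_0_lt_compat.
      replace (C2 * u * / C2) with u by (field; lra). lra. }
    assert (Hau : Rabs u = u) by (apply Rabs_pos_eq; lra).
    assert (Hv : v u = c * (1 - K * u)) by (unfold v; ring).
    assert (HKu : 0 < K * u < / 2). { split. apply Rmult_lt_0_compat; lra. lra. }
    assert (Hva : Rabs (v u) <= Rabs c).
    { rewrite Hv, Rabs_mult. rewrite <- (Rmult_1_r (Rabs c)) at 2. apply Rmult_le_compat_l; trivial. apply Rabs_le; lra. }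
    assert (Hpsi : Rabs (u ^ n * v u) < delta).
    { rewrite Rabs_mult. assert (P : 0 < u ^ n <= u).
      { split. apply pow_lt; lra. unfold n. simpl. rewrite <- (Rmult_1_r u) at 3. apply Rmult_le_compat_l. lra.
        rewrite <- (pow1 m). apply pow_incr. lra. }
      rewrite Rabs_pos_eq by lra. assert (0 <= Rabs (v u)) by apply Rabs_pos.
      assert (u ^ n * Rabs (v u) <= u * Rabs c) by (apply Rmult_le_compat; lra). lra. }
    rewrite HN by lra. set (gg := g u (u ^ n * v u)). assert (Hg : Rabs gg <= M) by (apply g_bound; lra).
    (* The bracket is [disc / (4 n) + u * (K c v + O(1) - n K^2 c^2 u)], where [O(1)] does not depend on [K]. *)
    assert (E : u ^ (m + n) * F u + u ^ m * G u * (u ^ n * v u) + (u ^ n * v u) ^ 2 * gg -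
       u ^ m * (INR n * v u - K * c * u) * (u ^ n * v u) =
       u ^ m * u ^ n * ((b ^ 2 + 4 * a * INR n) / (4 * INR n) +
         ((F u - a) + (G u - b) * v u + u * gg * (v u) ^ 2 + u * (K * c * v u) - C2 * u * u))).
    { replace ((u ^ n * v u) ^ 2) with (u ^ m * u ^ n * (u * (v u) ^ 2)) by (unfold n; simpl; ring).
      rewrite pow_add. unfold C2. rewrite Ec. rewrite Hv. field. lra. }
    rewrite E. apply Rmult_lt_0_compat.
    { apply Rmult_lt_0_compat; apply pow_lt; lra. }
    assert (D : 0 <= (b ^ 2 + 4 * a * INR n) / (4 * INR n)) by (apply Rdiv_le_0_compat; lra).
    assert (R1 := F_bound u ltac:(lra)). assert (R2 := G_bound u ltac:(lra)). rewrite Hau in R1, R2.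
    assert (R3 : Rabs ((G u - b) * v u) <= M * u * Rabs c).
    { rewrite Rabs_mult. apply Rmult_le_compat; trivial; apply Rabs_pos. }
    assert (R4 : Rabs (u * gg * v u ^ 2) <= u * (M * c ^ 2)).
    { rewrite !Rabs_mult, Hau, Rmult_assoc. apply Rmult_le_compat_l. lra.
      apply Rmult_le_compat; trivial; try apply Rabs_pos. rewrite <- RPow_abs, <- (pow2_abs c).
      apply pow_incr. split; trivial. apply Rabs_pos. }
    assert (R5 : K * c * v u >= K * c ^ 2 / 2).
    { rewrite Hv. replace (K * c * (c * (1 - K * u))) with (K * c ^ 2 * (1 - K * u)) by ring.
      assert (0 < K * c ^ 2) by now apply Rmult_lt_0_compat. nra. }
    assert (R6 : u * (K * c * v u) >= u * (K * c ^ 2 / 2)) by (apply Rmult_ge_compat_l; lra).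
    assert (R7 : u * (K * c ^ 2 / 2) = M * u + M * u * Rabs c + u * (M * c ^ 2) + u) by (rewrite EK; field).
    assert (R8 : C2 * u * u < u) by (rewrite <- (Rmult_1_l u) at 3; apply Rmult_lt_compat_r; lra).
    apply Rabs_le_between in R1, R3, R4. lra.
Qed.

End Exponents.

(** * Nilpotent foci *)

Lemma Ev_origin (rho : R) (a : nat -> nat -> R) : geometric rho a -> Ev a 0 0 = a O O.
Proof.
  intros Ha.
  assert (H0 : box rho 0 0) by (split; rewrite Rabs_R0; apply Ha).
  assert (S := geometric_series rho a 0 0 Ha H0). apply is_series_unique.
  assert (E : forall n, form (Datatypes.S n) (a (Datatypes.S n)) 0 0 = 0).
  { intros n. rewrite form_S. rewrite pow_ne_zero by lia. ring. }
  apply is_series_decr_1. rewrite form_0.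
  apply (is_series_ext (fun n => 0)). { intros n. now rewrite E. }
  unfold plus, opp; simpl. rewrite Rplus_opp_r.
  apply (is_series_Reals (fun _ => 0)). intros eps Heps. exists O. intros n _. rewrite sum_eq_R0 by trivial.
  now rewrite R_dist_eq.
Qed.

Lemma order_two_derivatives (f : R -> R -> R) : order_at_least 2 f ->
  exists rho fx fy fxx fxy fyy, 0 < rho /\ Ana rho f /\ Ana rho fx /\ Ana rho fy /\
    Ana rho fxx /\ Ana rho fxy /\ Ana rho fyy /\
    (forall x y, box rho x y -> differentiable_pt_lim f x y (fx x y) (fy x y) /\
       differentiable_pt_lim fx x y (fxx x y) (fxy x y) /\
       differentiable_pt_lim fy x y (fxy x y) (fyy x y)) /\
    f 0 0 = 0 /\ fx 0 0 = 0 /\ fy 0 0 = 0 /\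
    exists a, geometric rho a /\ (forall n i, (n < 2)%nat -> (i <= n)%nat -> a n i = 0) /\
      forall x y, box rho x y -> f x y = Ev a x y.
Proof.
  intros (a & Ha & H0). destruct (has_expansion_geometric _ _ Ha) as (rho & Hg & HE).
  assert (Gx := geometric_dx _ _ Hg). assert (Gy := geometric_dy _ _ Hg).
  assert (HA : forall b, geometric rho b -> Ana rho (Ev b)) by (intros b Hb; now exists b).
  assert (Sym : forall x y, Ev (dy_coefs (dx_coefs a)) x y = Ev (dx_coefs (dy_coefs a)) x y).
  { intros x y. apply Series_ext. intros n. apply form_ext. intros i Hi.
    unfold dy_coefs, dx_coefs, coef_x, coef_y. replace (S (S n) - S i)%nat with (S n - i)%nat by lia. ring. }
  assert (O0 : box rho 0 0) by (split; rewrite Rabs_R0; apply Hg).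
  exists rho, (Ev (dx_coefs a)), (Ev (dy_coefs a)), (Ev (dx_coefs (dx_coefs a))),
    (Ev (dy_coefs (dx_coefs a))), (Ev (dy_coefs (dy_coefs a))).
  repeat match goal with |- _ /\ _ => split end.
  - apply Hg.
  - now exists a.
  - now apply HA.
  - now apply HA.
  - apply HA. now apply geometric_dx.
  - apply HA. now apply geometric_dy.
  - apply HA. now apply geometric_dy.
  - intros x y Hxy. split; [|split].
    + apply differentiable_pt_lim_ext with (Ev a).
      * apply locally_2d_impl with (2 := box_open rho x y Hxy). apply locally_2d_forall.
        intros u v Huv. symmetry. now apply HE.
      * now apply Ev_differentiable with rho.
    + now apply Ev_differentiable with rho.
    + rewrite Sym. now apply Ev_differentiable with rho.
  - rewrite HE by trivial. rewrite (Ev_origin rho) by trivial. apply H0; lia.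
  - rewrite (Ev_origin rho) by trivial. unfold dx_coefs, coef_x. rewrite H0 by lia. ring.
  - rewrite (Ev_origin rho) by trivial. unfold dy_coefs, coef_y. rewrite H0 by lia. ring.
  - now exists a.
Qed.

Lemma Ck_bound_origin (k : nat) (rho eps : R) (f : R -> R -> R) : 0 < rho -> Ck k (box rho) f ->
  0 < eps -> exists r, 0 < r <= rho /\ forall x y, box r x y -> Rabs (f x y - f 0 0) < eps.
Proof.
  intros Hr Hf He. assert (O0 : box rho 0 0) by (split; rewrite Rabs_R0; lra).
  destruct (Ck_0 _ _ _ Hf 0 0 O0 (mkposreal eps He)) as [d Hd]. cbn [pos] in Hd.
  exists (Rmin rho d). split. { split. apply Rmin_case. lra. apply cond_pos. apply Rmin_l. }
  intros x y [Hx Hy]. apply Hd; rewrite Rminus_0_r.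
  apply Rlt_le_trans with (1 := Hx), Rmin_r. apply Rlt_le_trans with (1 := Hy), Rmin_r.
Qed.

(** * The change of variable Y = y + P2(x, y) *)

(** On a small box the first derivatives of p are at most 1/2, so y + p(x, y) can be solved for y by
    the intermediate value theorem. The Lipschitz estimates give uniqueness and continuity of the
    solution h. Its differential is expressed by p_x and p_y at the point (x, h), and class C^k
    follows by induction. *)
Lemma straighten (rho : R) (p px py : R -> R -> R) : 0 < rho ->
  (forall x y, box rho x y -> differentiable_pt_lim p x y (px x y) (py x y)) ->
  (forall k, Ck k (box rho) px) -> (forall k, Ck k (box rho) py) ->
  p 0 0 = 0 -> px 0 0 = 0 -> py 0 0 = 0 ->
  exists (r delta : R) (h : R -> R -> R), 0 < r <= rho /\ 0 < delta <= r /\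
    (forall x y, box r x y -> Rabs (py x y) <= / 2) /\
    (forall x y, box r x y -> Rabs (p x y) <= / 2 * Rabs x + / 2 * Rabs y) /\
    (forall x Y, box delta x Y -> box r x (h x Y) /\ h x Y + p x (h x Y) = Y /\
       Rabs (h x Y) <= Rabs x + 2 * Rabs Y) /\
    (forall x y, box r x y -> box delta x (y + p x y) -> h x (y + p x y) = y) /\
    (forall k, Ck k (box delta) h).
Proof.
  intros Hrho Hd Cx Cy p0 px0 py0.
  destruct (Ck_bound_origin 0 rho (/ 2) px Hrho (Cx O)) as (r1 & Hr1 & Bx); [lra|].
  destruct (Ck_bound_origin 0 rho (/ 2) py Hrho (Cy O)) as (r2 & Hr2 & By); [lra|].
  set (r := Rmin r1 r2).
  assert (Hr : 0 < r /\ r <= r1 /\ r <= r2).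
  { split; [|split; [apply Rmin_l|apply Rmin_r]]. apply Rmin_case; lra. }
  assert (Bx' : forall x y, box r x y -> Rabs (px x y) <= / 2).
  { intros x y [Hx Hy]. assert (X := Bx x y). rewrite px0, Rminus_0_r in X. apply Rlt_le, X. split; lra. }
  assert (By' : forall x y, box r x y -> Rabs (py x y) <= / 2).
  { intros x y [Hx Hy]. assert (X := By x y). rewrite py0, Rminus_0_r in X. apply Rlt_le, X. split; lra. }
  assert (Hsub : forall x y, box r x y -> box rho x y) by (intros x y [Hx Hy]; split; lra).
  assert (Lip : forall x y x' y', box r x y -> box r x' y' ->
     Rabs (p x y - p x' y') <= / 2 * Rabs (x - x') + / 2 * Rabs (y - y')).
  { intros x y x' y' [Hx Hy] [Hx' Hy'].
    replace (p x y - p x' y') with ((p x y - p x' y) + (p x' y - p x' y')) by ring.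
    apply Rle_trans with (1 := Rabs_triang _ _). apply Rplus_le_compat.
    - apply (derive_lipschitz (fun u => p u y) (fun u => px u y) (/ 2) (- r) r).
      + intros z Hz. apply (differentiable_is_derive p z y (px z y) (py z y)). apply Hd, Hsub. split; trivial. apply Rabs_def1; lra.
      + intros z Hz. apply Bx'. split; trivial. apply Rabs_def1; lra.
      + apply Rabs_def2 in Hx. lra.
      + apply Rabs_def2 in Hx'. lra.
    - apply (derive_lipschitz (fun v => p x' v) (fun v => py x' v) (/ 2) (- r) r).
      + intros z Hz. apply (differentiable_is_derive p x' z (px x' z) (py x' z)). apply Hd, Hsub. split; trivial. apply Rabs_def1; lra.
      + intros z Hz. apply By'. split; trivial. apply Rabs_def1; lra.
      + apply Rabs_def2 in Hy. lra.
      + apply Rabs_def2 in Hy'. lra. }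
  assert (O0 : box r 0 0) by (split; rewrite Rabs_R0; lra).
  assert (Bp : forall x y, box r x y -> Rabs (p x y) <= / 2 * Rabs x + / 2 * Rabs y).
  { intros x y Hxy. assert (X := Lip x y 0 0 Hxy O0). now rewrite p0, !Rminus_0_r in X. }
  (* At y = r / 2 one has |p| <= r / 16 + r / 4, so y + p exceeds r / 8; the other end is symmetric.
     All |Y| < r / 8 are therefore reached. *)
  set (delta := r / 8).
  assert (Hex : forall z : R * R, exists y, box delta (fst z) (snd z) ->
     box r (fst z) y /\ y + p (fst z) y = snd z).
  { intros [x Y]. cbn [fst snd]. destruct (classic (box delta x Y)) as [[Hx HY]|Hn].
    2: { exists 0. tauto. }
    unfold delta in Hx, HY.
    destruct (Ranalysis5.IVT_interv (fun y => y + p x y - Y) (- (r / 2)) (r / 2)) as (y & Hy & Ey).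
    - intros y Hy. apply continuity_pt_filterlim. apply (continuous_minus (fun y => y + p x y) (fun _ => Y)).
      + apply (continuous_plus (fun y => y) (p x)). apply continuous_id.
        apply (ex_derive_continuous (p x)). exists (py x y). apply (differentiable_is_derive p x y (px x y) (py x y)).
        apply Hd, Hsub. split. lra. apply Rabs_def1; lra.
      + apply continuous_const.
    - lra.
    - assert (X := Bp x (- (r / 2))). rewrite Rabs_Ropp, (Rabs_pos_eq (r / 2)) in X by lra.
      assert (X' : box r x (- (r / 2))). { split. lra. rewrite Rabs_Ropp, Rabs_pos_eq; lra. }
      apply X in X'. apply Rabs_le_between in X'. apply Rabs_def2 in HY. lra.
    - assert (X := Bp x (r / 2)). rewrite (Rabs_pos_eq (r / 2)) in X by lra.
      assert (X' : box r x (r / 2)). { split. lra. rewrite Rabs_pos_eq; lra. }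
      apply X in X'. apply Rabs_le_between in X'. apply Rabs_def2 in HY. lra.
    - exists y. intros _. split. split. lra. apply Rabs_def1; lra. lra. }
  destruct (choice _ Hex) as [h0 Hh0]. set (h := fun x Y => h0 (x, Y)).
  assert (Hh : forall x Y, box delta x Y -> box r x (h x Y) /\ h x Y + p x (h x Y) = Y).
  { intros x Y HxY. apply (Hh0 (x, Y)). exact HxY. }
  (* The increment of p takes up at most half of |y - y'|, which is moved to the left-hand side.
     This estimate yields continuity of h, its uniqueness and its size. *)
  assert (LipY : forall x y x' y', box r x y -> box r x' y' ->
     Rabs (y - y') <= Rabs (x - x') + 2 * Rabs ((y + p x y) - (y' + p x' y'))).
  { intros x y x' y' H H'. assert (X := Lip x y x' y' H H').
    assert (Z := Rabs_triang ((y + p x y) - (y' + p x' y')) (- (p x y - p x' y'))).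
    rewrite Rabs_Ropp in Z. replace (y + p x y - (y' + p x' y') + - (p x y - p x' y')) with (y - y') in Z by ring. lra. }
  assert (Hdl : 0 < delta <= r) by (unfold delta; lra).
  assert (Ch : forall x Y, box delta x Y -> continuity_2d_pt h x Y).
  { intros x Y HxY eps. assert (He : 0 < eps / 4) by (assert (X := cond_pos eps); lra).
    apply locally_2d_impl with (2 := box_open delta x Y HxY).
    exists (mkposreal _ He). simpl. intros u v Hu Hv Huv.
    destruct (Hh x Y HxY) as [A1 A2]. destruct (Hh u v Huv) as [B1 B2].
    assert (X := LipY u (h u v) x (h x Y) B1 A1). rewrite A2, B2 in X. lra. }
  assert (Dh : forall x Y, box delta x Y -> differentiable_pt_lim h x Y
     (- px x (h x Y) / (1 + py x (h x Y))) (1 / (1 + py x (h x Y)))).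
  { intros x Y HxY. destruct (Hh x Y HxY) as [A1 A2].
    assert (Bz := By' x (h x Y) A1). apply Rabs_le_between in Bz.
    destruct (differentiable_inverse (fun x _ => x) (fun x y => y + p x y) (fun x _ => x) h x Y 1 0 (px x (h x Y)) (1 + py x (h x Y))) as [_ D2].
    - apply differentiable_fst.
    - apply (differentiable_eq _ _ _ (0 + px x (h x Y)) (1 + py x (h x Y))); [|ring|ring].
      apply differentiable_plus. apply differentiable_snd. apply Hd. now apply Hsub.
    - lra.
    - apply continuity_2d_pt_id1.
    - now apply Ch.
    - apply locally_2d_impl with (2 := box_open delta x Y HxY). apply locally_2d_forall.
      intros u v Huv. split; trivial. now apply Hh.
    - apply (differentiable_eq _ _ _ _ _ _ _ D2); field; lra. }
  exists r, delta, h. repeat match goal with |- _ /\ _ => split end; try tauto; try lra.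
  - intros x Y HxY. destruct (Hh x Y HxY) as [A1 A2]. split; trivial. split; trivial.
    assert (X := LipY x (h x Y) 0 0 A1 O0). now rewrite A2, p0, Rplus_0_r, !Rminus_0_r in X.
  - intros x y Hxy HY. destruct (Hh _ _ HY) as [A1 A2].
    assert (X := LipY x (h x (y + p x y)) x y A1 Hxy). rewrite A2 in X.
    replace (x - x) with 0 in X by ring. replace (y + p x y - (y + p x y)) with 0 in X by ring.
    rewrite Rabs_R0 in X. assert (Z := Rabs_pos (h x (y + p x y) - y)).
    apply Rminus_diag_uniq. destruct (Req_dec (h x (y + p x y) - y) 0) as [E|E]; trivial.
    apply Rabs_pos_lt in E. lra.
  - induction k as [|k IH].
    + exact Ch.
    + exists (fun x Y => - px x (h x Y) / (1 + py x (h x Y))), (fun x Y => 1 / (1 + py x (h x Y))).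
      split; [exact Dh|].
      assert (N0 : forall x y, box delta x y -> 1 + py x (h x y) <> 0).
      { intros x y Hxy. assert (Z := By' x (h x y) (proj1 (Hh x y Hxy))). apply Rabs_le_between in Z. lra. }
      assert (Ccomp : forall f, Ck k (box rho) f -> Ck k (box delta) (fun x Y => f x (h x Y))).
      { intros f Hf. apply (Ck_comp k (box delta) (box rho) f (fun x _ => x) h); trivial. apply Ck_fst.
        intros x y Hxy. apply Hsub. now apply Hh. }
      assert (Cden : Ck k (box delta) (fun x Y => 1 + py x (h x Y))).
      { apply Ck_plus. apply Ck_const. now apply Ccomp. }
      split; apply Ck_div; trivial; try apply box_open.
      * apply Ck_opp. apply box_open. now apply Ccomp.
      * apply Ck_const.
Qed.

Lemma Ck_C1_on (e : R) (V : R -> R -> R) :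
  Ck 1 (box e) V <-> C1_on (fun z => Rabs (fst z) < e /\ Rabs (snd z) < e) V.
Proof.
  split.
  - intros (vx & vy & HD & Cx & Cy) x y Hxy.
    assert (HD' : forall u v, box e u v -> is_derive (fun z => V z v) u (vx u v) /\ is_derive (fun z => V u z) v (vy u v)).
    { intros u v Huv. now apply differentiable_is_derive, HD. }
    assert (E : forall f, (forall u v, box e u v -> f u v = vx u v) \/ (forall u v, box e u v -> f u v = vy u v) ->
       continuity_2d_pt f x y).
    { intros f [Hf|Hf]; [apply continuity_2d_pt_ext_loc with vx; [|now apply Cx]|apply continuity_2d_pt_ext_loc with vy; [|now apply Cy]];
      (apply locally_2d_impl with (2 := box_open e x y Hxy); apply locally_2d_forall; intros u v Huv; symmetry; now apply Hf). }
    destruct (HD' x y Hxy) as [A B]. split; [now exists (vx x y)|split; [now exists (vy x y)|split]].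
    + apply E. left. intros u v Huv. apply is_derive_unique. now apply HD'.
    + apply E. right. intros u v Huv. apply is_derive_unique. now apply HD'.
  - intros H. exists (Defs.d1 V), (Defs.d2 V). split; [|split].
    + intros x y Hxy. destruct (H x y Hxy) as (_ & B & C & _).
      apply differentiable_partials; trivial.
      * apply locally_2d_impl with (2 := box_open e x y Hxy). apply locally_2d_forall. intros u v Huv.
        apply Derive_correct. now apply (H u v).
      * now apply Derive_correct.
    + intros x y Hxy. now apply (H x y).
    + intros x y Hxy. now apply (H x y).
Qed.

(* With [J = 1 + p_y], the change of variable multiplies areas by [J], whence the factor [1 / J]. *)
Lemma straightened_factor (rho r delta e : R) (h p px py pxx pxy pyy q qx qy N W : R -> R -> R) :
  0 < r <= rho -> 0 < delta <= r -> 0 < e <= delta ->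
  (forall x y, box rho x y -> differentiable_pt_lim p x y (px x y) (py x y) /\
     differentiable_pt_lim px x y (pxx x y) (pxy x y) /\
     differentiable_pt_lim py x y (pxy x y) (pyy x y)) ->
  (forall x y, box rho x y -> differentiable_pt_lim q x y (qx x y) (qy x y)) ->
  Ck 1 (box rho) p -> Ck 1 (box rho) py ->
  (forall x y, box r x y -> Rabs (py x y) <= / 2) ->
  (forall x y, box r x y -> Rabs (p x y) <= / 2 * Rabs x + / 2 * Rabs y) ->
  (forall x Y, box delta x Y -> box r x (h x Y) /\ h x Y + p x (h x Y) = Y) ->
  (forall x y, box r x y -> box delta x (y + p x y) -> h x (y + p x y) = y) ->
  Ck 0 (box delta) h ->
  (forall x y, box r x y -> box delta x (y + p x y) ->
     N x (y + p x y) = (1 + py x y) * q x y + px x y * (y + p x y)) ->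
  (forall x Y, box delta x Y -> ex_derive (fun v => N x v) Y) ->
  inverse_integrating_factor (fun z => Rabs (fst z) < e /\ Rabs (snd z) < e) (fun _ v => v) N W ->
  inverse_integrating_factor (fun z => Rabs (fst z) < e / 4 /\ Rabs (snd z) < e / 4)
    (fun x y => y + p x y) q (fun x y => W x (y + p x y) / (1 + py x y)).
Proof.
  intros Hr Hdel He Dp Dq Cp Cpy Bpy BY Hh hY Ch HN DN (HW1 & HW2 & HW3).
  apply Ck_C1_on in HW1.
  assert (Sub : forall x y, box (e / 4) x y -> box r x y /\ box e x (y + p x y)).
  { intros x y [Hx Hy]. assert (A : box r x y) by (split; lra). split; trivial. split. lra.
    apply Rle_lt_trans with (1 := Rabs_triang _ _). assert (X := BY x y A). lra. }
  assert (Sub2 : forall x y, box r x y -> box rho x y) by (intros x y [Hx Hy]; split; lra).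
  assert (Sub3 : forall x y, box e x y -> box delta x y) by (intros x y [Hx Hy]; split; lra).
  assert (HJ : forall x y, box r x y -> 1 + py x y <> 0).
  { intros x y Hxy. assert (Z := Bpy x y Hxy). apply Rabs_le_between in Z. lra. }
  split; [|split].
  - apply Ck_C1_on. apply Ck_div.
    + apply box_open.
    + apply (Ck_comp 1 (box (e / 4)) (box e) W (fun x _ => x) (fun x y => y + p x y)); trivial.
      * apply Ck_fst.
      * apply Ck_plus. apply Ck_snd. apply Ck_subset with (box rho); trivial. intros x y Hxy. now apply Sub2, Sub.
      * intros x y Hxy. now apply Sub.
    + apply Ck_plus. apply Ck_const. apply Ck_subset with (box rho); trivial. intros x y Hxy. now apply Sub2, Sub.
    + intros x y Hxy. apply HJ. now apply Sub.
  - intros G HG [[x0 y0] Hz] HGU.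
    (* The open set is carried to the (x, Y)-plane through the continuous h; a point there with W
       non-zero comes back to a point of the given set. *)
    destruct (HW2 (fun z => box e (fst z) (snd z) /\ G (fst z, h (fst z) (snd z)))) as (x & Y & [HxY HGx] & HWn).
    + intros [x Y] [HxY HGx]. cbn [fst snd] in *. apply locally_pair.
      apply locally_2d_and. { exact (box_open e x Y HxY). }
      apply HG, locally_pair in HGx. destruct HGx as [d Hd].
      destruct (Ch x Y (Sub3 _ _ HxY) d) as [d' Hd'].
      exists (mkposreal (Rmin d d') (Rmin_case d d' (fun z => 0 < z) (cond_pos d) (cond_pos d'))). cbn [pos fst snd].
      intros u v Hu Hv. apply Hd. apply Rlt_le_trans with (1 := Hu), Rmin_l.
      apply Hd'. apply Rlt_le_trans with (1 := Hu), Rmin_r. apply Rlt_le_trans with (1 := Hv), Rmin_r.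
    + assert (B0 := HGU _ Hz). destruct (Sub x0 y0 B0) as [A1 A2].
      exists (x0, y0 + p x0 y0). cbn [fst snd]. split; trivial. now rewrite hY by auto.
    + intros z [Hz1 _]. exact Hz1.
    + cbn [fst snd] in *. destruct (Hh x Y (Sub3 _ _ HxY)) as [A1 A2].
      exists x, (h x Y). split; trivial. rewrite A2. apply Rmult_integral_contrapositive. split; trivial.
      now apply Rinv_neq_0_compat, HJ.
  - intros x y Hxy. destruct (Sub x y Hxy) as [A1 A2]. set (Y := y + p x y) in *.
    destruct (Dp x y (Sub2 x y A1)) as (Dp1 & Dpx & Dpy). assert (Dq1 := Dq x y (Sub2 x y A1)).
    assert (J0 := HJ x y A1).
    destruct HW1 as (wx & wy & DW & _ & _). assert (DW1 := DW x Y A2).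
    assert (DY : differentiable_pt_lim (fun x y => y + p x y) x y (px x y) (1 + py x y)).
    { apply (differentiable_eq _ _ _ (0 + px x y) (1 + py x y)); [|ring|ring].
      apply differentiable_plus; trivial. apply differentiable_snd. }
    assert (DJ : differentiable_pt_lim (fun x y => 1 + py x y) x y (pxy x y) (pyy x y)).
    { apply (differentiable_eq _ _ _ (0 + pxy x y) (0 + pyy x y)); [|ring|ring].
      apply (differentiable_plus (fun _ _ => 1)); trivial.
      apply (differentiable_pt_lim_proj1_0 (fun _ => 1)). apply derivable_pt_lim_const. }
    assert (DWc : differentiable_pt_lim (fun x y => W x (y + p x y)) x y (wx x Y + wy x Y * px x y) (wy x Y * (1 + py x y))).
    { apply (differentiable_eq _ _ _ (wx x Y * 1 + wy x Y * px x y) (wx x Y * 0 + wy x Y * (1 + py x y))); [|ring|ring].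
      apply (differentiable_pt_lim_comp W (fun x _ => x) (fun x y => y + p x y)); trivial. apply differentiable_fst. }
    assert (DV : differentiable_pt_lim (fun x y => W x (y + p x y) / (1 + py x y)) x y
       ((wx x Y + wy x Y * px x y) / (1 + py x y) - W x Y * pxy x y / (1 + py x y) ^ 2)
       (wy x Y - W x Y * pyy x y / (1 + py x y) ^ 2)).
    { apply (differentiable_eq _ _ _
        ((wx x Y + wy x Y * px x y) * / (1 + py x y) + W x (y + p x y) * (- / (1 + py x y) ^ 2 * pxy x y))
        ((wy x Y * (1 + py x y)) * / (1 + py x y) + W x (y + p x y) * (- / (1 + py x y) ^ 2 * pyy x y))).
      - apply (differentiable_mult (fun x y => W x (y + p x y)) (fun x y => / (1 + py x y))); trivial.
        apply (differentiable_comp1 Rinv (fun x y => 1 + py x y)); trivial.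
        auto_derive; trivial. field; trivial.
      - fold Y. field; trivial.
      - fold Y. field; trivial. }
    destruct (differentiable_is_derive _ _ _ _ _ DV) as [V1 V2].
    destruct (differentiable_is_derive _ _ _ _ _ DY) as [Y1 Y2].
    destruct (differentiable_is_derive _ _ _ _ _ Dq1) as [_ q2].
    destruct (differentiable_is_derive _ _ _ _ _ DW1) as [W1 W2].
    assert (DNx : exists nY : R, is_derive (fun v => N x v) Y nY) by exact (DN x Y (Sub3 _ _ A2)).
    destruct DNx as [nY HnY].
    (* N is known through its composition with Y = y + p(x, y); differentiating the composed
       identity in y recovers its derivative in Y. *)
    assert (EN : nY * (1 + py x y) = pyy x y * q x y + (1 + py x y) * qy x y + (pxy x y * Y + px x y * (1 + py x y))).
    { assert (N1 : is_derive (fun v => N x (v + p x v)) y ((1 + py x y) * nY)).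
      { apply (is_derive_comp (fun v => N x v) (fun v => v + p x v) y nY (1 + py x y)); trivial. }
      assert (N2 : is_derive (fun v => N x (v + p x v)) y
         (pyy x y * q x y + (1 + py x y) * qy x y + (pxy x y * Y + px x y * (1 + py x y)))).
      { destruct (differentiable_is_derive _ _ _ _ _ DJ) as [_ J2].
        destruct (differentiable_is_derive _ _ _ _ _ Dpx) as [_ X2].
        apply (is_derive_ext_loc (fun v => (1 + py x v) * q x v + px x v * (v + p x v))).
        - assert (L := box_open (e / 4) x y Hxy). apply locally_2d_1d_const_x in L.
          revert L. apply filter_imp. intros v Hv. destruct (Sub x v Hv) as [B1 B2]. symmetry. apply HN; auto.
        - apply (is_derive_plus (fun v => (1 + py x v) * q x v) (fun v => px x v * (v + p x v))).
          + apply (is_derive_mult (fun v => 1 + py x v) (fun v => q x v)); trivial. intros; apply Rmult_comm.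
          + apply (is_derive_mult (fun v => px x v) (fun v => v + p x v)); trivial. intros; apply Rmult_comm. }
      assert (E := is_derive_unique _ _ _ N1). rewrite (is_derive_unique _ _ _ N2) in E. lra. }
    assert (Eq := HW3 x Y A2). cbv beta in Eq.
    replace (Defs.d1 W x Y) with (wx x Y) in Eq by (symmetry; now apply is_derive_unique).
    replace (Defs.d2 W x Y) with (wy x Y) in Eq by (symmetry; now apply is_derive_unique).
    replace (Defs.d2 N x Y) with nY in Eq by (symmetry; now apply is_derive_unique).
    replace (Defs.d1 (fun _ v : R => v) x Y) with 0 in Eq by (unfold Defs.d1; now rewrite Derive_const).
    assert (HNx : N x Y = (1 + py x y) * q x y + px x y * Y) by (apply HN; auto).
    rewrite HNx in Eq.
    assert (E1 : Defs.d1 (fun x y => W x (y + p x y) / (1 + py x y)) x y = _) by exact (is_derive_unique _ _ _ V1).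
    assert (E2 : Defs.d2 (fun x y => W x (y + p x y) / (1 + py x y)) x y = _) by exact (is_derive_unique _ _ _ V2).
    assert (E3 : Defs.d1 (fun x y => y + p x y) x y = _) by exact (is_derive_unique _ _ _ Y1).
    assert (E4 : Defs.d2 q x y = _) by exact (is_derive_unique _ _ _ q2).
    rewrite E1, E2, E3, E4. cbv beta. fold Y.
    assert (EnY : nY = (pyy x y * q x y + (1 + py x y) * qy x y + (pxy x y * Y + px x y * (1 + py x y))) / (1 + py x y)).
    { rewrite <- EN. field; trivial. }
    assert (Ewx : Y * wx x Y = (0 + nY) * W x Y - ((1 + py x y) * q x y + px x y * Y) * wy x Y) by lra.
    replace (Y * ((wx x Y + wy x Y * px x y) / (1 + py x y) - W x Y * pxy x y / (1 + py x y) ^ 2))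
      with ((Y * wx x Y + Y * wy x Y * px x y) / (1 + py x y) - Y * W x Y * pxy x y / (1 + py x y) ^ 2) by (field; trivial).
    rewrite Ewx, EnY. field; trivial.
Qed.

Lemma Ana_snd (rho : R) : 0 < rho -> Ana rho (fun _ y => y).
Proof.
  intros Hr. set (a := fun n i => if Nat.eq_dec n 1 then (if Nat.eq_dec i 0 then 1 else 0) else 0).
  assert (F1 : forall x y, form 1 (a 1%nat) x y = y). { intros. rewrite form_S, form_0. unfold a. simpl. ring. }
  assert (Fn : forall n x y, n <> 1%nat -> form n (a n) x y = 0).
  { intros n x y Hn. rewrite (form_ext n (a n) (fun i => 0 * 0)), <- form_scal. ring.
    intros i _. unfold a. destruct (Nat.eq_dec n 1). lia. ring. }
  assert (Nn : forall n, n <> 1%nat -> fnorm n (a n) = 0).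
  { intros n Hn. apply Rle_antisym; [|apply fnorm_pos].
    apply Rle_trans with (0 * fnorm n (fun _ => 0)). apply fnorm_le. lra.
    intros i _. unfold a. destruct (Nat.eq_dec n 1). lia. rewrite Rabs_R0. lra. lra. }
  exists a. split.
  - split; trivial. exists (2 * rho), (/ (2 * rho)). repeat split.
    + lra.
    + apply Rinv_0_lt_compat. lra.
    + replace (/ (2 * rho) * rho) with (/ 2) by (field; lra). lra.
    + intros n. destruct (Nat.eq_dec n 1) as [->|Hn].
      * rewrite fnorm_S, fnorm_0. unfold a. simpl. rewrite Rabs_R1, Rabs_R0. right. field. lra.
      * rewrite Nn by trivial. apply Rmult_le_pos. lra. apply pow_le. left. apply Rinv_0_lt_compat. lra.
  - intros x y _. symmetry. apply is_series_unique. apply is_series_decr_1, is_series_decr_1.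
    rewrite F1, Fn by lia. apply (is_series_ext (fun _ => 0)). { intros n. now rewrite Fn by lia. }
    evar_last. apply is_series_Reals. intros eps Heps. exists O. intros n _. rewrite sum_eq_R0 by trivial.
    rewrite R_dist_eq. exact Heps. unfold plus, opp; simpl. ring.
Qed.

Lemma Ev_diag_y (c : nat -> R) (x y : R) : Ev (diag c) x y = Ev (diag c) x 0.
Proof. apply Series_ext. intros n. now rewrite !form_diag. Qed.

Lemma Ev_lipschitz_origin (rho : R) (a : nat -> nat -> R) : geometric rho a ->
  exists r M, 0 < r <= rho /\ 0 <= M /\ forall u, Rabs u < r -> Rabs (Ev a u 0 - a O O) <= M * Rabs u.
Proof.
  intros Ha. assert (Hx := geometric_dx _ _ Ha).
  destruct (Ck_bound_origin 0 rho 1 _ (proj1 Ha) (Ev_Ck 0 rho _ Hx)) as (r & Hr & HB); [lra|].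
  set (M := Rabs (Ev (dx_coefs a) 0 0) + 1). assert (HA := Rabs_pos (Ev (dx_coefs a) 0 0)).
  exists r, M. split; [trivial|split; [unfold M; lra|]].
  intros u Hu. rewrite <- (Ev_origin rho) by trivial. rewrite <- (Rminus_0_r u) at 2.
  apply (derive_lipschitz (fun u => Ev a u 0) (fun u => Ev (dx_coefs a) u 0) M (- r) r).
  - intros z Hz. apply (differentiable_is_derive (Ev a) z 0 (Ev (dx_coefs a) z 0) (Ev (dy_coefs a) z 0)).
    apply Ev_differentiable with rho; trivial. split. apply Rabs_def1; lra. rewrite Rabs_R0; lra.
  - intros z Hz. assert (X := HB z 0). assert (Y : box r z 0).
    { split. apply Rabs_def1; lra. rewrite Rabs_R0; lra. }
    apply X in Y. unfold M. replace (Ev (dx_coefs a) z 0) with (Ev (dx_coefs a) 0 0 + (Ev (dx_coefs a) z 0 - Ev (dx_coefs a) 0 0)) by ring.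
    apply Rle_trans with (1 := Rabs_triang _ _). lra.
  - apply Rabs_def2 in Hu. lra.
  - lra.
Qed.

(** * From the normal form to the inverse integrating factor *)

(** The weight of y is n = m + 2. Then N = r^(2n-1) [nu], where the term v^2 g contributes with an
    extra factor r and disappears at r = 0. The exponent k = (m + 1) + 2 + m is 2 n - 1, and B(th,
    0) is a quadratic form in cos^n and sin, whose negative discriminant excludes zeros. *)
Lemma nilpotent_planar (m : nat) (N F G g : R -> R -> R) (x y : R -> R) (sg delta eta : R) :
  0 < delta <= 1 -> 0 < eta ->
  Ck 2 (box delta) N -> Ck 2 (box delta) F -> Ck 2 (box delta) G -> Ck 2 (box delta) g ->
  (forall u v, box delta u v ->
     N u v = u ^ (S m + S (S m)) * F u 0 + u ^ S m * G u 0 * v + v ^ 2 * g u v) ->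
  F 0 0 < 0 -> G 0 0 ^ 2 + 4 * F 0 0 * INR (S (S m)) < 0 ->
  signed_orbit (fun _ v => v) N sg x y ->
  exists V0 e0, 0 < e0 <= eta /\
    inverse_integrating_factor (fun z => Rabs (fst z) < e0 /\ Rabs (snd z) < e0) (fun _ v => v) N V0.
Proof.
  intros Hdel Heta CN CF CG Cg HN Ha Hdisc (Hsg & Hor & Lx & Ly).
  set (n := S (S m)) in *. assert (Hn : 0 < INR n) by apply lt_0_INR, Nat.lt_0_succ.
  set (nu := fun th r => cos th ^ (S m + n) * F (r * cos th) 0 + cos th ^ S m * sin th * G (r * cos th) 0
     + r * sin th ^ 2 * g (r * cos th) (r ^ n * sin th)).
  set (B := fun th r => cos th * nu th r - INR n * sin th ^ 2).
  set (A := fun th r => cos th * sin th + sin th * nu th r).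
  assert (Hbox : forall th r, strip delta th r -> box delta (r * cos th) (r ^ n * sin th)).
  { intros th r Hr. unfold strip in Hr. assert (X := box_polar delta th r Hr).
    split. apply X. apply Rle_lt_trans with (2 := proj2 X). rewrite !Rabs_mult. apply Rmult_le_compat_r. apply Rabs_pos.
    rewrite <- RPow_abs. apply Rle_trans with (Rabs r * 1); [|lra].
    change (Rabs r ^ n) with (Rabs r * Rabs r ^ S m). apply Rmult_le_compat_l. apply Rabs_pos.
    rewrite <- (pow1 (S m)). apply pow_incr. split. apply Rabs_pos. lra. }
  assert (Hbox0 : forall th r, strip delta th r -> box delta (r * cos th) 0).
  { intros th r Hr. split. now apply Hbox. rewrite Rabs_R0. lra. }
  assert (Ccs := Ck_cos_sin 2 (strip delta)). destruct Ccs as [Cc Cs].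
  assert (Crc : Ck 2 (strip delta) (fun th r => r * cos th)) by (apply Ck_mult; trivial; apply Ck_snd).
  assert (C1 : forall H, Ck 2 (box delta) H -> Ck 2 (strip delta) (fun th r => H (r * cos th) 0)).
  { intros H CH. apply (Ck_comp 2 (strip delta) (box delta) H (fun th r => r * cos th) (fun _ _ => 0)); trivial. apply Ck_const. }
  assert (Cnu : Ck 2 (strip delta) nu).
  { apply Ck_plus. apply Ck_plus.
    - apply Ck_mult; auto. now apply Ck_pow.
    - apply Ck_mult; auto. apply Ck_mult; trivial. now apply Ck_pow.
    - apply Ck_mult. apply Ck_mult. apply Ck_snd. now apply Ck_pow.
      apply (Ck_comp 2 (strip delta) (box delta) g (fun th r => r * cos th) (fun th r => r ^ n * sin th)); trivial.
      apply Ck_mult; trivial. apply Ck_pow, Ck_snd. }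
  assert (CA : Ck 2 (strip delta) A).
  { apply Ck_plus; now apply Ck_mult. }
  assert (CB : Ck 2 (strip delta) B).
  { apply Ck_minus. apply strip_open. now apply Ck_mult. apply Ck_mult. apply Ck_const. now apply Ck_pow. }
  assert (Pnu : forall th r, nu (th + 2 * PI) r = nu th r).
  { intros. unfold nu. now rewrite cos_2PI_shift, sin_2PI_shift. }
  assert (PA : forall th r, A (th + 2 * PI) r = A th r).
  { intros. unfold A. now rewrite cos_2PI_shift, sin_2PI_shift, Pnu. }
  assert (PB : forall th r, B (th + 2 * PI) r = B th r).
  { intros. unfold B. now rewrite cos_2PI_shift, sin_2PI_shift, Pnu. }
  destruct (nonvanishing_strip delta B) as (dl & Hdl & HB); trivial; try lra.
  { (* [4 n B(th, 0) = (b^2 + 4 a n) X^2 - (2 n sin - b X)^2] with [X = cos^n] *)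
    intros th. unfold B, nu. rewrite !Rmult_0_l, Rplus_0_r. intros E.
    rewrite pow_add in E. set (X := cos th ^ n) in *.
    assert (EX : F 0 0 * X ^ 2 + G 0 0 * X * sin th - INR n * sin th ^ 2 = 0).
    { etransitivity; [|exact E]. unfold X. change (cos th ^ n) with (cos th * cos th ^ S m). ring. }
    assert (E2 : (G 0 0 ^ 2 + 4 * F 0 0 * INR n) * X ^ 2 - (2 * INR n * sin th - G 0 0 * X) ^ 2 = 0).
    { replace ((G 0 0 ^ 2 + 4 * F 0 0 * INR n) * X ^ 2 - (2 * INR n * sin th - G 0 0 * X) ^ 2)
        with (4 * INR n * (F 0 0 * X ^ 2 + G 0 0 * X * sin th - INR n * sin th ^ 2)) by ring.
      rewrite EX. ring. }
    assert (S1 := pow2_ge_0 (2 * INR n * sin th - G 0 0 * X)).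
    destruct (Req_dec X 0) as [E0|E0].
    - rewrite E0 in E2. assert (sin th = 0).
      { assert (Z : (2 * INR n * sin th) ^ 2 = 0) by lra.
        replace ((2 * INR n * sin th) ^ 2) with ((2 * INR n) ^ 2 * (sin th * sin th)) in Z by ring.
        apply Rmult_integral in Z. destruct Z as [Z|Z].
        - exfalso. apply (pow_nonzero (2 * INR n) 2); trivial. lra.
        - apply Rmult_integral in Z. tauto. }
      assert (Hc : cos th <> 0). { intros Hc. assert (W := sin2_cos2_pow th). rewrite Hc, H in W. lra. }
      now apply (pow_nonzero _ n Hc).
    - assert (0 < X ^ 2) by now apply pow2_gt_0. nra. }
  assert (Sub : forall th r, strip dl th r -> strip delta th r) by (unfold strip; intros; lra).
  assert (HNp : forall th r, 0 < r < dl -> N (r * cos th) (r ^ n * sin th) = r ^ (S m + n) * nu th r).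
  { intros th r Hr. rewrite HN. 2: { apply Hbox. unfold strip. rewrite Rabs_pos_eq; lra. }
    unfold nu. set (gg := g (r * cos th) (r ^ n * sin th)).
    rewrite !Rpow_mult_distr, !pow_add. change (r ^ n) with (r * r ^ S m). ring. }
  destruct (Ck_S _ _ _ CN) as (nx & ny & DN & _).
  destruct (planar_conclusion (S m) m (fun _ v => v) N (fun _ _ => 0) (fun _ _ => 1) nx ny A B dl)
    with (sg := sg) (x := x) (y := y) (eta := eta) as (V0 & e0 & He0 & HV); trivial; try lra.
  - intros u v _ _. apply differentiable_snd.
  - intros u v Hu Hv. apply DN. split; lra.
  - now apply Ck_subset with (strip delta).
  - now apply Ck_subset with (strip delta).
  - intros th r Hr. fold n. rewrite HNp by trivial. unfold B.
    replace (S m + 2 + m)%nat with (S m + n)%nat by (unfold n; lia).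
    rewrite pow_add. change (r ^ n) with (r * r ^ S m). ring.
  - intros th r Hr. fold n. rewrite HNp by trivial. unfold A.
    replace (S m + 2 + m)%nat with (S m + n)%nat by (unfold n; lia).
    change (r ^ S (S m + n)) with (r * r ^ (S m + n)).
    rewrite pow_add. change (r ^ n) with (r * r ^ S m). ring.
  - now exists V0, e0.
Qed.

Lemma least_nonzero (c : nat -> R) (j : nat) : c j <> 0 ->
  exists k, (k <= j)%nat /\ c k <> 0 /\ forall i, (i < k)%nat -> c i = 0.
Proof.
  induction j as [j IH] using lt_wf_ind. intros Hj.
  destruct (classic (exists i, (i < j)%nat /\ c i <> 0)) as [(i & Hi & Hc)|Hn].
  - destruct (IH i Hi Hc) as (k & Hk & H). exists k. split; trivial. lia.
  - exists j. split; trivial. split; trivial. intros i Hi. apply NNPP. intros Hc. apply Hn. now exists i.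
Qed.

(** The exponents are read off the barriers: the order of f is odd with a negative leading
    coefficient, the coefficients of phi below degree n - 1 vanish by [strong_damping], and
    [real_separatrix] gives the discriminant condition. The coefficient of phi in degree n - 1 may
    be zero. *)
Lemma nilpotent_normal_form (N g : R -> R -> R) (c c' : nat -> R) (x y : R -> R) (sg delta eta : R) (j : nat) :
  0 < delta <= 1 -> 0 < eta -> geometric delta (diag c) -> geometric delta (diag c') ->
  Ck 2 (box delta) N -> Ck 2 (box delta) g ->
  (forall u v, box delta u v -> N u v = Ev (diag c) u 0 + v * (Ev (diag c') u 0 + v * g u v)) ->
  c 0%nat = 0 -> c 1%nat = 0 -> c j <> 0 ->
  signed_orbit (fun _ v => v) N sg x y -> crosses x y ->
  exists V0 e0, 0 < e0 <= eta /\
    inverse_integrating_factor (fun z => Rabs (fst z) < e0 /\ Rabs (snd z) < e0) (fun _ v => v) N V0.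
Proof.
  intros Hdel Heta Gc Gc' CN Cg HN c0 c1 cj Hor Hcr.
  destruct (least_nonzero c j cj) as (al & _ & Hal & Hmin).
  destruct (Ev_diag_factor delta c al Gc Hmin) as [GF HF].
  set (cF := diag (fun n => c (n + al)%nat)) in *.
  assert (EF : cF O O = c al) by reflexivity.
  destruct (Ev_lipschitz_origin delta cF GF) as (rF & MF & HrF & HMF & BF). rewrite EF in BF.
  destruct (Ck_bound_origin 2 delta 1 g (proj1 Hdel) Cg) as (rg & Hrg & Bg); [lra|].
  assert (HF' : forall u, Rabs u < delta -> Ev (diag c) u 0 = u ^ al * Ev cF u 0).
  { intros u Hu. apply HF. split; trivial. rewrite Rabs_R0; lra. }
  destruct (restoring_force N (fun u => Ev cF u 0) x y sg (c al) MF rF) with (al := al) as [Hneg [m' Hodd]]; trivial.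
  { lra. }
  { intros u Hu. rewrite HN, HF' by (try split; rewrite ?Rabs_R0; lra). ring. }
  (* The order of f is odd and at least 2, hence at least 3, and equals 2 n - 1 with n = m + 2. *)
  assert (Hm : exists m, al = (S m + S (S m))%nat).
  { destruct al as [|[|al]]; try tauto. exists (m' - 1)%nat. lia. }
  destruct Hm as [m Em].
  assert (Gfact : forall k, (forall i, (i < k)%nat -> c' i = 0) ->
    geometric delta (diag (fun n => c' (n + k)%nat)) /\
    exists M d, 0 < d <= 1 /\ d <= delta /\ 0 <= M /\
      (forall u, Rabs u < d -> Rabs (Ev cF u 0 - c al) <= M * Rabs u) /\
      (forall u, Rabs u < d -> Rabs (Ev (diag (fun n => c' (n + k)%nat)) u 0 - c' k) <= M * Rabs u) /\
      (forall u v, Rabs u < d -> Rabs v < d -> Rabs (g u v) <= M) /\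
      (forall u v, box delta u v -> N u v = u ^ al * Ev cF u 0 + u ^ k * Ev (diag (fun n => c' (n + k)%nat)) u 0 * v + v ^ 2 * g u v)).
  { intros k Hk. destruct (Ev_diag_factor delta c' k Gc' Hk) as [GG HG]. split; trivial.
    destruct (Ev_lipschitz_origin delta _ GG) as (rG & MG & HrG & HMG & BG).
    assert (Eg : diag (fun n => c' (n + k)%nat) O O = c' k) by reflexivity. rewrite Eg in BG.
    set (M := MF + MG + (Rabs (g 0 0) + 1)). assert (Hg0 := Rabs_pos (g 0 0)).
    set (d := Rmin rF (Rmin rG rg)).
    assert (Hd : 0 < d /\ d <= rF /\ d <= rG /\ d <= rg).
    { split. { repeat apply Rmin_case; lra. } split. apply Rmin_l.
      split; apply Rle_trans with (1 := Rmin_r _ _). apply Rmin_l. apply Rmin_r. }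
    exists M, d. unfold M. split. lra. split. lra. split. lra. split; [|split; [|split]].
    - intros u Hu. apply Rle_trans with (1 := BF u ltac:(lra)). apply Rmult_le_compat_r. apply Rabs_pos. lra.
    - intros u Hu. apply Rle_trans with (1 := BG u ltac:(lra)). apply Rmult_le_compat_r. apply Rabs_pos. lra.
    - intros u v Hu Hv. assert (X : box rg u v) by (split; lra). apply Bg in X.
      assert (Z := Rabs_triang (g u v - g 0 0) (g 0 0)). replace (g u v - g 0 0 + g 0 0) with (g u v) in Z by ring. lra.
    - intros u v Huv. rewrite HN by trivial. rewrite HF' by apply Huv. rewrite HG.
      ring. split. apply Huv. rewrite Rabs_R0; lra. }
  assert (Hlow : forall i, (i < S m)%nat -> c' i = 0).
  { intros i Hi. apply NNPP. intros Hc'. destruct (least_nonzero c' i Hc') as (k & Hki & Hk & Hkmin).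
    destruct (Gfact k Hkmin) as (_ & M & d & Hd & Hdd & HM & B1 & B2 & B3 & HNk).
    apply (strong_damping N g (fun u => Ev cF u 0) (fun u => Ev (diag (fun n => c' (n + k)%nat)) u 0) x y sg (c al) (c' k) M d Hor Hcr Hd HM B1 B2 B3 k (m - k)); trivial.
    intros u v Hu Hv. rewrite HNk by (split; lra).
    replace (S (m - k) + k + (k + 2 + (m - k)))%nat with al by lia. reflexivity. }
  destruct (Gfact (S m) Hlow) as (GG & M & d & Hd & Hdd & HM & B1 & B2 & B3 & HNk).
  assert (Hdisc : c' (S m) ^ 2 + 4 * c al * INR (S (S m)) < 0).
  { apply Rnot_le_lt. intros Hdisc.
    apply (real_separatrix N g (fun u => Ev cF u 0) (fun u => Ev (diag (fun n => c' (n + S m)%nat)) u 0) x y sg (c al) (c' (S m)) M d Hor Hcr Hd HM B1 B2 B3 (S m)); trivial.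
    intros u v Hu Hv. rewrite HNk by (split; lra). now rewrite Em at 1. }
  assert (O1 : Ev cF 0 0 = c al) by now rewrite (Ev_origin delta).
  assert (O2 : Ev (diag (fun n => c' (n + S m)%nat)) 0 0 = c' (S m)) by now rewrite (Ev_origin delta).
  apply (nilpotent_planar m N (Ev cF) (Ev (diag (fun n => c' (n + S m)%nat))) g x y sg delta eta); trivial.
  - now apply Ev_Ck.
  - now apply Ev_Ck.
  - intros u v Huv. rewrite HNk by trivial. now rewrite <- Em.
  - now rewrite O1.
  - now rewrite O1, O2.
Qed.

Lemma differentiable_unique_x (f g : R -> R -> R) (x y a b a' b' : R) :
  locally_2d (fun u v => f u v = g u v) x y ->
  differentiable_pt_lim f x y a b -> differentiable_pt_lim g x y a' b' -> a = a'.
Proof.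
  intros Hfg Hf Hg. apply differentiable_pt_lim_ext with (2 := Hf) in Hfg.
  destruct (differentiable_is_derive _ _ _ _ _ Hfg) as [H1 _]. destruct (differentiable_is_derive _ _ _ _ _ Hg) as [H2 _].
  apply is_derive_unique in H1, H2. now rewrite <- H1, <- H2.
Qed.

Lemma Ev_diag_zero (c : nat -> R) (x y : R) : (forall n, c n = 0) -> Ev (diag c) x y = 0.
Proof.
  intros H. unfold Ev. rewrite (Series_ext _ (fun _ => 0 * 0)). rewrite Series_scal_l. ring.
  intros n. rewrite form_diag, H. ring.
Qed.

Lemma is_lim_shift_0 (f : R -> R) (T : R) : is_lim f p_infty 0 -> is_lim (fun t => f (t + T)) p_infty 0.
Proof.
  intros H. apply is_lim_spec in H. apply is_lim_spec. intros eps. destruct (H eps) as [M HM].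
  exists (M - T). intros t Ht. apply HM. lra.
Qed.

(** After a shift of time the orbit lies in the box where the change of variable is invertible. On
    the y-axis |p| <= |y| / 2, so Y has the sign of y and the crossings survive. The orbit still
    avoids the origin because x = Y = 0 forces y = 0. *)
Lemma straightened_orbit (r delta d sg : R) (p px py q h N : R -> R -> R) (x y : R -> R) :
  0 < d <= delta -> delta <= r ->
  (forall u v, box r u v -> differentiable_pt_lim p u v (px u v) (py u v)) ->
  (forall u v, box r u v -> Rabs (p u v) <= / 2 * Rabs u + / 2 * Rabs v) ->
  (forall u Y, box delta u Y -> Rabs (h u Y) <= Rabs u + 2 * Rabs Y) ->
  (forall u v, box r u v -> box delta u (v + p u v) -> h u (v + p u v) = v) ->
  (forall u v, box r u v -> box delta u (v + p u v) ->
     N u (v + p u v) = (1 + py u v) * q u v + px u v * (v + p u v)) ->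
  signed_orbit (fun u v => v + p u v) q sg x y -> crosses x y ->
  exists x' Y', signed_orbit (fun _ v => v) N sg x' Y' /\ crosses x' Y'.
Proof.
  intros Hd Hdr Dp Bp Bh Hh HN (Hsg & Hor & Lx & Ly) Hcr.
  assert (He : 0 < d / 4) by lra.
  assert (Lx' := Lx). assert (Ly' := Ly). apply is_lim_spec in Lx', Ly'.
  destruct (Lx' (mkposreal _ He)) as [T1 HT1]. destruct (Ly' (mkposreal _ He)) as [T2 HT2]. cbn [pos] in HT1, HT2.
  set (T := Rmax 0 (Rmax T1 T2 + 1)).
  assert (HT : 0 <= T /\ T1 < T /\ T2 < T).
  { assert (A := Rmax_l 0 (Rmax T1 T2 + 1)). assert (B := Rmax_r 0 (Rmax T1 T2 + 1)). fold T in A, B.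
    assert (C := Rmax_l T1 T2). assert (D := Rmax_r T1 T2). lra. }
  assert (Hb : forall t, T <= t -> box (d / 4) (x t) (y t)).
  { intros t Ht. split; rewrite <- (Rminus_0_r (_ t)); [apply HT1|apply HT2]; lra. }
  assert (Hbr : forall u v, box (d / 4) u v -> box r u v /\ box delta u (v + p u v)).
  { intros u v [Hu Hv]. assert (A : box r u v) by (split; lra). split; trivial. split. lra.
    apply Rle_lt_trans with (1 := Rabs_triang _ _). assert (X := Bp u v A). lra. }
  set (Y := fun t => y t + p (x t) (y t)).
  assert (HY : forall t, T <= t -> Rabs (Y t) <= Rabs (x t) + 2 * Rabs (y t)).
  { intros t Ht. unfold Y. apply Rle_trans with (1 := Rabs_triang _ _). assert (X := Bp _ _ (proj1 (Hbr _ _ (Hb t Ht)))).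
    assert (X1 := Rabs_pos (x t)). assert (X2 := Rabs_pos (y t)). lra. }
  exists (fun t => x (t + T)), (fun t => Y (t + T)). split.
  - split; [trivial|split; [|split]].
    + intros t Ht. assert (Ht' : T <= t + T) by lra. destruct (Hbr _ _ (Hb _ Ht')) as [A1 A2].
      destruct (Hor (t + T)) as (Hn & Dx & Dy). lra.
      assert (Dsh : is_derive (fun t => t + T) t 1) by (auto_derive; trivial).
      split; [|split].
      * intros E. injection E as E1 E2. apply Hn. f_equal; trivial.
        assert (X := Hh _ _ A1 A2). assert (Z := Bh _ _ A2). rewrite X in Z. fold (Y (t + T)) in Z.
        rewrite E1, E2, Rabs_R0 in Z. destruct (Req_dec (y (t + T)) 0) as [E|E]; trivial.
        apply Rabs_pos_lt in E. lra.
      * evar_last. apply (is_derive_comp x (fun t => t + T) t (sg * (y (t + T) + p (x (t + T)) (y (t + T)))) 1); trivial.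
        unfold scal; simpl; unfold mult; simpl. unfold Y. ring.
      * evar_last.
        { apply (is_derive_comp Y (fun t => t + T) t (sg * N (x (t + T)) (Y (t + T))) 1); trivial.
          unfold Y at 1. evar_last.
          - apply (is_derive_plus y (fun s => p (x s) (y s)) (t + T)); [exact Dy|].
            apply (is_derive_comp_2d p x y (t + T) _ _ _ _ (Dp _ _ A1) Dx Dy).
          - unfold Y. rewrite HN by trivial. unfold plus; simpl. ring. }
        unfold scal; simpl; unfold mult; simpl. ring.
    + now apply is_lim_shift_0.
    + apply is_lim_shift_0. apply is_lim_spec. intros eps.
      assert (He4 : 0 < eps / 4) by (assert (X := cond_pos eps); lra).
      apply is_lim_spec in Lx, Ly. destruct (Lx (mkposreal _ He4)) as [M1 HM1]. destruct (Ly (mkposreal _ He4)) as [M2 HM2].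
      cbn [pos] in HM1, HM2. exists (Rmax T (Rmax M1 M2)). intros t Ht.
      assert (A := Rmax_l T (Rmax M1 M2)). assert (B := Rmax_r T (Rmax M1 M2)).
      assert (C := Rmax_l M1 M2). assert (D := Rmax_r M1 M2).
      assert (X1 := HM1 t ltac:(lra)). assert (X2 := HM2 t ltac:(lra)). rewrite Rminus_0_r in *.
      assert (Z := HY t ltac:(lra)). lra.
  - intros T' s Hs. destruct (Hcr (Rmax T (T' + T)) s Hs) as (t & Ht & E & Hp).
    assert (A := Rmax_l T (T' + T)). assert (B := Rmax_r T (T' + T)).
    exists (t - T). replace (t - T + T) with t by ring. split; [lra|split; trivial].
    assert (X := Bp _ _ (proj1 (Hbr _ _ (Hb t ltac:(lra))))). rewrite E, Rabs_R0 in X.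
    unfold Y. rewrite E. apply Rabs_le_between in X.
    destruct Hs as [->| ->].
    + rewrite Rabs_pos_eq in X by lra. lra.
    + rewrite Rabs_left in X by lra. lra.
Qed.

(** Y' is written as a function of (x, y) and divided twice by Y. The dividend has neither constant
    nor linear part, which starts f in degree at least 2, and f is not identically zero because the
    singular point is isolated. *)
Lemma nilpotent_focus (D : R * R -> Prop) (P2 Q2 : R -> R -> R) :
  open D -> D (0, 0) -> order_at_least 2 P2 -> order_at_least 2 Q2 ->
  is_focus D (fun x y => y + P2 x y) Q2 ->
  has_inverse_integrating_factor D (fun x y => y + P2 x y) Q2.
Proof.
  intros HD HD0 HP HQ Hfoc.
  destruct (order_two_derivatives P2 HP) as (r1 & px & py & pxx & pxy & pyy & Hr1 & AP & APx & APy & _ & _ & _ & DP & p0 & px0 & py0 & pc & Gp & pc0 & HE).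
  destruct (order_two_derivatives Q2 HQ) as (r2 & qx & qy & qxx & qxy & qyy & Hr2 & AQ & AQx & AQy & _ & _ & _ & DQ & q0 & qx0 & qy0 & _).
  set (rho := Rmin r1 r2).
  assert (Hrho : 0 < rho /\ rho <= r1 /\ rho <= r2).
  { split; [|split; [apply Rmin_l|apply Rmin_r]]. apply Rmin_case; lra. }
  assert (Sub : forall s s' u v, s <= s' -> box s u v -> box s' u v) by (intros s s' u v Hs [Hu Hv]; split; lra).
  apply Ana_shrink with (rho' := rho) in AP; [|lra]. apply Ana_shrink with (rho' := rho) in APx; [|lra].
  apply Ana_shrink with (rho' := rho) in APy; [|lra]. apply Ana_shrink with (rho' := rho) in AQ; [|lra].
  apply geometric_shrink with (rho' := rho) in Gp; [|lra].
  assert (DP' : forall x y, box rho x y -> differentiable_pt_lim P2 x y (px x y) (py x y) /\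
       differentiable_pt_lim px x y (pxx x y) (pxy x y) /\ differentiable_pt_lim py x y (pxy x y) (pyy x y)).
  { intros x y Hxy. apply DP. now apply Sub with rho. }
  assert (DQ' : forall x y, box rho x y -> differentiable_pt_lim Q2 x y (qx x y) (qy x y)).
  { intros x y Hxy. apply DQ. now apply Sub with rho. }
  destruct (straighten rho P2 px py) as (r & delta & h & Hr & Hdel & Bpy & Bp & Hh & hY & Ch); trivial; try tauto.
  { intros x y Hxy. now apply DP'. } { intros k. now apply Ana_Ck. } { intros k. now apply Ana_Ck. }
  (* This is Y' = (1 + P2_y) Q2 + P2_x (y + P2), expanded into sums and products of analytic
     functions. *)
  set (N0 := fun x y => (Q2 x y + py x y * Q2 x y) + (px x y * P2 x y + px x y * y)).
  assert (AN : Ana rho N0).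
  { apply Ana_plus; apply Ana_plus; trivial; apply Ana_mult; trivial. apply Ana_snd; tauto. }
  assert (AN' := AN). destruct AN' as (a & Ga & Ea).
  destruct (weierstrass_division rho a pc Ga Gp pc0) as (s1 & c & b & Hs1 & Gc & Gb & Ec0 & Ediv1).
  destruct (weierstrass_division s1 b pc Gb (geometric_shrink rho s1 pc Hs1 Gp) pc0) as (s & c' & b' & Hs & Gc' & Gb' & _ & Ediv2).
  assert (EN : forall x y, box s x y -> N0 x y = Ev (diag c) x 0 + (y + P2 x y) * (Ev (diag c') x 0 + (y + P2 x y) * Ev b' x y)).
  { intros x y Hxy. assert (H1 : box s1 x y) by (now apply Sub with (2 := Hxy)).
    assert (H2 : box rho x y) by (now apply Sub with (2 := H1)).
    assert (H3 : box r1 x y) by (now apply Sub with (2 := H2)).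
    rewrite Ea, Ediv1, Ediv2 by trivial. rewrite <- HE by trivial. now rewrite !(Ev_diag_y _ x y). }
  assert (O0 : forall z, 0 < z -> box z 0 0) by (intros z Hz; split; rewrite Rabs_R0; lra).
  assert (c0 : c O = 0).
  { rewrite Ec0, <- (Ev_origin rho) by trivial. rewrite <- Ea by (apply O0; tauto).
    unfold N0. rewrite q0, px0, p0. ring. }
  assert (c1 : c 1%nat = 0).
  (* The x-derivative at the origin is computed on both sides of the division. It is 0 for the
     dividend, and the product contributes nothing because Y and its x-derivative vanish there. *)
  { destruct (DP' 0 0) as (D1 & D2 & D3). { apply O0; tauto. }
    assert (D4 := DQ' 0 0 (O0 rho (proj1 Hrho))).
    assert (Nd : differentiable_pt_lim N0 0 0 0 0).
    { eapply differentiable_eq.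
      - apply differentiable_plus; apply differentiable_plus.
        + exact D4.
        + apply (differentiable_mult py Q2 0 0 _ _ _ _ D3 D4).
        + apply (differentiable_mult px P2 0 0 _ _ _ _ D2 D1).
        + apply (differentiable_mult px (fun _ y => y) 0 0 _ _ _ _ D2 (differentiable_snd 0 0)).
      - rewrite qx0, q0, py0, px0, p0. ring.
      - rewrite qy0, q0, py0, px0, p0. ring. }
    assert (E : 0 = Ev (dx_coefs (diag c)) 0 0 + ((0 + px 0 0) * Ev b 0 0 + (0 + P2 0 0) * Ev (dx_coefs b) 0 0)).
    { apply (differentiable_unique_x N0 (fun x y => Ev (diag c) x y + (y + P2 x y) * Ev b x y) 0 0 0 0 _
        (Ev (dy_coefs (diag c)) 0 0 + ((1 + py 0 0) * Ev b 0 0 + (0 + P2 0 0) * Ev (dy_coefs b) 0 0))); trivial.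
      - apply locally_2d_impl with (2 := box_open s1 0 0 (O0 s1 (proj1 Hs1))). apply locally_2d_forall.
        intros u v Huv. assert (H2 : box rho u v) by (now apply Sub with (2 := Huv)).
        rewrite Ea, Ediv1 by trivial. rewrite HE; trivial. now apply Sub with (2 := H2).
      - apply (differentiable_plus (Ev (diag c)) (fun x y => (y + P2 x y) * Ev b x y)).
        + apply Ev_differentiable with s1; trivial. apply O0; tauto.
        + apply (differentiable_mult (fun x y => y + P2 x y) (Ev b)).
          * apply (differentiable_plus (fun _ y => y) P2); trivial. apply differentiable_snd.
          * apply Ev_differentiable with s1; trivial. apply O0; tauto. }
    rewrite px0, p0, (Ev_origin s1) in E by now apply geometric_dx.
    unfold dx_coefs, coef_x, diag in E. simpl in E. lra. }
  assert (Hj : exists j, c j <> 0).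
  (* If f vanished identically, Y and Y' would both vanish along the curve Y = 0, which is the graph
     y = h(x, 0). Its points would be singular and accumulate at the origin. *)
  { apply NNPP. intros Hn. assert (Hc : forall j, c j = 0).
    { intros j. apply NNPP. intros Hj. apply Hn. now exists j. }
    destruct Hfoc as [(_ & _ & Hiso) _]. apply locally_pair in Hiso. destruct Hiso as [d Hd]. cbn [fst snd] in Hd.
    set (x := Rmin d (Rmin delta s) / 2).
    assert (Hx : 0 < x /\ x < d /\ x < delta /\ x < s).
    { assert (Z : 0 < Rmin d (Rmin delta s)). { repeat apply Rmin_case; try lra. apply cond_pos. }
      assert (Z1 := Rmin_l d (Rmin delta s)). assert (Z2 := Rmin_r d (Rmin delta s)).
      assert (Z3 := Rmin_l delta s). assert (Z4 := Rmin_r delta s). unfold x. lra. }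
    assert (Hax : Rabs x = x) by (apply Rabs_pos_eq; lra).
    destruct (Hh x 0) as (H1 & H2 & H3). { split; [lra|rewrite Rabs_R0; lra]. }
    rewrite Rabs_R0 in H3.
    assert (Hbs : box s x (h x 0)) by (split; lra).
    assert (E := EN _ _ Hbs). rewrite H2, Ev_diag_zero in E by trivial.
    assert (EQ : Q2 x (h x 0) = 0).
    { assert (J := Bpy _ _ H1). apply Rabs_le_between in J.
      unfold N0 in E. assert (EP : P2 x (h x 0) = - h x 0) by lra. rewrite EP in E.
      assert (E' : (1 + py x (h x 0)) * Q2 x (h x 0) = 0) by lra.
      apply Rmult_integral in E'. destruct E' as [E'|E']; trivial. lra. }
    assert (Z := Hd x (h x 0)). rewrite !Rminus_0_r in Z.
    assert (W : (x, h x 0) = (0, 0)) by (apply Z; trivial; lra). injection W. lra. }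
  destruct Hj as [j Hj].
  set (N := fun x Y => N0 x (h x Y)).
  assert (CN : forall k, Ck k (box delta) N).
  { intros k. apply (Ck_comp k (box delta) (box rho) N0 (fun x _ => x) h).
    - now apply Ana_Ck.
    - apply Ck_fst.
    - apply Ch.
    - intros x Y HxY. apply Sub with r. lra. now apply Hh. }
  assert (HN : forall x y, box r x y -> box delta x (y + P2 x y) ->
     N x (y + P2 x y) = (1 + py x y) * Q2 x y + px x y * (y + P2 x y)).
  { intros x y Hxy HY. unfold N. rewrite hY by trivial. unfold N0. ring. }
  destruct (box_in_open D HD HD0) as (eta & Heta & HDe).
  (* With |x| and |Y| below s / 4, the estimate |h| <= |x| + 2 |Y| keeps (x, h) in the box of side s
     where the second division holds. *)
  set (d := Rmin (Rmin delta 1) (s / 4)).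
  assert (Hd : 0 < d /\ d <= 1 /\ d <= delta /\ d <= s / 4).
  { assert (A := Rmin_l (Rmin delta 1) (s / 4)). assert (B := Rmin_r (Rmin delta 1) (s / 4)).
    assert (A1 := Rmin_l delta 1). assert (B1 := Rmin_r delta 1). fold d in A, B.
    split; [|lra]. unfold d. repeat apply Rmin_case; lra. }
  assert (Hds : forall x Y, box d x Y -> box s x (h x Y)).
  { intros x Y [Hx HY]. destruct (Hh x Y) as (_ & _ & X). split; lra. split; lra. }
  destruct (focus_orbit D _ _ Hfoc) as (sg & x & y & Hor & Hsp).
  destruct (straightened_orbit r delta d sg P2 px py Q2 h N x y) as (x' & Y' & Hor' & Hcr'); trivial; try lra.
  { intros u v Huv. apply DP'. apply Sub with r; trivial; lra. }
  { intros u Y HuY. now apply Hh. }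
  { now apply spirals_crosses. }
  destruct (nilpotent_normal_form N (fun x Y => Ev b' x (h x Y)) c c' x' Y' sg d (Rmin delta eta) j)
    as (W & e & He & HW); trivial; try lra.
  - apply Rmin_case; lra.
  - apply geometric_shrink with s1; trivial; lra.
  - apply geometric_shrink with s; trivial; lra.
  - apply Ck_subset with (box delta); trivial. intros u v Huv. apply Sub with d; trivial; lra.
  - apply (Ck_comp 2 (box d) (box s) (Ev b') (fun x _ => x) h); trivial.
    + now apply Ev_Ck.
    + apply Ck_fst.
    + apply Ck_subset with (box delta); trivial. intros u v Huv. apply Sub with d; trivial; lra.
  - intros u v Huv. unfold N. rewrite EN by now apply Hds.
    assert (Hv : box delta u v) by (apply Sub with d; trivial; lra).
    destruct (Hh u v Hv) as (_ & E & _). now rewrite E.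
  - assert (B1 := Rmin_l delta eta). assert (B2 := Rmin_r delta eta).
    apply (iif_on_box D _ _ (fun x y => W x (y + P2 x y) / (1 + py x y)) (e / 4)).
    + lra.
    + intros u v Huv. apply HDe. apply Sub with (2 := Huv). lra.
    + apply (straightened_factor rho r delta e h P2 px py pxx pxy pyy Q2 qx qy N W); trivial; try lra.
      * now apply Ana_Ck.
      * now apply Ana_Ck.
      * intros u v Huv. destruct (Hh u v Huv) as (A1 & A2 & _). now split.
      * intros u v Huv. destruct (CN 1%nat) as (nx & ny & DN & _). exists (ny u v).
        apply (differentiable_is_derive N u v (nx u v) (ny u v)). now apply DN.
Qed.

Theorem corollary19 :
  (forall (D : R * R -> Prop) (d : nat) (p q : nat -> R) (P1 Q1 : R -> R -> R),
     open D -> D (0, 0) ->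
     (1 < d)%nat -> Nat.Odd d ->
     (exists x y : R, (form d p x y) ^ 2 + (form d q x y) ^ 2 <> 0) ->
     analytic_on D P1 -> analytic_on D Q1 ->
     order_at_least (d + 1) P1 -> order_at_least (d + 1) Q1 ->
     ~ (exists a b : R, characteristic_direction d p q a b) ->
     is_focus D (fun x y => form d p x y + P1 x y)
                (fun x y => form d q x y + Q1 x y) ->
     has_inverse_integrating_factor D
                (fun x y => form d p x y + P1 x y)
                (fun x y => form d q x y + Q1 x y))
  /\
  (forall (D : R * R -> Prop) (P2 Q2 : R -> R -> R),
     open D -> D (0, 0) ->
     analytic_on D P2 -> analytic_on D Q2 ->
     order_at_least 2 P2 -> order_at_least 2 Q2 ->
     is_focus D (fun x y => y + P2 x y) Q2 ->
     has_inverse_integrating_factor D (fun x y => y + P2 x y) Q2).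
Proof.
  split.
  - intros D d p q P1 Q1 HD H0 Hd _ _ _ _ HP HQ Hchar Hfoc. now apply degenerate_focus.
  - intros D P2 Q2 HD H0 _ _ HP HQ Hfoc. now apply nilpotent_focus.
Qed.
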